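(* Let $M$ be a smooth, connected, compact Riemannian manifold without boundary and let $H:T^*M\times\mathbb{R}\to\mathbb{R}$, $(x,p,u)\mapsto H(x,p,u)$, be of class $C^3$ such that: (i) for every $(x,p,u)\in T^*M\times\mathbb{R}$, $\frac{\partial^2 H}{\partial p^2}(x,p,u)$ is positive definite; (ii) for every $(x,u)\in M\times\mathbb{R}$ and every $A<+\infty$ there is a constant $C(A,x,u)<+\infty$ with $H(x,p,u)\ge A\|p\|-C(A,x,u)$ for all $p\in T_x^*M$; (iii) there is $\lambda>0$ with $\left|\frac{\partial H}{\partial u}(x,p,u)\right|\le\lambda$ for all $(x,p,u)\in T^*M\times\mathbb{R}$. Let $P:T^*M\times\mathbb{R}\to\mathbb{R}$ be a $C^3$ function with compact support and $|P(x,p,u)|\le 1$ for all $(x,p,u)\in T^*M\times\mathbb{R}$. Let $u_-\in C(M,\mathbb{R})$ be a viscosity solution of $H(x,D_xu(x),u(x))=0$, $x\in M$, and suppose that $$\frac{\partial H}{\partial u}(x,p,u)>0\quad\text{for all }(x,p,u)\in\Lambda_{u_-}.$$ Then there is a constant $\delta_0>0$ such that for every $\delta\in(0,\delta_0]$ there is $\varepsilon_\delta>0$ such that for every $\varepsilon\in[0,\varepsilon_\delta]$ the equation $$H(x,D_xu(x),u(x))+\varepsilon P(x,D_xu(x),u(x))=0,\quad x\in M,$$ has a unique viscosity solution $u_-^\varepsilon$ satisfying $\|u_-^\varepsilon-u_-\|_\infty\le\delta$. Moreover, $u_-^\varepsilon$ is locally asymptotically stable (with respect to the semigroup $\{T_t^\varepsilon\}_{t\ge0}$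 of the perturbed Hamiltonian $H+\varepsilon P$).
   Context: For a viscosity solution $v$ (such solutions are Lipschitz), $$\Lambda_v:=\operatorname{cl}\big\{(x,p,u):\ v\text{ is differentiable at }x,\ p=D_xv(x),\ u=v(x)\big\}\subset T^*M\times\mathbb{R}.$$ Let $H^\varepsilon=H+\varepsilon P$. Since $P$ is $C^3$ with compact support, there is $\theta>0$ such that for $\varepsilon\in[0,\theta]$ the function $H^\varepsilon$ satisfies (i)-(iii) (possibly with another constant in (iii)); $\varepsilon$ is always taken in $[0,\theta]$. Put $L^\varepsilon(x,\dot x,u)=\sup_{p\in T_x^*M}\{\langle\dot x,p\rangle-H^\varepsilon(x,p,u)\}$. The semigroup $\{T_t^\varepsilon\}_{t\ge0}$ on $C(M,\mathbb{R})$ is defined as follows: for $\varphi\in C(M,\mathbb{R})$, $(x,t)\mapsto T_t^\varepsilon\varphi(x)$ is the unique continuous function on $M\times[0,+\infty)$ such that $$T_t^\varepsilon\varphi(x)=\inf_\gamma\Big\{\varphi(\gamma(0))+\int_0^tL^\varepsilon(\gamma(\tau),\dot\gamma(\tau),T_\tau^\varepsilon\varphi(\gamma(\tau)))\,d\tau\Big\},$$ the infimum being over absolutely continuous curves $\gamma:[0,t]\to M$ with $\gamma(t)=x$. Equivalently, it is the unique viscosity solution of $\partial_tu+H^\varepsilon(x,D_xu,u)=0$ with $u(0,\cdot)=\varphi$. A viscosity solution $u$ of $H^\varepsilon(x,D_xu,u)=0$ is Lyapunov stable if for every $\eta>0$ there is $\rho>0$ such that $\|\varphi-u\|_\infty<\rho$,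 $\varphi\in C(M,\mathbb{R})$, implies $\|T_t^\varepsilon\varphi-u\|_\infty<\eta$ for all $t>0$. It is (locally) asymptotically stable if it is Lyapunov stable and there is $\rho>0$ such that $\lim_{t\to+\infty}\|T_t^\varepsilon\varphi-u\|_\infty=0$ for every $\varphi\in C(M,\mathbb{R})$ with $\|\varphi-u\|_\infty<\rho$. *)

(* Defs.v *)
From HB Require Import structures.
From mathcomp Require Import all_boot all_order all_algebra.
From mathcomp Require Import all_classical all_reals all_analysis.

Set Implicit Arguments.
Unset Strict Implicit.
Unset Printing Implicit Defensive.

Import Order.TTheory GRing.Theory Num.Theory.
Import numFieldNormedType.Exports.

Local Open Scope classical_set_scope.
Local Open Scope ring_scope.

(* [f] is of class C^k on the open set [U], for [V] finite-dimensional: f is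
   C^(k+1) iff it is differentiable and each x |-> Df(x)v is C^k. *)
Fixpoint class_C (R : realType) (V W : normedModType R) (k : nat)
    (U : set V) (f : V -> W) : Prop :=
  if k is k'.+1 then
    (forall x, U x -> differentiable f x) /\
    (forall v, class_C k' U (fun x => 'd f x v))
  else forall x, U x -> {for x, continuous f}.

(* Smooth n-manifolds without boundary, given by a smooth atlas. The chart
   [chart_map c] is meaningful on [chart_dom c] only, and its inverse
   [chart_inv c] is meaningful on [chart_map c @` chart_dom c] only. *)
Record manifold (R : realType) (n : nat) := Manifold {
  manifold_sort :> topologicalType ;
  manifold_hausdorff : hausdorff_space manifold_sort ;
  manifold_second_countable : @second_countable manifold_sort ;
  chart : Type ;
  chart_dom : chart -> set manifold_sort ;
  chart_map : chart -> manifold_sort -> 'rV[R]_n ;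
  chart_inv : chart -> 'rV[R]_n -> manifold_sort ;
  open_chart_dom : forall c, open (chart_dom c) ;
  open_chart_range : forall c, open (chart_map c @` chart_dom c) ;
  chart_dom_cover : forall x, exists c, chart_dom c x ;
  chart_mapK : forall c x, chart_dom c x -> chart_inv c (chart_map c x) = x ;
  chart_map_continuous : forall c x, chart_dom c x ->
    {for x, continuous (chart_map c)} ;
  chart_inv_continuous : forall c y, (chart_map c @` chart_dom c) y ->
    {for y, continuous (chart_inv c)} ;
  change_smooth : forall (c d : chart) (k : nat),
    class_C k (chart_map c @` (chart_dom c `&` chart_dom d))
      (chart_map d \o chart_inv c)
}.

Section Geometry.
Variables (R : realType) (n : nat) (M : manifold R n).
Implicit Types (x : M) (c d : chart M).

Definition chart_at x : chart M := projT1 (cid (chart_dom_cover x)).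

Definition chart_range c : set 'rV[R]_n := chart_map c @` chart_dom c.

(* Jacobian matrix at [chart_map c x] of the change of charts from c to d. In
   these charts tangent vectors are rows and covectors are columns, so that
   components transform by v_d = v_c *m J and p_c = J *m p_d, and the pairing
   <v, p> = v *m p does not depend on the chart. *)
Definition change_jac c d x : 'M[R]_n :=
  jacobian (chart_map d \o chart_inv c) (chart_map c x).

Definition of_class (k : nat) (f : M -> R) : Prop :=
  forall c, class_C k (chart_range c) (f \o chart_inv c).

(* A (co)tangent vector at x is identified with its components in the chart
   [chart_at x]. As this chart need not depend continuously on x, neither the
   topology of T^*M nor the regularity of functions on T^*M is that of the
   product M * 'cV_n: both are defined below through the bundle charts
   [bundle_inv c]. *)
Record cotangent := Cotangent {
  base : M ;
  covector : 'cV[R]_n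
}.

HB.instance Definition _ := gen_eqMixin cotangent.
HB.instance Definition _ := gen_choiceMixin cotangent.

(* The covector at [chart_inv c y] with components q in the chart c. *)
Definition bundle_inv c (z : 'rV[R]_n * 'cV[R]_n) : cotangent :=
  let x := chart_inv c z.1 in
  Cotangent x (change_jac (chart_at x) c x *m z.2).

Definition bundle_open (A : set cotangent) : Prop :=
  forall c, open ((chart_range c `*` setT) `&` bundle_inv c @^-1` A).

Lemma bundle_openT : bundle_open setT.
Proof.
move=> c; rewrite preimage_setT setIT.
rewrite [_ `*` setT](_ : _ = fst @^-1` chart_range c); last first.
  by apply/seteqP; split=> z /= => [[]|].
by apply: open_comp; [move=> z _; exact: cvg_fst | exact: open_chart_range].
Qed.

Lemma bundle_openI (A B : set cotangent) :
  bundle_open A -> bundle_open B -> bundle_open (A `&` B).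
Proof.
by move=> oA oB c; rewrite preimage_setI setIIr; apply: openI.
Qed.

Lemma bundle_open_bigU (I : Type) (F : I -> set cotangent) :
  (forall i, bundle_open (F i)) -> bundle_open (\bigcup_i F i).
Proof.
move=> oF c; rewrite preimage_bigcup setI_bigcupr.
by apply: bigcup_open => i _; exact: oF.
Qed.

HB.instance Definition _ := isOpenTopological.Build cotangent
  bundle_openT bundle_openI bundle_open_bigU.

Definition of_class_bundle (k : nat) (H : cotangent * R -> R) : Prop :=
  forall c, class_C k (chart_range c `*` [set: 'cV[R]_n] `*` [set: R])
    (fun z : 'rV[R]_n * 'cV[R]_n * R => H (bundle_inv c z.1, z.2)).

Definition posdef (A : 'M[R]_n) : Prop :=
  forall w : 'cV[R]_n, w != 0 -> 0 < (w^T *m A *m w) 0 0.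

Record riemannian_metric := RiemannianMetric {
  riem : M -> 'M[R]_n ;
  riem_sym : forall x, (riem x)^T = riem x ;
  riem_posdef : forall x, posdef (riem x) ;
  riem_smooth : forall c (a b : 'I_n) (k : nat), class_C k (chart_range c)
    (fun y => let x := chart_inv c y in let J := change_jac c (chart_at x) x in
       (J *m riem x *m J^T) a b)
}.

(* The dual norm on T_x^*M. *)
Definition conorm (g : riemannian_metric) (z : cotangent) : R :=
  Num.sqrt (((covector z)^T *m invmx (riem g (base z)) *m covector z) 0 0).

Definition differentiable_at (f : M -> R) x : Prop :=
  let c := chart_at x in differentiable (f \o chart_inv c) (chart_map c x).

Definition diff_at (f : M -> R) x : cotangent :=
  let c := chart_at x in
  Cotangent x (\col_i 'd (f \o chart_inv c) (chart_map c x) (delta_mx 0 i)).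

(* The components in [chart_at (gamma t)] of the velocity of gamma at t. *)
Definition velocity (gamma : R -> M) (t : R) : 'rV[R]_n :=
  derive1 (chart_map (chart_at (gamma t)) \o gamma) t.

Definition pairing x (v : 'rV[R]_n) (p : 'cV[R]_n) : R := (v *m p) 0 0.

Definition hessian_p (H : cotangent * R -> R) x (p : 'cV[R]_n) (u : R) :
    'M[R]_n :=
  \matrix_(i, j) 'D_(delta_mx i 0)
    (fun q => 'D_(delta_mx j 0) (fun r => H (Cotangent x r, u)) q) p.

Definition partial_u (H : cotangent * R -> R) (z : cotangent * R) : R :=
  derive1 (fun s => H (z.1, s)) z.2.

Definition strictly_convex (H : cotangent * R -> R) : Prop :=
  forall x p u, posdef (hessian_p H x p u).

Definition superlinear (g : riemannian_metric) (H : cotangent * R -> R) :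
    Prop :=
  forall x u A, exists C : R, forall p : 'cV[R]_n,
    A * conorm g (Cotangent x p) - C <= H (Cotangent x p, u).

Definition lipschitz_u (H : cotangent * R -> R) : Prop :=
  exists2 lambda : R, 0 < lambda & forall z, `|partial_u H z| <= lambda.

Definition supp (P : cotangent * R -> R) : set (cotangent * R) :=
  closure [set z | P z != 0].

Definition viscosity_subsolution (H : cotangent * R -> R) (u : M -> R) : Prop :=
  forall (f : M -> R) x, of_class 1 f ->
    (\forall y \near x, u y - f y <= u x - f x) ->
    H (diff_at f x, u x) <= 0.

Definition viscosity_supersolution (H : cotangent * R -> R) (u : M -> R) :
    Prop :=
  forall (f : M -> R) x, of_class 1 f ->
    (\forall y \near x, u x - f x <= u y - f y) ->
    0 <= H (diff_at f x, u x).

Definition viscosity_solution (H : cotangent * R -> R) (u : M -> R) : Prop :=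
  [/\ continuous u, viscosity_subsolution H u & viscosity_supersolution H u].

Definition Lambda (v : M -> R) : set (cotangent * R) :=
  closure [set (diff_at v x, v x) | x in [set x | differentiable_at v x]].

Definition supnorm (f : M -> R) : R := sup [set `|f x| | x in [set: M]].

Definition perturb (H P : cotangent * R -> R) (eps : R) : cotangent * R -> R :=
  fun z => H z + eps * P z.

(* The Lagrangian, with values in the extended reals; it is finite when H is
   superlinear. *)
Definition lagrangian (H : cotangent * R -> R) x (v : 'rV[R]_n) (u : R) :
    \bar R :=
  ereal_sup [set (pairing x v p - H (Cotangent x p, u))%:E
            | p in [set: 'cV[R]_n]].

Definition abs_cont (a b : R) (f : R -> 'rV[R]_n) : Prop :=
  forall e : R, 0 < e -> exists2 d : R, 0 < d &
    forall (m : nat) (l r : 'I_m -> R),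
      (forall k, [/\ a <= l k, l k <= r k & r k <= b]) ->
      trivIset [set: 'I_m] (fun k => `]l k, r k[%classic) ->
      \sum_(k < m) (r k - l k) < d ->
      \sum_(k < m) `|f (r k) - f (l k)| < e.

(* Absolutely continuous curves [0, t] -> M; gamma is irrelevant outside
   [0, t]. *)
Definition abs_cont_curve (t : R) (gamma : R -> M) : Prop :=
  {within `[0, t], continuous gamma} /\
  forall c (a b : R), 0 <= a -> a <= b -> b <= t ->
    gamma @` `[a, b] `<=` chart_dom c -> abs_cont a b (chart_map c \o gamma).

Definition action (H : cotangent * R -> R) (phi : M -> R) (U : R -> M -> R)
    (t : R) (gamma : R -> M) : \bar R :=
  ((phi (gamma 0))%:E +
   \int[lebesgue_measure]_(tau in `[0%R, t])
      lagrangian H (gamma tau) (velocity gamma tau) (U tau (gamma tau)))%E.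

Definition is_evolution (H : cotangent * R -> R) (phi : M -> R)
    (U : R -> M -> R) : Prop :=
  {within [set z : R * M | 0 <= z.1], continuous (fun z => U z.1 z.2)} /\
  forall t x, 0 <= t ->
    (U t x)%:E = ereal_inf [set action H phi U t gamma
      | gamma in [set gamma | abs_cont_curve t gamma /\ gamma t = x]].

(* T_t phi(x) is [semigroup H t phi x]: the (t, x) |-> T_t phi(x) satisfying
   [is_evolution], picked by classical description. Only t >= 0 is
   meaningful. *)
Definition semigroup (H : cotangent * R -> R) (t : R) (phi : M -> R) :
    M -> R :=
  xget (fun _ _ => 0) [set U | is_evolution H phi U] t.

Definition lyapunov_stable (H : cotangent * R -> R) (u : M -> R) : Prop :=
  forall eta : R, 0 < eta -> exists2 rho : R, 0 < rho &
    forall phi : M -> R, continuous phi -> supnorm (phi \- u) < rho ->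
      forall t, 0 < t -> supnorm (semigroup H t phi \- u) < eta.

Definition locally_asymptotically_stable (H : cotangent * R -> R)
    (u : M -> R) : Prop :=
  lyapunov_stable H u /\
  exists2 rho : R, 0 < rho &
    forall phi : M -> R, continuous phi -> supnorm (phi \- u) < rho ->
      supnorm (semigroup H t phi \- u) @[t --> +oo] --> 0.

End Geometry.

(* Main.v *)
(* By strong convexity in the momentum, a proximal gradient p at x of a solution w
   of the perturbed equation that is uniformly close to u lies close to a proximal
   gradient of u at a nearby point: one descends from x along minus the derivative
   of H(x, ., w(x)) at p and applies the mean value theorem to u.  Hence (x, p, w(x))
   is close to Lambda_u, where the perturbed Hamiltonians increase strictly with the
   value, and w + tau, w - tau are a strict super- and a strict subsolution for small
   tau > 0.  Doubling of variables turns this into comparison between solutions close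
   to u, and Perron's method between u - delta and u + delta produces one.  The
   evolution is the fixed point of the value operator U |-> V_U, which contracts a sup
   norm weighted by exp(2 lambda t); dynamic programming makes it a viscosity solution,
   and doubling against the barrier rho / (1 + e t), which decays slowly enough to be
   absorbed by the strictness, bounds its distance to the stationary solution. *)

(* Monotonicity in the value is assumed on [Lambda] only, so a comparison may use it just for
   gradients known to lie near [Lambda]. Hence in the doublings behind uniqueness and stability
   strictness is asked of one stationary solution alone, at its own proximal gradients; the
   competitor, another solution or the evolution, only satisfies its plain viscosity inequality.
   Proximal subgradients cause no trouble: convexity yields a bound from above whose constants
   ignore the curvature of the touching paraboloid, so the solution is differentiable there. A
   proximal supergradient at a kink may be far from [Lambda]; strictness for w - tau then comes, by
   convexity, from subgradients at nearby points. One threshold e serves as strictness rate, largest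
   shift and closeness to u: u - delta and u + delta are strict by e * delta, which absorbs
   perturbations of size at most e * delta. For the evolution the obstacle is measurability:
   velocities exist almost everywhere only and the Lagrangian is an uncountable supremum, so actions
   are handled through measurable representatives off null sets. *)
Require Import Defs.
From HB Require Import structures.
From mathcomp Require Import all_boot all_order all_algebra.
From mathcomp Require Import all_classical all_reals all_analysis.
From mathcomp Require Import unstable measurable_realfun ring lra.
Import Order.TTheory GRing.Theory Num.Theory.
Import numFieldNormedType.Exports.
Set Implicit Arguments.
Unset Strict Implicit.
Unset Printing Implicit Defensive.
Local Open Scope classical_set_scope.
Local Open Scope ring_scope.

(** * Densities of functions of bounded variation *)

Section AbsCont.
Context {R : realType}.
Notation mu := (@lebesgue_measure R).

(** Absolute continuity on the whole line, for finite unordered families of disjoint open intervals.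
    Functions on a segment are brought to this form by composition with [clamp]. *)
Definition acR (f : R -> R) : Prop := forall e : R, 0 < e ->
  exists2 d : R, 0 < d & forall (m : nat) (l r : 'I_m -> R),
    (forall k, l k <= r k) ->
    trivIset [set: 'I_m] (fun k => `]l k, r k[%classic) ->
    \sum_(k < m) (r k - l k) < d -> \sum_(k < m) `|f (r k) - f (l k)| < e.

Lemma acR_continuous f : acR f -> continuous f.
Proof.
move=> acf.
have K (e : R) : 0 < e -> exists2 d, 0 < d &
    forall x y : R, `|x - y| < d -> `|f x - f y| < e.
  move=> e0; have [d d0 D] := acf e e0; exists d => // x y.
  have H (a b : R) : a <= b -> b - a < d -> `|f b - f a| < e.
    move=> ab bad; have := D 1 (fun=> a) (fun=> b); rewrite !big_ord1; apply => //.
    by move=> i j _ _ _; rewrite (ord1 i) (ord1 j).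
  have [xley|yltx] := leP x y.
    by rewrite ler0_norm ?subr_le0// distrC => xy; apply: H => //; lra.
  by rewrite gtr0_norm ?subr_gt0// => xy; apply: H => //; exact: ltW.
move=> x; apply/cvgrPdist_lt => e /K[d d0 D].
by apply/nbhs_ballP; exists d => //= y; exact: D.
Qed.

Lemma open_bounded_itv (I : set R) : open I -> is_interval I ->
  (mu I < +oo)%E -> exists l r : R, l <= r /\ I = `]l, r[%classic.
Proof.
move=> oI iI muI.
have [I0|/set0P [x Ix]] := eqVneq I set0.
  by exists 0, 0; split => //; rewrite I0 set_itv_ge// bnd_simp ltxx.
have IE : I = [set` Rhull I] by apply/is_intervalP.
have [lI uI] : has_lbound I /\ has_ubound I.
  move: muI; rewrite {1}IE lebesgue_measure_itv /Rhull /=.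
  case: (asboolP (has_lbound I)) => hl; case: (asboolP (has_ubound I)) => hu //=.
  - by rewrite ltry addye.
  - by rewrite ltNyr addey.
have le : inf I <= sup I.
  by apply: (@le_trans _ _ x); [exact: ge_inf|exact: ub_le_sup].
exists (inf I), (sup I); split => //.
have := interval_bounded_interior iI lI uI.
rewrite (interior_id I).1// => IE2; rewrite {1}IE2.
Qed.

Section Monotone.
Variables (G : R -> R) (B : R).
Hypotheses (Gnd : {homo G : x y / x <= y}) (acG : acR G).
Hypothesis GB : forall x, `|G x| <= B.

Let G_rc : right_continuous G.
Proof. by apply: right_continuousW; exact: acR_continuous. Qed.

HB.instance Definition _ := isCumulative.Build R _ R G Gnd G_rc.

Let nu := lebesgue_stieltjes_measure G.

Let nu_itv x y : x <= y -> nu `]x, y]%classic = (G y - G x)%:E.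
Proof.
move=> xy; rewrite /nu /lebesgue_stieltjes_measure/=.
rewrite /measure_extension measurable_mu_extE/=; last exact: is_ocitv.
by rewrite wlength_itv_bnd.
Qed.

Let nu_fin : fin_num_fun nu.
Proof.
have nuT : (nu setT <= (2 * B)%:E)%E.
  pose F (n : nat) := `](- n%:R : R), n%:R]%classic.
  have FT : \bigcup_n F n = setT.
    rewrite -subTset => x _ /=; exists (Num.bound x) => //=.
    by rewrite /F/= in_itv/= ltrNl ltrNbound ltW// ltr_bound.
  have := @nondecreasing_cvg_mu _ _ _ nu F.
  rewrite FT => H.
  have {H} H : nu (F n) @[n --> \oo] --> nu setT.
    apply: H => //.
    - by move=> i; exact: measurable_itv.
    - move=> n m nm; apply/subsetPset => x; rewrite /F /= !in_itv/=.
      move=> /andP[h1 h2]; rewrite (le_trans h2) ?ler_nat// andbT.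
      by apply: le_lt_trans h1; rewrite lerN2 ler_nat.
  rewrite -(cvg_lim _ H)//; apply: lime_le.
    by apply/cvg_ex; eexists; exact: H.
  near=> n; rewrite /F nu_itv; last by rewrite ge0_cp ?ler0n.
  rewrite lee_fin mulr_natl mulr2n.
  by have := GB n%:R; have := GB (- n%:R); rewrite !ler_norml; lra.
apply: lty_fin_num_fun.
exact: le_lt_trans nuT (ltry _).
Unshelve. all: by end_near. Qed.

HB.instance Definition _ := Measure.on nu.
HB.instance Definition _ := Measure_isFinite.Build _ _ _ nu nu_fin.

(** The Stieltjes measure of an absolutely continuous function does not charge null sets: a null set
    lies in an open set of measure below the modulus d, and every finite subfamily of the components
    of that open set has small increments of [G]. *)
Let nu_dom : nu `<< mu.
Proof.
apply/null_content_dominatesP => A mA muA.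
apply/eqP; rewrite eq_le measure_ge0 andbT.
apply/lee_addgt0Pr => e e0; rewrite add0e.
have [d d0 D] := acG e0.
have [U [oU AU mUA]] := @lebesgue_regularity_outer _ A d mA ltac:(by rewrite muA ltry) d0.
have muU : (mu U < d%:E)%E.
  have mU := measurable_realfun.open_measurable oU.
  rewrite -(setDUK AU) measureU//=; last 2 first.
  - exact: measurableD.
  - by rewrite setDIK.
  by rewrite muA add0e.
have [I [oiI tI UI]] := OpenSetDisjointItvs.open_disjoint_itv oU.
have mI k : measurable (I k) by apply: measurable_realfun.open_measurable; have [] := oiI k.
have muIU k : (mu (I k) <= mu U)%E.
  apply: le_measure; rewrite ?inE//; [exact: mI|exact: measurable_realfun.open_measurable|].
  by rewrite UI; exact: bigcup_sup.
have /choice [l lP] : forall k, exists l : R, exists r, l <= r /\ I k = `]l, r[%classic.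
  move=> k; have [oIk iIk] := oiI k.
  by apply: open_bounded_itv => //; apply: le_lt_trans (muIU k) (lt_trans muU (ltry _)).
have /choice [r lr] := lP.
apply: (@le_trans _ _ (nu U)).
  by apply: le_measure; rewrite ?inE//; exact: measurable_realfun.open_measurable.
rewrite UI measure_bigcup//; last by move=> *; exact: mI.
have -> : \big[+%E/0%R]_(0 <= i <oo | i \in setT) nu (I i) = \big[+%E/0%R]_(0 <= i <oo) nu (I i).
  by apply: eq_eseriesl => i; rewrite in_setT.
apply: lime_le; first exact: is_cvg_nneseries.
near=> m; rewrite big_mkord.
have nuI k : (nu (I k) <= (G (r k) - G (l k))%:E)%E.
  have [lk ->] := lr k; rewrite -nu_itv//.
  apply: le_measure; rewrite ?inE; try exact: measurable_itv.
  by apply: subset_itvl; rewrite bnd_simp.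
apply: (@le_trans _ _ (\sum_(k < m) (G (r k) - G (l k)))%:E).
  by rewrite -sumEFin; apply: lee_sum.
rewrite lee_fin ltW//.
have -> : \sum_(k < m) (G (r k) - G (l k)) = \sum_(k < m) `|G (r k) - G (l k)|.
  apply: eq_bigr => k _; rewrite ger0_norm// subr_ge0; apply: Gnd.
  by have [] := lr k.
apply: D.
- by move=> k; have [] := lr k.
- move=> i j _ _ [x [/= xi xj]]; apply/val_inj.
  apply: (tI i j) => //; exists x; split.
    by have [_ ->] := lr i.
  by have [_ ->] := lr j.
- rewrite -lte_fin; apply: le_lt_trans muU.
  rewrite UI measure_bigcup//; last by move=> *; exact: mI.
  have -> : \big[+%E/0%R]_(0 <= i <oo | i \in setT) mu (I i) = \big[+%E/0%R]_(0 <= i <oo) mu (I i).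
    by apply: eq_eseriesl => i; rewrite in_setT.
  apply: (@le_trans _ _ (\sum_(0 <= k < m) mu (I k))%E); last first.
    exact: nneseries_lim_ge.
  rewrite big_mkord -sumEFin; apply: lee_sum => k _.
  have [lk ->] := lr k.
  rewrite lebesgue_measure_itv/= lte_fin; case: ltP => //.
  by move=> rl; rewrite lee_fin subr_le0.
Unshelve. all: by end_near. Qed.

(** The density is the Radon-Nikodym derivative of the Stieltjes measure of [G]; the almost
    everywhere derivative is Lebesgue's differentiation theorem for the primitive of this
    density. *)
Lemma ac_nondecreasing_density : exists h : R -> R,
  [/\ mu.-integrable setT (EFin \o h),
     forall x y, x <= y -> (\int[mu]_(t in `]x, y]) (h t)%:E = (G y - G x)%:E)%E &
     {ae mu, forall x, derivable G x 1 /\ derive1 G x = h x}].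
Proof.
have [f [f0 ff fi fE]] := radon_nikodym_sigma_finite nu_dom.
pose h x := fine (f x).
have hE : EFin \o h = f by apply/funext => x /=; rewrite /h fineK.
have hI x y : x <= y -> (\int[mu]_(t in `]x, y]) (h t)%:E = (G y - G x)%:E)%E.
  move=> xy; rewrite -nu_itv// fE//; by rewrite -hE.
exists h; split => //; first by rewrite hE.
have hi (A : set R) : measurable A -> mu.-integrable A (EFin \o h).
  by move=> mA; rewrite hE; apply: integrableS fi.
have lh : locally_integrable setT h.
  by apply: open_integrable_locally => //; [exact: openT|exact: hi].
have := @FTC1Ny _ h (fun y => hi _ (measurable_itv _)) lh.
apply: filterS; first exact: (ae_filter_ringOfSetsType mu).
move=> x /=; set F := (F in derivable F); move=> [dF F'].
(* The primitive starts at minus infinity, so it agrees with [G] up to a constant only. *)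
have GE : G = F \+ cst (G 0 - F 0).
  apply/funext => y /=.
  have FI a b : a <= b -> F b - F a = G b - G a.
    move=> ab; rewrite /F.
    have -> : [set` `]-oo, b]] = [set` `]-oo, a]] `|` `]a, b]%classic :> set R.
      by rewrite -itv_bndbnd_setU// bnd_simp.
    rewrite Rintegral_setU//; last 2 first.
    - by apply: hi; apply: measurableU; exact: measurable_itv.
    - apply/disj_setPS => z [/=]; rewrite !in_itv/= => za /andP[az _].
      by move: (lt_le_trans az za); rewrite ltxx.
    by rewrite addrC addKr /Rintegral hI.
  have [y0|y0] := leP 0 y; first by have := FI _ _ y0; lra.
  by have := FI _ _ (ltW y0); lra.
have c0 := @derivable_cst R R R (G 0 - F 0) x 1.
rewrite GE; split; first exact: (derivableD dF c0).
by rewrite derive1E (deriveD dF c0) derive_cst addr0 -derive1E.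
Qed.
End Monotone.

(** Families indexed by an arbitrary finite type, so that the pieces of several partitions can be
    indexed by pairs. *)
Lemma acR_fin f e : acR f -> 0 < e -> exists2 d : R, 0 < d &
  forall (T : finType) (l r : T -> R), (forall k, l k <= r k) ->
    trivIset [set: T] (fun k => `]l k, r k[%classic) ->
    \sum_k (r k - l k) < d -> \sum_k `|f (r k) - f (l k)| < e.
Proof.
move=> /[apply] -[d d0 D]; exists d => // T l r lr tlr.
have E (F : T -> R) : \sum_k F k = \sum_(i < #|T|) F (enum_val i).
  by rewrite -(big_enum_val F); apply: eq_bigl.
rewrite !E; apply: D => // i j _ _ ij; apply: enum_val_inj; exact: tlr.
Qed.

(** Partitions that almost attain the variations on the given intervals cut them into one disjoint
    family of the same total length, to which absolute continuity applies. *)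
Lemma acR_variation f e : acR f -> 0 < e -> exists2 d : R, 0 < d &
  forall (m : nat) (l r : 'I_m -> R), (forall k, l k <= r k) ->
    trivIset [set: 'I_m] (fun k => `]l k, r k[%classic) ->
    \sum_(k < m) (r k - l k) < d ->
    (\sum_(k < m) total_variation (l k) (r k) f <= e%:E)%E.
Proof.
move=> acf e0; have [d d0 D] := acR_fin acf e0; exists d => //.
have part m (l r : 'I_m -> R) (s : 'I_m -> seq R) :
    (forall k, l k <= r k) ->
    trivIset [set: 'I_m] (fun k => `]l k, r k[%classic) ->
    \sum_(k < m) (r k - l k) < d ->
    (forall k, itv_partition (l k) (r k) (s k)) ->
    \sum_(k < m) variation (l k) (r k) f (s k) < e.
  move=> lr tlr ds ps.
  (* The pair (k, j) stands for the j-th piece of the partition of the k-th interval. *)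
  pose T := {k : 'I_m & 'I_(size (s k))}.
  pose p k j := nth (r k) (l k :: s k) j.
  have pnd k i j : (i <= j <= size (s k))%N -> p k i <= p k j.
    move=> /andP[ij jk]; have [pk _] := ps k.
    have srt : sorted <=%R (l k :: s k) by apply: sub_path pk => u v; exact: ltW.
    by apply: (sorted_leq_nth le_trans le_refl) => //; rewrite inE/= ltnS//; exact: leq_trans jk.
  have pl k : p k 0%N = l k by [].
  have pr k : p k (size (s k)) = r k.
    by have [_ /eqP] := ps k; rewrite /p (last_nth (r k)).
  have tel k : \sum_(j < size (s k)) (p k j.+1 - p k j) = r k - l k.
    by rewrite -(big_mkord xpredT (fun j => p k j.+1 - p k j)) telescope_sumr// pr pl.
  have := D T (fun t => p (tag t) (tagged t)) (fun t => p (tag t) (tagged t).+1).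
  have sg (F : forall k, 'I_(size (s k)) -> R) :
      \sum_(t : T) F (tag t) (tagged t) = \sum_k \sum_(j < size (s k)) F k j.
    by rewrite (sig_big_dep xpredT (fun _ _ => true) F).
  rewrite (sg (fun k j => p k j.+1 - p k j)) (sg (fun k j => `|f (p k j.+1) - f (p k j)|)).
  have -> : \sum_k variation (l k) (r k) f (s k) =
      \sum_k \sum_(j < size (s k)) `|f (p k j.+1) - f (p k j)|.
    by apply: eq_bigr => k _; rewrite /variation big_mkord.
  apply.
  - by move=> [k j] /=; apply: pnd; rewrite leqnSn/= ltn_ord.
  - move=> [k j] [k' j'] _ _ /= [x [/=]]; rewrite !in_itv/= => /andP[xl xr] /andP[xl' xr'].
    have kk' : k = k'.
      apply: (tlr k k') => //; exists x; rewrite /= !in_itv/= -!pl -!pr.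
      have q1 : p k 0%N <= p k j by apply: pnd; rewrite leq0n ltnW//= ltn_ord.
      have q2 : p k j.+1 <= p k (size (s k)) by apply: pnd; rewrite leqnn ltn_ord.
      have q3 : p k' 0%N <= p k' j' by apply: pnd; rewrite leq0n ltnW//= ltn_ord.
      have q4 : p k' j'.+1 <= p k' (size (s k')) by apply: pnd; rewrite leqnn ltn_ord.
      by rewrite (le_lt_trans q1 xl) (le_lt_trans q3 xl') (lt_le_trans xr q2) (lt_le_trans xr' q4).
    subst k'; congr existT; apply/val_inj => /=.
    case: (ltngtP j j') => // jj.
    + have := pnd k j.+1 j'; rewrite jj ltnW//= => /(_ isT) h.
      by move: (lt_le_trans xr (le_trans h (ltW xl'))); rewrite ltxx.
    + have := pnd k j'.+1 j; rewrite jj ltnW//= => /(_ isT) h.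
      by move: (lt_le_trans xr' (le_trans h (ltW xl))); rewrite ltxx.
  - by under eq_bigr do rewrite tel.
move=> m l r lr tlr ds.
have ex k : exists s, itv_partition (l k) (r k) s.
  have := lr k; rewrite le_eqVlt => /predU1P[->|lk]; first by exists [::]; split.
  by exists [:: r k]; split => //=; rewrite lk.
have /choice [s0 s0P] := ex.
(* Finiteness must come before almost optimal partitions can be chosen; the other intervals receive
   arbitrary partitions [s0]. *)
have TVle k : (total_variation (l k) (r k) f <= e%:E)%E.
  apply: ge_ereal_sup => _ [_ [s ps <-] <-]; rewrite lee_fin.
  pose s' j := if j == k then s else s0 j.
  have ps' j : itv_partition (l j) (r j) (s' j) by rewrite /s'; case: eqP => [->|].
  apply: le_trans (ltW (part _ _ _ s' lr tlr ds ps')).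
  rewrite (bigD1 k)//= {1}/s' eqxx lerDl; apply: sumr_ge0 => j _.
  by apply: variation_ge0.
have TVfin k : total_variation (l k) (r k) f \is a fin_num.
  rewrite ge0_fin_numE ?total_variation_ge0//.
  exact: le_lt_trans (TVle k) (ltry _).
apply/lee_addgt0Pr => h h0.
(* Each of the m intervals may lose this much; m + 1 keeps the denominator nonzero when the family
   is empty. *)
have hm : 0 < h / m.+1%:R by rewrite divr_gt0.
have /choice [s sP] : forall k, exists s, itv_partition (l k) (r k) s /\
    fine (total_variation (l k) (r k) f) - h / m.+1%:R <= variation (l k) (r k) f s.
  move=> k.
  have := @ub_ereal_sup_adherent R [set x%:E | x in variations (l k) (r k) f] (h / m.+1%:R) hm (TVfin k).
  move=> [_ [_ [s ps <-] <-]] hs; exists s; split => //.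
  by rewrite -lee_fin EFinB fineK// ltW.
apply: (@le_trans _ _ (\sum_k (variation (l k) (r k) f (s k) + h / m.+1%:R))%:E).
  rewrite -sumEFin; apply: lee_sum => k _; rewrite -(fineK (TVfin k)) lee_fin.
  by rewrite -lerBlDr; have [] := sP k.
rewrite -EFinD lee_fin big_split/= lerD//.
  by apply: ltW; apply: part => // k; have [] := sP k.
by rewrite sumr_const card_ord -[X in X <= _]mulr_natr mulrAC ler_pdivrMr// ler_pM2l// ler_nat.
Qed.

(** The variation is at most 1 on intervals of length d / 2, and finitely many of these cover the
    segment. *)
Lemma acR_TV_fin f x y : acR f -> x <= y -> total_variation x y f \is a fin_num.
Proof.
move=> acf xy; have [d d0 D] := acR_variation acf ltr01.
have d2 : 0 < d / 2 by rewrite divr_gt0.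
have step c z : c <= z -> z - c <= d / 2 -> total_variation c z f \is a fin_num.
  move=> cz zc; rewrite ge0_fin_numE ?total_variation_ge0//.
  have := D 1 (fun=> c) (fun=> z); rewrite !big_ord1 => H.
  apply: le_lt_trans (ltry (1 : R)); apply: H => //.
  - by move=> i j _ _ _; rewrite (ord1 i) (ord1 j).
  - by apply: le_lt_trans zc _; rewrite ltr_pdivrMr// ltr_pMr// ltr1n.
have H n z : x <= z -> z <= x + n%:R * (d / 2) -> total_variation x z f \is a fin_num.
  elim: n z => [|n IH] z xz zn.
    by rewrite (_ : z = x) ?total_variationxx//; move: zn; rewrite mul0r; lra.
  have [h|h] := leP (z - x) (d / 2); first exact: step.
  rewrite (@total_variationD _ x z (z - d / 2)); [|lra|lra].
  rewrite fin_numD IH ?step//; try lra.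
apply: (H (Num.bound ((y - x) / (d / 2)))) => //.
by rewrite -lerBlDl -ler_pdivrMr// ltW// ltr_bound.
Qed.

Section Clamp.
Variables (a b : R).
Hypothesis ab : a <= b.
Definition clamp x : R := Num.max a (Num.min b x).

Lemma clamp_itv x : a <= clamp x <= b.
Proof. by rewrite /clamp le_max lexx/= ge_max ab ge_min lexx. Qed.

Lemma clamp_id x : a <= x <= b -> clamp x = x.
Proof. by move=> /andP[ax xb]; rewrite /clamp min_r// max_r. Qed.

Lemma clamp_nd x y : x <= y -> clamp x <= clamp y.
Proof. by move=> xy; rewrite /clamp le_max2// le_min2. Qed.

Lemma clamp_lip x y : x <= y -> clamp y - clamp x <= y - x.
Proof.
move=> xy; have d0 : 0 <= y - x by rewrite subr_ge0.
rewrite lerBlDr /clamp ge_max ler_wpDl ?le_max ?lexx//= -lerBlDl le_max le_min.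
apply/orP; right; rewrite !lerBlDl subrK !ge_min.
by rewrite lerDr d0 lexx orbT.
Qed.

Lemma clamp_disj m (l r : 'I_m -> R) :
  trivIset [set: 'I_m] (fun k => `]l k, r k[%classic) ->
  trivIset [set: 'I_m] (fun k => `]clamp (l k), clamp (r k)[%classic).
Proof.
move=> tlr i j _ _ [x [/= xi xj]]; apply: tlr => //; exists x => /=.
suff H y z : clamp y < x < clamp z -> y < x < z.
  by split; rewrite in_itv/=; apply: H; [move: xi|move: xj]; rewrite in_itv.
move=> /andP[h1 h2]; case/andP: (clamp_itv y) => h3 _; case/andP: (clamp_itv z) => _ h4.
have xab : a <= x <= b by rewrite (ltW (le_lt_trans h3 h1)) (ltW (lt_le_trans h2 h4)).
by apply/andP; split; rewrite ltNge; apply/negP => /clamp_nd; rewrite (clamp_id xab) leNgt ?h1 ?h2.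
Qed.

Lemma acR_clamp f :
  (forall e, 0 < e -> exists2 d, 0 < d & forall m (l r : 'I_m -> R),
    (forall k, [/\ a <= l k, l k <= r k & r k <= b]) ->
    trivIset [set: 'I_m] (fun k => `]l k, r k[%classic) ->
    \sum_(k < m) (r k - l k) < d -> \sum_(k < m) `|f (r k) - f (l k)| < e) ->
  acR (f \o clamp).
Proof.
move=> acf e e0; have [d d0 D] := acf e e0; exists d => // m l r lr tlr ds.
apply: D; last 2 first.
- exact: clamp_disj.
- by apply: le_lt_trans ds; apply: ler_sum => k _; exact: clamp_lip.
- move=> k; have /andP[h1 h2] := clamp_itv (l k); have /andP[h3 h4] := clamp_itv (r k).
  by split => //; exact: clamp_nd.
Qed.

Lemma acRB f h : acR f -> acR h -> acR (f \- h).
Proof.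
move=> acf ach e e0; have e2 : 0 < e / 2 by rewrite divr_gt0.
have [d d0 D] := acf _ e2; have [c c0 C] := ach _ e2.
exists (Num.min d c); first by rewrite lt_min d0.
move=> m l r lr tlr; rewrite lt_min => /andP[hd hc].
have := D m l r lr tlr hd; have := C m l r lr tlr hc.
set s1 := \sum_(_ < _) _; set s2 := \sum_(_ < _) _ => h1 h2.
apply: (@le_lt_trans _ _ (s2 + s1)); last by rewrite [ltRHS](splitr e) ltrD.
rewrite /s1 /s2 -big_split/=; apply: ler_sum => k _.
have -> : (f \- h) (r k) - (f \- h) (l k) = (f (r k) - f (l k)) - (h (r k) - h (l k)).
  by rewrite /=; ring.
exact: ler_normB.
Qed.

(** Jordan decomposition: the variation V and V - f are nondecreasing, bounded and absolutely
    continuous, and f is their difference. *)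
Lemma acR_density f : acR f -> (forall x, f x = f (clamp x)) ->
  exists h : R -> R,
  [/\ mu.-integrable setT (EFin \o h),
     forall x y, x <= y -> (\int[mu]_(t in `]x, y]) (h t)%:E = (f y - f x)%:E)%E &
     {ae mu, forall x, derivable f x 1 /\ derive1 f x = h x}].
Proof.
move=> acf fc.
have TVfin x y : a <= x -> x <= y -> y <= b -> total_variation x y f \is a fin_num.
  by move=> _ xy _; exact: acR_TV_fin.
pose V x := fine (total_variation a (clamp x) f).
have VB x y : x <= y -> V y - V x = fine (total_variation (clamp x) (clamp y) f).
  move=> xy; have /andP[ax xb] := clamp_itv x; have /andP[ay yb] := clamp_itv y.
  have cxy := clamp_nd xy.
  rewrite /V (total_variationD f ax cxy) fineD ?TVfin//.
  by rewrite addrC addKr.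
have Vge x y : x <= y -> `|f y - f x| <= V y - V x.
  move=> xy; rewrite VB// fc (fc x) -lee_fin fineK; last first.
    by apply: TVfin; [have /andP[]:= clamp_itv x|exact: clamp_nd|have /andP[]:= clamp_itv y].
  by apply: total_variation_ge; exact: clamp_nd.
have Vnd : {homo V : x y / x <= y}.
  by move=> x y xy; rewrite -subr_ge0; apply: le_trans (Vge _ _ xy).
have acV : acR V.
  move=> e e0; have e2 : 0 < e / 2 by rewrite divr_gt0.
  have [d d0 D] := acR_variation acf e2; exists d => // m l r lr tlr ds.
  have := D m (clamp \o l) (clamp \o r) (fun k => clamp_nd (lr k)) (clamp_disj tlr).
  have cd : \sum_(k < m) ((clamp \o r) k - (clamp \o l) k) < d.
    by apply: le_lt_trans ds; apply: ler_sum => k _; exact: clamp_lip.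
  move=> /(_ cd) H.
  apply: (@le_lt_trans _ _ (e / 2)); last by rewrite ltr_pdivrMr// ltr_pMr// ltr1n.
  rewrite -lee_fin -sumEFin; apply: le_trans H; apply: lee_sum => k _.
  rewrite ger0_norm; last by rewrite subr_ge0 Vnd.
  rewrite VB// fineK//; apply: TVfin; [have /andP[]:= clamp_itv (l k)|exact: clamp_nd|have /andP[]:= clamp_itv (r k)] => //.
have clampK x : clamp (clamp x) = clamp x by apply: clamp_id; exact: clamp_itv.
have bnd (G : R -> R) : {homo G : x y / x <= y} -> (forall x, G x = G (clamp x)) ->
    exists B, forall x, `|G x| <= B.
  move=> Gnd Gc; exists (`|G a| + `|G b|) => x; rewrite Gc ler_norml.
  have /andP[/Gnd h1 /Gnd h2] := clamp_itv x.
  have := ler_norm (G b); have := ler_norm (- G a); rewrite normrN.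
  by have := normr_ge0 (G a); have := normr_ge0 (G b); lra.
have Vc x : V x = V (clamp x) by rewrite /V clampK.
pose W := V \- f.
have Wnd : {homo W : x y / x <= y}.
  by move=> x y xy; rewrite /W /=; have := Vge _ _ xy; rewrite ler_norml; lra.
have Wc x : W x = W (clamp x) by rewrite /W /= -Vc -fc.
have [B1 VB1] := bnd V Vnd Vc; have [B2 WB2] := bnd W Wnd Wc.
have [h1 [i1 I1 D1]] := ac_nondecreasing_density Vnd acV VB1.
have [h2 [i2 I2 D2]] := ac_nondecreasing_density Wnd (acRB acV acf) WB2.
have fE : f = V \- W by apply/funext => x; rewrite /W /=; ring.
exists (h1 \- h2); split.
- have -> : EFin \o (h1 \- h2) = ((EFin \o h1) \- (EFin \o h2))%E by [].
  exact: integrableB.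
- move=> x y xy.
  under eq_integral do rewrite EFinB.
  rewrite integralB_EFin//; [|by apply: integrableS i1|by apply: integrableS i2].
  by rewrite I1// I2// -EFinB fE /=; congr EFin; ring.
- move: D1 D2; apply: filterS2; first exact: (ae_filter_ringOfSetsType mu).
  move=> x [dV V'] [dW W'].
  rewrite fE; split; first exact: (derivableB dV dW).
  by rewrite derive1E (deriveB dV dW) -!derive1E V' W'.
Qed.
End Clamp.
End AbsCont.

(** * Integrals of functions known off a null set *)

Section AEInt.
Context {R : realType}.
Notation mu := (@lebesgue_measure R).
Implicit Types (a b : R) (f g : R -> \bar R).

Import HBNNSimple.

(** Neither function is assumed measurable, so the integral is a bare supremum over simple functions
    lying below. Killing such a simple function on the null set [N] keeps its integral and puts it
    below the other function. *)
Lemma integral_eq_off_null (D N : set R) f g : measurable N -> mu N = 0%E ->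
  (forall x, D x -> ~ N x -> f x = g x) ->
  (\int[mu]_(x in D) f x = \int[mu]_(x in D) g x)%E.
Proof.
move=> mN N0.
(* The second alternative cannot occur for positive and negative parts, the only functions to which
   this is applied. *)
suff H f' g' : (forall x, ~ N x -> f' x = g' x) ->
   (ereal_sup [set sintegral mu h | h in [set h : {nnsfun measurableTypeR R >-> R} |
      forall x, ((h x)%:E <= f' x)%E]] <=
    ereal_sup [set sintegral mu h | h in [set h : {nnsfun measurableTypeR R >-> R} |
      forall x, ((h x)%:E <= g' x)%E]])%E \/ (exists x, N x /\ g' x < 0)%E.
  move=> fg.
  have P f' g' : (forall x, ~ N x -> f' x = g' x) -> (forall x, 0 <= g' x)%E ->
    (ereal_sup [set sintegral mu h | h in [set h : {nnsfun measurableTypeR R >-> R} |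
      forall x, ((h x)%:E <= f' x)%E]] <=
    ereal_sup [set sintegral mu h | h in [set h : {nnsfun measurableTypeR R >-> R} |
      forall x, ((h x)%:E <= g' x)%E]])%E.
    by move=> fg' g0; have [//|[x [_]]] := H _ _ fg'; rewrite ltNge g0.
  rewrite /integral; congr (_ - _)%E; apply/eqP; rewrite eq_le; apply/andP; split;
    apply: P => x; rewrite ?funepos_ge0 ?funeneg_ge0// => Nx;
    rewrite ?funeposE ?funenegE /patch; case: ifPn => //; rewrite inE => Dx;
    by rewrite fg.
move=> fg; have [g0|/existsNP[x]] := pselect (forall x, N x -> 0 <= g' x)%E; last first.
  by move=> /not_implyP[Nx /negP]; rewrite -ltNge => gx; right; exists x.
left; apply: ge_ereal_sup => _ [h hf <-]; apply: ereal_sup_ubound.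
have mNc : measurable (~` N) by exact: measurableC.
exists (proj_nnsfun h mNc).
  move=> x; rewrite /= /proj_nnsfun/= mindicE.
  have [/set_mem Nx|Nx] := boolP (x \in ~` N); first by rewrite mulr1 -fg.
  rewrite mulr0 g0//; apply: contrapT => nN; move/negP: Nx; apply; exact/mem_set.
transitivity (\int[mu]_x (proj_nnsfun h mNc x)%:E)%E; first by rewrite integralT_nnsfun.
rewrite -integralT_nnsfun; apply: ge0_ae_eq_integral => //.
- by apply/measurable_EFinP; exact: measurable_funTS.
- by apply/measurable_EFinP; exact: measurable_funTS.
- by move=> x _; rewrite lee_fin.
- by move=> x _; rewrite lee_fin.
exists N; split => // x /= xh; apply: contrapT => Nx; apply: xh => _.
by rewrite /proj_nnsfun/= mindicE mem_set// mulr1.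
Qed.

(** The Lagrangian along a curve is under control only where the curve is differentiable, so its
    measurability is stated for a representative off a null set. *)
Definition aem a b f := exists (g : R -> \bar R) (N : set R),
  [/\ measurable_fun `[a, b] g, measurable N, mu N = 0%E &
   forall x, a <= x <= b -> ~ N x -> f x = g x].

Lemma aem_glue a m b f : a <= m -> m <= b -> aem a m f -> aem m b f -> aem a b f.
Proof.
move=> am mb [g1 [N1 [mg1 mN1 N10 fg1]]] [g2 [N2 [mg2 mN2 N20 fg2]]].
exists (fun x => if x <= m then g1 x else g2 x), (N1 `|` N2); split.
- rewrite (_ : `[a, b]%classic = `[a, m] `|` `]m, b]); last first.
    by rewrite -itv_bndbnd_setU// bnd_simp.
  apply/measurable_funU; [exact: measurable_itv|exact: measurable_itv|split].
    apply: eq_measurable_fun mg1 => x; rewrite inE/= in_itv/= => /andP[_ ->] //.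
  apply: (@eq_measurable_fun _ _ _ _ _ g2).
    by move=> x; rewrite inE/= in_itv/= => /andP[]; rewrite ltNge => /negbTE ->.
  apply: measurable_funS mg2; first exact: measurable_itv.
  by apply: subset_itvr; rewrite bnd_simp.
- exact: measurableU.
- by apply/eqP; rewrite measureU0//; apply/eqP.
- move=> x /andP[ax xb] /not_orP[h1 h2]; case: leP => xm.
    by apply: fg1 => //; rewrite ax xm.
  by apply: fg2 => //; rewrite xb ltW.
Qed.

Lemma mu_segment (a b : R) : a <= b -> mu `[a, b]%classic = (b - a)%:E.
Proof.
move=> ab; rewrite lebesgue_measure_itv/= lte_fin; case: ltP => // ba.
by rewrite (_ : b = a) ?subrr//; apply/eqP; rewrite eq_le ab ba.
Qed.

Lemma integral_addc a b (C : R) g : a <= b -> 0 <= C -> measurable_fun `[a, b] g ->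
  (forall x, a <= x <= b -> ((- C)%:E <= g x)%E) ->
  (\int[mu]_(x in `[a, b]) (g x + C%:E) =
   \int[mu]_(x in `[a, b]) g x + (C * (b - a))%:E)%E.
Proof.
move=> ab C0 mg gC.
have mI : measurable (`[a, b]%classic : set (measurableTypeR R)) by exact: measurable_itv.
have muab := mu_segment ab.
have gC' x : x \in `[a, b] -> ((- C)%:E <= g x)%E by rewrite in_itv; exact: gC.
have n1 x : `[a, b]%classic x -> (0 <= g x + C%:E)%E.
  by move=> /gC' h; rewrite -(@oppeK _ C%:E) sube_ge0// EFinN.
have n2 : (\int[mu]_(x in `[a, b]) (g x + C%:E) + \int[mu]_(x in `[a, b]) (g^\- x) =
   \int[mu]_(x in `[a, b]) g^\+ x + \int[mu]_(x in `[a, b]) C%:E)%E.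
  rewrite -!ge0_integralD//.
  - apply: eq_integral => x; rewrite inE/= => xab.
    rewrite funeposE funenegE; have := gC' _ xab.
    case: (g x) => [r| |]//=; rewrite ?lee_fin => rC.
    + rewrite -!EFin_max -!EFinD; congr EFin.
      by case: (leP r 0); case: (leP (-r) 0); lra.
    + by rewrite maxye maxNye adde0.
  - exact: measurable_funepos.
  - by apply: emeasurable_funD => //; exact: measurable_cst.
  - exact: measurable_funeneg.
have intC : (\int[mu]_(x in `[a, b]) C%:E = (C * (b - a))%:E)%E.
  transitivity (C%:E * mu `[a, b]%classic)%E; first exact: integral_cst.
  by rewrite muab.
have fn : (\int[mu]_(x in `[a, b]) g^\- x)%E \is a fin_num.
  rewrite ge0_fin_numE; last by apply: integral_ge0 => x _; rewrite funeneg_ge0.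
  apply: (@le_lt_trans _ _ (\int[mu]_(x in `[a, b]) C%:E)%E).
    apply: ge0_le_integral => //.
    - exact: measurable_funeneg.
    - move=> x xab; rewrite funenegE ge_max lee_fin C0 andbT leeNl; exact: gC'.
  by rewrite intC ltry.
rewrite [in RHS]integralE.
move: n2; rewrite intC => n2.
by rewrite -[LHS](@addeK _ _ _ fn) n2 addeAC.
Qed.


Lemma integral_subc a b (C : R) g : a <= b -> 0 <= C -> measurable_fun `[a, b] g ->
  (forall x, a <= x <= b -> ((- C)%:E <= g x)%E) ->
  (\int[mu]_(x in `[a, b]) g x =
   \int[mu]_(x in `[a, b]) (g x + C%:E) - (C * (b - a))%:E)%E.
Proof. by move=> ab C0 mg gC; rewrite integral_addc// addeK. Qed.

Lemma itv_lower a b C f g N : (forall x, a <= x <= b -> ((- C)%:E <= f x)%E) ->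
  (forall x, a <= x <= b -> ~ N x -> f x = g x) ->
  forall x, a <= x <= b -> ((- C)%:E <= maxe (g x) (- C)%:E)%E /\
    (~ N x -> f x = maxe (g x) (- C)%:E).
Proof.
move=> fC fg x xab; rewrite le_max lexx orbT; split => // Nx.
by rewrite -fg// max_l// fC.
Qed.

Lemma aem_lower a b C f : aem a b f ->
  (forall x, a <= x <= b -> ((- C)%:E <= f x)%E) ->
  exists (g : R -> \bar R) (N : set R),
  [/\ measurable_fun `[a, b] g, measurable N, mu N = 0%E,
   forall x, a <= x <= b -> ((- C)%:E <= g x)%E &
   forall x, a <= x <= b -> ~ N x -> f x = g x].
Proof.
move=> [g [N [mg mN N0 fg]]] fC; exists (fun x => maxe (g x) (- C)%:E), N; split => //.
- by apply: measurable_maxe => //; exact: measurable_cst.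
- by move=> x xab; have [] := itv_lower fC fg xab.
- by move=> x xab; have [] := itv_lower fC fg xab.
Qed.

Lemma int_split a m b C f : a <= m -> m <= b -> 0 <= C -> aem a b f ->
  (forall x, a <= x <= b -> ((- C)%:E <= f x)%E) ->
  (\int[mu]_(x in `[a, b]) f x =
   \int[mu]_(x in `[a, m]) f x + \int[mu]_(x in `[m, b]) f x)%E.
Proof.
move=> am mb C0 aef fC; have [g [N [mg mN N0 gC fg]]] := aem_lower aef fC.
have sub1 x : a <= x <= m -> a <= x <= b by move=> /andP[-> /le_trans]; apply.
have sub2 x : m <= x <= b -> a <= x <= b by move=> /andP[/(le_trans am) -> ->].
have ab := le_trans am mb.
rewrite (@integral_eq_off_null `[a, b] N f g)//.
rewrite (@integral_eq_off_null `[a, m] N f g)//; last first.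
  by move=> x /=; rewrite in_itv/= => /sub1; exact: fg.
rewrite (@integral_eq_off_null `[m, b] N f g)//; last first.
  by move=> x /=; rewrite in_itv/= => /sub2; exact: fg.
have mg1 : measurable_fun `[a, m] g.
  apply: (measurable_funS _ _ mg); first exact: measurable_itv.
  by apply: subset_itv; rewrite bnd_simp.
have mg2 : measurable_fun `[m, b] g.
  apply: (measurable_funS _ _ mg); first exact: measurable_itv.
  by apply: subset_itv; rewrite bnd_simp.
have mg2' : measurable_fun `]m, b] (fun x => g x + C%:E)%E.
  apply: emeasurable_funD => //.
  apply: (measurable_funS _ _ mg2); first exact: measurable_itv.
  by apply: subset_itv; rewrite bnd_simp.
rewrite (integral_subc ab C0 mg gC) (integral_subc am C0 mg1 (fun x h => gC x (sub1 x h))).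
rewrite (integral_subc mb C0 mg2 (fun x h => gC x (sub2 x h))) addeACA.
rewrite -(integral_itv_obnd_cbnd mg2') -ge0_integral_setU//.
- rewrite -itv_bndbnd_setU ?bnd_simp//; congr (_ + _)%E.
  by rewrite -EFinD; congr EFin; ring.
- rewrite -itv_bndbnd_setU ?bnd_simp//; apply: emeasurable_funD => //.
- rewrite -itv_bndbnd_setU ?bnd_simp//= => x; rewrite in_itv/= => /gC h.
  by rewrite -(@oppeK _ C%:E) sube_ge0// EFinN.
- apply/disj_setPS => x [/=]; rewrite !in_itv/= => /andP[_ xm] /andP[mx _].
  by move: (lt_le_trans mx xm); rewrite ltxx.
Qed.

(** All terms are made nonnegative by adding C and by sending the negative part of k to the left;
    monotonicity of nonnegative integrals then applies off the union of the null sets. *)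
Lemma int_le a b C f1 f2 (N : set R) (k : R -> R) : a <= b -> 0 <= C ->
  measurable N -> mu N = 0%E ->
  aem a b f1 -> aem a b f2 -> mu.-integrable `[a, b] (EFin \o k) ->
  (forall x, a <= x <= b -> ((- C)%:E <= f1 x)%E) ->
  (forall x, a <= x <= b -> ((- C)%:E <= f2 x)%E) ->
  (forall x, a <= x <= b -> ~ N x -> (f1 x <= f2 x + (k x)%:E)%E) ->
  (\int[mu]_(x in `[a, b]) f1 x <=
   \int[mu]_(x in `[a, b]) f2 x + \int[mu]_(x in `[a, b]) (k x)%:E)%E.
Proof.
move=> ab C0 mN N0 aef1 aef2 ik fC1 fC2 f12.
have [g1 [N1 [mg1 mN1 N10 gC1 fg1]]] := aem_lower aef1 fC1.
have [g2 [N2 [mg2 mN2 N20 gC2 fg2]]] := aem_lower aef2 fC2.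
have mI : measurable (`[a, b]%classic : set (measurableTypeR R)) by exact: measurable_itv.
rewrite (@integral_eq_off_null `[a, b] N1 f1 g1)//.
rewrite (@integral_eq_off_null `[a, b] N2 f2 g2)//.
rewrite (integral_subc ab C0 mg1 gC1) (integral_subc ab C0 mg2 gC2) addeAC leeD2r//.
have ge0 (g : R -> \bar R) : (forall x, a <= x <= b -> ((- C)%:E <= g x)%E) ->
    forall x, `[a, b]%classic x -> (0 <= g x + C%:E)%E.
  move=> gC x /=; rewrite in_itv/= => /gC h.
  by rewrite -(@oppeK _ C%:E) sube_ge0// EFinN.
have mk : measurable_fun `[a, b] (EFin \o k) by have /integrableP[] := ik.
have mD (g : R -> \bar R) : measurable_fun `[a, b] g -> measurable_fun `[a, b] (fun x => g x + C%:E)%E.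
  by move=> mg; exact: emeasurable_funD.
have fn : (\int[mu]_(x in `[a, b]) ((EFin \o k)^\- x))%E \is a fin_num.
  exact: integrable_neg_fin_num.
rewrite [X in (_ <= _ + X)%E]integralE addeA leeBrDr//.
rewrite -!ge0_integralD//; try by [exact: ge0|exact: mD|exact: measurable_funepos|exact: measurable_funeneg].
pose N' := N `|` (N1 `|` N2).
have mN' : measurable N' by apply: measurableU => //; exact: measurableU.
have N'0 : mu N' = 0%E by rewrite /N' !measureU0//; exact: measurableU.
rewrite (@ge0_negligible_integral _ _ _ mu `[a, b] N')//; last 2 first.
- by apply: emeasurable_funD; [exact: mD|exact: measurable_funeneg].
- by move=> x xab; apply: adde_ge0 => //; exact: ge0.
rewrite [leRHS](@ge0_negligible_integral _ _ _ mu `[a, b] N')//; last 2 first.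
- by apply: emeasurable_funD; [exact: mD|exact: measurable_funepos].
- by move=> x xab; apply: adde_ge0 => //; exact: ge0.
have mS (g : R -> \bar R) : measurable_fun `[a, b] g -> measurable_fun (`[a, b] `\` N') g.
  by move=> mg; apply: (measurable_funS _ _ mg) => //; exact: subDsetl.
apply: ge0_le_integral.
- exact: measurableD.
- by move=> x [xab _]; apply: adde_ge0 => //; exact: ge0.
- by apply: mS; apply: emeasurable_funD; [exact: mD|exact: measurable_funeneg].
- by apply: mS; apply: emeasurable_funD; [exact: mD|exact: measurable_funepos].
move=> x [xab /not_orP[nN /not_orP[nN1 nN2]]].
move: xab; rewrite /= in_itv/= => xab.
have := f12 x xab nN; rewrite (fg1 x xab nN1) (fg2 x xab nN2).
have := gC1 _ xab; have := gC2 _ xab.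
rewrite funeposE funenegE /=.
case: (g1 x) => [r1| |]; case: (g2 x) => [r2| |] //=; rewrite ?lee_fin => h2 h1 h12.
  rewrite -!EFin_max -!EFinD lee_fin.
  by case: (leP (k x) 0); case: (leP (- k x) 0); lra.
all: by rewrite -?EFin_max -?EFinD ?addye ?leey.
Qed.

Lemma lebesgue_shift (s : R) (A : set R) : measurable A ->
  pushforward mu ((fun x => x + s) : R -> measurableTypeR R) A = mu A.
Proof.
move=> mA; apply/esym.
have ms : measurable_fun setT ((fun x : R => x + s) : R -> measurableTypeR R).
  by apply: measurable_funD => //; exact: measurable_cst.
apply: (@lebesgue_measure_unique _ (pushforward mu ((fun x => x + s) : R -> measurableTypeR R))) => //.
move=> X [[l r] _ <-] /=.
rewrite /pushforward (_ : _ @^-1` _ = `]l - s, r - s]%classic); last first.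
  by apply/seteqP; split => x /=; rewrite !in_itv/=; lra.
rewrite !lebesgue_measure_itv/= !lte_fin ltrD2r.
by case: ifP => // _; rewrite -!EFinD; congr EFin; ring.
Qed.

(** Both sides are replaced by measurable representatives, made nonnegative by adding C, and
    compared as integrals against the pushforward of Lebesgue measure under the translation. *)
Lemma int_shift a b s C f : a <= b -> 0 <= C -> aem a b f ->
  (forall x, a <= x <= b -> ((- C)%:E <= f x)%E) ->
  (\int[mu]_(x in `[(a + s)%R, (b + s)%R]) f (x - s)%R =
   \int[mu]_(x in `[a, b]) f x)%E.
Proof.
move=> ab C0 aef fC; have [g [N [mg mN N0 gC fg]]] := aem_lower aef fC.
have ms : measurable_fun setT ((fun x : R => x + s) : R -> measurableTypeR R).
  by apply: measurable_funD => //; exact: measurable_cst.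
have ms' : measurable_fun setT ((fun x : R => x + (- s)) : R -> measurableTypeR R).
  by apply: measurable_funD => //; exact: measurable_cst.
have mI : measurable (`[a, b]%classic : set (measurableTypeR R)) by exact: measurable_itv.
rewrite (@integral_eq_off_null `[a, b] N f g)//.
rewrite (@integral_eq_off_null `[(a + s)%R, (b + s)%R] ((fun x => x - s) @^-1` N) _ (fun x => g (x - s)))//; last 3 first.
- by rewrite -[X in measurable X]setTI; exact: ms'.
- by rewrite -N0 -(lebesgue_shift (- s) mN).
- by move=> x /=; rewrite in_itv/= => xab Nx; apply: fg => //; lra.
have mgs : measurable_fun `[a + s, b + s] (fun x => g (x - s)).
  apply: (measurable_comp (F := `[a, b]%classic) (f := g)) => //.
  + by move=> _ [x /=] /[swap] <-; rewrite /= !in_itv/=; lra.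
  + exact: measurable_funTS.
rewrite (integral_subc ab C0 mg gC) (@integral_subc (a + s) (b + s) C)//; last 2 first.
- by rewrite lerD2r.
- by move=> x xab; apply: gC; lra.
have -> : b + s - (a + s) = b - a by ring.
congr (_ - _)%E.
have H := @ge0_integral_pushforward _ _ (measurableTypeR R) (measurableTypeR R) R (fun x : R => x + s : R) ms mu `[a + s, b + s]%classic
  (fun x : R => g (x - s)%R + C%:E)%E (measurable_itv _).
apply: (eq_trans _ (eq_trans (H _ _) _)).
- by apply: eq_measure_integral => A mA _; first [exact: lebesgue_shift|exact/esym/lebesgue_shift].
- exact: emeasurable_funD.
- move=> x; rewrite inE/= in_itv/= => xab.
  by rewrite -(@oppeK _ C%:E) sube_ge0//; apply: gC; lra.
- rewrite (_ : _ @^-1` _ = `[a, b]%classic); last first.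
    by apply/seteqP; split => x /=; rewrite !in_itv/=; lra.
  by apply: eq_integral => x _ /=; rewrite addrK.
Qed.

Lemma const_integrable (a b k : R) : mu.-integrable `[a, b] (EFin \o cst k).
Proof.
apply: continuous_compact_integrable; first exact: segment_compact.
by apply: continuous_subspaceT; exact: cst_continuous.
Qed.

Lemma const_integral (a b k : R) : a <= b -> (\int[mu]_(t in `[a, b]) (cst k t)%:E = (k * (b - a))%:E)%E.
Proof.
move=> ab; apply: etrans (integral_cst mu (measurable_itv `[a, b]) k%:E) _.
have muab := mu_segment ab.
exact: (congr1 (fun z : \bar R => k%:E * z)%E muab).
Qed.

Lemma aem_const (a b k : R) : aem a b (cst k%:E).
Proof. by exists (cst k%:E), set0; split => //; exact: measure0. Qed.

End AEInt.

(* [lra] after turning the non-arithmetic atoms into variables, which makes its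
   atom comparisons syntactic. *)
Ltac alra_generalize :=
  repeat match goal with
  | |- context [@Num.norm ?a ?b (@Algebra.add ?V ?x (@Algebra.opp ?W ?y))] =>
      let t := constr:(@Num.norm a b (@Algebra.add V x (@Algebra.opp W y))) in
      match goal with
      | |- context [@Num.norm ?a2 ?b2 (@Algebra.add ?V2 x (@Algebra.opp ?W2 y))] =>
        let t2 := constr:(@Num.norm a2 b2 (@Algebra.add V2 x (@Algebra.opp W2 y))) in
        tryif constr_eq t t2 then fail else change t2 with t
      end
  end;
  repeat match goal with
  | |- context [@Num.norm ?a ?b ?x] => generalize (@Num.norm a b x); intro
  | F : _ -> _ -> _ -> Real.sort _ |- context [?F ?a ?b ?c] => is_var F; generalize (F a b c); intro
  | w : _ -> _ -> Real.sort _ |- context [?w ?a ?b] => is_var w; generalize (w a b); intro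
  | w : _ -> Real.sort _ |- context [?w ?a] => is_var w; generalize (w a); intro
  end;
  clear; intros.
Ltac alra := alra_generalize; lra.

(** Reads one bound off an upper bound by an iterated [Num.min], the form in which all small
    parameters are chosen below. *)
Ltac min_ub bound := refine (le_trans bound _); rewrite ?ge_min lexx ?orbT.

(** * Proximal gradients of Lipschitz functions *)

Section Euclid.
Context {R : realType} {n : nat}.
Notation E := 'rV[R]_n.
Implicit Types (x y z p q : E).

(** The norm of 'rV[R]_n is the sup norm. Quadratic penalties need the Euclidean structure, hence a
    separate inner product [dot], squared norm [nsq] and norm [en]; passing to the sup norm costs
    the factor sqrt n. *)
Definition dot x y : R := \sum_i x 0 i * y 0 i.
Definition nsq x := dot x x.
Definition en x : R := Num.sqrt (nsq x).

Lemma dotC x y : dot x y = dot y x.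
Proof. by apply: eq_bigr => i _; rewrite mulrC. Qed.
Lemma dotDl x y z : dot (x + y) z = dot x z + dot y z.
Proof. by rewrite -big_split; apply: eq_bigr => i _; rewrite mxE mulrDl. Qed.
Lemma dotZl a x y : dot (a *: x) y = a * dot x y.
Proof. by rewrite mulr_sumr; apply: eq_bigr => i _; rewrite mxE mulrA. Qed.
Lemma dotNl x y : dot (- x) y = - dot x y.
Proof. by rewrite -scaleN1r dotZl mulN1r. Qed.
Lemma dotBl x y z : dot (x - y) z = dot x z - dot y z.
Proof. by rewrite dotDl dotNl. Qed.
Lemma dotDr x y z : dot z (x + y) = dot z x + dot z y.
Proof. by rewrite !(dotC z) dotDl. Qed.
Lemma dotZr a x y : dot y (a *: x) = a * dot y x.
Proof. by rewrite !(dotC y) dotZl. Qed.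
Lemma dotNr x y : dot y (- x) = - dot y x.
Proof. by rewrite !(dotC y) dotNl. Qed.
Lemma dotBr x y z : dot z (x - y) = dot z x - dot z y.
Proof. by rewrite dotDr dotNr. Qed.
Lemma dot0l x : dot 0 x = 0.
Proof. by rewrite -(scale0r 0) dotZl mul0r. Qed.
Lemma dot0r x : dot x 0 = 0.
Proof. by rewrite dotC dot0l. Qed.
Definition dotE := (dotDl, dotDr, dotNl, dotNr, dotZl, dotZr, dot0l, dot0r).

Lemma nsq_ge0 x : 0 <= nsq x.
Proof. by apply: sumr_ge0 => i _; rewrite -expr2 sqr_ge0. Qed.
Lemma nsqD x y : nsq (x + y) = nsq x + 2 * dot x y + nsq y.
Proof. by rewrite /nsq !dotE (dotC y x); ring. Qed.
Lemma nsqB x y : nsq (x - y) = nsq x - 2 * dot x y + nsq y.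
Proof. by rewrite /nsq !dotE (dotC y x); ring. Qed.
Lemma nsqZ a x : nsq (a *: x) = a ^+ 2 * nsq x.
Proof. by rewrite /nsq !dotE; ring. Qed.
Lemma nsqN x : nsq (- x) = nsq x.
Proof. by rewrite /nsq !dotE opprK. Qed.
Lemma nsq0 : nsq 0 = 0.
Proof. by rewrite /nsq dot0l. Qed.
Lemma nsqC x y : nsq (x - y) = nsq (y - x).
Proof. by rewrite -nsqN opprB. Qed.

Lemma coord_le_norm x i : `|x 0 i| <= `|x|.
Proof.
rewrite [leRHS]/Num.norm/= mx_normrE.
by apply: (le_bigmax _ (fun i : 'I_1 * 'I_n => `|x i.1 i.2|) (0, i)).
Qed.

Lemma norm_sq_le x : `|x| ^+ 2 <= nsq x.
Proof.
rewrite [X in X ^+ 2]/Num.norm/= mx_normrE.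
have [->|[i ->]] : \big[Num.max/0%R]_i `|x i.1 i.2| = 0 \/
    exists i, \big[Num.max/0%R]_i `|x i.1 i.2| = `|x 0 i|.
- elim/big_ind: _ => [|a b|[j i] _]; first by left.
  + by move=> ha hb; case: (leP a b) => _; [exact: hb|exact: ha].
  + by right; exists i; rewrite (ord1 j).
- by rewrite expr0n nsq_ge0.
- rewrite /nsq /dot (bigD1 i)//= real_normK ?num_real// expr2 lerDl.
  by apply: sumr_ge0 => j _; rewrite -expr2 sqr_ge0.
Qed.

Lemma nsq_le_norm x : nsq x <= n%:R * `|x| ^+ 2.
Proof.
rewrite -[X in X%:R]card_ord mulr_natl -sumr_const; apply: ler_sum => i _.
rewrite -expr2 -real_normK ?num_real// lerXn2r ?nnegrE//; exact: coord_le_norm.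
Qed.

Lemma en_ge0 x : 0 <= en x. Proof. exact: sqrtr_ge0. Qed.
Lemma en_sq x : en x ^+ 2 = nsq x. Proof. by rewrite sqr_sqrtr ?nsq_ge0. Qed.
Lemma norm_le_en x : `|x| <= en x.
Proof.
by rewrite -(@ler_pXn2r _ 2)// ?nnegrE ?en_ge0// en_sq norm_sq_le.
Qed.
Lemma enN x : en (- x) = en x. Proof. by rewrite /en nsqN. Qed.
Lemma enC x y : en (x - y) = en (y - x). Proof. by rewrite /en nsqC. Qed.
Lemma en0 : en 0 = 0. Proof. by rewrite /en nsq0 sqrtr0. Qed.
Lemma enZ a x : en (a *: x) = `|a| * en x.
Proof. by rewrite /en nsqZ sqrtrM ?sqr_ge0// sqrtr_sqr. Qed.
Lemma en_eq0 x : en x = 0 -> x = 0.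
Proof. by move=> x0; apply/eqP; rewrite -normr_eq0 eq_le normr_ge0 andbT -x0 norm_le_en. Qed.
Lemma en_gt0 x : x != 0 -> 0 < en x.
Proof. by move=> x0; rewrite lt_neqAle en_ge0 andbT; apply: contra x0 => /eqP/esym/en_eq0 ->. Qed.
Lemma en_le_norm x : en x <= Num.sqrt n%:R * `|x|.
Proof.
rewrite -(@ler_pXn2r _ 2)// ?nnegrE ?en_ge0// ?mulr_ge0 ?sqrtr_ge0// en_sq.
by rewrite exprMn sqr_sqrtr ?ler0n// nsq_le_norm.
Qed.

Lemma dot_sq_le x y : dot x y ^+ 2 <= nsq x * nsq y.
Proof.
have [y0|y0] := eqVneq (nsq y) 0.
  have -> : y = 0 by apply: en_eq0; rewrite /en y0 sqrtr0.
  by rewrite dot0r nsq0 mulr0 expr0n.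
have yp : 0 < nsq y by rewrite lt_neqAle eq_sym y0 nsq_ge0.
have := nsq_ge0 (nsq y *: x - dot x y *: y); rewrite nsqB !nsqZ !dotE -/(nsq y).
rewrite (_ : _ + _ = nsq y * (nsq x * nsq y - dot x y ^+ 2)); last by ring.
by rewrite pmulr_rge0// subr_ge0.
Qed.

Lemma dot_le x y : dot x y <= en x * en y.
Proof.
have [h|h] := leP (dot x y) 0; first by apply: le_trans h _; rewrite mulr_ge0 ?en_ge0.
rewrite -(@ler_pXn2r _ 2)// ?nnegrE ?mulr_ge0 ?en_ge0 ?(ltW h)//.
by rewrite exprMn !en_sq dot_sq_le.
Qed.

Lemma abs_dot_le x y : `|dot x y| <= en x * en y.
Proof. by rewrite ler_norml dot_le lerNl -dotNl -(enN x) dot_le. Qed.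

Lemma enD x y : en (x + y) <= en x + en y.
Proof.
rewrite -(@ler_pXn2r _ 2)// ?nnegrE ?addr_ge0 ?en_ge0//.
rewrite en_sq nsqD sqrrD !en_sq lerD2r lerD2l -[leRHS]mulr_natl ler_pM2l//.
exact: dot_le.
Qed.
Lemma enB x y z : en (x - z) <= en (x - y) + en (y - z).
Proof. by rewrite (_ : x - z = (x - y) + (y - z)) ?enD//; rewrite addrA subrK. Qed.

(** A quadratic function that touches the norm from above on the sphere of radius e; it turns cones
    into paraboloids away from their vertex. *)
Lemma en_quad x (e : R) : 0 < e -> en x <= e + (nsq x - e ^+ 2) / (2 * e).
Proof.
move=> e0; rewrite -subr_ge0 -en_sq.
have -> : e + (en x ^+ 2 - e ^+ 2) / (2 * e) - en x = (en x - e) ^+ 2 / (2 * e).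
  by field; rewrite gt_eqF.
by rewrite divr_ge0 ?sqr_ge0// mulr_ge0// ltW.
Qed.

Lemma continuous_sum (T : topologicalType) (I : Type) (r : seq I) (P : pred I)
    (f : I -> T -> R) (x : T) : (forall i, P i -> {for x, continuous (f i)}) ->
  {for x, continuous (fun t => \sum_(i <- r | P i) f i t)}.
Proof.
move=> fc; elim: r => [|i r IH].
  rewrite (_ : (fun _ => _) = cst 0); first exact: cvg_cst.
  by apply/funext => t; rewrite big_nil.
have [Pi|nPi] := boolP (P i).
  rewrite (_ : (fun _ => _) = fun t => f i t + \sum_(i <- r | P i) f i t).
    by apply: cvgD; [exact: fc|exact: IH].
  by apply/funext => t; rewrite big_cons Pi.
rewrite (_ : (fun _ => _) = fun t => \sum_(i <- r | P i) f i t) //.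
by apply/funext => t; rewrite big_cons (negbTE nPi).
Qed.

Lemma dot_continuous q : continuous (dot q).
Proof.
move=> x; rewrite /dot; apply: continuous_sum => i _.
by apply: continuousM; [exact: cst_continuous|exact: coord_continuous].
Qed.
Lemma nsq_continuous : continuous nsq.
Proof.
by move=> x; apply: continuous_sum => i _; apply: continuousM; exact: coord_continuous.
Qed.
Lemma en_continuous : continuous en.
Proof. by move=> x; apply: continuous_comp; [exact: nsq_continuous|exact: sqrt_continuous]. Qed.

Definition cball (y : E) (r : R) : set E := [set z | `|z - y| <= r].

Lemma cball_compact y r : compact (cball y r).
Proof.
apply: bounded_closed_compact.
  exists (`|y| + r); split; first by rewrite num_real.
  move=> M yM z /= zy; apply: le_trans (ltW yM).
  by rewrite -(subrK y z) (le_trans (ler_normD _ _))// addrC lerD.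
have -> : cball y r = (fun z => `|z - y|) @^-1` [set t | t <= r] by [].
apply: closed_comp; last exact: closed_le.
move=> z _; apply: continuous_comp; last exact: norm_continuous.
by apply: continuousB; [exact: id|exact: cst_continuous].
Qed.

Lemma near_cball y r z : `|z - y| < r -> \forall x \near z, `|x - y| <= r.
Proof.
move=> zy; near=> x.
have : `|z - x| < r - `|z - y| by near: x; apply: cvgr_dist_lt => //; rewrite subr_gt0.
have -> : x - y = (z - y) - (z - x) by rewrite opprB [RHS]addrC subrKA.
have := ler_normB (z - y) (z - x); lra.
Unshelve. all: by end_near. Qed.

End Euclid.

Section LocalViscosity.
Context {R : realType} {n : nat}.
Notation E := 'rV[R]_n.
Implicit Types (x y z p q : E) (w : E -> R) (F : E -> E -> R -> R).

Lemma near_normP (P : E -> Prop) y :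
  (\forall z \near y, P z) <-> exists2 d : R, 0 < d & forall z, `|z - y| < d -> P z.
Proof.
split.
  move=> /nbhs_ballP[d /= d0 H]; exists d => // z zy; apply: H.
  by rewrite -ball_normE /= distrC.
move=> [d d0 H]; apply/nbhs_ballP; exists d => //= z.
by rewrite -ball_normE /= distrC; exact: H.
Qed.

Lemma contE w y : {for y, continuous w} <->
  forall e : R, 0 < e -> exists2 d : R, 0 < d & forall z, `|z - y| < d -> `|w z - w y| < e.
Proof.
split.
  move=> wc e e0; apply/near_normP.
  have h : \forall z \near y, ball (w y) e (w z) := wc _ (nbhsx_ballx (w y) e e0).
  by apply: filterS h => z; rewrite -ball_normE /= distrC.
move=> H A /nbhs_ballP[e /= e0 eA].
have /near_normP := H e e0; rewrite /nbhs/=; apply: filterS => z wz; apply: eA.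
by rewrite -ball_normE /= distrC.
Qed.

Lemma compact_max (T : topologicalType) (f : T -> R) (A : set T) :
  A !=set0 -> compact A -> (forall x : T, A x -> {for x, continuous f}) ->
  exists2 m, A m & forall x : T, A x -> f x <= f m.
Proof.
move=> A0 cA fc; have fc' : {within A, continuous f}.
  by apply: continuous_in_subspaceT => x; rewrite inE; exact: fc.
have [m mA mM] := compact_EVT_max A0 cA fc'.
exists m; first by move: mA; rewrite inE.
by move=> x Ax; apply: mM; rewrite inE.
Qed.

Lemma cball_max w y r : 0 <= r -> (forall x, `|x - y| <= r -> {for x, continuous w}) ->
  exists2 m, `|m - y| <= r & forall x, `|x - y| <= r -> w x <= w m.
Proof.
move=> r0 wc; apply: (compact_max (A := cball y r)) => //.
- by exists y; rewrite /cball/= subrr normr0.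
- exact: cball_compact.
Qed.

Lemma sub_continuous y : continuous (fun z : E => z - y).
Proof. by move=> x; apply: continuousB; [exact: id|exact: cst_continuous]. Qed.
Lemma en_sub_continuous K y x : {for x, continuous (fun z : E => K * en (z - y))}.
Proof.
apply: continuousM; first exact: cst_continuous.
by apply: (@continuous_comp _ _ _ (fun z => z - y) en); [exact: sub_continuous|exact: en_continuous].
Qed.
Lemma nsq_sub_continuous K y x : {for x, continuous (fun z : E => K * nsq (z - y))}.
Proof.
apply: continuousM; first exact: cst_continuous.
by apply: (@continuous_comp _ _ _ (fun z => z - y) nsq); [exact: sub_continuous|exact: nsq_continuous].
Qed.
Lemma dot_sub_continuous p y x : {for x, continuous (fun z : E => dot p (z - y))}.
Proof.
by apply: (@continuous_comp _ _ _ (fun z => z - y) (dot p)); [exact: sub_continuous|exact: dot_continuous].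
Qed.

Lemma lin_ub_le0 (a b d : R) : 0 < d -> (forall t, 0 < t -> t <= d -> a <= b * t) -> a <= 0.
Proof.
move=> d0 H; rewrite leNgt; apply/negP => a0.
have b0 : 0 < b.
  by rewrite -(pmulr_lgt0 _ d0); apply: lt_le_trans a0 (H d d0 (lexx _)).
pose t := Num.min d (a / (2 * b)).
have t0 : 0 < t by rewrite lt_min d0 divr_gt0// mulr_gt0.
have := H t t0; rewrite /t ge_min lexx => /(_ isT).
apply/negP; rewrite -ltNge.
apply: (@le_lt_trans _ _ (b * (a / (2 * b)))).
  by rewrite ler_pM2l// ge_min lexx orbT.
rewrite (_ : b * _ = a / 2); last by field; rewrite gt_eqF.
lra.
Qed.

Lemma addrKx (V : zmodType) (x y : V) : x + y - x = y.
Proof. by rewrite addrAC subrr add0r. Qed.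
Lemma sub_split (V : zmodType) (x m z : V) : x - z = (m - z) + (x - m).
Proof. by rewrite [RHS]addrC addrA subrK. Qed.

(** Proximal super- and subgradients: touching by paraboloids of any curvature. They behave better
    than smooth test functions under penalization, and the viscosity inequalities can be read off
    them in both directions. *)
Definition psup w y q := exists N : R,
  \forall z \near y, w z <= w y + dot q (z - y) + N * nsq (z - y).
Definition psub w y q := exists N : R,
  \forall z \near y, w y + dot q (z - y) - N * nsq (z - y) <= w z.

Lemma psubN w y q : psub w y q -> psup (fun z => - w z) y (- q).
Proof. by move=> [N H]; exists N; apply: filterS H => z; rewrite dotNl; lra. Qed.
Lemma psupN w y q : psup w y q -> psub (fun z => - w z) y (- q).
Proof. by move=> [N H]; exists N; apply: filterS H => z; rewrite dotNl; lra. Qed.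

Lemma near_line (P : E -> Prop) y v : (\forall z \near y, P z) ->
  exists2 d : R, 0 < d & forall t, 0 <= t -> t < d -> P (y + t *: v).
Proof.
move=> /near_normP[d d0 H]; exists (d / (1 + `|v|)).
  by rewrite divr_gt0// ltr_pwDl.
move=> t t0; rewrite ltr_pdivlMr ?ltr_pwDl// => td; apply: H.
rewrite addrC addKr normrZ ger0_norm//; apply: le_lt_trans td.
by rewrite ler_wpM2l// lerDr.
Qed.

Definition lip_on w y0 r K := forall y z, `|y - y0| <= r -> `|z - y0| <= r ->
  `|w y - w z| <= K * en (y - z).

Lemma lip_continuous w y0 r K y : 0 <= K -> lip_on w y0 r K -> `|y - y0| < r ->
  {for y, continuous w}.
Proof.
move=> K0 wK yr; apply/contE => e e0.
have S0 : 0 <= Num.sqrt n%:R :> R by exact: sqrtr_ge0.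
have D0 : 0 < 1 + K * Num.sqrt n%:R by rewrite ltr_pwDl// mulr_ge0.
exists (Num.min (r - `|y - y0|) (e / (1 + K * Num.sqrt n%:R))).
  by rewrite lt_min subr_gt0 yr divr_gt0.
move=> z; rewrite lt_min => /andP[h1]; rewrite ltr_pdivlMr// => h2.
apply: le_lt_trans (wK _ _ _ (ltW yr)) _.
  by rewrite -(subrK y z) -addrA (le_trans (ler_normD _ _))//; lra.
apply: le_lt_trans h2; rewrite mulrDr mulr1 mulrCA.
apply: (@le_trans _ _ (K * (Num.sqrt n%:R * `|z - y|))).
  by rewrite ler_wpM2l// en_le_norm.
by rewrite (mulrC `|z - y|) lerDr.
Qed.


(** Moving from y in the direction -q, w would decrease faster than the Lipschitz constant allows if
    [en q] exceeded K. *)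
Lemma psup_lip w y0 r K y q : 0 <= K -> lip_on w y0 r K -> `|y - y0| < r ->
  psup w y q -> en q <= K.
Proof.
move=> K0 wK yr [N H].
have [->|q0] := eqVneq q 0; first by rewrite en0.
have e0 := en_gt0 q0.
have nr : \forall z \near y, w z <= w y + dot q (z - y) + N * nsq (z - y) /\ `|z - y0| <= r.
  by apply: filterI => //; exact: near_cball.
have [d d0 D] := near_line (- q) nr.
rewrite -subr_le0 -(pmulr_rle0 _ e0).
apply: (@lin_ub_le0 _ (N * nsq q) (d / 2)); first by rewrite divr_gt0.
move=> t t0 td.
have [||h1 h2] := D t; [exact: ltW|lra|].
have := wK y (y + t *: - q) (ltW yr) h2.
have -> : y - (y + t *: - q) = t *: q by rewrite opprD addrA subrr add0r scalerN opprK.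
rewrite enZ (gtr0_norm t0) => hw; move: h1 hw; rewrite !addrKx nsqZ nsqN !dotE -/(nsq q).
rewrite ler_norml -en_sq => h1 /andP[_ h3].
have : t * (en q * (en q - K)) <= t * (N * en q ^+ 2 * t).
  by rewrite !mulrBr; move: h1 h3; rewrite !expr2; nra.
by rewrite ler_pM2l.
Qed.

Lemma psub_lip w y0 r K y q : 0 <= K -> lip_on w y0 r K -> `|y - y0| < r ->
  psub w y q -> en q <= K.
Proof.
move=> K0 wK yr /psubN H; rewrite -enN.
apply: (psup_lip K0 _ yr H) => x z hx hz.
by rewrite -opprD normrN; exact: wK.
Qed.

(* Maximizing [w] minus a large multiple of the distance to [y]: coercivity
   forbids an interior maximum off [y]. *)
Lemma subsolution_lip F w y0 r B R0 K : 0 < r ->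
  (forall y q s, `|y - y0| <= r -> `|s| <= B -> R0 <= en q -> 0 < F y q s) ->
  (forall y, `|y - y0| <= r -> {for y, continuous w}) ->
  (forall y, `|y - y0| <= r -> `|w y| <= B) ->
  (forall y q, `|y - y0| < r -> psup w y q -> F y q (w y) <= 0) ->
  R0 <= K -> 0 <= K -> 2 * B < K * (r / 2) ->
  lip_on w y0 (r / 4) K.
Proof.
move=> r0 Fco wc wB ws R0K K0 BK.
suff H y z : `|y - y0| <= r / 4 -> `|z - y0| <= r / 4 -> w z - w y <= K * en (z - y).
  move=> y z hy hz; rewrite ler_norml lerNl opprB {1}enC.
  by rewrite !H.
move=> hy hz.
have sub x : `|x - y| <= r / 2 -> `|x - y0| < r.
  have := ler_normD (x - y) (y - y0); rewrite subrKA; lra.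
pose f x := w x - K * en (x - y).
have [||m mA mM'] := @cball_max f y (r / 2); first by rewrite divr_ge0// ltW.
  move=> x xy; apply: continuousB; first by apply: wc; apply/ltW/sub.
  exact: en_sub_continuous.
have yy : `|y - y| <= r / 2 by rewrite subrr normr0 divr_ge0// ltW.
have fy : f y = w y by rewrite /f subrr en0 mulr0 subr0.
have zy : `|z - y| <= r / 2.
  by have := ler_normB (z - y0) (y - y0); rewrite opprB subrKA; lra.
have := mM' _ zy; rewrite {1}/f.
suff -> : m = y by rewrite fy; lra.
apply/eqP; apply: contraT => my.
have my0 : m - y != 0 by rewrite subr_eq0.
have ep := en_gt0 my0.
have mr : `|m - y| < r / 2.
  rewrite lt_neqAle mA andbT; apply/eqP => mE.
  have := mM' _ yy; rewrite fy /f.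
  have : K * (r / 2) <= K * en (m - y) by rewrite ler_wpM2l// -mE norm_le_en.
  have := wB _ (ltW (sub _ mA)); have := wB _ (ltW (sub _ yy)).
  by rewrite !ler_norml; lra.
(* Off its vertex the cone is majorized by the paraboloid of [en_quad], so w has at m a proximal
   supergradient of length K, where F is positive. *)
suff ps : psup w m ((K / en (m - y)) *: (m - y)).
  have := ws _ _ (sub _ mA) ps; rewrite leNgt Fco//; first exact/ltW/sub.
    exact/wB/ltW/sub.
  by rewrite enZ ger0_norm ?divr_ge0 ?en_ge0// divfK ?gt_eqF.
exists (K / (2 * en (m - y))); apply/near_normP; exists (r / 2 - `|m - y|); first by rewrite subr_gt0.
move=> x xm.
have xy : `|x - y| <= r / 2 by have := ler_normD (x - m) (m - y); rewrite subrKA; lra.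
have := mM' _ xy; rewrite /f => h.
have q := en_quad (x - y) ep.
have : w x <= w m + K * (en (x - y) - en (m - y)) by lra.
move=> /le_trans; apply; rewrite -addrA lerD2l.
apply: (@le_trans _ _ (K * ((nsq (x - y) - en (m - y) ^+ 2) / (2 * en (m - y))))).
  by rewrite ler_wpM2l//; lra.
rewrite en_sq.
have -> : nsq (x - y) = nsq (m - y) + 2 * dot (m - y) (x - m) + nsq (x - m).
  by rewrite -nsqD -sub_split.
rewrite dotZl le_eqVlt; apply/orP; left; apply/eqP.
by field; rewrite gt_eqF.
Qed.

(* The test function is perturbed by [N |z - z0|^2], whose maximum point moves
   to [z0] as [N] grows. *)
Lemma frechet_subsolution F w z0 p :
  (forall e, 0 < e -> exists2 d, 0 < d & forall y q s, en (y - z0) < d ->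
     en (q - p) < d -> `|s - w z0| < d -> F z0 p (w z0) <= F y q s + e) ->
  (\forall y \near z0, {for y, continuous w}) ->
  (\forall y \near z0, forall q, psup w y q -> F y q (w y) <= 0) ->
  (forall sg, 0 < sg -> \forall z \near z0, w z <= w z0 + dot p (z - z0) + sg * en (z - z0)) ->
  F z0 p (w z0) <= 0.
Proof.
move=> Fc wc ws H; apply/ler_addgt0Pr => e e0; rewrite add0r.
have [d d0 D] := Fc e e0.
have /contE/(_ d d0)[d1 d10 D1] : {for z0, continuous w} by exact: nbhs_singleton wc.
have sg0 : 0 < d / 4 by rewrite divr_gt0.
have /near_normP[rho rho0 rhoP] : \forall z \near z0, [/\ {for z, continuous w},
   forall q, psup w z q -> F z q (w z) <= 0 &
   w z <= w z0 + dot p (z - z0) + d / 4 * en (z - z0)].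
  by move: wc ws (H _ sg0); apply: filterS3.
have rho2 : 0 < rho / 2 by rewrite divr_gt0.
(* Since N times the distance from the maximum point to z0 will be at most d / 4, the three
   quotients d / rho, d / d1 and d / d put that point within rho / 2, d1 and d of z0. *)
pose N := 1 + d / rho + d / d1 + d.
have N0 : 0 < N by rewrite /N !addr_gt0// divr_gt0.
pose f x := w x - dot p (x - z0) - N * nsq (x - z0).
have inr x : `|x - z0| <= rho / 2 -> `|x - z0| < rho by lra.
have [||m mA mM'] := @cball_max f z0 (rho / 2); first exact: ltW.
  move=> x /inr/rhoP[wx _ _]; apply: continuousB; last exact: nsq_sub_continuous.
  by apply: continuousB => //; exact: dot_sub_continuous.
have [_ wm mle] := rhoP _ (inr _ mA).
have z00 : `|z0 - z0| <= rho / 2 by rewrite subrr normr0 ltW.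
have := mM' _ z00; rewrite {1}/f subrr dot0r nsq0 mulr0 !subr0 /f => fm.
have Ne : N * en (m - z0) <= d / 4.
  have [->|m0] := eqVneq m z0; first by rewrite subrr en0 mulr0 ltW.
  have ep : 0 < en (m - z0) by rewrite en_gt0// subr_eq0.
  rewrite -(ler_pM2r ep) -mulrA -expr2 en_sq; lra.
have eN k : 0 < k -> d / k <= N -> en (m - z0) < k.
  move=> k0 dk; have h : d / k * en (m - z0) <= d / 4.
    by apply: le_trans Ne; rewrite ler_wpM2r// en_ge0.
  rewrite ltNge; apply/negP => hk.
  have : d / k * k <= d / k * en (m - z0) by rewrite ler_wpM2l// divr_ge0// ltW.
  by rewrite divfK ?gt_eqF//; lra.
have dk k : 0 < k -> 0 < d / k by move=> k0; rewrite divr_gt0.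
have m1 : en (m - z0) < rho / 2.
  have h : N * en (m - z0) <= d / 4 by [].
  rewrite ltNge; apply/negP => hk.
  have : d / rho * (rho / 2) <= N * en (m - z0).
    apply: ler_pM => //; [by rewrite ltW// dk|by rewrite ltW|].
    rewrite /N; have := dk _ d10; lra.
  by rewrite mulrA divfK ?gt_eqF//; lra.
have m2 : en (m - z0) < d1 by apply: eN => //; rewrite /N; have := dk _ rho0; lra.
have m3 : en (m - z0) < d.
  by apply: eN => //; rewrite divff ?gt_eqF// /N; have := dk _ rho0; have := dk _ d10; lra.
have mr : `|m - z0| < rho / 2 by apply: le_lt_trans m1; exact: norm_le_en.
have ps : psup w m (p + (2 * N) *: (m - z0)).
  exists N; apply/near_normP; exists (rho / 2 - `|m - z0|); first by rewrite subr_gt0.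
  move=> x xm.
  have xr : `|x - z0| <= rho / 2 by have := ler_normD (x - m) (m - z0); rewrite subrKA; lra.
  have := mM' _ xr; rewrite /f.
  have -> : nsq (x - z0) = nsq (m - z0) + 2 * dot (m - z0) (x - m) + nsq (x - m).
    by rewrite -nsqD -sub_split.
  have -> : dot p (x - z0) = dot p (m - z0) + dot p (x - m).
    by rewrite -dotDr -sub_split.
  by rewrite dotDl dotZl; lra.
apply: le_trans (D m (p + (2 * N) *: (m - z0)) (w m) m3 _ _) _.
- rewrite addrC addKr enZ ger0_norm; last by rewrite mulr_ge0// ltW.
  by rewrite -mulrA; lra.
- by apply: D1; apply: le_lt_trans m2; exact: norm_le_en.
- by rewrite gerDr; exact: wm.
Qed.

End LocalViscosity.

(** * Gradients of nearby solutions *)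

Section ForContinuity.
Context {R : realType} {T : topologicalType}.
Implicit Types (V : normedModType R) (t : T).

Lemma forB V (f g : T -> V) t : {for t, continuous f} -> {for t, continuous g} -> {for t, continuous (fun z => f z - g z)}.
Proof. exact: continuousB. Qed.

Lemma forD V (f g : T -> V) t : {for t, continuous f} -> {for t, continuous g} -> {for t, continuous (fun z => f z + g z)}.
Proof. exact: continuousD. Qed.

Lemma forZ V (k : R) (f : T -> V) t : {for t, continuous f} -> {for t, continuous (fun z => k *: f z)}.
Proof. by move=> fc; apply: cvgZl_tmp. Qed.

Lemma forM (f g : T -> R) t : {for t, continuous f} -> {for t, continuous g} -> {for t, continuous (fun z => f z * g z)}.
Proof. exact: continuousM. Qed.

Lemma for_comp (T1 T2 : topologicalType) (f : T -> T1) (g : T1 -> T2) t :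
  {for t, continuous f} -> continuous g -> {for t, continuous (fun z => g (f z))}.
Proof. by move=> cf cg; apply: (@continuous_comp _ _ _ f g) => //; exact: cg. Qed.

Lemma fst1_continuous (A B C : topologicalType) : continuous (fun z : A * B * C => z.1.1).
Proof. by move=> z; apply: (@continuous_comp _ _ _ (fun z : A * B * C => z.1) fst); exact: cvg_fst. Qed.

Lemma snd1_continuous (A B C : topologicalType) : continuous (fun z : A * B * C => z.1.2).
Proof.
by move=> z; apply: (@continuous_comp _ _ _ (fun z : A * B * C => z.1) snd); [exact: cvg_fst|exact: cvg_snd].
Qed.

Lemma for_pair (T1 T2 : topologicalType) (f : T -> T1) (g : T -> T2) t :
  {for t, continuous f} -> {for t, continuous g} -> {for t, continuous (fun t => (f t, g t))}.
Proof. by move=> cf cg; exact: (cvg_pair cf cg). Qed.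
End ForContinuity.

(** * Bounds from above at proximal subgradients *)

Section Touch.
Context {R : realType} {n : nat}.
Notation E := 'rV[R]_n.
Implicit Types (x y z p q : E) (w : E -> R) (F : E -> E -> R -> R).

(** Quantitative forms of smoothness and of strong convexity on the compact set of positions,
    momenta and values that actually occur; C and c are the only traces of F in the estimates
    below. *)
Definition ham_lip F y0 r B K C := forall y y' q q' s s',
  `|y - y0| <= r -> `|y' - y0| <= r -> en q <= K -> en q' <= K ->
  `|s| <= B -> `|s'| <= B ->
  F y q s - F y' q' s' <= C * (en (y - y') + en (q - q') + `|s - s'|).
Definition ham_cvx F y0 r B K C c := forall y p s,
  `|y - y0| <= r -> en p <= K -> `|s| <= B ->
  exists2 g, en g <= C & forall q, en q <= K ->
    F y p s + dot g (q - p) + c * nsq (q - p) <= F y q s.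
Definition sub_on F w y0 r := forall y q, `|y - y0| < r -> psup w y q ->
  F y q (w y) <= 0.
Definition sup_on F w y0 r := forall y q, `|y - y0| < r -> psub w y q ->
  0 <= F y q (w y).

Lemma line_sub_en (x z : E) (l : R) : x - (l *: x + (1 - l) *: z) = (1 - l) *: (x - z).
Proof. by apply/rowP => i; rewrite !mxE; ring. Qed.
Lemma line_sub_en' (x z : E) (l : R) : z - (l *: x + (1 - l) *: z) = - (l *: (x - z)).
Proof.
by apply/rowP => i; rewrite !mxE; ring.
Qed.

(* Three-point doubling at a maximum: the constraint on [en (xi - y)] is
   what remains after the strong convexity beats the first order terms. *)
Lemma triple_point (F : E -> E -> R -> R) (w : E -> R) (y0 : E) (r B K C c : R) :
  0 < r -> 1 <= K -> 0 <= C -> 0 < c ->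
  ham_lip F y0 r B K C -> ham_cvx F y0 r B K C c ->
  (forall y, `|y - y0| <= r -> `|w y| <= B) ->
  lip_on w y0 r K -> sub_on F w y0 r -> sup_on F w y0 r -> forall (z0 x z y : E) (l A k sg N c1 : R), `|z0 - y0| <= r / 2 ->
  0 < l -> l < 1 -> 0 < en (x - z) -> 0 <= sg -> 0 <= N -> 0 <= c1 -> 0 < A ->
  let xi := l *: x + (1 - l) *: z in
  let chi y := c1 * nsq (y - z0) in
  `|x - y0| < r -> `|z - y0| < r -> `|y - y0| < r ->
  k = sg + chi y + 2 * N * en (x - z) ->
  let Phi x z y := l * w x + (1 - l) * w z - w y
     - A * nsq (l *: x + (1 - l) *: z - y)
     - l * (1 - l) * ((sg + chi y) * en (x - z) + N * nsq (x - z)) in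
  (\forall x' \near x, Phi x' z y <= Phi x z y) ->
  (\forall z' \near z, Phi x z' y <= Phi x z y) ->
  (\forall y' \near y, Phi x z y' <= Phi x z y) ->
  c * (l * (1 - l)) * k ^+ 2 <=
    l * (1 - l) * en (x - z) * (2 * C * (1 + K) + 2 * C * c1 * en (y - z0))
    + C * (1 + K) * en (xi - y).
Proof.
move=> r0 K1 C0 c0 FL FC wB wK wsub wsup; have K0 : 0 < K by exact: lt_le_trans ltr01 K1.
move=> z0 x z y l A k sg N c1 z0r l0 l1 ep sg0 N0 c10 A0 xi chi xr zr yr kE Phi Hx Hz Hy.
have l1' : 0 < 1 - l by rewrite subr_gt0.
set e := en (x - z) in ep kE *.
have ne : e != 0 by rewrite gt_eqF.
pose kap := k / e.
(* [px], [pz] and [py] are the gradients that the penalties impose at x, z and y. They share the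
   part a of the coupling term and differ by multiples of x - z and of y - z0. *)
pose a := (2 * A) *: (xi - y).
pose px := a + ((1 - l) * kap) *: (x - z).
pose pz := a - (l * kap) *: (x - z).
pose py := a - (l * (1 - l) * e * (2 * c1)) *: (y - z0).
have S0 : 0 <= sg + chi y by rewrite addr_ge0// mulr_ge0// nsq_ge0.
have enq x' : en (x' - z) - e <= (nsq (x' - z) - nsq (x - z)) / (2 * e).
  by rewrite lerBlDl -(en_sq (x - z)); apply: en_quad.
have enq' z' : en (x - z') - e <= (nsq (x - z') - nsq (x - z)) / (2 * e).
  by rewrite lerBlDl -(en_sq (x - z)); apply: en_quad.
have psx : psup w x px.
  exists (A * l + (1 - l) * ((sg + chi y) / (2 * e) + N)).
  apply: filterS Hx => x' Hx; rewrite -subr_ge0 -(pmulr_rge0 _ l0).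
  have h1 : nsq (l *: x' + (1 - l) *: z - y) = nsq (xi - y) + 2 * l * dot (xi - y) (x' - x) + l ^+ 2 * nsq (x' - x).
    rewrite (_ : l *: x' + _ - y = (xi - y) + l *: (x' - x)).
      by rewrite (nsqD (xi - y)) nsqZ dotZr; ring.
    by apply/rowP => i; rewrite !mxE; ring.
  have h2 : nsq (x' - z) = nsq (x - z) + 2 * dot (x - z) (x' - x) + nsq (x' - x).
    by rewrite -nsqD -sub_split.
  have h3 := enq x'; rewrite h2 in h3.
  have h4 : l * (1 - l) * (sg + chi y) * (en (x' - z) - e) <=
     l * (1 - l) * (sg + chi y) * ((2 * dot (x - z) (x' - x) + nsq (x' - x)) / (2 * e)).
    by rewrite ler_wpM2l ?mulr_ge0 ?(ltW l0) ?(ltW l1')//; apply: le_trans h3 _; rewrite le_eqVlt; apply/orP; left; apply/eqP; congr (_ / _); ring.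
  move: Hx; rewrite /Phi h1 h2 -/xi -/e => Hx.
  rewrite /px /a dotDl !dotZl /kap kE.
  set X1 := l * (1 - l) * _ * (_ / _) in h4.
  have X1E : X1 = l * (1 - l) * ((sg + chi y) / e * dot (x - z) (x' - x) + (sg + chi y) / (2 * e) * nsq (x' - x)).
    by rewrite /X1; field.
  have -> : (sg + chi y + 2 * N * e) / e = (sg + chi y) / e + 2 * N by field.
  move: X1E Hx h4; set S := sg + chi y; set D1 := dot (xi - y) _; set D2 := dot (x - z) _.
  set Q := nsq (x' - x); set Q0 := nsq (x - z); set Q1 := nsq (xi - y).
  set T := S / e; set T2 := S / (2 * e) => ->; nra.
have psz : psup w z pz.
  exists (A * (1 - l) + l * ((sg + chi y) / (2 * e) + N)).
  apply: filterS Hz => z' Hz; rewrite -subr_ge0 -(pmulr_rge0 _ l1').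
  have h1 : nsq (l *: x + (1 - l) *: z' - y) = nsq (xi - y) + 2 * (1 - l) * dot (xi - y) (z' - z) + (1 - l) ^+ 2 * nsq (z' - z).
    rewrite (_ : l *: x + _ - y = (xi - y) + (1 - l) *: (z' - z)).
      by rewrite (nsqD (xi - y)) nsqZ dotZr; ring.
    by apply/rowP => i; rewrite !mxE; ring.
  have h2 : nsq (x - z') = nsq (x - z) - 2 * dot (x - z) (z' - z) + nsq (z' - z).
    by rewrite -nsqB; congr nsq; rewrite opprB addrA subrK.
  have h3 := enq' z'; rewrite h2 in h3.
  have h4 : l * (1 - l) * (sg + chi y) * (en (x - z') - e) <=
     l * (1 - l) * (sg + chi y) * ((- 2 * dot (x - z) (z' - z) + nsq (z' - z)) / (2 * e)).
    by rewrite ler_wpM2l ?mulr_ge0 ?(ltW l0) ?(ltW l1')//; apply: le_trans h3 _; rewrite le_eqVlt; apply/orP; left; apply/eqP; congr (_ / _); ring.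
  move: Hz; rewrite /Phi h1 h2 -/xi -/e => Hz.
  rewrite /pz /a dotBl !dotZl /kap kE.
  set X1 := l * (1 - l) * _ * (_ / _) in h4.
  have X1E : X1 = l * (1 - l) * (- ((sg + chi y) / e * dot (x - z) (z' - z)) + (sg + chi y) / (2 * e) * nsq (z' - z)).
    by rewrite /X1; field.
  have -> : (sg + chi y + 2 * N * e) / e = (sg + chi y) / e + 2 * N by field.
  move: X1E Hz h4; set S := sg + chi y; set D1 := dot (xi - y) _; set D2 := dot (x - z) _.
  set Q := nsq (z' - z); set Q0 := nsq (x - z); set Q1 := nsq (xi - y).
  set T := S / e; set T2 := S / (2 * e) => ->; nra.
have psy : psub w y py.
  exists (A + l * (1 - l) * e * c1).
  apply: filterS Hy => y' Hy.
  have h1 : nsq (xi - y') = nsq (xi - y) - 2 * dot (xi - y) (y' - y) + nsq (y' - y).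
    by rewrite -nsqB; congr nsq; rewrite opprB addrA subrK.
  have h2 : nsq (y' - z0) = nsq (y - z0) + 2 * dot (y - z0) (y' - y) + nsq (y' - y).
    by rewrite -nsqD -sub_split.
  move: Hy; rewrite /Phi /chi -/xi h1 h2 -/e /py (dotBl a) /a !dotZl; lra.
have bx := psup_lip (ltW K0) wK xr psx.
have bz := psup_lip (ltW K0) wK zr psz.
have by_ := psub_lip (ltW K0) wK yr psy.
have Fx := wsub _ _ xr psx; have Fz := wsub _ _ zr psz; have Fy := wsup _ _ yr psy.
(* As a is the convex combination of [px] and [pz], the linear terms of the convexity inequality at
   a cancel and its quadratic terms add up to c * l * (1 - l) * k ^ 2. *)
have aE : a = l *: px + (1 - l) *: pz.
  by apply/rowP => i; rewrite /px /pz !mxE; ring.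
have ba : en a <= K.
  rewrite aE; apply: le_trans (enD _ _) _; rewrite !enZ gtr0_norm// gtr0_norm//.
  have := ler_wpM2l (ltW l0) bx; have := ler_wpM2l (ltW l1') bz; lra.
have [g gC Hg] := FC _ _ _ (ltW yr) ba (wB _ (ltW yr)).
have Gx := Hg _ bx; have Gz := Hg _ bz.
have ke : kap * e = k by rewrite /kap divfK.
have nx : nsq (px - a) = (1 - l) ^+ 2 * k ^+ 2.
  by rewrite /px addrKx nsqZ exprMn -en_sq -/e -ke; ring.
have nz : nsq (pz - a) = l ^+ 2 * k ^+ 2.
  by rewrite /pz addrKx nsqN nsqZ exprMn -en_sq -/e -ke; ring.
have dx : dot g (px - a) = (1 - l) * kap * dot g (x - z) by rewrite /px addrKx dotZr.
have dz : dot g (pz - a) = - (l * kap * dot g (x - z)) by rewrite /pz addrKx dotNr dotZr.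
have lipw u : `|u - y0| < r -> `|w y - w u| <= K * en (y - u) by move=> ur; apply: wK; exact: ltW.
have Lx := FL _ _ _ _ _ _ (ltW yr) (ltW xr) bx bx (wB _ (ltW yr)) (wB _ (ltW xr)).
have Lz := FL _ _ _ _ _ _ (ltW yr) (ltW zr) bz bz (wB _ (ltW yr)) (wB _ (ltW zr)).
have La := FL _ _ _ _ _ _ (ltW yr) (ltW yr) by_ ba (wB _ (ltW yr)) (wB _ (ltW yr)).
rewrite subrr en0 addr0 in Lx; rewrite subrr en0 addr0 in Lz.
rewrite !subrr en0 normr0 addr0 add0r in La.
have Lx' : F y px (w y) <= C * ((1 + K) * en (y - x)).
  apply: (@le_trans _ _ (C * (en (y - x) + `|w y - w x|))); first by clear - Lx Fx; lra.
  by rewrite ler_wpM2l// mulrDl mul1r lerD2l lipw.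
have Lz' : F y pz (w y) <= C * ((1 + K) * en (y - z)).
  apply: (@le_trans _ _ (C * (en (y - z) + `|w y - w z|))); first by clear - Lz Fz; lra.
  by rewrite ler_wpM2l// mulrDl mul1r lerD2l lipw.
have La' : - (C * (l * (1 - l) * e * (2 * c1) * en (y - z0))) <= F y a (w y).
  have : en (py - a) = l * (1 - l) * e * (2 * c1) * en (y - z0).
    by rewrite /py addrKx enN enZ ger0_norm// !mulr_ge0// ltW.
  by move=> <-; clear - La Fy; lra.
have dyx : en (y - x) <= (1 - l) * e + en (xi - y).
  apply: le_trans (enB y xi x) _; rewrite enC addrC lerD2r enC /xi line_sub_en.
  by rewrite enZ gtr0_norm.
have dyz : en (y - z) <= l * e + en (xi - y).
  apply: le_trans (enB y xi z) _; rewrite enC addrC lerD2r enC /xi line_sub_en'.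
  by rewrite enN enZ gtr0_norm.
have CK : 0 <= C * (1 + K) by rewrite mulr_ge0// addr_ge0// ltW.
have X1 := ler_wpM2l CK dyx; have X2 := ler_wpM2l CK dyz.
have Y1 : l * F y px (w y) <= l * (C * (1 + K) * ((1 - l) * e + en (xi - y))).
  by rewrite ler_pM2l//; clear - Lx' X1; lra.
have Y2 : (1 - l) * F y pz (w y) <= (1 - l) * (C * (1 + K) * (l * e + en (xi - y))).
  by rewrite ler_pM2l//; clear - Lz' X2; lra.
have Z1 := ler_wpM2l (ltW l0) Gx; have Z2 := ler_wpM2l (ltW l1') Gz.
rewrite nx dx in Z1; rewrite nz dz in Z2.
move: Z1 Z2 Y1 Y2 La'; set Fa := F y a _; set Fpx := F y px _; set Fpz := F y pz _.
set G := dot g _; set h := en (xi - y); set ez := en (y - z0).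
clear; lra.
Qed.


(** Consequences of a positive penalized gap m. The first summand of A makes K' q - A q ^ 2 at most
    m / 2 by Young's inequality, the second forces q <= eta, and the size of N forces e < r' /
    32. *)
Lemma touch_arith1 (K' A m q e l sg chi N eta r' : R) : 0 < K' -> 0 < m -> 0 < N ->
  0 < l -> l < 1 -> 0 <= sg -> 0 <= chi -> 0 <= e -> 0 <= q -> 0 < eta -> 0 < r' ->
  A = K' ^+ 2 / (2 * m) + (K' + K' ^+ 2 / N / eta) / eta + 1 ->
  64 * K' / r' <= N ->
  m <= K' * q - A * q ^+ 2 + l * (1 - l) * (2 * K' - sg - chi - N * e) * e ->
  [/\ 0 < e, chi < 2 * K', e < r' / 32, q <= eta & m <= 4 * K' * e].
Proof.
move=> Kp m0 N0 l0 l1 sg0 chi0 e_ge0 q0 eta0 rp AE N1 key.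
have l1' : 0 < 1 - l by lra.
have ll0 : 0 < l * (1 - l) by rewrite mulr_gt0.
have ll1 : l * (1 - l) <= 1 by rewrite mulr_ile1// ?ltW//; lra.
have Ne0 : 0 <= N * e by rewrite mulr_ge0// ltW.
have q20 : 0 <= q ^+ 2 by exact: sqr_ge0.
have T0 : 0 < K' ^+ 2 / N by rewrite divr_gt0// exprn_gt0.
have A1 : 0 < K' ^+ 2 / (2 * m) by rewrite divr_gt0 ?exprn_gt0 ?mulr_gt0.
have A2 : 0 < (K' + K' ^+ 2 / N / eta) / eta by rewrite divr_gt0// addr_gt0// divr_gt0.
have pars : K' * q - A * q ^+ 2 <= m / 2.
  have h1 : K' * q <= K' ^+ 2 / (2 * m) * q ^+ 2 + m / 2.
    rewrite -subr_ge0.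
    have -> : K' ^+ 2 / (2 * m) * q ^+ 2 + m / 2 - K' * q = (K' * q - m) ^+ 2 / (2 * m).
      by field; rewrite gt_eqF.
    by rewrite divr_ge0 ?sqr_ge0// mulr_ge0// ltW.
  have h2 : K' ^+ 2 / (2 * m) * q ^+ 2 <= A * q ^+ 2.
    by rewrite ler_wpM2r// AE; lra.
  lra.
have pos : 0 < l * (1 - l) * (2 * K' - sg - chi - N * e) * e by lra.
have e0 : 0 < e.
  by rewrite lt_neqAle e_ge0 andbT; apply/eqP => ee; move: pos; rewrite -ee mulr0 ltxx.
have pos2 : 0 < 2 * K' - sg - chi - N * e.
  by move: pos; rewrite pmulr_lgt0// pmulr_rgt0.
have X0 : 0 <= (2 * K' - sg - chi - N * e) * e by rewrite mulr_ge0// ltW.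
have bnd : l * (1 - l) * (2 * K' - sg - chi - N * e) * e <= (2 * K' - sg - chi - N * e) * e.
  by rewrite -[leLHS]mulrA ler_piMl.
split => //.
- lra.
- have h : 64 * K' / r' * e < 2 * K' by apply: (@le_lt_trans _ _ (N * e)); [rewrite ler_wpM2r|lra].
  move: h; rewrite mulrAC ltr_pdivrMr// => h1.
  have : K' * (32 * e) < K' * r' by lra.
  by rewrite ltr_pM2l//; lra.
- rewrite leNgt; apply/negP => hq.
  have bT : (2 * K' - sg - chi - N * e) * e <= K' ^+ 2 / N.
    apply: (@le_trans _ _ ((2 * K' - N * e) * e)); first by rewrite ler_wpM2r//; lra.
    rewrite ler_pdivlMr// -subr_ge0.
    have -> : K' ^+ 2 - (2 * K' - N * e) * e * N = (K' - N * e) ^+ 2 by ring.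
    exact: sqr_ge0.
  have h0 : A * q ^+ 2 < K' * q + K' ^+ 2 / N by lra.
  move: h0; apply/negP; rewrite -leNgt.
  have h1 : (K' + K' ^+ 2 / N / eta) / eta * q ^+ 2 <= A * q ^+ 2.
    by rewrite ler_wpM2r// AE; lra.
  apply: le_trans h1.
  have h2 : 1 <= q / eta by rewrite ler_pdivlMr// mul1r ltW.
  have -> : (K' + K' ^+ 2 / N / eta) / eta * q ^+ 2 = (K' * q) * (q / eta) + K' ^+ 2 / N * (q / eta) ^+ 2.
    by field; rewrite !gt_eqF.
  have Kq : 0 <= K' * q by rewrite mulr_ge0// ltW.
  apply: lerD; first by rewrite ler_peMr.
  by rewrite ler_peMr ?(ltW T0)// expr_ge1// (le_trans ler01 h2).
- have : (2 * K' - sg - chi - N * e) * e <= 2 * K' * e by rewrite ler_wpM2r//; lra.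
  lra.
Qed.

(** The square on the left is at least 8 sg N e, which by the choice of N exceeds every term
    proportional to e on the right. What is left is a multiple of q, too small because e is bounded
    below in terms of m. *)
Lemma touch_arith2 (K' C' c' m q e l sg chi N r' ez : R) : 0 < K' -> 0 <= C' -> 0 < c' ->
  0 < m -> 0 < N -> 0 < l -> l < 1 -> 0 < sg -> 0 <= chi -> 0 < e -> 0 <= q -> 0 < r' ->
  q <= l * (1 - l) * m / (8 * K' * (1 + C' * (1 + K'))) -> m <= 4 * K' * e ->
  ez < r' / 8 -> 2 * C' * (1 + K') + 64 * C' * K' / r' + 1 <= 8 * c' * sg * N ->
  c' * (l * (1 - l)) * (sg + chi + 2 * N * e) ^+ 2 <=
    l * (1 - l) * e * (2 * C' * (1 + K') + 2 * C' * (8 * K' / (r' / 4) ^+ 2) * ez)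
    + C' * (1 + K') * q -> False.
Proof.
move=> Kp C0' c0' m0 N0 l0 l1 sg0 chi0 e0 q0 rp qe em ezr N2 TP.
have l1' : 0 < 1 - l by lra.
have ll0 : 0 < l * (1 - l) by rewrite mulr_gt0.
have Ne0 : 0 <= 2 * N * e by rewrite !mulr_ge0// ltW.
have k2 : 8 * sg * N * e <= (sg + chi + 2 * N * e) ^+ 2.
  have h1 : (sg + 2 * N * e) ^+ 2 <= (sg + chi + 2 * N * e) ^+ 2.
    by rewrite lerXn2r ?nnegrE; lra.
  apply: le_trans h1; rewrite -subr_ge0.
  have -> : (sg + 2 * N * e) ^+ 2 - 8 * sg * N * e = (sg - 2 * N * e) ^+ 2 by ring.
  exact: sqr_ge0.
have {TP k2} TP1 : l * (1 - l) * e * (8 * c' * sg * N) <=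
    l * (1 - l) * e * (2 * C' * (1 + K') + 2 * C' * (8 * K' / (r' / 4) ^+ 2) * ez) + C' * (1 + K') * q.
  apply: le_trans TP.
  have := ler_wpM2l (ltW (mulr_gt0 c0' ll0)) k2.
  set X := (_ ^+ 2); lra.
have cc : 2 * C' * (8 * K' / (r' / 4) ^+ 2) * ez <= 64 * C' * K' / r'.
  have h : (8 * K' / (r' / 4) ^+ 2) * ez <= 16 * K' / r'.
    apply: (@le_trans _ _ ((8 * K' / (r' / 4) ^+ 2) * (r' / 8))).
      by rewrite ler_pM2l ?ltW// divr_gt0 ?mulr_gt0// exprn_gt0// divr_gt0.
    rewrite le_eqVlt; apply/orP; left; apply/eqP; field; rewrite gt_eqF//.
  have := ler_wpM2l C0' h; rewrite -!mulrA; set X := _ * ez; set Y := K' / r'.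
  have Y0 : 0 <= C' * Y by rewrite mulr_ge0// divr_ge0// ltW.
  lra.
have le0 : 0 < l * (1 - l) * e by rewrite mulr_gt0.
have fin : l * (1 - l) * e <= C' * (1 + K') * q.
  have h1 := ler_wpM2l (ltW le0) N2.
  have h2 := ler_wpM2l (ltW le0) cc.
  move: TP1 h1 h2; set U := l * (1 - l) * e; set V := 2 * C' * _ * ez; set W := _ / r'; lra.
have CK : 0 <= C' * (1 + K') by rewrite mulr_ge0// addr_ge0// ltW.
have qe2 : q * (8 * K' * (1 + C' * (1 + K'))) <= l * (1 - l) * m.
  by rewrite -ler_pdivlMr// !mulr_gt0// ltr_pwDl.
have z1 : l * (1 - l) * m <= l * (1 - l) * (4 * K' * e) by rewrite ler_pM2l.
have z2 : 4 * K' * (l * (1 - l) * e) <= 4 * K' * (C' * (1 + K') * q).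
  by rewrite ler_pM2l// mulr_gt0.
have z3 : 0 <= K' * q by rewrite mulr_ge0// ltW.
have z4 : 0 <= K' * (C' * (1 + K') * q) by apply: mulr_ge0; [exact: ltW|exact: mulr_ge0].
have z5 : 0 < l * (1 - l) * m by rewrite mulr_gt0.
clear - z1 z2 z3 z4 z5 qe2; lra.
Qed.

(** A semiconcavity estimate. If the bound fails at xb, a point slightly behind z0 on the line
    through xb makes z0 a convex combination, and the proximal inequality bounds w below there; the
    penalized gap of convexity is then positive, which [triple_point] excludes at a maximum. N
    depends on the constants of F and on sg, but not on the curvature of the paraboloid that touches
    at z0. *)
Lemma touch_above (F : E -> E -> R -> R) (w : E -> R) (y0 : E) (r B K C c : R) :
  0 < r -> 1 <= K -> 0 <= C -> 0 < c ->
  ham_lip F y0 r B K C -> ham_cvx F y0 r B K C c ->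
  (forall y, `|y - y0| <= r -> `|w y| <= B) ->
  lip_on w y0 r K -> sub_on F w y0 r -> sup_on F w y0 r -> 
  forall (z0 p : E) (sg N : R), `|z0 - y0| <= r / 2 -> psub w z0 p ->
  0 < sg -> 64 * K / r <= N ->
  2 * C * (1 + K) + 64 * C * K / r + 1 <= 8 * c * sg * N ->
  forall x, `|x - z0| <= r / 4 ->
  w x <= w z0 + dot p (x - z0) + sg * en (x - z0) + N * nsq (x - z0).
Proof.
move=> r0 K1 C0 c0 FL FC wB wK wsub wsup; have K0 : 0 < K by exact: lt_le_trans ltr01 K1.
move=> z0 p sg N z0r [Np Hp] sg0 N1 N2 xb xbr; rewrite leNgt; apply/negP => gap0.
have N0 : 0 < N by apply: lt_le_trans N1; rewrite divr_gt0// mulr_gt0.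
set gap := w xb - (w z0 + dot p (xb - z0) + sg * en (xb - z0) + N * nsq (xb - z0)).
have gp : 0 < gap by rewrite subr_gt0.
have inr x : `|x - z0| <= r / 4 -> `|x - y0| < r.
  by move=> hx; have := ler_distD z0 x y0; have := r0; lra.
set h := xb - z0 in gap0 gap gp *.
have [d d0 D] := near_line (- h) Hp.
have Q0 := nsq_ge0 h.
have c20 : 0 < (`|Np| + N) * nsq h + 1.
  by rewrite ltr_wpDl// mulr_ge0// addr_ge0// ltW.
(* So small that the proximal inequality holds at z0 - mu h and that its quadratic error, with the
   one of the penalty, stays below the gap. *)
pose mu := Num.min (d / 2) (Num.min 1 (gap / 2 / ((`|Np| + N) * nsq h + 1))).
have mu0 : 0 < mu by rewrite !lt_min ltr01 !divr_gt0.
have mud : mu < d by rewrite gt_min ltr_pdivrMr// ltr_pMr// ltr1n.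
have mu1 : mu <= 1 by rewrite !ge_min lexx orbT.
have mug : mu * ((`|Np| + N) * nsq h + 1) <= gap / 2.
  by rewrite -ler_pdivlMr// !ge_min lexx !orbT.
have gapmu : mu * ((Np + N) * nsq h) < gap.
  apply: (@le_lt_trans _ _ (gap / 2)); last lra.
  apply: le_trans mug; rewrite ler_pM2l//.
  have : Np * nsq h <= `|Np| * nsq h by rewrite ler_wpM2r// ler_norm.
  lra.
(* The weight for which z0 = l xb + (1 - l) (z0 - mu h). *)
have [l lE] : exists l : R, l = mu / (1 + mu) by exists (mu / (1 + mu)).
have mp : 0 < 1 + mu by rewrite addr_gt0.
have mn : 1 + mu != 0 by rewrite gt_eqF.
have l0 : 0 < l by rewrite lE divr_gt0.
have l1 : l < 1 by rewrite lE ltr_pdivrMr// mul1r ltrDr.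
have l1' : 0 < 1 - l by rewrite subr_gt0.
pose zm := z0 + mu *: - h.
have zmz : zm - z0 = mu *: - h by rewrite /zm addrKx.
have := D mu (ltW mu0) mud; rewrite -/zm zmz nsqZ nsqN dotZr dotNr => Dm.
have xbz : xb - zm = (1 + mu) *: h.
  by rewrite /zm scalerN opprD opprK addrA scalerDl scale1r.
(* The value of the penalized functional [Phi] at the triple (xb, zm, z0), where both the coupling
   and the localization terms vanish. *)
pose m := l * w xb + (1 - l) * w zm - w z0
   - l * (1 - l) * (sg * en (xb - zm) + N * nsq (xb - zm)).
have m0 : 0 < m.
  rewrite -(pmulr_rgt0 _ mp).
  have -> : (1 + mu) * m = mu * (w xb - w z0 - sg * en h - N * nsq h)
      + (w zm - w z0) - mu ^+ 2 * N * nsq h.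
    by rewrite /m xbz enZ nsqZ gtr0_norm// lE; field.
  have : 0 < mu * (gap - mu * ((Np + N) * nsq h)) by rewrite mulr_gt0// subr_gt0.
  move: Dm; rewrite -/zm /gap; clear.
  by set wz := w zm; set ww := w xb; set w0 := w z0; set d1 := dot p h; set d2 := en h; set d3 := nsq h; lra.
have CK : 0 <= C * (1 + K) by rewrite mulr_ge0// addr_ge0// ltW.
pose r2 := r / 4.
have r20 : 0 < r2 by rewrite divr_gt0.
(* At distance r2 / 2 from z0 the localization [chi] reaches 2 K, more than the Lipschitz bound can
   pay for; the maximum therefore stays in the interior. *)
pose c1 := 8 * K / r2 ^+ 2.
have c10 : 0 < c1 by rewrite divr_gt0 ?exprn_gt0// mulr_gt0.
pose eta := Num.min (r2 / 8) (l * (1 - l) * m / (8 * K * (1 + C * (1 + K)))).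
have eta0 : 0 < eta.
  rewrite lt_min divr_gt0//= divr_gt0 ?mulr_gt0//.
  by rewrite ltr_pwDl.
have T0 : 0 < K ^+ 2 / N by rewrite divr_gt0// exprn_gt0.
pose A := K ^+ 2 / (2 * m) + (K + K ^+ 2 / N / eta) / eta + 1.
have A1 : 0 < K ^+ 2 / (2 * m) by rewrite divr_gt0 ?exprn_gt0 ?mulr_gt0.
have A2 : 0 < (K + K ^+ 2 / N / eta) / eta by rewrite divr_gt0// addr_gt0// divr_gt0.
have A0 : 0 < A by rewrite !addr_gt0.
pose chi y := c1 * nsq (y - z0).
pose Phi (x z y : E) := l * w x + (1 - l) * w z - w y
     - A * nsq (l *: x + (1 - l) *: z - y)
     - l * (1 - l) * ((sg + chi y) * en (x - z) + N * nsq (x - z)).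
pose X := cball z0 r2.
have [t [[/= tx tz] ty] tmax] : exists2 t : E * E * E, (X `*` X `*` X) t &
    forall t', (X `*` X `*` X) t' -> Phi t'.1.1 t'.1.2 t'.2 <= Phi t.1.1 t.1.2 t.2.
  apply: (compact_max (f := fun t : E * E * E => Phi t.1.1 t.1.2 t.2)).
  - by exists (z0, z0, z0); rewrite /X /cball/= subrr normr0 ltW.
  - by do 2?apply: compact_setX; exact: cball_compact.
  move=> [[x z] y] [[/= hx hz] hy].
  have wc u : `|u - z0| <= r2 -> {for u, continuous w}.
    by move=> /inr ur; exact: lip_continuous (ltW K0) wK ur.
  have px := @fst1_continuous E E E (x, z, y).
  have pz := @snd1_continuous E E E (x, z, y).
  have py : {for (x, z, y), continuous (fun t : E * E * E => t.2)} by exact: cvg_snd.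
  have pwx : {for (x, z, y), continuous (fun t : E * E * E => w t.1.1)}.
    by apply: (@continuous_comp _ _ _ (fun t : E * E * E => t.1.1) w) => //; exact: wc.
  have pwz : {for (x, z, y), continuous (fun t : E * E * E => w t.1.2)}.
    by apply: (@continuous_comp _ _ _ (fun t : E * E * E => t.1.2) w) => //; exact: wc.
  have pwy : {for (x, z, y), continuous (fun t : E * E * E => w t.2)}.
    by apply: (@continuous_comp _ _ _ (fun t : E * E * E => t.2) w) => //; exact: wc.
  have pxz := forB px pz.
  have pn (f : E * E * E -> E) (h : {for (x, z, y), continuous f}) := for_comp h (@nsq_continuous _ _).
  have pe := for_comp pxz (@en_continuous _ _).
  have pc (k : R) : {for (x, z, y), continuous (fun t : E * E * E => k)} by exact: cst_continuous.
  have pz0 : {for (x, z, y), continuous (fun t : E * E * E => z0)} by exact: cst_continuous.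
  have k1 := forB (forD (forM (pc l) pwx) (forM (pc (1 - l)) pwz)) pwy.
  have k2 := forM (pc A) (pn _ (forB (forD (@forZ _ _ _ l _ _ px) (@forZ _ _ _ (1 - l) _ _ pz)) py)).
  have k3 := forM (forD (pc sg) (forM (pc c1) (pn _ (forB py pz0)))) pe.
  exact: forB (forB k1 k2) (forM (pc (l * (1 - l))) (forD k3 (forM (pc N) (pn _ pxz)))).
move: t => [[x z] y] /= in tx tz ty tmax.
have max' x' z' y' : `|x' - z0| <= r2 -> `|z' - z0| <= r2 -> `|y' - z0| <= r2 ->
   Phi x' z' y' <= Phi x z y.
  by move=> hx hz hy; apply: (tmax (x', z', y')).
set e := en (x - z).
set xi := l *: x + (1 - l) *: z.
have e_ge0 : 0 <= e by exact: en_ge0.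
have hle : `|h| <= r2 by [].
have mPhi : m <= Phi x z y.
  apply: le_trans (max' xb zm z0 _ _ _) => //.
  - rewrite le_eqVlt; apply/orP; left; apply/eqP.
    rewrite /m /Phi /chi subrr nsq0 mulr0 addr0.
    have -> : l *: xb + (1 - l) *: zm - z0 = 0.
      by apply/rowP => i; rewrite /zm /h lE !mxE; field.
    by rewrite nsq0 mulr0 subr0.
  - rewrite /zm addrKx normrZ normrN gtr0_norm//; apply: le_trans hle.
    by rewrite ler_piMl.
  - by rewrite subrr normr0 ltW.
have ir := inr; rewrite -/r2 in ir.
have xir : `|xi - z0| <= r2.
  have -> : xi - z0 = l *: (x - z0) + (1 - l) *: (z - z0).
    by apply/rowP => i; rewrite /xi !mxE; ring.
  apply: le_trans (ler_normD _ _) _; rewrite !normrZ gtr0_norm// gtr0_norm//.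
  have := ler_wpM2l (ltW l0) tx; have := ler_wpM2l (ltW l1') tz; rewrite /X/cball/=.
  clear; lra.
have lx : w x - w xi <= K * ((1 - l) * e).
  have := wK _ _ (ltW (ir _ tx)) (ltW (ir _ xir)).
  by rewrite /xi line_sub_en enZ (gtr0_norm l1') -/e -/xi ler_norml => /andP[_].
have lz : w z - w xi <= K * (l * e).
  have := wK _ _ (ltW (ir _ tz)) (ltW (ir _ xir)).
  by rewrite {2}/xi line_sub_en' enN enZ (gtr0_norm l0) -/e -/xi ler_norml => /andP[_].
have lxi : w xi - w y <= K * en (xi - y).
  have := wK _ _ (ltW (ir _ xir)) (ltW (ir _ ty)).
  by rewrite ler_norml => /andP[_].
set q := en (xi - y) in lxi *.
have q0 : 0 <= q by exact: en_ge0.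
have chi0 : 0 <= chi y by rewrite mulr_ge0 ?nsq_ge0// ltW.
have lx' := ler_wpM2l (ltW l0) lx; have lz' := ler_wpM2l (ltW l1') lz.
have key : m <= K * q - A * q ^+ 2 + l * (1 - l) * (2 * K - sg - chi y - N * e) * e.
  apply: le_trans mPhi _; rewrite /Phi -/xi -(en_sq (xi - y)) -/q -(en_sq (x - z)) -/e.
  clear - lx' lz' lxi; lra.
have [e0 chi2 er qe em] := touch_arith1 K0 m0 N0 l0 l1 (ltW sg0) chi0 e_ge0 q0 eta0 r0 erefl N1 key.
have yr : en (y - z0) < r2 / 2.
  clear - chi2 K0 r20; have h : nsq (y - z0) < (r2 / 2) ^+ 2.
    move: chi2; rewrite /chi /c1 mulrAC ltr_pdivrMr ?exprn_gt0// => h1.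
    have : K * (4 * nsq (y - z0)) < K * r2 ^+ 2 by lra.
    by rewrite ltr_pM2l// => h2; rewrite exprMn exprVn; lra.
  by move: h; rewrite -en_sq ltr_pXn2r// nnegrE ?en_ge0// divr_ge0// ltW.
have norms (u v : E) : `|u - v| <= en (u - v) by exact: norm_le_en.
have q8 : q <= r2 / 8 by min_ub qe.
have er' : e < r2 / 8 by rewrite /r2; clear - er; lra.
have yy : `|y - z0| < r2 by have := norms y z0; clear - yr r20; lra.
have dxi : en (x - xi) <= e.
  by rewrite /xi line_sub_en enZ gtr0_norm// ler_piMl// gerBl ltW.
have dzi : en (z - xi) <= e.
  by rewrite /xi line_sub_en' enN enZ gtr0_norm// ler_piMl// ltW.
have xx : `|x - z0| < r2.
  have := norms x z0; have := enB x xi z0; have := enB xi y z0; rewrite -/q.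
  clear - dxi dzi q8 er' yr r20; lra.
have zz : `|z - z0| < r2.
  have := norms z z0; have := enB z xi z0; have := enB xi y z0; rewrite -/q.
  clear - dxi dzi q8 er' yr r20; lra.
have := @triple_point F w y0 r B K C c r0 K1 C0 c0 FL FC wB wK wsub wsup z0 x z y l A (sg + chi y + 2 * N * e) sg N c1 z0r l0 l1 e0
  (ltW sg0) (ltW N0) (ltW c10) A0 (ir _ (ltW xx)) (ir _ (ltW zz)) (ir _ (ltW yy)) erefl.
move=> TP; have {}TP := TP
  (filterS (fun x' hx' => max' x' z y hx' tz ty) (near_cball xx))
  (filterS (fun z' hz' => max' x z' y tx hz' ty) (near_cball zz))
  (filterS (fun y' hy' => max' x z y' tx tz hy') (near_cball yy)).
have {}TP := TP (nbhs_filter _) (nbhs_filter _) (nbhs_filter _).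
move: TP; rewrite -/e -/xi -/q => TP.
have hq : q <= l * (1 - l) * m / (8 * K * (1 + C * (1 + K))).
  by min_ub qe.
have hy : en (y - z0) < r / 8 by apply: lt_le_trans yr _; rewrite /r2; clear - r0; lra.
have T2 := @touch_arith2 K C c m q e l sg (chi y) N r (en (y - z0)) K0 C0 c0 m0 N0 l0 l1 sg0 chi0 e0 q0 r0 hq em hy N2.
apply: T2; exact: TP.
Qed.

End Touch.

(** * A mean value inequality for proximal subgradients *)

Section MeanValue.
Context {R : realType} {n : nat}.
Notation E := 'rV[R]_n.
Implicit Types (x y z p q : E) (w : E -> R) (F : E -> E -> R -> R).

(** The common source of small parameters: b collects the wanted bounds in a [Num.min], M the
    constants by which the parameter will be multiplied. *)
Lemma pick_small (M b : R) : 0 <= M -> 0 < b -> exists t : R, [/\ 0 < t, t <= b & t * M <= b].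
Proof.
move=> M0 b0; have M1 : 0 < M + 1 by rewrite ltr_wpDl.
exists (b / (M + 1)); split; first by rewrite divr_gt0.
  by rewrite ler_pdivrMr// ler_peMr ?(ltW b0)// lerDr.
by rewrite mulrAC ler_pdivrMr// ler_pM2l// lerDl.
Qed.

Lemma mean_value_arith (K N te k : R) : 0 <= K -> 0 < te -> 0 < N ->
  K ^+ 2 / te < 4 * N -> - K * k + N * k ^+ 2 <= - te -> False.
Proof.
move=> K0 te0 N0; rewrite ltr_pdivrMr// => h1 h2.
have : 0 <= (2 * N * k - K) ^+ 2 by exact: sqr_ge0.
have h3 : 4 * N * (- K * k + N * k ^+ 2) <= 4 * N * (- te) by rewrite ler_pM2l// mulr_gt0.
rewrite sqrrB; lra.
Qed.

(* Minimizing [w y - s tau (a + e) + N |y - x0 - s tau v|^2] over [y] and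
   [s \in [0, 1]]; the minimum cannot be at [s = 0]. *)
Lemma mean_value w (x0 : E) (rho K : R) (v : E) (tau a e : R) :
  0 <= K -> lip_on w x0 rho K -> 0 < tau -> 0 < e -> tau * `|v| + e < rho ->
  w (x0 + tau *: v) <= w x0 + tau * a ->
  exists y q, [/\ `|y - x0| <= tau * `|v| + e, psub w y q & dot q v <= a + e].
Proof.
move=> K0 wK tau0 e0 rhoe hw.
set rr := tau * `|v| + e in rhoe *.
have rr0 : 0 < rr by rewrite ltr_wpDl// mulr_ge0// ltW.
have rho0 : 0 < rho by exact: lt_trans rhoe.
(* The first summand excludes s = 0 by completing the square, the second keeps y within e of the
   segment. *)
pose N := K ^+ 2 / (tau * e) + (K + 1) / e.
have te0 : 0 < tau * e by rewrite mulr_gt0.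
have N1 : 0 <= K ^+ 2 / (tau * e) by rewrite divr_ge0 ?sqr_ge0// ltW.
have N2 : 0 < (K + 1) / e by rewrite divr_gt0// ltr_wpDl.
have N0 : 0 < N by rewrite ltr_wpDl.
pose zeta (s : R) := x0 + (s * tau) *: v.
pose f (t : E * R) := - (w t.1 - t.2 * (tau * (a + e)) + N * nsq (t.1 - zeta t.2)).
have inr y : `|y - x0| <= rr -> `|y - x0| < rho by move=> /le_lt_trans; apply.
have ze (s : R) : 0 <= s <= 1 -> `|zeta s - x0| <= tau * `|v|.
  move=> /andP[s0 s1]; rewrite /zeta addrKx normrZ ger0_norm ?mulr_ge0// ?(ltW tau0)//.
  by rewrite -mulrA ler_piMl// mulr_ge0// ltW.
have zer (s : R) : 0 <= s <= 1 -> `|zeta s - x0| <= rr.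
  by move=> /ze /le_trans; apply; rewrite /rr lerDl ltW.
have [[y s] [/= yr sr] fmax] : exists2 t : E * R, (cball x0 rr `*` [set s : R | 0 <= s <= 1]) t &
    forall t', (cball x0 rr `*` [set s : R | 0 <= s <= 1]) t' -> f t' <= f t.
  apply: (compact_max (f := f)).
  - by exists (x0, 0); split => /=; rewrite ?lexx ?ler01// /cball/= subrr normr0 ltW.
  - apply: compact_setX; first exact: cball_compact.
    rewrite (_ : mkset _ = `[0, 1]%classic); first exact: segment_compact.
    by apply/seteqP; split => u /=; rewrite in_itv.
  move=> [y s] [/= yr sr]; rewrite /f /zeta.
  have p1 : {for (y, s), continuous (fun t : E * R => t.1)} by exact: cvg_fst.
  have p2 : {for (y, s), continuous (fun t : E * R => t.2)} by exact: cvg_snd.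
  have pc (k : R) : {for (y, s), continuous (fun t : E * R => k)} by exact: cst_continuous.
  have pw : {for (y, s), continuous (fun t : E * R => w t.1)}.
    by apply: (@continuous_comp _ _ _ fst w) => //; exact: lip_continuous wK (inr _ yr).
  have px : {for (y, s), continuous (fun t : E * R => x0)} by exact: cst_continuous.
  have pz : {for (y, s), continuous (fun t : E * R => (t.2 * tau) *: v)}.
    by apply: cvgZr_tmp; exact: forM p2 (pc tau).
  have pq := for_comp (forB p1 (forD px pz)) (@nsq_continuous _ _).
  apply: continuousN; exact: forD (forB pw (forM p2 (pc _))) (forM (pc N) pq).
have fmin y' (s' : R) : `|y' - x0| <= rr -> 0 <= s' <= 1 ->
    w y - s * (tau * (a + e)) + N * nsq (y - zeta s) <=
    w y' - s' * (tau * (a + e)) + N * nsq (y' - zeta s').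
  by move=> hy hs; have := fmax (y', s') (conj hy hs); rewrite /f /=; lra.
set d := y - zeta s.
have dK : N * en d ^+ 2 <= K * en d.
  have := fmin (zeta s) s (zer _ sr) sr; rewrite subrr nsq0 mulr0 en_sq -/d.
  by have := wK _ _ (ltW (inr _ (zer _ sr))) (ltW (inr _ yr)); rewrite enC -/d ler_norml; lra.
have de : en d < e.
  have [d0|d0] := eqVneq d 0; first by rewrite d0 en0.
  have ed := en_gt0 d0.
  have : N * en d <= K by rewrite -(ler_pM2r ed) -mulrA -expr2.
  move=> hK; rewrite ltNge; apply/negP => ed'.
  have : (K + 1) / e * e <= N * en d.
    by apply: ler_pM => //; [exact: ltW|exact: ltW|rewrite /N lerDr].
  by rewrite divfK ?gt_eqF//; lra.
have yr' : `|y - x0| < rr.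
  have -> : y - x0 = d + (zeta s - x0) by rewrite /d addrA subrK.
  apply: le_lt_trans (ler_normD _ _) _; rewrite /rr addrC ler_ltD ?ze//.
  by apply: le_lt_trans de; exact: norm_le_en.
have s0 : 0 < s.
  rewrite lt_neqAle (andP sr).1 andbT; apply/eqP => s0.
  have z0 : zeta s = x0 by rewrite /zeta -s0 mul0r scale0r addr0.
  have h01 : 0 <= (1 : R) <= 1 by rewrite ler01 lexx.
  have := fmin (zeta 1) 1 (zer _ h01) h01.
  have -> : zeta 1 = x0 + tau *: v by rewrite /zeta mul1r.
  rewrite subrr nsq0 mulr0 addr0 z0 -s0 mul0r subr0 mul1r -en_sq => h.
  have := wK _ _ (ltW (inr _ yr)); move=> /(_ x0); rewrite subrr normr0 => /(_ (ltW rho0)).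
  rewrite ler_norml => /andP[h2 _].
  apply: (@mean_value_arith K N (tau * e) (en (y - x0))) => //.
    by rewrite /N; lra.
  lra.
exists y, (- (2 * N) *: d); split; first exact: ltW.
  exists N; apply/near_normP; exists (rr - `|y - x0|); first by rewrite subr_gt0.
  move=> y' hy'.
  have hr : `|y' - x0| <= rr by have := ler_distD y y' x0; lra.
  have := fmin y' s hr sr; rewrite -/d.
  have -> : y' - zeta s = d + (y' - y) by rewrite /d -sub_split.
  by rewrite nsqD dotZl; lra.
rewrite dotZl -subr_le0.
(* Because s > 0, the minimum may be compared with the parameter s - t; the first order in t is the
   claimed slope. *)
apply: (@lin_ub_le0 _ _ (N * tau * nsq v) s s0) => t t0 ts.
have st : 0 <= s - t <= 1 by move/andP: sr; lra.
have := fmin y (s - t) yr st; rewrite -/d.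
have -> : y - zeta (s - t) = d + (t * tau) *: v.
  by apply/rowP => i; rewrite /d /zeta !mxE; ring.
rewrite nsqD nsqZ dotZr => h.
have tt0 : 0 < t * tau by rewrite mulr_gt0.
rewrite -(ler_pM2l tt0).
move: h; rewrite exprMn; lra.
Qed.

End MeanValue.

Section NearGradient.
Context {R : realType} {n : nat}.
Notation E := 'rV[R]_n.
Implicit Types (x y z p q : E) (w : E -> R) (F : E -> E -> R -> R).

Lemma ham_lip_le F (y0 : E) (r B K K' C : R) : K' <= K -> ham_lip F y0 r B K C ->
  ham_lip F y0 r B K' C.
Proof. by move=> KK H y y' q q' s s' ? ? ? ?; apply: H => //; apply: le_trans KK. Qed.

Lemma ham_cvx_le F (y0 : E) (r B K K' C c : R) : K' <= K -> ham_cvx F y0 r B K C c ->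
  ham_cvx F y0 r B K' C c.
Proof.
move=> KK H y p s yr pK sB; have [g gC Hg] := H y p s yr (le_trans pK KK) sB.
by exists g => // q qK; apply: Hg; apply: le_trans KK.
Qed.

(** Near z0 the quadratic term of [touch_above] is absorbed in half of sg. Together with the
    proximal inequality from below this makes w differentiable at z0 with gradient p. *)
Lemma psub_frechet F w (y0 : E) (r B K C c : R) z0 p :
  0 < r -> 1 <= K -> 0 <= C -> 0 < c ->
  ham_lip F y0 r (B + 1) (K + 1) C -> ham_cvx F y0 r (B + 1) (K + 1) C c ->
  (forall y, `|y - y0| <= r -> `|w y| <= B) ->
  lip_on w y0 r K -> sub_on F w y0 r -> sup_on F w y0 r ->
  `|z0 - y0| <= r / 2 -> psub w z0 p ->
  forall sg : R, 0 < sg -> \forall z \near z0, w z <= w z0 + dot p (z - z0) + sg * en (z - z0).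
Proof.
move=> r0 K1 C0 c0 FL FC wB wK ws wS z0r ps.
have K0 : 0 <= K by exact: le_trans ler01 K1.
have KK : K <= K + 1 by rewrite lerDl.
have wB1 y : `|y - y0| <= r -> `|w y| <= B + 1 by move=> /wB; lra.
move=> sg sg0.
have sg2 : 0 < sg / 2 by rewrite divr_gt0.
pose N := Num.max (64 * K / r) ((2 * C * (1 + K) + 64 * C * K / r + 1) / (8 * c * (sg / 2))).
have N1 : 64 * K / r <= N by rewrite le_max lexx.
have N2 : 2 * C * (1 + K) + 64 * C * K / r + 1 <= 8 * c * (sg / 2) * N.
  have D0 : 0 < 8 * c * (sg / 2) by rewrite !mulr_gt0.
  by rewrite [leRHS]mulrC -(ler_pdivrMr _ _ D0) /N le_max lexx orbT.
have T := touch_above r0 K1 C0 c0 (ham_lip_le KK FL) (ham_cvx_le KK FC) wB1 wK ws wS z0r ps sg2 N1 N2.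
have N0 : 0 < N by apply: lt_le_trans N1; rewrite divr_gt0// mulr_gt0// (lt_le_trans ltr01).
have S0 : 0 <= Num.sqrt n%:R :> R by exact: sqrtr_ge0.
have [t [t0 tr tS]] := @pick_small R (Num.sqrt n%:R * N) (Num.min (r / 4) (sg / 2)) (mulr_ge0 S0 (ltW N0)) ltac:(by rewrite lt_min !divr_gt0).
apply/near_normP; exists t => // z zt.
have zr : `|z - z0| <= r / 4 by apply: ltW; apply: lt_le_trans zt _; apply: le_trans tr _; rewrite ge_min lexx.
apply: le_trans (T z zr) _; rewrite -!addrA lerD2l lerD2l -en_sq.
have : N * en (z - z0) <= sg / 2.
  apply: (@le_trans _ _ (t * (Num.sqrt n%:R * N))); last by min_ub tS.
  rewrite mulrC mulrA ler_pM2r// (le_trans (en_le_norm _))// mulrC ler_wpM2r// ltW//.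
move=> /(ler_wpM2r (en_ge0 (z - z0))); rewrite expr2 mulrA; lra.
Qed.

(** By differentiability the subsolution inequality can also be tested at p; a proximal subgradient
    of a solution thus satisfies F = 0, not only F >= 0. *)
Lemma psub_eq0 F w (y0 : E) (r B K C c : R) z0 p :
  0 < r -> 1 <= K -> 0 <= C -> 0 < c ->
  ham_lip F y0 r (B + 1) (K + 1) C -> ham_cvx F y0 r (B + 1) (K + 1) C c ->
  (forall y, `|y - y0| <= r -> `|w y| <= B) ->
  lip_on w y0 r K -> sub_on F w y0 r -> sup_on F w y0 r ->
  `|z0 - y0| <= r / 2 -> psub w z0 p -> F z0 p (w z0) <= 0.
Proof.
move=> r0 K1 C0 c0 FL FC wB wK ws wS z0r ps.
have K0 : 0 <= K by exact: le_trans ler01 K1.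
have KK : K <= K + 1 by rewrite lerDl.
have z0r' : `|z0 - y0| < r by lra.
have pK := psub_lip K0 wK z0r' ps.
have wB1 y : `|y - y0| <= r -> `|w y| <= B + 1 by move=> /wB; lra.
apply: (@frechet_subsolution R n F w z0 p).
- move=> e e0; pose d := Num.min (r / 2) (Num.min 1 (e / (3 * C + 1))).
  have D0 : 0 < 3 * C + 1 by rewrite ltr_wpDl// mulr_ge0.
  have d0 : 0 < d by rewrite !lt_min ltr01 !divr_gt0.
  have d1 : d <= 1 by rewrite !ge_min lexx orbT.
  have dr : d <= r / 2 by rewrite ge_min lexx.
  have de : d * (3 * C + 1) <= e by rewrite -ler_pdivlMr// !ge_min lexx !orbT.
  exists d => // y q s hy hq hs.
  have yr : `|y - y0| <= r.
    have := ler_distD z0 y y0; have := norm_le_en (y - z0); lra.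
  have qK : en q <= K + 1.
    by have := enD (q - p) p; rewrite subrK; lra.
  have sB : `|s| <= B + 1.
    by have := wB _ (ltW z0r'); have := ler_normD (s - w z0) (w z0); rewrite subrK; lra.
  have := FL z0 y p q (w z0) s (ltW z0r') yr (le_trans pK KK) qK (wB1 _ (ltW z0r')) sB.
  rewrite (enC z0) (enC p) (distrC (w z0)) => h.
  have : C * (en (y - z0) + en (q - p) + `|s - w z0|) <= C * (3 * d).
    by rewrite ler_wpM2l//; lra.
  by lra.
- apply/near_normP; exists (r / 2); first by rewrite divr_gt0.
  move=> z zz; apply: lip_continuous K0 wK _; have := ler_distD z0 z y0; lra.
- apply/near_normP; exists (r / 2); first by rewrite divr_gt0.
  move=> z zz q; apply: ws; have := ler_distD z0 z y0; lra.
- exact: psub_frechet r0 K1 C0 c0 FL FC wB wK ws wS z0r ps.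
Qed.

End NearGradient.

Section LemmaB.
Context {R : realType} {n : nat}.
Notation E := 'rV[R]_n.
Implicit Types (x y z p q : E) (w u : E -> R) (F : E -> E -> R -> R).

(* Descending from [z0] along minus the subgradient of [Fe z0] at [p], the upper
   bound [touch_above] for [w] passes to the nearby function [u]; the mean value
   theorem yields a proximal gradient [q] of [u] on the far side of the tangent
   hyperplane, and strong convexity forces [q] to be close to [p]. *)
Lemma near_gradient (y0 : E) (r B K C c eta : R) :
  0 < r -> 1 <= K -> 0 <= C -> 0 < c -> 0 < eta ->
  exists2 d0 : R, 0 < d0 & forall (F0 Fe : E -> E -> R -> R) (u w : E -> R) (d : R),
  0 <= d -> d <= d0 ->
  ham_lip F0 y0 r (B + 1) (K + 1) C -> ham_cvx F0 y0 r (B + 1) (K + 1) C c ->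
  ham_lip Fe y0 r (B + 1) (K + 1) C -> ham_cvx Fe y0 r (B + 1) (K + 1) C c ->
  (forall y q s, `|y - y0| <= r -> `|Fe y q s - F0 y q s| <= d) ->
  (forall y, `|y - y0| <= r -> `|u y| <= B) ->
  (forall y, `|y - y0| <= r -> `|w y| <= B) ->
  (forall y, `|y - y0| <= r -> `|w y - u y| <= d) ->
  lip_on u y0 r K -> sub_on F0 u y0 r -> sup_on F0 u y0 r ->
  lip_on w y0 r K -> sub_on Fe w y0 r -> sup_on Fe w y0 r ->
  forall z0 p, `|z0 - y0| <= r / 4 -> psub w z0 p ->
  exists y' q, [/\ `|y' - z0| <= eta, en (q - p) <= eta & psub u y' q].
Proof.
move=> r0 K1 C0 c0 eta0.
have K0 : 0 <= K by exact: le_trans ler01 K1.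
have S0 : 0 <= Num.sqrt n%:R :> R by exact: sqrtr_ge0.
pose S : R := Num.sqrt n%:R.
(* The unit of error: strong convexity yields c |q - p| ^ 2 <= 10 b0 once all errors are counted in
   multiples of b0. *)
pose b0 := c * eta ^+ 2 / 10.
have b00 : 0 < b0 by rewrite divr_gt0// mulr_gt0// exprn_gt0.
have [sg [sg0 _ sgC]] := @pick_small R C b0 C0 b00.
pose N := Num.max (64 * K / r) ((2 * C * (1 + K) + 64 * C * K / r + 1) / (8 * c * sg)).
have N1 : 64 * K / r <= N by rewrite /N le_max lexx.
have D0 : 0 < 8 * c * sg by rewrite !mulr_gt0.
have N2 : 2 * C * (1 + K) + 64 * C * K / r + 1 <= 8 * c * sg * N.
  by rewrite [leRHS]mulrC -(ler_pdivrMr _ _ D0) /N le_max lexx orbT.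
have N0 : 0 <= N by apply: le_trans N1; rewrite divr_ge0 ?mulr_ge0// ltW.
pose b1 := Num.min b0 (Num.min (r / 8) (eta / 4)).
have b10 : 0 < b1 by rewrite !lt_min b00 !divr_gt0.
have b11 : b1 <= b0 by rewrite ge_min lexx.
have b12 : b1 <= r / 8 by rewrite !ge_min lexx orbT.
have b13 : b1 <= eta / 4 by rewrite !ge_min lexx !orbT.
pose MM := N * C ^+ 2 + C + S * C * (C * (1 + K)) + S * C * (1 + K).
have SC0 : 0 <= S * C by rewrite mulr_ge0.
have CK0 : 0 <= C * (1 + K) by rewrite mulr_ge0// addr_ge0.
have SCC0 : 0 <= S * C * (C * (1 + K)) by rewrite mulr_ge0.
have NC0 : 0 <= N * C ^+ 2 by rewrite mulr_ge0// exprn_ge0.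
have MM0 : 0 <= MM by rewrite !addr_ge0// mulr_ge0// addr_ge0.
have [t [t0 tb tM]] := @pick_small R MM b1 MM0 b10.
pose M2 := 1 + S * C * (1 + K).
have M20 : 0 <= M2 by rewrite addr_ge0// mulr_ge0// addr_ge0.
have [e [e0 eb eM]] := @pick_small R M2 b1 M20 b10.
(* Chosen after the descent length t, since the distance between w and u enters the slope of u as 2
   d / t. *)
pose d0 := Num.min (b0 / (1 + C)) (t * b0 / 2).
have C1 : 0 < 1 + C by rewrite ltr_pwDl.
have d00 : 0 < d0 by rewrite lt_min divr_gt0//= divr_gt0// mulr_gt0.
exists d0 => // F0 Fe u w d d_ge0 dd0 FL FC FeL FeC dF uB wB wu uK us uS wK ws wS z0 p z0r ps.
have d1 : d * (1 + C) <= b0.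
  by rewrite -ler_pdivlMr//; apply: le_trans dd0 _; rewrite ge_min lexx.
have d2 : 2 * d / t <= b0.
  rewrite ler_pdivrMr//; have : d <= t * b0 / 2 by min_ub dd0.
  alra.
have KK : K <= K + 1 by rewrite lerDl.
have z0r2 : `|z0 - y0| <= r / 2 by move: z0r r0; alra.
have z0r' : `|z0 - y0| < r by move: z0r r0; alra.
have z0r1 : `|z0 - y0| <= r by move: z0r r0; alra.
have pK := psub_lip K0 wK z0r' ps.
have wB1 y : `|y - y0| <= r -> `|w y| <= B + 1 by move=> /wB; alra.
have uB1 y : `|y - y0| <= r -> `|u y| <= B + 1 by move=> /uB; alra.
have [g gC Hg] := FeC z0 p (w z0) z0r1 (le_trans pK KK) (wB1 _ z0r1).
have TA := touch_above r0 K1 C0 c0 (ham_lip_le KK FeL) (ham_cvx_le KK FeC) wB1 wK ws wS z0r2 ps sg0 N1 N2.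
have gn : `|g| <= C by apply: le_trans gC; exact: norm_le_en.
have SK0 : 0 <= S * C * (1 + K) by rewrite mulr_ge0// addr_ge0.
have tC : t * C <= b1 by apply: le_trans tM; rewrite ler_pM2l// /MM; move: NC0 SCC0 SK0; alra.
have tg : t * `|g| <= b1 by apply: le_trans tC; rewrite ler_pM2l.
have tgr : `|(z0 + t *: - g) - z0| <= r / 4.
  rewrite addrKx normrZ normrN gtr0_norm//; apply: le_trans tg (le_trans b12 _).
  by rewrite ler_pM2l// lef_pV2 ?posrE// ler_nat.
have hw := TA _ tgr.
rewrite addrKx nsqZ enZ enN nsqN dotZr dotNr (gtr0_norm t0) in hw.
have zr' : `|(z0 + t *: - g) - y0| <= r.
  by have := ler_distD z0 (z0 + t *: - g) y0; move: z0r tgr r0; alra.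
have uK' : lip_on u z0 (r / 2) K.
  move=> a b ha hb; apply: uK; [have := ler_distD z0 a y0|have := ler_distD z0 b y0]; move: ha hb z0r r0; alra.
have tNC : t * (N * C ^+ 2) <= b0.
  apply: le_trans b11; apply: le_trans tM; rewrite ler_pM2l// /MM.
  have : 0 <= S * C * (1 + K) by rewrite mulr_ge0// addr_ge0.
  move: C0 SCC0; alra.
have ng : nsq g <= C ^+ 2 by rewrite -en_sq lerXn2r ?nnegrE ?en_ge0.
have hu : u (z0 + t *: - g) <= u z0 + t * (- dot p g + 3 * b0).
  have h1 := wu _ zr'; have h2 := wu _ z0r1.
  have h3 : sg * (t * en g) <= t * b0.
    rewrite mulrCA ler_pM2l//; apply: le_trans sgC; rewrite ler_pM2l//.
  have h4 : N * (t ^+ 2 * nsq g) <= t * b0.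
    rewrite expr2 mulrCA -mulrA ler_pM2l//; apply: le_trans tNC.
    by rewrite ler_pM2l// ler_wpM2l.
  have h5 : 2 * d <= t * b0 by move: d2; rewrite ler_pdivrMr// (mulrC b0).
  move: h1 h2; rewrite !ler_norml => /andP[h1 _] /andP[_ h2].
  move: hw h1 h2 h3 h4 h5 b00 t0 d_ge0; alra.
have te : t * `|- g| + e < r / 2 by rewrite normrN; move: tg b12 eb r0; alra.
have [y' [q [hy' psq hq]]] := mean_value K0 uK' t0 e0 te hu.
rewrite normrN in hy'.
exists y', q; split => //; first by move: hy' tg eb b13 eta0; alra.
have y'z : `|y' - z0| <= r / 4 by move: hy' tg eb b12; alra.
have y'r : `|y' - y0| <= r / 2 by have := ler_distD z0 y' y0; move: y'z z0r r0; alra.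
have y'r1 : `|y' - y0| < r by move: y'r r0; alra.
have qK := psub_lip K0 uK y'r1 psq.
have Fq := psub_eq0 r0 K1 C0 c0 FL FC uB uK us uS y'r psq.
have Fp := wS _ _ z0r' ps.
have Hq := Hg q (le_trans qK KK).
have Dq := dF y' q (u y') (ltW y'r1).
have Lq := FeL z0 y' q q (w z0) (u y') z0r1 (ltW y'r1) (le_trans qK KK) (le_trans qK KK) (wB1 _ z0r1) (uB1 _ (ltW y'r1)).
rewrite subrr en0 addr0 in Lq.
have ey : en (z0 - y') <= S * (t * C) + S * e.
  rewrite enC; apply: le_trans (en_le_norm _) _; rewrite -mulrDr ler_wpM2l//.
  by apply: le_trans hy' _; rewrite lerD2r ler_pM2l.
have wuy : `|w z0 - u y'| <= d + K * en (z0 - y').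
  apply: le_trans (ler_distD (u z0) _ _) _; apply: lerD; first exact: wu.
  by apply: uK => //; exact: ltW.
have Cb : C * (en (z0 - y') + `|w z0 - u y'|) <= C * d + b0 + b0.
  have h1 : C * (en (z0 - y') + `|w z0 - u y'|) <= C * (d + (1 + K) * en (z0 - y')).
    by rewrite ler_wpM2l//; move: wuy; alra.
  have h2 : C * ((1 + K) * en (z0 - y')) <= C * ((1 + K) * (S * (t * C) + S * e)).
    by rewrite ler_wpM2l// ler_wpM2l// addr_ge0.
  have h3 : t * (S * C * (C * (1 + K))) <= b0.
    apply: le_trans b11; apply: le_trans tM; rewrite ler_pM2l// /MM.
    have : 0 <= S * C * (1 + K) by rewrite mulr_ge0// addr_ge0.
    move: NC0 C0; alra.
  have h4 : e * (S * C * (1 + K)) <= b0.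
    by apply: le_trans b11; apply: le_trans eM; rewrite ler_pM2l// /M2 lerDr.
  move: h1 h2 h3 h4; alra.
(* With Fe(z0, p) >= 0 and F0(y', q) <= 0 this is all that the convexity inequality at p needs in
   order to bound q - p. *)
have hgq : - (4 * b0) <= dot g (q - p).
  rewrite dotBr (dotC g q) (dotC g p).
  move: hq; rewrite dotNr.
  have : e <= b0 by move: eb b11; alra.
  alra.
move: Dq; rewrite ler_norml => /andP[_ Dq].
have : c * nsq (q - p) <= c * eta ^+ 2.
  have -> : c * eta ^+ 2 = 10 * b0 by rewrite /b0; field.
  have : d * (1 + C) = d + C * d by ring.
  move: Hq Dq Lq Cb hgq Fq Fp d1 d_ge0 b00; alra.
by rewrite ler_pM2l// -en_sq ler_pXn2r// nnegrE ?en_ge0// ltW.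
Qed.

(** The chart form of positivity of the derivative in the value near [Lambda]: a neighborhood of
    [Lambda] is described through the proximal subgradients q of u at nearby points y'. *)
Definition u_pos_on F u y0 (eta kap : R) := forall y y' p q (s1 s2 : R),
  `|y - y0| <= eta -> `|y' - y0| <= eta -> psub u y' q -> en (q - p) <= eta ->
  `|s1 - u y0| <= eta -> `|s2 - u y0| <= eta -> s1 <= s2 ->
  kap * (s2 - s1) <= F y p s2 - F y p s1.

(** For a subgradient p, [near_gradient] puts p near a gradient of u, where F increases. A
    supergradient p may lie far from all of these: one descends from y against a subgradient g of
    F(y, ., w y - tau) at p, finds by [mean_value] a subgradient q of w with g . (q - p) almost
    nonnegative, uses strictness at q, and returns to p by convexity. *)
Lemma strict_psub_psup (F0 : E -> E -> R -> R) (u : E -> R) (y0 : E) (r B K C c eta kap : R) :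
  0 < r -> 1 <= K -> 0 <= C -> 0 < c -> 0 < eta ->
  ham_lip F0 y0 r (B + 1) (K + 1) C -> ham_cvx F0 y0 r (B + 1) (K + 1) C c ->
  (forall y, `|y - y0| <= r -> `|u y| <= B) ->
  lip_on u y0 r K -> sub_on F0 u y0 r -> sup_on F0 u y0 r ->
  exists2 d0 : R, 0 < d0 & forall (Fe : E -> E -> R -> R) (w : E -> R) (d : R),
  0 <= d -> d <= d0 ->
  ham_lip Fe y0 r (B + 1) (K + 1) C -> ham_cvx Fe y0 r (B + 1) (K + 1) C c ->
  (forall y q s, `|y - y0| <= r -> `|Fe y q s - F0 y q s| <= d) ->
  u_pos_on Fe u y0 eta kap ->
  (forall y, `|y - y0| <= r -> `|w y| <= B) ->
  (forall y, `|y - y0| <= r -> `|w y - u y| <= d) ->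
  lip_on w y0 r K -> sub_on Fe w y0 r -> sup_on Fe w y0 r ->
  forall y p (tau : R), `|y - y0| <= d0 -> 0 <= tau -> tau <= d0 ->
  (psub w y p -> kap * tau <= Fe y p (w y + tau)) /\
  (psup w y p -> Fe y p (w y - tau) <= - (kap * tau)).
Proof.
move=> r0 K1 C0 c0 eta0 FL FC uB uK us uS.
have K0 : 0 <= K by exact: le_trans ler01 K1.
pose S : R := Num.sqrt n%:R.
have S0 : 0 <= S by exact: sqrtr_ge0.
have [d1 d10 NG] := near_gradient y0 B r0 K1 C0 c0 (divr_gt0 eta0 (ltr0n _ 2)).
have KS : 0 <= K * S by rewrite mulr_ge0.
have b0p : 0 < Num.min (eta / 6) (Num.min (r / 8) 1) by rewrite !lt_min ltr01 !divr_gt0.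
have [d2 [d20 d2b d2K]] := @pick_small R (K * S) _ KS b0p.
have d2e : d2 <= eta / 6 by min_ub d2b.
have d2r : d2 <= r / 8 by min_ub d2b.
have d21 : d2 <= 1 by min_ub d2b.
have d2Ke : d2 * (K * S) <= eta / 6 by min_ub d2K.
pose d0 := Num.min d1 (d2 / 2).
have d00 : 0 < d0 by rewrite lt_min d10 divr_gt0.
have d01 : d0 <= d1 by rewrite ge_min lexx.
have d02 : d0 <= d2 / 2 by rewrite ge_min lexx orbT.
exists d0 => // Fe w d d_ge0 dd0 FeL FeC dF pos wB wu wK ws wS.
have y00 : `|y0 - y0| <= r by rewrite subrr normr0 ltW.
have inc y p s1 s2 : `|y - y0| <= d2 -> psub w y p -> `|s1 - w y| <= d2 -> `|s2 - w y| <= d2 ->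
    s1 <= s2 -> kap * (s2 - s1) <= Fe y p s2 - Fe y p s1.
  move=> yd ps h1 h2 s12.
  have yr4 : `|y - y0| <= r / 4 by move: yd d2r r0; alra.
  have [y' [q [y'y qp psq]]] := NG F0 Fe u w d d_ge0 (le_trans dd0 d01) FL FC FeL FeC dF uB wB wu uK us uS wK ws wS y p yr4 ps.
  have wy : `|w y - u y0| <= eta / 3.
    have yr : `|y - y0| <= r by move: yd d2r r0; alra.
    have := ler_distD (w y0) (w y) (u y0); have := wu _ y00.
    have := wK _ _ yr y00.
    have : K * en (y - y0) <= d2 * (K * S).
      rewrite mulrC [leRHS]mulrC -mulrA [leRHS]mulrC ler_wpM2r//.
      apply: le_trans (en_le_norm _) _; rewrite ler_wpM2l//.
    move: d2Ke d2e dd0 d02 d20; alra.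
  apply: (pos y y' p q) => //.
  - move: yd d2e eta0; alra.
  - by have := ler_distD y y' y0; move: y'y yd d2e eta0; alra.
  - move: qp eta0; alra.
  - by have := ler_distD (w y) s1 (u y0); move: h1 wy d2e eta0; alra.
  - by have := ler_distD (w y) s2 (u y0); move: h2 wy d2e eta0; alra.
move=> y p tau yd tau0 taud.
have yr2 : `|y - y0| <= r / 2 by move: yd d02 d2r r0 d20; alra.
have yr1 : `|y - y0| < r by move: yd d02 d2r r0 d20; alra.
have wB1 z : `|z - y0| <= r -> `|w z| <= B + 1 by move=> /wB; alra.
have KK : K <= K + 1 by rewrite lerDl.
split=> ps.
  have Fp := wS _ _ yr1 ps.
  have yd2 : `|y - y0| <= d2 by move: yd d02 d20; alra.
  have h1 : `|w y - w y| <= d2 by rewrite subrr normr0 ltW.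
  have h2 : `|w y + tau - w y| <= d2 by rewrite addrKx ger0_norm//; move: taud d02 d20; alra.
  have h3 : w y <= w y + tau by rewrite lerDl.
  have := inc y p _ _ yd2 ps h1 h2 h3; rewrite addrKx; move: Fp; alra.
have pK := psup_lip K0 wK yr1 ps.
set s := w y - tau.
have sB : `|s| <= B + 1.
  apply: le_trans (ler_normB _ _) _; rewrite (ger0_norm tau0); apply: lerD; first exact: wB (ltW yr1).
  by move: taud d02 d21 d20; clear; lra.
have [g gC Hg] := FeC y p s (ltW yr1) (le_trans pK KK) sB.
have gn : `|g| <= C by apply: le_trans gC; exact: norm_le_en.
apply/ler_addgt0Pr => e e0.
have [Np HN] := ps.
have [t0 t00 Ht0] := near_line (- g) HN.
pose MM := `|Np| * C ^+ 2 + C + C * (1 + K) * (S * C) + C * (1 + K) * S + 1.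
have CK0 : 0 <= C * (1 + K) by rewrite mulr_ge0// addr_ge0.
have MMa : 0 <= `|Np| * C ^+ 2 by rewrite mulr_ge0// exprn_ge0.
have MMb : 0 <= C * (1 + K) * (S * C) by rewrite mulr_ge0// mulr_ge0.
have MMc : 0 <= C * (1 + K) * S by rewrite mulr_ge0.
have MM0 : 0 <= MM by rewrite !addr_ge0.
have bp : 0 < Num.min (t0 / 2) (Num.min (e / 4) (d2 / 4)) by rewrite !lt_min !divr_gt0.
have [t [tp tb tM]] := @pick_small R MM _ MM0 bp.
have tt0 : t < t0 by apply: le_lt_trans tb _; rewrite !gt_min ltr_pdivrMr// ltr_pMr// ltr1n.
have tMe : t * MM <= e / 4 by min_ub tM.
have tMd : t * MM <= d2 / 4 by min_ub tM.
have part a : a <= MM -> t * a <= e / 4 /\ t * a <= d2 / 4.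
  move=> aM; have tam := ler_wpM2l (ltW tp) aM; split; move: tam tMe tMd; alra.
have [e1 e1'] : t * (`|Np| * C ^+ 2) <= e / 4 /\ t * (`|Np| * C ^+ 2) <= d2 / 4 by apply: part; rewrite /MM; move: MMa MMb MMc C0; alra.
have [e2 e2'] : t * C <= e / 4 /\ t * C <= d2 / 4 by apply: part; rewrite /MM; move: MMa MMb MMc C0; alra.
have [e3 _] : t * (C * (1 + K) * (S * C) + C * (1 + K) * S + 1) <= e / 4 /\ t * (C * (1 + K) * (S * C) + C * (1 + K) * S + 1) <= d2 / 4 by apply: part; rewrite /MM; move: MMa MMb MMc C0; alra.
have [e4 e4'] : t * 1 <= e / 4 /\ t * 1 <= d2 / 4 by apply: part; rewrite /MM; move: MMa MMb MMc C0; alra.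
have hw : w (y + t *: - g) <= w y + t * (- dot p g + e / 4).
  have := Ht0 t (ltW tp) tt0; rewrite !addrKx dotZr dotNr nsqZ nsqN.
  have : Np * (t ^+ 2 * nsq g) <= t * (e / 4).
    apply: (@le_trans _ _ (t * (t * (`|Np| * C ^+ 2)))); last by rewrite ler_pM2l.
    have -> : t * (t * (`|Np| * C ^+ 2)) = `|Np| * (t ^+ 2 * C ^+ 2) by ring.
    apply: (@le_trans _ _ (`|Np| * (t ^+ 2 * nsq g))).
      by rewrite ler_wpM2r ?ler_norm// mulr_ge0 ?nsq_ge0// exprn_ge0// ltW.
    rewrite ler_wpM2l// ler_pM2l ?exprn_gt0//.
    by rewrite -en_sq lerXn2r ?nnegrE ?en_ge0.
  by move=> h /le_trans; apply; rewrite mulrDr addrA lerD2l.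
have wK' : lip_on w y (r / 2) K.
  move=> a b ha hb; apply: wK; [have := ler_distD y a y0|have := ler_distD y b y0]; move: ha hb yr2 r0; alra.
have tg : t * `|g| <= t * C by rewrite ler_pM2l.
have te : t * `|- g| + t < r / 2 by rewrite normrN; move: tg e2' e4' d2r d20 r0; alra.
have [y' [q [hy' psq hq]]] := mean_value K0 wK' tp tp te hw.
rewrite normrN in hy'; rewrite dotNr in hq.
have y'y : `|y' - y| <= d2 / 2 by move: hy' tg e2' e4'; alra.
have y'd : `|y' - y0| <= d2 by have := ler_distD y y' y0; move: y'y yd d02 d20; alra.
have y'r : `|y' - y0| <= r / 2 by move: y'd d2r r0; alra.
have y'r1 : `|y' - y0| < r by move: y'r r0; alra.
have qK := psub_lip K0 wK y'r1 psq.
have Fq := psub_eq0 r0 K1 C0 c0 FeL FeC wB wK ws wS y'r psq.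
have Iq : kap * tau <= Fe y' q (w y') - Fe y' q (w y' - tau).
  have h1 : `|w y' - tau - w y'| <= d2 by rewrite addrKx normrN ger0_norm//; move: taud d02 d20; alra.
  have h2 : `|w y' - w y'| <= d2 by rewrite subrr normr0 ltW.
  have h3 : w y' - tau <= w y' by rewrite lerBlDr lerDl.
  by have := inc y' q _ _ y'd psq h1 h2 h3; rewrite opprB addrC subrK.
have Hq := Hg q (le_trans qK KK).
have sB' : `|w y' - tau| <= B + 1.
  apply: le_trans (ler_normB _ _) _; rewrite (ger0_norm tau0); apply: lerD; first exact: wB (ltW y'r1).
  by move: taud d02 d21 d20; clear; lra.
have Lq := FeL y y' q q s (w y' - tau) (ltW yr1) (ltW y'r1) (le_trans qK KK) (le_trans qK KK) sB sB'.
rewrite subrr en0 addr0 in Lq.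
have ss : `|s - (w y' - tau)| <= K * en (y - y').
  rewrite /s (_ : w y - tau - (w y' - tau) = w y - w y'); last by ring.
  by apply: wK; exact: ltW.
have ey : en (y - y') <= S * (t * C) + S * t.
  rewrite enC; apply: le_trans (en_le_norm _) _; rewrite -mulrDr ler_wpM2l//.
  by apply: le_trans hy' _; rewrite lerD2r.
have Cb : C * (en (y - y') + `|s - (w y' - tau)|) <= e / 4.
  have h1 : C * (en (y - y') + `|s - (w y' - tau)|) <= C * ((1 + K) * en (y - y')).
    by rewrite ler_wpM2l//; move: ss; alra.
  have h2 : C * ((1 + K) * en (y - y')) <= C * ((1 + K) * (S * (t * C) + S * t)).
    by rewrite ler_wpM2l// ler_wpM2l// addr_ge0.
  move: h1 h2 e3 tp; alra.
have hgq : - (e / 4 + t) <= dot g (q - p).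
  by rewrite dotBr (dotC g q) (dotC g p); move: hq; alra.
have cn : 0 <= c * nsq (q - p) by rewrite mulr_ge0 ?nsq_ge0// ltW.
move: Fq Iq Hq Lq Cb hgq cn e4 e0; alra.
Qed.

End LemmaB.

(** * Smooth Hamiltonians on a Euclidean domain *)

Section Calculus.
Context {R : realType}.
Implicit Types (V W X : normedModType R).

Lemma nearB V (P : V -> Prop) (x : V) :
  (\forall z \near x, P z) <-> (\forall h \near (0 : V), P (h + x)).
Proof.
split => /nbhs_ballP[d /= d0 H]; apply/nbhs_ballP; exists d => //= z.
  by rewrite -ball_normE /= sub0r normrN => zd; apply: H; rewrite -ball_normE /= opprD addrCA subrr addr0 normrN.
by rewrite -ball_normE /= => zd; rewrite -(subrK x z); apply: H; rewrite -ball_normE /= sub0r normrN distrC.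
Qed.

Lemma differentiable_approx V W (f : V -> W) (x : V) (e : R) : differentiable f x -> 0 < e ->
  \forall z \near x, `|f z - f x - 'd f x (z - x)| <= e * `|z - x|.
Proof.
move=> df e0; have [_ /eqaddoP H] := (diff_locallyP x f).1 df.
apply/nearB; apply: filterS (H e e0) => h /=.
by rewrite addrK opprD addrA.
Qed.

Lemma approx_differentiable V W (f : V -> W) (x : V) (l : {linear V -> W}) :
  continuous l ->
  (forall e : R, 0 < e -> \forall z \near x, `|f z - f x - l (z - x)| <= e * `|z - x|) ->
  differentiable f x /\ 'd f x = l :> (V -> W).
Proof.
move=> lc H; have E : f \o shift x = cst (f x) + l +o_ (0 : V) id.
  apply/eqaddoP => e e0; have /nearB := H e e0; apply: filterS => h /=.
  by rewrite addrK opprD addrA.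
have dE := diff_unique lc E; split => //; apply/diff_locallyP; rewrite dE; split => //.
Qed.

Lemma near_eq_differentiable V W (f g : V -> W) (x : V) :
  (\forall z \near x, f z = g z) -> differentiable f x ->
  differentiable g x /\ 'd g x = 'd f x :> (V -> W).
Proof.
move=> fg df; apply: approx_differentiable; first exact: diff_continuous.
move=> e e0; have fgx := nbhs_singleton fg.
by apply: filterS2 fg (differentiable_approx df e0) => z <-; rewrite -fgx.
Qed.

(** [class_C] speaks of functions on the whole space, while formulas in charts agree on an open set
    only. *)
Lemma class_C_ext V W k (U : set V) (f g : V -> W) : open U ->
  (forall x, U x -> f x = g x) -> class_C k U f -> class_C k U g.
Proof.
move=> oU; elim: k f g => [|k IH] f g fg /=.
  move=> fc x Ux; have near_fg : \forall z \near x, f z = g z.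
    by apply: filterS (open_nbhs_nbhs (conj oU Ux)) => z /fg.
  change (g z @[z --> x] --> g x); rewrite -(fg x Ux).
  by apply: cvg_trans (fc x Ux); apply: near_eq_cvg; apply: filterS near_fg => z ->.
have near_fg x : U x -> \forall z \near x, f z = g z.
  by move=> Ux; apply: filterS (open_nbhs_nbhs (conj oU Ux)) => z /fg.
move=> [df dC]; split.
  by move=> x Ux; have [] := near_eq_differentiable (near_fg x Ux) (df x Ux).
move=> v; apply: IH (dC v) => x Ux.
by have [_ ->] := near_eq_differentiable (near_fg x Ux) (df x Ux).
Qed.

Lemma class_CS V W k (U : set V) (f : V -> W) : class_C k.+1 U f -> class_C k U f.
Proof.
elim: k f => [|k IH] f [df dC].
  by move=> x Ux; exact/differentiable_continuous/df.
by split => // v; apply: IH; exact: dC.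
Qed.

Lemma class_C_comp_linear V W X k (U : set V) (l : {linear X -> V}) (f : V -> W) :
  continuous l -> open U -> class_C k U f -> class_C k (l @^-1` U) (f \o l).
Proof.
move=> lc oU; have oU' : open (l @^-1` U) by apply: open_comp => // x _; exact: lc.
elim: k f => [|k IH] f /=.
  by move=> fc x Ux; apply: continuous_comp; [exact: lc|exact: fc].
move=> [df dC]; have dl x : differentiable l x by exact: linear_differentiable.
split; first by move=> x Ux; apply: differentiable_comp => //; exact: df.
move=> v; apply: class_C_ext (IH _ (dC (l v))) => // x Ux /=.
by rewrite (diff_comp (dl x) (df _ Ux)) /= (diff_lin _ lc).
Qed.

Lemma class_C1_diff_continuous V W (U : set V) (f : V -> W) v :
  class_C 1 U f -> forall x, U x -> {for x, continuous (fun y => 'd f y v)}.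
Proof. by move=> [_ dC] x Ux; exact: dC. Qed.

Lemma line_is_derive V (f : V -> R) (x v : V) (t : R) : differentiable f (x + t *: v) ->
  is_derive t 1 (fun s : R => f (x + s *: v)) ('d f (x + t *: v) v).
Proof.
move=> df; have [dv <-] : derivable f (x + t *: v) v /\ 'D_v f (x + t *: v) = 'd f (x + t *: v) v.
  by split; [exact: diff_derivable|exact: deriveE].
have E : (fun h : R => h^-1 *: (((fun s : R => f (x + s *: v)) \o shift t) (h *: 1) - f (x + t *: v)))
    = (fun h : R => h^-1 *: ((f \o shift (x + t *: v)) (h *: v) - f (x + t *: v))).
  apply/funext => h /=; congr (_ *: (f _ - _)).
  by rewrite scalerDl addrCA; congr (_ *: _ + _); rewrite /GRing.scale/= mulr1.
by apply: DeriveDef; rewrite /derivable /derive E.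
Qed.

End Calculus.

(** * Constants uniform on compact sets *)

Section CompactUniform.
Context {R : realType} {T : topologicalType}.

(** A property that is monotone in C and holds locally with some C holds on a compact set with one
    C. This replaces explicit subcovers everywhere; [compact_unif0] is the version for small
    parameters, by reciprocals. *)
Lemma compact_unif (A : set T) (P : R -> T -> Prop) : compact A ->
  (forall (C C' : R) x, C <= C' -> P C x -> P C' x) ->
  (forall x : T, A x -> exists C : R, \forall y \near x, P C y) ->
  exists2 C : R, 0 < C & forall x, A x -> P C x.
Proof.
move=> /compact_near_coveringP cA Pm Pl.
have H : \forall C \near +oo%R, A `<=` P C.
  apply: cA => x Ax; have [C HC] := Pl x Ax.
  exists (P C, [set C' : R | C <= C']) => //=.
    by split => //; apply: nbhs_pinfty_ge; exact: num_real.
  by move=> [y C'] /= [Py CC]; exact: Pm CC Py.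
have [C [HC C0]] : exists C : R, A `<=` P C /\ 0 < C.
  apply: (@filter_ex _ (pinfty_nbhs R)); apply: filterI H _.
  by apply: nbhs_pinfty_gt; exact: num_real.
by exists C.
Qed.

Lemma compact_unif0 (A : set T) (P : R -> T -> Prop) : compact A ->
  (forall (d d' : R) x, 0 < d' -> d' <= d -> P d x -> P d' x) ->
  (forall x : T, A x -> exists2 d : R, 0 < d & \forall y \near x, P d y) ->
  exists2 d : R, 0 < d & forall x, A x -> P d x.
Proof.
move=> cA Pm Pl.
have [C C0 H] : exists2 C : R, 0 < C & forall x, A x -> 0 < C /\ P C^-1 x.
  apply: compact_unif => //.
    move=> C C' x CC [C0 PC]; have C'0 := lt_le_trans C0 CC; split => //.
    by apply: (Pm C^-1); rewrite ?invr_gt0// lef_pV2.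
  move=> x Ax; have [d d0 H] := Pl x Ax; exists d^-1.
  by apply: filterS H => y Py; rewrite invr_gt0 invrK.
by exists C^-1; rewrite ?invr_gt0// => x /H[].
Qed.

Lemma compact_bounded_fun (A : set T) (f : T -> R) : compact A ->
  (forall x, A x -> {for x, continuous f}) ->
  exists2 C : R, 0 < C & forall x, A x -> `|f x| <= C.
Proof.
move=> cA fc; apply: compact_unif => //; first by move=> C C' x CC /le_trans; apply.
move=> x Ax; exists (`|f x| + 1).
have nc : {for x, continuous (fun y => `|f y|)}.
  by apply: (@continuous_comp _ _ _ f (fun s : R => `|s|)); [exact: fc|exact: norm_continuous].
have : \forall y \near x, `|f y| < `|f x| + 1.
  by apply: (cvgr_lt (`|f x|)) => //; rewrite ltrDl.
by apply: filterS => y /ltW.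
Qed.

End CompactUniform.

Section Hamiltonian.
Context {R : realType} {n : nat}.
Notation E := 'rV[R]_n.
Notation Z := (E * E * R)%type.
Implicit Types (y p q w : E) (G : Z -> R) (D : set E).

Definition tube D : set Z := D `*` setT `*` setT.

(** Covectors are written as rows here; [gradq] is the partial gradient of G in the momentum. *)
Definition ebasis (i : 'I_n) : E := delta_mx 0 i.
Definition gradq G y p (s : R) : E := \row_j 'd G (y, p, s) (0, ebasis j, 0).

Lemma row_ebasis (a : E) : a = \sum_i a 0 i *: ebasis i.
Proof. exact: row_sum_delta. Qed.

Lemma linear_coord (l : {linear Z -> R}) (a b : E) (t : R) :
  l (a, b, t) = \sum_i a 0 i * l (ebasis i, 0, 0) + \sum_i b 0 i * l (0, ebasis i, 0) + t * l (0, 0, 1).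
Proof.
have -> : (a, b, t) = \sum_i a 0 i *: ((ebasis i, 0, 0) : Z) + \sum_i b 0 i *: ((0, ebasis i, 0) : Z)
    + t *: ((0, 0, 1) : Z).
  have h (f : E -> Z) (c : E) : (forall (k : R) x z, f (k *: x + z) = k *: f x + f z) ->
      \sum_i c 0 i *: f (ebasis i) = f c.
    move=> fl; have f0 : f 0 = 0 by have := fl 1 0 0; rewrite !scale1r addr0 => /eqP; rewrite eq_sym -subr_eq0 addrK => /eqP.
    rewrite [in RHS](row_ebasis c); elim/big_ind2 : _ => //.
      by move=> x1 x2 y1 y2 -> ->; have := fl 1 x1 y1; rewrite !scale1r.
    by move=> i _; have := fl (c 0 i) (ebasis i) 0; rewrite f0 !addr0.
  rewrite (h (fun x => (x, 0, 0)) a); last by move=> k x z; congr (_, _, _); rewrite /= ?scaler0 ?addr0.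
  rewrite (h (fun x => (0, x, 0)) b); last by move=> k x z; congr (_, _, _); rewrite /= ?scaler0 ?addr0.
  congr (_, _, _) => /=; rewrite ?scaler0 ?addr0 ?add0r//.
  by rewrite /GRing.scale/= mulr1.
by rewrite !linearD !linear_sum linearZ; do 2?congr (_ + _); apply: eq_bigr => i _; rewrite linearZ.
Qed.

Lemma dot_gradq G y p s w : dot (gradq G y p s) w = 'd G (y, p, s) (0, w, 0).
Proof.
rewrite linear_coord mul0r addr0 [X in X + _]big1; last by move=> i _; rewrite mxE mul0r.
by rewrite add0r; apply: eq_bigr => i _; rewrite mxE mulrC.
Qed.

Definition zbox y0 (r K B : R) : set Z := cball y0 r `*` cball 0 K `*` `[- B, B]%classic.

Lemma zbox_compact y0 r K B : compact (zbox y0 r K B).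
Proof. by do 2?apply: compact_setX; [exact: cball_compact|exact: cball_compact|exact: segment_compact]. Qed.

Lemma zboxP y0 r K B y q s : `|y - y0| <= r -> en q <= K -> `|s| <= B -> zbox y0 r K B (y, q, s).
Proof.
move=> yr qK sB; split; first split => //=.
  by rewrite /cball/= subr0; apply: le_trans (norm_le_en _) qK.
by rewrite /= in_itv/= -ler_norml.
Qed.

Lemma sum_norm_le (a : E) (f : 'I_n -> R) (C : R) : (forall i, `|f i| <= C) ->
  `|\sum_i a 0 i * f i| <= n%:R * C * en a.
Proof.
move=> fC; apply: le_trans (ler_norm_sum _ _ _) _.
have -> : n%:R * C * en a = \sum_(i < n) C * en a.
  by rewrite sumr_const card_ord -[RHS]mulr_natl mulrA.
apply: ler_sum => i _; rewrite normrM mulrC ler_pM//.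
by apply: le_trans (coord_le_norm _ _) (norm_le_en _).
Qed.

Lemma ord_bound (P : 'I_n -> R -> Prop) : (forall i (C C' : R), C <= C' -> P i C -> P i C') ->
  (forall i, exists2 C : R, 0 < C & P i C) -> exists2 C : R, 0 < C & forall i, P i C.
Proof.
move=> Pm H; have /choice[f Hf] : forall i, exists C : R, 0 < C /\ P i C.
  by move=> i; have [C] := H i; exists C.
exists (1 + \sum_i f i); first by rewrite ltr_pwDl// sumr_ge0// => i _; exact/ltW/(Hf i).1.
move=> i; apply: Pm (Hf i).2; rewrite (bigD1 i)//= addrCA lerDl addr_ge0//.
by rewrite sumr_ge0// => j _; exact/ltW/(Hf j).1.
Qed.

Lemma diff_bound G D y0 r B K : class_C 1 (tube D) G ->
  cball y0 r `<=` D -> exists2 C : R, 0 < C & forall z, zbox y0 r K B z ->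
  forall (a b : E) (t : R), `|'d G z (a, b, t)| <= C * (en a + en b + `|t|).
Proof.
move=> GC yD.
have zD z : zbox y0 r K B z -> tube D z by move=> [[/= h1 h2] h3]; split => //; split => //; exact: yD.
have bd v : exists2 C : R, 0 < C & forall z, zbox y0 r K B z -> `|'d G z v| <= C.
  apply: (@compact_bounded_fun R Z (zbox y0 r K B) (fun z => 'd G z v)); first exact: zbox_compact.
  by move=> z /zD; exact: class_C1_diff_continuous GC z.
have [C1 C10 H1] : exists2 C : R, 0 < C & forall i z, zbox y0 r K B z -> `|'d G z (ebasis i, 0, 0)| <= C.
  by apply: (@ord_bound (fun i C => forall z, _)) => // i C C' CC H z /H /le_trans; apply.
have [C2 C20 H2] : exists2 C : R, 0 < C & forall i z, zbox y0 r K B z -> `|'d G z (0, ebasis i, 0)| <= C.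
  by apply: (@ord_bound (fun i C => forall z, _)) => // i C C' CC H z /H /le_trans; apply.
have [C3 C30 H3] := bd (0, 0, 1).
exists (n%:R * C1 + n%:R * C2 + C3).
  by rewrite ltr_wpDl// addr_ge0// mulr_ge0// ltW.
move=> z zz a b t; rewrite linear_coord.
have h1 := sum_norm_le a (fun i => H1 i z zz).
have h2 := sum_norm_le b (fun i => H2 i z zz).
have h3 : `|t * 'd G z (0, 0, 1)| <= C3 * `|t| by rewrite normrM mulrC ler_wpM2r// H3.
apply: le_trans (ler_normD _ _) _; apply: (@le_trans _ _ (n%:R * C1 * en a + n%:R * C2 * en b + C3 * `|t|)).
  by rewrite lerD//; apply: le_trans (ler_normD _ _) _; rewrite lerD.
have nC1 : 0 <= n%:R * C1 by rewrite mulr_ge0// ltW.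
have nC2 : 0 <= n%:R * C2 by rewrite mulr_ge0// ltW.
have := mulr_ge0 nC1 (en_ge0 b); have := mulr_ge0 nC1 (normr_ge0 t).
have := mulr_ge0 nC2 (en_ge0 a); have := mulr_ge0 nC2 (normr_ge0 t).
have := mulr_ge0 (ltW C30) (en_ge0 a); have := mulr_ge0 (ltW C30) (en_ge0 b).
clear; lra.
Qed.

Lemma cball_convex y0 (r : R) (x y : E) (t : R) : 0 <= t <= 1 -> cball y0 r x -> cball y0 r y ->
  cball y0 r (x + t *: (y - x)).
Proof.
move=> /andP[t0 t1]; rewrite /cball/= => hx hy.
have -> : x + t *: (y - x) - y0 = (1 - t) *: (x - y0) + t *: (y - y0).
  by apply/rowP => i; rewrite !mxE; ring.
apply: le_trans (ler_normD _ _) _; rewrite !normrZ (ger0_norm t0) ger0_norm ?subr_ge0//.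
have := ler_wpM2l t0 hy; have t1' : 0 <= 1 - t by rewrite subr_ge0.
have := ler_wpM2l t1' hx; clear; lra.
Qed.

Lemma zbox_convex y0 r K B (z z' : Z) (t : R) : 0 <= t <= 1 -> zbox y0 r K B z -> zbox y0 r K B z' ->
  zbox y0 r K B (z + t *: (z' - z)).
Proof.
move: z z' => [[y q] s] [[y' q'] s'] t01 [[/= h1 h2] h3] [[/= h1' h2'] h3'].
split; first by split => /=; exact: cball_convex.
move: h3 h3' t01; rewrite /= !in_itv/= => /andP[a1 a2] /andP[b1 b2] /andP[t0 t1].
rewrite /GRing.scale/=.
have t1' : 0 <= 1 - t by rewrite subr_ge0.
have := ler_wpM2l t0 b1; have := ler_wpM2l t0 b2; have := ler_wpM2l t1' a1; have := ler_wpM2l t1' a2.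
by move=> *; apply/andP; split; lra.
Qed.

Lemma line_MVT (V : normedModType R) (f : V -> R) (x v : V) :
  (forall t : R, 0 <= t <= 1 -> differentiable f (x + t *: v)) ->
  exists2 t : R, 0 <= t <= 1 & f (x + v) - f x = 'd f (x + t *: v) v.
Proof.
move=> df; have [|||t] := @MVT_segment R (fun t => f (x + t *: v)) (fun t => 'd f (x + t *: v) v) 0 1.
- exact: ler01.
- by move=> t; rewrite in_itv/= => /andP[t0 t1]; apply: line_is_derive; apply: df; rewrite !ltW.
- apply: derivable_within_continuous => t; rewrite in_itv/= => t01.
  by have [] := line_is_derive (df t t01).
rewrite in_itv/= scale1r scale0r addr0 subr0 mulr1 => t01 H.
by exists t.
Qed.

Lemma ham_lip_class G D y0 r B K : class_C 1 (tube D) G ->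
  cball y0 r `<=` D -> exists2 C : R, 0 < C & ham_lip (fun y q s => G (y, q, s)) y0 r B K C.
Proof.
move=> GC yD; have [C C0 H] := diff_bound B K GC yD.
exists C => // y y' q q' s s' yr y'r qK q'K sB s'B.
have z1 := zboxP yr qK sB; have z2 := zboxP y'r q'K s'B.
have zD z : zbox y0 r K B z -> tube D z by move=> [[/= h1 h2] h3]; split => //; split => //; exact: yD.
have [|t t01] := @line_MVT Z G (y', q', s') ((y, q, s) - (y', q', s')).
  by move=> t t01; apply: (proj1 GC); apply: zD; exact: zbox_convex.
have -> : (y', q', s') + ((y, q, s) - (y', q', s')) = (y, q, s) by rewrite [LHS]addrC subrK.
move=> ->; apply: le_trans (ler_norm _) _; apply: (H _ _ (y - y') (q - q') (s - s')).
exact: zbox_convex.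
Qed.

End Hamiltonian.

Lemma diff_lincomb (R : realType) (V : normedModType R) (m : nat) (c : 'I_m -> R)
    (f : 'I_m -> V -> R) (z : V) : (forall j, differentiable (f j) z) ->
  differentiable (fun x => \sum_j c j * f j x) z /\
  forall v, 'd (fun x => \sum_j c j * f j x) z v = \sum_j c j * 'd (f j) z v.
Proof.
move=> df; elim: (index_enum _) => [|i r [dr Hr]].
  have -> : (fun x => \sum_(j <- [::]) c j * f j x) = cst (0 : R) by apply/funext => x; rewrite big_nil.
  by split => [|v]; [exact: differentiable_cst|rewrite diff_cst big_nil].
have -> : (fun x => \sum_(j <- i :: r) c j * f j x) = (c i *: f i) + (fun x => \sum_(j <- r) c j * f j x).
  by apply/funext => x; rewrite big_cons.
have di : differentiable (c i *: f i) z by exact: differentiableZ.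
split => [|v]; first exact: differentiableD.
rewrite big_cons; apply: etrans (congr1 (@^~ v) (diffD di dr)) _ => /=.
congr (_ + _); last exact: Hr.
by apply: etrans (congr1 (fun g : V -> R => g v) (diffZ (c i) (df i))) _.
Qed.

(** * Strong convexity in the momentum *)

Section Convexity.
Context {R : realType} {n : nat}.
Notation E := 'rV[R]_n.
Notation Z := (E * E * R)%type.
Implicit Types (y p q w : E) (G : Z -> R) (D : set E).

Definition gradc G (j : 'I_n) (z : Z) : R := 'd G z ((0, ebasis j, 0) : Z).
Definition hessc G (i j : 'I_n) (z : Z) : R := 'd (gradc G j) z ((0, ebasis i, 0) : Z).
Definition hessq G (z : Z) (w : E) : R := 'd (fun z' => 'd G z' ((0, w, 0) : Z)) z (0, w, 0).

Lemma linear_coord_q (l : {linear Z -> R}) (w : E) : l (0, w, 0) = \sum_i w 0 i * l (0, ebasis i, 0).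
Proof.
rewrite linear_coord mul0r addr0 [X in X + _]big1; last by move=> i _; rewrite mxE mul0r.
by rewrite add0r.
Qed.

(** Second-order Taylor with a lower bound m on the Hessian along the segment, by two applications
    of the mean value theorem: the derivative of the remainder [k] is nonnegative. *)
Lemma taylor_lower G D y p q s (m : R) : class_C 2 (tube D) G -> D y ->
  (forall t : R, 0 <= t <= 1 -> m <= hessq G (y, p + t *: (q - p), s) (q - p)) ->
  G (y, p, s) + dot (gradq G y p s) (q - p) + m / 2 <= G (y, q, s).
Proof.
move=> [Gd GC] Dy Hm; pose w := q - p; pose v : Z := (0, w, 0).
have lineE (t : R) : (y, p, s) + t *: v = (y, p + t *: w, s).
  by congr (_, _, _); rewrite /= ?scaler0 ?addr0// /GRing.scale/= mulr0 addr0.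
have inD (t : R) : tube D ((y, p, s) + t *: v) by rewrite lineE.
pose h (t : R) := G ((y, p, s) + t *: v).
pose h1 (t : R) := 'd G ((y, p, s) + t *: v) v.
have dh (t : R) : is_derive t 1 h (h1 t) by apply: line_is_derive; apply: Gd.
have dh1 (t : R) : is_derive t 1 h1 (hessq G ((y, p, s) + t *: v) w).
  by apply: (@line_is_derive R Z (fun z => 'd G z v)); apply: (proj1 (GC v)).
pose k (t : R) := h t - h 0 - h1 0 * t - m / 2 * t ^+ 2.
have dsq (t : R) : is_derive t 1 (fun x : R => m / 2 * x ^+ 2) (m * t).
  by apply: is_derive_eq; rewrite /GRing.scale/=; field.
have dlin (t : R) : is_derive t 1 (fun x : R => h1 0 * x) (h1 0).
  by apply: is_derive_eq; rewrite /GRing.scale/= mulr1.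
have dk (t : R) : is_derive t 1 k (h1 t - h1 0 - m * t).
  have dc : is_derive t 1 (fun _ : R => h 0) 0 by exact: is_derive_cst.
  have := is_deriveB (is_deriveB (is_deriveB (dh t) dc) (dlin t)) (dsq t).
  by rewrite subr0.
have k1 (t : R) : 0 <= t <= 1 -> 0 <= h1 t - h1 0 - m * t.
  move=> /andP[t0 t1].
  have [|x] := @MVT_segment R h1 (fun t => hessq G ((y, p, s) + t *: v) w) 0 t t0.
    by apply: derivable_within_continuous => x _; have [] := dh1 x.
  rewrite in_itv/= subr0 => /andP[x0 xt] ->.
  by rewrite -mulrBl mulr_ge0// subr_ge0 lineE; apply: Hm; rewrite x0 (le_trans xt).
have [|x] := @MVT_segment R k (fun t => h1 t - h1 0 - m * t) 0 1 ler01.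
  by apply: derivable_within_continuous => x _; have [] := dk x.
rewrite in_itv/= subr0 mulr1 => x01 kE.
have z0E : (y, p, s) + 0 *: v = (y, p, s) by rewrite scale0r addr0.
have h10 : h1 0 = dot (gradq G y p s) w by rewrite dot_gradq /h1 z0E.
have h0 : h 0 = G (y, p, s) by rewrite /h z0E.
have h1E : h 1 = G (y, q, s).
  by rewrite /h lineE scale1r; congr (G (_, _, _)); rewrite /w [LHS]addrC subrK.
have := k1 x x01; rewrite -kE /k h0 h1E h10 -/w.
by move: (G _) (G _) (dot _ _) => a b g; clear; lra.
Qed.

Lemma hessq_coord G D (z : Z) (w : E) : class_C 2 (tube D) G -> open D -> tube D z ->
  hessq G z w = \sum_i w 0 i * \sum_j w 0 j * hessc G i j z.
Proof.
move=> [Gd GC] oD Dz.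
have dj j : differentiable (gradc G j) z by exact: (proj1 (GC _)).
have E1 : (fun z' => 'd G z' (0, w, 0)) = (fun z' => \sum_j w 0 j * gradc G j z').
  by apply/funext => z'; exact: linear_coord_q.
apply: etrans (linear_coord_q _ w) _; apply: eq_bigr => i _; congr (_ * _).
apply: etrans (congr1 (fun f : Z -> R => 'd f z (0, ebasis i, 0)) E1) _.
exact: (proj2 (diff_lincomb _ dj)).
Qed.

Lemma hessq_continuous G D (z : Z) (w : E) : class_C 2 (tube D) G -> open D -> tube D z ->
  {for (z, w), continuous (fun t : Z * E => \sum_i t.2 0 i * \sum_j t.2 0 j * hessc G i j t.1)}.
Proof.
move=> [Gd GC] oD Dz.
have c2 i : {for (z, w), continuous (fun t : Z * E => t.2 0 i)}.
  apply: (@continuous_comp _ _ _ (fun t : Z * E => t.2) (fun w : E => w 0 i)); first exact: cvg_snd.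
  exact: coord_continuous.
apply: continuous_sum => i _; apply: continuousM; first exact: c2.
apply: continuous_sum => j _; apply: continuousM; first exact: c2.
apply: (@continuous_comp _ _ _ (fun t : Z * E => t.1) (hessc G i j)).
  exact: cvg_fst.
by apply: (proj2 (GC _)).
Qed.

Lemma hessqZ G D (z : Z) (w : E) (a : R) : class_C 2 (tube D) G -> open D -> tube D z ->
  hessq G z (a *: w) = a ^+ 2 * hessq G z w.
Proof.
move=> GC oD Dz; rewrite !(hessq_coord _ GC oD Dz) expr2 -mulrA mulr_sumr mulr_sumr; apply: eq_bigr => i _.
rewrite !mxE -!mulrA; congr (_ * _); rewrite mulrCA; congr (_ * _).
by rewrite mulr_sumr; apply: eq_bigr => j _; rewrite mxE mulrA.
Qed.

Lemma hessq_bounds G D y0 r B K : class_C 2 (tube D) G -> open D -> cball y0 r `<=` D ->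
  exists2 C : R, 0 < C & forall z, zbox y0 r K B z -> forall w, `|hessq G z w| <= C * nsq w.
Proof.
move=> GC oD yD.
have zD z : zbox y0 r K B z -> tube D z by move=> [[/= h1 h2] h3]; split => //; split => //; exact: yD.
have [C C0 H] := @compact_bounded_fun R _ (zbox y0 r K B `*` cball (0 : E) 1) _
  (compact_setX (@zbox_compact _ _ y0 r K B) (@cball_compact _ _ 0 1))
  (fun t At => match t return (zbox y0 r K B `*` cball (0 : E) 1) t -> {for t, continuous _} with (z, w) => fun At => hessq_continuous GC oD (zD z At.1) end At).
exists C => // z zz w.
have [->|w0] := eqVneq w 0.
  by rewrite -(scale0r 0) (hessqZ _ _ GC oD (zD z zz)) expr0n mul0r normr0 scale0r nsq0 mulr0.
have e0 := en_gt0 w0.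
have -> : w = en w *: ((en w)^-1 *: w) by rewrite scalerA divff ?gt_eqF// scale1r.
rewrite (hessqZ _ _ GC oD (zD z zz)) nsqZ normrM ger0_norm ?sqr_ge0// mulrCA ler_wpM2l ?sqr_ge0//.
have n1 : nsq ((en w)^-1 *: w) = 1 by rewrite nsqZ -en_sq exprVn mulVf// gt_eqF// exprn_gt0.
rewrite n1 mulr1 (hessq_coord _ GC oD (zD z zz)).
apply: (H (z, (en w)^-1 *: w)); split => //=.
rewrite /cball/= subr0; apply: le_trans (norm_le_en _) _.
by rewrite /en n1 sqrtr1.
Qed.

(** By homogeneity it suffices to treat the compact product of the box with the unit sphere, on
    which a positive continuous function has a positive minimum. *)
Lemma hessq_pos_bound G D y0 r B K : class_C 2 (tube D) G -> open D -> cball y0 r `<=` D ->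
  (forall z w, tube D z -> w != 0 -> 0 < hessq G z w) ->
  exists2 c : R, 0 < c & forall z, zbox y0 r K B z -> forall w, c * nsq w <= hessq G z w.
Proof.
move=> GC oD yD pos.
have zD z : zbox y0 r K B z -> tube D z by move=> [[/= h1 h2] h3]; split => //; split => //; exact: yD.
have cA : compact (zbox y0 r K B `*` (cball (0 : E) 1 `&` [set w | nsq w = 1])).
  apply: compact_setX; first exact: zbox_compact.
  apply: compact_closedI; first exact: cball_compact.
  have -> : [set w : E | nsq w = 1] = nsq @^-1` [set 1 : R] by [].
  apply: closed_comp; last exact: closed_eq.
  by move=> x _; exact: nsq_continuous.
pose f (t : Z * E) := \sum_i t.2 0 i * \sum_j t.2 0 j * hessc G i j t.1.
have fE z w : zbox y0 r K B z -> f (z, w) = hessq G z w by move=> /zD Dz; rewrite (hessq_coord _ GC oD Dz).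
have [c c0 H] : exists2 c : R, 0 < c & forall t, (zbox y0 r K B `*` (cball (0 : E) 1 `&` [set w | nsq w = 1])) t -> c <= f t.
  have [[t0 At0]|nA] := pselect ((zbox y0 r K B `*` (cball (0 : E) 1 `&` [set w | nsq w = 1])) !=set0); last first.
    by exists 1 => // t At; case: nA; exists t.
  have [m [mz [mb mn]] mM] := @compact_max _ _ (fun t => - f t) _ (ex_intro _ t0 At0) cA ltac:(
    move=> [z w] [/= zz _]; apply: continuousN; exact: hessq_continuous GC oD (zD z zz)).
  exists (f m); last by move=> t /mM; rewrite lerN2.
  move: m mz mb mn mM => [z w] /= mz mb mn mM; rewrite fE//; apply: pos; first exact: zD.
  by apply: contra_eq_neq mn => ->; rewrite nsq0 eq_sym oner_eq0.
exists c => // z zz w.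
have [->|w0] := eqVneq w 0.
  by rewrite -(scale0r 0) (hessqZ _ _ GC oD (zD z zz)) nsqZ expr0n !mul0r mulr0.
have e0 := en_gt0 w0.
have -> : w = en w *: ((en w)^-1 *: w) by rewrite scalerA divff ?gt_eqF// scale1r.
rewrite (hessqZ _ _ GC oD (zD z zz)) nsqZ mulrCA ler_wpM2l ?sqr_ge0//.
have n1 : nsq ((en w)^-1 *: w) = 1 by rewrite nsqZ -en_sq exprVn mulVf// gt_eqF// exprn_gt0.
rewrite n1 mulr1 -fE//; apply: H; split => //=; split => //=.
rewrite /cball/= subr0; apply: le_trans (norm_le_en _) _.
by rewrite /en n1 sqrtr1.
Qed.

Lemma gradq_bound G D y0 r B K : class_C 1 (tube D) G -> cball y0 r `<=` D ->
  exists2 C : R, 0 < C & forall y p s, `|y - y0| <= r -> en p <= K -> `|s| <= B -> en (gradq G y p s) <= C.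
Proof.
move=> GC yD; have [C C0 H] := diff_bound B K GC yD; exists C => // y p s yr pK sB.
have := H _ (zboxP yr pK sB) 0 (gradq G y p s) 0.
rewrite -dot_gradq -/(nsq _) en0 normr0 addr0 add0r ger0_norm ?nsq_ge0// -en_sq expr2.
have [->|/en_gt0 g0] := eqVneq (gradq G y p s) 0; first by rewrite en0 => _; exact: ltW.
by rewrite ler_pM2r.
Qed.

Lemma quad_lower G D y0 r B K (c : R) : class_C 2 (tube D) G -> cball y0 r `<=` D ->
  (forall z, zbox y0 r K B z -> forall w, 2 * c * nsq w <= hessq G z w) ->
  forall y p q s, `|y - y0| <= r -> en p <= K -> en q <= K -> `|s| <= B ->
  G (y, p, s) + dot (gradq G y p s) (q - p) + c * nsq (q - p) <= G (y, q, s).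
Proof.
move=> GC yD H y p q s yr pK qK sB.
have -> : c * nsq (q - p) = 2 * c * nsq (q - p) / 2 by field.
apply: (taylor_lower GC); first exact: yD.
move=> t t01; apply: H; apply: zboxP => //.
have -> : p + t *: (q - p) = (1 - t) *: p + t *: q by apply/rowP => i; rewrite !mxE; ring.
move/andP: t01 => [t0 t1]; have t1' : 0 <= 1 - t by rewrite subr_ge0.
apply: le_trans (enD _ _) _; rewrite !enZ !ger0_norm//.
have := ler_wpM2l t0 qK; have := ler_wpM2l t1' pK; clear; lra.
Qed.

Lemma convex_lower G D y p q s : class_C 2 (tube D) G -> D y ->
  (forall z w, tube D z -> w != 0 -> 0 < hessq G z w) ->
  G (y, p, s) + dot (gradq G y p s) (q - p) <= G (y, q, s).
Proof.
move=> GC Dy pos; have [<-|pq] := eqVneq p q; first by rewrite subrr dot0r addr0.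
have := @taylor_lower G D y p q s 0 GC Dy; rewrite mul0r addr0; apply => t _.
by apply/ltW/pos => //; rewrite subr_eq0 eq_sym.
Qed.

End Convexity.

(** * Bounds uniform over the perturbed family *)

Section Family.
Context {R : realType} {n : nat}.
Notation E := 'rV[R]_n.
Notation Z := (E * E * R)%type.
Implicit Types (y p q w : E) (G : Z -> R) (D : set E).

Definition fam (G0 G1 : Z -> R) (e : R) y q (s : R) : R := G0 (y, q, s) + e * G1 (y, q, s).

(** A supporting hyperplane valid for all momenta q, not just for those of the box. It makes the
    subgradient g a velocity for which the supremum in the Lagrangian is attained at p. *)
Definition ham_sgr (F : E -> E -> R -> R) y0 (r B K C : R) := forall y p (s : R),
  `|y - y0| <= r -> en p <= K -> `|s| <= B ->
  exists2 g, en g <= C & forall q, F y p s + dot g (q - p) <= F y q s.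

Definition ham_superlin (F : E -> E -> R -> R) y0 (r B : R) := forall A : R,
  exists2 C : R, 0 < C & forall y q (s : R), `|y - y0| <= r -> `|s| <= B -> A * en q - C <= F y q s.

Lemma fam_lip G0 G1 D y0 (r B K : R) : class_C 1 (tube D) G0 -> class_C 1 (tube D) G1 ->
  cball y0 r `<=` D ->
  exists2 C : R, 0 < C & forall e : R, 0 <= e <= 1 -> ham_lip (fam G0 G1 e) y0 r B K C.
Proof.
move=> C0 C1 yD.
have [c0 c00 H0] := ham_lip_class B K C0 yD; have [c1 c10 H1] := ham_lip_class B K C1 yD.
exists (c0 + c1); first exact: addr_gt0.
move=> e /andP[e0 e1] y y' q q' s s' yr y'r qK q'K sB s'B.
have h0 := H0 _ _ _ _ _ _ yr y'r qK q'K sB s'B.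
have h1 := H1 _ _ _ _ _ _ yr y'r qK q'K sB s'B.
have := ler_wpM2l e0 h1; rewrite /fam.
have P0 : 0 <= en (y - y') + en (q - q') + `|s - s'| by rewrite !addr_ge0 ?en_ge0.
have h2 : e * (c1 * (en (y - y') + en (q - q') + `|s - s'|)) <= c1 * (en (y - y') + en (q - q') + `|s - s'|).
  by rewrite ler_piMl// mulr_ge0// ltW.
move: h0 h2; move: (en _ + _ + _) (G0 _) (G0 _) (G1 _) (G1 _) => P a b c d; clear; lra.
Qed.

Lemma fam_arith1 (e c C2 nn d1 d2 a b f g : R) : a + d1 + c / 2 * nn <= b ->
  e * (f + d2 + - (C2 / 2) * nn) <= e * g -> e * C2 * nn <= c / 2 * nn ->
  a + e * f + (d1 + e * d2) + c / 4 * nn <= b + e * g.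
Proof. lra. Qed.

Lemma fam_arith2 (e c C2 g1 t d1 d2 d3 a b m f g : R) :
  m + (t - 1) * d3 <= b -> (t - 1) * (m - d3) <= (t - 1) * a -> t * (a + d1 + c / 2) <= t * m ->
  e * (C2 + 2 + g1) * t <= c / 2 * t -> e * - (g1 * t) <= e * - (t * d2) ->
  e * 2 <= e * 2 * t -> 0 <= c * t -> 0 <= e * C2 * t -> e * - 1 <= e * g -> e * f <= e * 1 ->
  a + e * f + (t * d1 + e * (t * d2)) <= b + e * g.
Proof. lra. Qed.

(** The Hessian of the perturbation is bounded on the box, so for small e it costs at most half of
    the convexity of G0. *)
Lemma fam_cvx G0 G1 D y0 (r B K : R) : open D -> class_C 2 (tube D) G0 -> class_C 2 (tube D) G1 ->
  cball y0 r `<=` D ->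
  (forall z w, tube D z -> w != 0 -> 0 < hessq G0 z w) ->
  exists C c e1 : R, [/\ 0 < C, 0 < c, 0 < e1, e1 <= 1 &
   forall e : R, 0 <= e <= e1 -> ham_cvx (fam G0 G1 e) y0 r B K C c].
Proof.
move=> oD C0 C1 yD pos.
have [c c0 Hc] := hessq_pos_bound B K C0 oD yD pos.
have [C2 C20 HC2] := hessq_bounds B K C1 oD yD.
have [g0 g00 Hg0] := gradq_bound B K (class_CS C0) yD.
have [g1 g10 Hg1] := gradq_bound B K (class_CS C1) yD.
have ep : 0 < Num.min 1 (c / (2 * C2)) by rewrite lt_min ltr01/= divr_gt0// mulr_gt0.
exists (g0 + g1), (c / 4), (Num.min 1 (c / (2 * C2))); split => //.
- exact: addr_gt0.
- by rewrite divr_gt0.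
- by rewrite ge_min lexx.
move=> e /andP[e0 e1] y p s yr pK sB.
have e11 : e <= 1 by min_ub e1.
have eC : e * C2 <= c / 2.
  have : e <= c / (2 * C2) by min_ub e1.
  by rewrite ler_pdivlMr ?mulr_gt0//; lra.
exists (gradq G0 y p s + e *: gradq G1 y p s).
  apply: le_trans (enD _ _) _; rewrite enZ ger0_norm//; apply: lerD; first exact: Hg0.
  by apply: le_trans (Hg1 y p s yr pK sB); rewrite ler_piMl// en_ge0.
move=> q qK.
have h0 := @quad_lower _ _ G0 D y0 r B K (c / 2) C0 yD ltac:(by move=> z zz w; rewrite mulrCA divff// mulr1; exact: Hc) y p q s yr pK qK sB.
have h1 := @quad_lower _ _ G1 D y0 r B K (- (C2 / 2)) C1 yD ltac:(by move=> z zz w; rewrite (_ : 2 * - (C2 / 2) = - C2); [rewrite mulNr; have := HC2 z zz w; rewrite ler_norml => /andP[]|field]) y p q s yr pK qK sB.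
rewrite /fam dotDl dotZl.
exact: fam_arith1 h0 (ler_wpM2l e0 h1) (ler_wpM2r (nsq_ge0 (q - p)) eC).
Qed.

Lemma unit_step (p q : E) : q != p -> exists u : E, en u = 1 /\ q - p = en (q - p) *: u.
Proof.
move=> qp; have e0 : 0 < en (q - p) by rewrite en_gt0// subr_eq0.
exists ((en (q - p))^-1 *: (q - p)); split.
  by rewrite enZ gtr0_norm ?invr_gt0// mulVf// gt_eqF.
by rewrite scalerA divff ?gt_eqF// scale1r.
Qed.

Local Opaque gradq.
(** Within distance 1 of p the strong convexity of G0 beats the Hessian of the perturbation. Beyond,
    convexity of G0 makes the gain c / 2 reached at distance 1 grow linearly, which pays for the
    linear term and for the oscillation of G1, at most 2. *)
Lemma fam_sgr G0 G1 D y0 (r B K : R) : open D -> class_C 2 (tube D) G0 -> class_C 2 (tube D) G1 ->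
  cball y0 r `<=` D ->
  (forall z w, tube D z -> w != 0 -> 0 < hessq G0 z w) ->
  (forall z, `|G1 z| <= 1) ->
  exists C e1 : R, [/\ 0 < C, 0 < e1, e1 <= 1 &
   forall e : R, 0 <= e <= e1 -> ham_sgr (fam G0 G1 e) y0 r B K C].
Proof.
move=> oD C0 C1 yD pos G11.
have [c c0 Hc] := hessq_pos_bound B (K + 1) C0 oD yD pos.
have [C2 C20 HC2] := hessq_bounds B (K + 1) C1 oD yD.
have [g0 g00 Hg0] := gradq_bound B K (class_CS C0) yD.
have [g1 g10 Hg1] := gradq_bound B K (class_CS C1) yD.
have Pp : 0 < 2 * (C2 + 2 + g1) by rewrite mulr_gt0// !addr_gt0.
have ep : 0 < Num.min 1 (c / (2 * (C2 + 2 + g1))) by rewrite lt_min ltr01/= divr_gt0.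
exists (g0 + g1), (Num.min 1 (c / (2 * (C2 + 2 + g1)))); split => //.
- exact: addr_gt0.
- by rewrite ge_min lexx.
move=> e /andP[e0 e1] y p s yr pK sB.
have e11 : e <= 1 by min_ub e1.
have eC : e * (C2 + 2 + g1) <= c / 2.
  have : e <= c / (2 * (C2 + 2 + g1)) by min_ub e1.
  by rewrite ler_pdivlMr//; lra.
have eC2 : e * C2 <= c / 2.
  by apply: le_trans eC; rewrite ler_wpM2l// -addrA lerDl addr_ge0// ltW.
exists (gradq G0 y p s + e *: gradq G1 y p s).
  apply: le_trans (enD _ _) _; rewrite enZ ger0_norm//; apply: lerD; first exact: Hg0.
  by apply: le_trans (Hg1 y p s yr pK sB); rewrite ler_piMl// en_ge0.
move=> q; have [->|qp] := eqVneq q p; first by rewrite subrr dot0r addr0.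
have pK1 : en p <= K + 1 by apply: le_trans pK _; rewrite lerDl.
have Dy : D y by exact: yD.
have [u [u1 qpE]] := unit_step qp.
set t := en (q - p) in qpE; have t0 : 0 <= t by exact: en_ge0.
have near_p q' : en (q' - p) <= 1 -> en q' <= K + 1.
  move=> h; have := enD (q' - p) p; rewrite subrK; lra.
have low q' : en (q' - p) <= 1 -> G0 (y, p, s) + dot (gradq G0 y p s) (q' - p) + c / 2 * nsq (q' - p) <= G0 (y, q', s).
  move=> h; apply: (@quad_lower _ _ G0 D y0 r B (K + 1) (c / 2) C0 yD) => //; last exact: near_p.
  by move=> z zz w; rewrite mulrCA divff// mulr1; exact: Hc.
rewrite /fam dotDl dotZl.
have [t1|t1] := leP t 1.
  have h0 := low q t1.
  have h1 := @quad_lower _ _ G1 D y0 r B (K + 1) (- (C2 / 2)) C1 yD ltac:(by move=> z zz w; rewrite (_ : 2 * - (C2 / 2) = - C2); [rewrite mulNr; have := HC2 z zz w; rewrite ler_norml => /andP[]|field]) y p q s yr pK1 (near_p _ t1) sB.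
  have := fam_arith1 h0 (ler_wpM2l e0 h1) (ler_wpM2r (nsq_ge0 (q - p)) eC2).
  by apply: le_trans; rewrite lerDl mulr_ge0 ?nsq_ge0// divr_ge0// ltW.
have um : p + u - p = u by rewrite addrKx.
have h0 := low (p + u); rewrite um u1 -en_sq u1 expr1n mulr1 lexx in h0; have {}h0 := h0 isT.
have hq := @convex_lower _ _ G0 D y (p + u) q s C0 Dy pos.
have hp := @convex_lower _ _ G0 D y (p + u) p s C0 Dy pos.
have qm : q - (p + u) = (t - 1) *: u by rewrite opprD addrA qpE scalerBl scale1r.
have pm : p - (p + u) = - u by rewrite opprD addrA subrr add0r.
rewrite qm dotZr in hq; rewrite pm dotNr in hp.
have qpE' g : dot g (q - p) = t * dot g u by rewrite qpE dotZr.
have g1b : - (g1 * t) <= - (t * dot (gradq G1 y p s) u).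
  by rewrite -qpE' lerN2; apply: le_trans (dot_le _ _) _; rewrite -/t ler_wpM2r//; exact: Hg1.
have /ler_normlP[f1 f1'] := G11 (y, p, s); have /ler_normlP[f2 f2'] := G11 (y, q, s).
have t10 : 0 <= t - 1 by rewrite subr_ge0 ltW.
move: hp h0 g1b; move: (gradq G0 y p s) (gradq G1 y p s) => gr0 gr1 hp h0 g1b.
rewrite (qpE' gr0) (qpE' gr1).
apply: fam_arith2 hq (ler_wpM2l t10 hp) (ler_wpM2l t0 h0) (ler_wpM2r t0 eC) (ler_wpM2l e0 g1b) _ _ _ _ _.
- by rewrite ler_peMr ?(ltW t1)// mulr_ge0.
- by rewrite mulr_ge0// ltW.
- by rewrite !mulr_ge0// ltW.
- by rewrite ler_wpM2l// lerNl.
- by rewrite ler_wpM2l.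
Qed.

(** Along a ray a convex function that has mean slope A up to radius rho keeps at least that slope
    further out. *)
Lemma superlin_step (A rho : R) G D y p s : class_C 2 (tube D) G -> D y ->
  (forall z w, tube D z -> w != 0 -> 0 < hessq G z w) -> 0 < rho ->
  (forall q, en q = rho -> A * rho <= G (y, q, s) - G (y, 0, s)) ->
  rho <= en p -> A * en p <= G (y, p, s) - G (y, 0, s).
Proof.
move=> GC Dy pos rho0 H rp.
have p0 : 0 < en p by exact: lt_le_trans rp.
pose m := (rho / en p) *: p.
have em : en m = rho by rewrite enZ ger0_norm ?divr_ge0 ?en_ge0 ?(ltW rho0)// divfK// gt_eqF.
have hq := @convex_lower _ _ G D y m p s GC Dy pos.
have hp := @convex_lower _ _ G D y m 0 s GC Dy pos.
have E1 : p - m = (en p / rho - 1) *: m.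
  rewrite scalerBl scale1r /m scalerA mulrA divfK ?gt_eqF// divff ?gt_eqF// scale1r//.
rewrite E1 dotZr in hq; rewrite sub0r dotNr in hp.
have k0 : 0 <= en p / rho - 1 by rewrite subr_ge0 ler_pdivlMr// mul1r.
have k1 : 0 <= en p / rho by rewrite divr_ge0 ?en_ge0// ltW.
have h1 := ler_wpM2l k0 hp; have h2 := ler_wpM2l k1 (H m em).
have -> : A * en p = en p / rho * (A * rho) by field; rewrite gt_eqF.
move: hq h1 h2; move: (G _) (G _) (G _) (dot _ _) (en p / rho) (A * rho) => a b c d t x; clear; lra.
Qed.

(** Superlinearity is assumed with a constant depending on the point. Growth on one sphere of
    momenta survives small changes of position and value by continuity, and convexity carries it to
    infinity. *)
Lemma superlin_unif G D y0 (r B : R) : open D -> class_C 2 (tube D) G -> cball y0 r `<=` D ->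
  (forall z w, tube D z -> w != 0 -> 0 < hessq G z w) ->
  (forall y s A, D y -> exists C : R, forall q, A * en q - C <= G (y, q, s)) ->
  ham_superlin (fun y q s => G (y, q, s)) y0 r B.
Proof.
move=> oD GC yD pos pw A.
have [C C0 H] : exists2 C : R, 0 < C & forall x : E * R, (cball y0 r `*` `[- B, B]%classic) x ->
    forall q, A * en q - C <= G (x.1, q, x.2).
  apply: compact_unif; first by apply: compact_setX; [exact: cball_compact|exact: segment_compact].
    by move=> C C' x CC H q; apply: le_trans (H q); lra.
  move=> [y1 s1] [/= y1r _]; have Dy1 : D y1 by exact: yD.
  (* The surplus slope 2 on the sphere of radius rho pays for C1, for the value at momentum 0 and
     for two oscillations of size 1 / 2. *)
  have [C1 HC1] := pw y1 s1 (A + 2) Dy1.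
  pose m0 := G (y1, 0, s1).
  pose rho := Num.max 1 (C1 + m0).
  have rho1 : 1 <= rho by rewrite le_max lexx.
  have rho2 : C1 + m0 <= rho by rewrite le_max lexx orbT.
  have rho0 : 0 < rho by exact: lt_le_trans rho1.
  have /near_normP[d d0 Hd] : \forall z \near y1, D z by apply: open_nbhs_nbhs.
  have d2 : 0 < d / 2 by rewrite divr_gt0.
  have y1D : cball y1 (d / 2) `<=` D.
    by move=> z; rewrite /cball/= => hz; apply: Hd; apply: le_lt_trans hz _; rewrite ltr_pdivrMr// ltr_pMr// ltr1n.
  have [L L0 HL] := ham_lip_class (`|s1| + 1) rho (class_CS GC) y1D.
  have S0 : 0 <= Num.sqrt n%:R :> R by exact: sqrtr_ge0.
  have [t [t0 td tL]] := @pick_small R (L * (Num.sqrt n%:R + 1)) (Num.min (d / 2) (1 / 2))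
    (mulr_ge0 (ltW L0) (addr_ge0 S0 ler01)) ltac:(by rewrite lt_min d2/=; lra).
  have td2 : t <= d / 2 by min_ub td.
  have t12 : t <= 1 / 2 by min_ub td.
  have tL2 : t * (L * (Num.sqrt n%:R + 1)) <= 1 / 2 by min_ub tL.
  exists (`|C1| + `|m0| + 1 + (`|A| + 1) * rho).
  apply/nbhs_ballP; exists t => //= -[y s]; rewrite -ball_normE /= => yst.
  have yt : `|y - y1| <= t.
    by rewrite distrC; apply: ltW; apply: le_lt_trans yst; rewrite prod_normE le_max lexx.
  have st : `|s - s1| <= t.
    by rewrite distrC; apply: ltW; apply: le_lt_trans yst; rewrite prod_normE le_max lexx orbT.
  have Dy : D y by apply: y1D; rewrite /cball/=; lra.
  have cl q : en q <= rho -> `|G (y, q, s) - G (y1, q, s1)| <= 1 / 2.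
    move=> qr; have yd : `|y - y1| <= d / 2 by lra.
    have y1d : `|y1 - y1| <= d / 2 by rewrite subrr normr0 ltW.
    have sB : `|s| <= `|s1| + 1 by have := ler_distD 0 s s1; have := ler_normD (s - s1) s1; rewrite subrK; lra.
    have sB1 : `|s1| <= `|s1| + 1 by lra.
    have ey : en (y - y1) + `|s - s1| <= t * (Num.sqrt n%:R + 1).
      rewrite mulrDr mulr1 lerD//; apply: le_trans (en_le_norm _) _; rewrite mulrC ler_wpM2r//.
    have := ler_wpM2l (ltW L0) ey.
    have := HL y y1 q q s s1 yd y1d qr qr sB sB1; have := HL y1 y q q s1 s y1d yd qr qr sB1 sB.
    rewrite subrr en0 addr0 enC (distrC s1) ler_norml => h1 h2 h3; apply/andP; split; lra.
  have e00 : en (0 : E) <= rho by rewrite en0 ltW.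
  have /ler_normlP[c1 c2] := cl 0 e00; rewrite -/m0 in c1 c2.
  have big q : rho <= en q -> A * en q <= G (y, q, s) - G (y, 0, s).
    apply: (superlin_step GC Dy pos rho0) => q' q'r.
    have /ler_normlP[c3 c4] := cl q' ltac:(by rewrite q'r).
    have := HC1 q'; rewrite q'r; lra.
  have nA := ler_norm A; have nA' : 0 <= `|A| by []; have Ar := mulr_ge0 nA' (ltW rho0).
  have n1 := ler_norm C1;
  have n2 : - m0 <= `|m0| by rewrite -normrN ler_norm.
  move=> q; have [qr|qr] := leP rho (en q).
    by have := big q qr; have := normr_ge0 C1; move: c1; clear - rho0 n2 Ar; lra.
  have /ler_normlP[c3 c4] := cl q (ltW qr).
  have := HC1 q; have q0 := en_ge0 q; have := normr_ge0 m0; move: c3; clear - rho0 n1 Ar q0; lra.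
by exists C => // y q s yr sB; apply: (H (y, s)); split => //=; rewrite in_itv/= -ler_norml.
Qed.

End Family.

(** * Hamiltonians in charts *)

Section Charts.
Context {R : realType} {n : nat} {M : manifold R n}.
Notation E := 'rV[R]_n.
Notation Z := (E * E * R)%type.
Implicit Types (x : M) (c d e : chart M).

Lemma chart_inv_dom c (y : E) : chart_range c y -> chart_dom c (chart_inv c y).
Proof. by move=> [x xc <-]; rewrite chart_mapK. Qed.
Lemma chart_invK c (y : E) : chart_range c y -> chart_map c (chart_inv c y) = y.
Proof. by move=> [x xc <-]; rewrite chart_mapK. Qed.
Lemma chart_map_range c x : chart_dom c x -> chart_range c (chart_map c x).
Proof. by move=> xc; exists x. Qed.
Lemma chart_at_dom x : chart_dom (chart_at x) x.
Proof. by rewrite /chart_at; case: cid. Qed.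

Lemma near_chart c x (P : M -> Prop) : chart_dom c x ->
  (\forall z \near x, P z) <-> (\forall y \near chart_map c x, P (chart_inv c y)).
Proof.
move=> xc; split => H.
  have ic := chart_inv_continuous (chart_map_range xc).
  by apply: (ic P); rewrite chart_mapK.
have mc := chart_map_continuous xc.
have dc : \forall z \near x, chart_dom c z by apply: open_nbhs_nbhs; split => //; exact: open_chart_dom.
by apply: filterS2 dc (mc _ H) => z zc /=; rewrite chart_mapK.
Qed.

Lemma near_chart_inv c (y : E) (P : M -> Prop) : chart_range c y ->
  (\forall z \near chart_inv c y, P z) <-> (\forall y' \near y, P (chart_inv c y')).
Proof.
by move=> yc; rewrite (near_chart P (chart_inv_dom yc)) chart_invK.
Qed.

Lemma near_chart_range c (y : E) : chart_range c y -> \forall y' \near y, chart_range c y'.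
Proof. by move=> yc; apply: open_nbhs_nbhs; split => //; exact: open_chart_range. Qed.

Lemma continuous_chart c (f : M -> R) (y : E) : chart_range c y -> {for chart_inv c y, continuous f} ->
  {for y, continuous (f \o chart_inv c)}.
Proof.
by move=> yc fc; apply: continuous_comp => //; exact: chart_inv_continuous.
Qed.

(** The change of charts under a name, so that its differential can be rewritten with
    [change_jac]. *)
Definition trans c d := chart_map d \o chart_inv c.

Lemma trans_differentiable c d x : chart_dom c x -> chart_dom d x ->
  differentiable (trans c d) (chart_map c x).
Proof. by move=> xc xd; have [H _] := change_smooth c d 1; apply: H; exists x. Qed.

Lemma transE c d x : chart_dom c x -> trans c d (chart_map c x) = chart_map d x.
Proof. by move=> xc; rewrite /trans /= chart_mapK. Qed.

Lemma diff_trans c d x (v : E) : chart_dom c x -> chart_dom d x ->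
  'd (trans c d) (chart_map c x) v = v *m change_jac c d x.
Proof. by move=> xc xd; rewrite /change_jac /jacobian mul_rV_lin1. Qed.

Lemma mulmx_rowP (A B : 'M[R]_n) : (forall v : E, v *m A = v *m B) -> A = B.
Proof. by move=> H; apply/row_matrixP => i; rewrite rowE [RHS]rowE. Qed.

Lemma near_dom c x : chart_dom c x -> \forall z \near x, chart_dom c z.
Proof. by move=> xc; apply: open_nbhs_nbhs; split => //; exact: open_chart_dom. Qed.

Lemma change_jac_comp c d e x : chart_dom c x -> chart_dom d x -> chart_dom e x ->
  change_jac c d x *m change_jac d e x = change_jac c e x.
Proof.
move=> xc xd xe; apply: mulmx_rowP => v; rewrite mulmxA.
apply: etrans (esym (diff_trans _ xd xe)) _; apply: etrans _ (diff_trans v xc xe).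
apply: etrans (congr1 ('d (trans d e) (chart_map d x)) (esym (diff_trans v xc xd))) _.
have := transE d xc; move: (chart_map d x) => y0 yE.
have near_eq : \forall y \near chart_map c x, (trans d e \o trans c d) y = trans c e y.
  have := near_dom xd; rewrite (near_chart _ xc); apply: filterS => y yd.
  by rewrite /trans /= chart_mapK.
have d1 := trans_differentiable xc xd.
have d2 : differentiable (trans d e) (trans c d (chart_map c x)).
  by rewrite (transE d xc); exact: (trans_differentiable xd xe).
have [_ H] := near_eq_differentiable near_eq (differentiable_comp d1 d2).
apply: etrans _ (esym (congr1 (fun f : E -> E => f v) H)).
by apply: etrans _ (esym (congr1 (fun f : E -> E => f v) (diff_comp d1 d2))); rewrite -yE.
Qed.

Lemma change_jac_id c x : chart_dom c x -> change_jac c c x = 1%:M.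
Proof.
move=> xc; apply: mulmx_rowP => v; apply: etrans (esym (diff_trans v xc xc)) _; rewrite mulmx1.
have near_eq : \forall y \near chart_map c x, id y = trans c c y.
  by apply: filterS (near_chart_range (chart_map_range xc)) => y yc; rewrite /trans/= chart_invK.
have ic : continuous (idfun : E -> E) by move=> z; exact: cvg_id.
have ap (e : R) : 0 < e -> \forall z \near chart_map c x,
    `|trans c c z - trans c c (chart_map c x) - idfun (z - chart_map c x)| <= e * `|z - chart_map c x|.
  move=> e0; apply: filterS near_eq => z <-; rewrite transE//= subrr normr0 mulr_ge0// ltW//.
have [_ H] := approx_differentiable ic ap.
exact: (congr1 (fun f : E -> E => f v) H).
Qed.

Lemma change_jacK c d x : chart_dom c x -> chart_dom d x -> change_jac c d x *m change_jac d c x = 1%:M.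
Proof. by move=> xc xd; rewrite change_jac_comp// change_jac_id. Qed.

Definition gradE (h : E -> R) (y : E) : E := \row_i 'd h y (ebasis i).

Lemma dot_gradE (h : E -> R) (y v : E) : dot (gradE h y) v = 'd h y v.
Proof.
rewrite [in RHS](row_ebasis v) linear_sum; apply: eq_bigr => i _.
by rewrite linearZ mxE mulrC.
Qed.

Lemma differentiable_chart (f : M -> R) c d x : chart_dom c x -> chart_dom d x ->
  differentiable (f \o chart_inv c) (chart_map c x) ->
  differentiable (f \o chart_inv d) (chart_map d x) /\
  forall v, 'd (f \o chart_inv d) (chart_map d x) v =
            'd (f \o chart_inv c) (chart_map c x) (v *m change_jac d c x).
Proof.
move=> xc xd df.
have near_eq : \forall y \near chart_map d x, ((f \o chart_inv c) \o trans d c) y = (f \o chart_inv d) y.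
  have := near_dom xc; rewrite (near_chart _ xd); apply: filterS => y yd.
  by rewrite /trans /= chart_mapK.
have d1 := trans_differentiable xd xc.
have d2 : differentiable (f \o chart_inv c) (trans d c (chart_map d x)) by rewrite transE.
have [df' dE] := near_eq_differentiable near_eq (differentiable_comp d1 d2).
split => // v; apply: etrans (congr1 (fun f : E -> R => f v) dE) _.
apply: etrans (congr1 (fun f : E -> R => f v) (diff_comp d1 d2)) _ => /=.
by apply: etrans (congr1 _ (diff_trans v xd xc)) _; rewrite transE.
Qed.

Lemma bundle_inv_chart c x (q : 'cV[R]_n) : chart_dom c x ->
  bundle_inv c (chart_map c x, q) = Cotangent x (change_jac (chart_at x) c x *m q).
Proof. by move=> xc; rewrite /bundle_inv /= chart_mapK. Qed.

Lemma diff_at_chart (f : M -> R) c x : chart_dom c x ->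
  differentiable (f \o chart_inv c) (chart_map c x) ->
  diff_at f x = bundle_inv c (chart_map c x, (gradE (f \o chart_inv c) (chart_map c x))^T).
Proof.
move=> xc df; rewrite bundle_inv_chart// /diff_at; congr Cotangent.
apply/matrixP => i j; rewrite !mxE.
have [_ ->] := differentiable_chart xc (chart_at_dom x) df.
rewrite -dot_gradE /dot; apply: eq_bigr => k _.
by rewrite (ord1 j) -rowE !mxE mulrC.
Qed.

(* The Hamiltonian read in the chart [c], covectors being written as rows. *)
Definition Hc (H : cotangent M * R -> R) c (z : Z) : R := H (bundle_inv c (z.1.1, z.1.2^T), z.2).

(** Turning row covectors into columns is linear and continuous, so the regularity of H in bundle
    charts passes to [Hc] by composition with a linear map. *)
Definition tr_fiber (z : Z) : E * 'cV[R]_n * R := (z.1.1, z.1.2^T, z.2).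

Lemma tr_fiber_linear : linear tr_fiber.
Proof. by move=> k z z'; rewrite /tr_fiber /= linearP. Qed.

HB.instance Definition _ := GRing.isLinear.Build R Z (E * 'cV[R]_n * R)%type _ tr_fiber tr_fiber_linear.

Lemma trmx_continuous m k : continuous (@trmx R m k).
Proof.
move=> x A /nbhs_ballP[e /= e0 eA]; apply/nbhs_ballP; exists e => //= y xy; apply: eA.
by case: xy => _ xy; split => // i j; rewrite !mxE; exact: xy.
Qed.

Lemma trmx_fiber_continuous m k : continuous (fun z : E * 'M[R]_(m, k) * R => (z.1.1, z.1.2^T, z.2)).
Proof.
move=> z; have h2 := for_comp (@snd1_continuous E 'M[R]_(m, k) R z) (@trmx_continuous m k).
exact: for_pair (for_pair (@fst1_continuous E 'M[R]_(m, k) R z) h2) cvg_snd.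
Qed.

Lemma tr_fiber_continuous : continuous tr_fiber.
Proof. exact: trmx_fiber_continuous. Qed.

Lemma Hc_class k (H : cotangent M * R -> R) c : of_class_bundle k H -> class_C k (tube (chart_range c)) (Hc H c).
Proof.
move=> HC; have oU : open (chart_range c `*` [set: 'cV[R]_n] `*` [set: R]).
  have -> : chart_range c `*` [set: 'cV[R]_n] `*` [set: R] = (fun z : E * 'cV[R]_n * R => z.1.1) @^-1` chart_range c.
    by apply/seteqP; split => z /=; [move=> [[]]|].
  apply: open_comp; last exact: open_chart_range.
  by move=> z _; apply: continuous_comp; exact: cvg_fst.
exact: (class_C_comp_linear (l := tr_fiber) tr_fiber_continuous oU (HC c)).
Qed.

End Charts.

Section LineDerivative.
Context {R : realType} {n : nat}.
Notation E := 'rV[R]_n.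
Notation Z := (E * E * R)%type.

Lemma derive_line (V W : normedModType R) (f : V -> W) (a v : V) :
  'D_v f a = derive1 (fun t : R => f (a + t *: v)) 0.
Proof.
rewrite /derive /derive1.
suff -> : (fun h : R => h^-1 *: ((f \o shift a) (h *: v) - f a)) =
          (fun h : R => h^-1 *: (f (a + (h + 0) *: v) - f (a + 0 *: v))) by [].
by apply/funext => h /=; rewrite scale0r !addr0 [h *: v + a]addrC.
Qed.

Lemma diff_fiber_line (G : Z -> R) (y q w : E) (s : R) : differentiable G (y, q, s) ->
  'd G (y, q, s) (0, w, 0) = derive1 (fun t : R => G (y, q + t *: w, s)) 0.
Proof.
move=> dG; apply: etrans (esym (deriveE _ dG)) _; apply: etrans (derive_line _ _ _) _.
apply: (congr1 (fun f : R -> R => derive1 f 0)); apply/funext => t; congr (G (_, _, _)).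
- by rewrite /= scaler0 addr0.
- by rewrite /= /GRing.scale/= mulr0 addr0.
Qed.

End LineDerivative.

(** * Convexity and growth read in charts *)

Section StrictConvexity.
Context {R : realType} {n : nat} {M : manifold R n}.
Notation E := 'rV[R]_n.
Notation Z := (E * E * R)%type.
Implicit Types (H : cotangent M * R -> R) (x : M) (c : chart M).

(** The linear action of the change from the chart c to [chart_at x] on the fiber over x. *)
Definition fiber_jac c x (q : E) : E := (change_jac (chart_at x) c x *m q^T)^T.

Lemma fiber_jacD c x (q w : E) (t : R) : fiber_jac c x (q + t *: w) = fiber_jac c x q + t *: fiber_jac c x w.
Proof. by rewrite /fiber_jac !linearD /= !linearZ /=. Qed.

Lemma fiber_jac_inj c x (w : E) : chart_dom c x -> w != 0 -> fiber_jac c x w != 0.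
Proof.
move=> xc; apply: contra => /eqP H; apply/eqP.
have : (change_jac c (chart_at x) x *m (fiber_jac c x w)^T)^T = w.
  by rewrite /fiber_jac trmxK mulmxA change_jacK ?mul1mx ?trmxK//; exact: chart_at_dom.
by rewrite H trmx0 mulmx0 trmx0.
Qed.

Lemma Hc_chart_at H x (q : E) (s : R) :
  Hc H (chart_at x) (chart_map (chart_at x) x, q, s) = H (Cotangent x q^T, s).
Proof.
by rewrite /Hc /= bundle_inv_chart ?change_jac_id ?mul1mx//; exact: chart_at_dom.
Qed.

Lemma Hc_fiber_jac H c x (q : E) (s : R) : chart_dom c x ->
  Hc H c (chart_map c x, q, s) = Hc H (chart_at x) (chart_map (chart_at x) x, fiber_jac c x q, s).
Proof. by move=> xc; rewrite Hc_chart_at /Hc /= bundle_inv_chart// /fiber_jac trmxK. Qed.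

Lemma hessian_p_hessc H x (p : E) (s : R) (i j : 'I_n) : of_class_bundle 2 H ->
  hessian_p H x p^T s i j = hessc (Hc H (chart_at x)) i j (chart_map (chart_at x) x, p, s).
Proof.
move=> HC; have GC := Hc_class (chart_at x) HC; have [Gd Gdd] := GC.
have Dx := chart_map_range (chart_at_dom x).
set ya := chart_map (chart_at x) x in Dx *.
have inner (q : E) : 'D_(delta_mx j 0) (fun r => H (Cotangent x r, s)) q^T = gradc (Hc H (chart_at x)) j (ya, q, s).
  have dG : differentiable (Hc H (chart_at x)) (ya, q, s) by apply: Gd.
  rewrite /gradc; apply: etrans (derive_line _ _ _) _; apply: etrans _ (esym (diff_fiber_line _ dG)).
  apply: (congr1 (fun f : R -> R => derive1 f 0)); apply/funext => t.
  by rewrite Hc_chart_at linearD linearZ /= trmx_delta.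
have dG : differentiable (gradc (Hc H (chart_at x)) j) (ya, p, s) by apply: (proj1 (Gdd _)).
rewrite mxE; apply: etrans (derive_line _ _ _) _; apply: etrans _ (esym (diff_fiber_line _ dG)).
apply: (congr1 (fun f : R -> R => derive1 f 0)); apply/funext => t.
have -> : p^T + t *: delta_mx i 0 = (p + t *: ebasis i)^T by rewrite linearD linearZ /= trmx_delta.
exact: inner.
Qed.

(** On a fixed fiber the change of charts is linear, so both second derivatives are iterated
    derivatives along matching lines; no second-order chain rule arises. *)
Lemma hessq_fiber_jac H c x (q w : E) (s : R) : of_class_bundle 2 H -> chart_dom c x ->
  hessq (Hc H c) (chart_map c x, q, s) w =
  hessq (Hc H (chart_at x)) (chart_map (chart_at x) x, fiber_jac c x q, s) (fiber_jac c x w).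
Proof.
move=> HC xc; have [Gd Gdd] := Hc_class c HC; have [Gd' Gdd'] := Hc_class (chart_at x) HC.
have Dc := chart_map_range xc; have Da := chart_map_range (chart_at_dom x).
have dG : differentiable (fun z => 'd (Hc H c) z ((0, w, 0) : Z)) (chart_map c x, q, s) by apply: (proj1 (Gdd _)).
set w' := fiber_jac c x w; set ya := chart_map (chart_at x) x in Da *.
have dG' : differentiable (fun z => 'd (Hc H (chart_at x)) z ((0, w', 0) : Z)) (ya, fiber_jac c x q, s) by apply: (proj1 (Gdd' _)).
apply: etrans (diff_fiber_line w dG) _; apply: etrans _ (esym (diff_fiber_line w' dG')).
apply: (congr1 (fun f : R -> R => derive1 f 0)); apply/funext => t.
have dG2 : differentiable (Hc H c) (chart_map c x, q + t *: w, s) by apply: Gd.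
have dG2' : differentiable (Hc H (chart_at x)) (ya, fiber_jac c x q + t *: w', s) by apply: Gd'.
apply: etrans (diff_fiber_line w dG2) _; apply: etrans _ (esym (diff_fiber_line w' dG2')).
apply: (congr1 (fun f : R -> R => derive1 f 0)); apply/funext => t'.
by rewrite Hc_fiber_jac// !fiber_jacD.
Qed.

Lemma hessq_pos H c (z : Z) (w : E) : of_class_bundle 2 H -> strictly_convex H ->
  tube (chart_range c) z -> w != 0 -> 0 < hessq (Hc H c) z w.
Proof.
move: z => [[y q] s] HC Hs [[/= Dy _] _] w0.
have xc := chart_inv_dom Dy; set x := chart_inv c y in xc.
have -> : y = chart_map c x by rewrite /x chart_invK.
rewrite (hessq_fiber_jac _ _ _ HC xc).
have w'0 := fiber_jac_inj xc w0.
move: (fiber_jac c x w) (fiber_jac c x q) w'0 => w' p w'0.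
have Da := chart_map_range (chart_at_dom x).
rewrite (hessq_coord _ (Hc_class (chart_at x) HC) (@open_chart_range _ _ _ _)); last by [].
have := Hs x p^T s w'^T; rewrite trmx_eq0 w'0 trmxK => /(_ isT).
rewrite mxE => /lt_le_trans; apply.
under eq_bigr do rewrite mxE mulr_suml.
rewrite exchange_big /= le_eqVlt; apply/orP; left; apply/eqP; apply: eq_bigr => i _.
rewrite mulr_sumr; apply: eq_bigr => j _.
by rewrite (hessian_p_hessc _ _ _ _ _ HC) !mxE; ring.
Qed.

End StrictConvexity.

Section Superlinear.
Context {R : realType} {n : nat} {M : manifold R n}.
Notation E := 'rV[R]_n.
Implicit Types (x : M) (c : chart M).

Lemma quadE (A : 'M[R]_n) (q : 'cV[R]_n) : (q^T *m A *m q) 0 0 = \sum_i q i 0 * \sum_j q j 0 * A i j.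
Proof.
rewrite mxE; under eq_bigr do rewrite mxE mulr_suml.
rewrite exchange_big; apply: eq_bigr => i _; rewrite mulr_sumr; apply: eq_bigr => j _.
by rewrite !mxE; ring.
Qed.

Lemma posdef_unit (A : 'M[R]_n) : posdef A -> A \in unitmx.
Proof.
move=> pA; rewrite -row_free_unit; apply: inj_row_free => v vA.
apply: contrapT => /eqP v0; have := pA v^T; rewrite trmx_eq0 v0 => /(_ isT).
by rewrite trmxK vA mul0mx mxE ltxx.
Qed.

Lemma posdef_inv (A : 'M[R]_n) : A^T = A -> posdef A -> posdef (invmx A).
Proof.
move=> As pA w w0; have uA := posdef_unit pA.
have wE : w = A *m (invmx A *m w) by rewrite mulmxA mulmxV// mul1mx.
have r0 : invmx A *m w != 0 by apply: contra w0 => /eqP r0; rewrite wE r0 mulmx0.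
set r := invmx A *m w in wE r0 *.
by rewrite -mulmxA -/r {1}wE trmx_mul As; exact: pA.
Qed.

Lemma posdef_bound (A : 'M[R]_n) : posdef A ->
  exists2 k : R, 0 < k & forall q : E, k * nsq q <= (q *m A *m q^T) 0 0.
Proof.
move=> pA; pose f (q : E) := \sum_i q 0 i * \sum_j q 0 j * A i j.
have fE q : (q *m A *m q^T) 0 0 = f q.
  by rewrite -{1}(trmxK q) quadE; apply: eq_bigr => i _; rewrite mxE; congr (_ * _); apply: eq_bigr => j _; rewrite mxE.
have fZ (a : R) q : f (a *: q) = a ^+ 2 * f q.
  rewrite /f expr2 -mulrA mulr_sumr mulr_sumr; apply: eq_bigr => i _.
  rewrite !mxE -!mulrA; congr (_ * _); rewrite mulrCA; congr (_ * _).
  by rewrite mulr_sumr; apply: eq_bigr => j _; rewrite mxE mulrA.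
have fc : continuous f.
  move=> q; apply: continuous_sum => i _; apply: continuousM; first exact: coord_continuous.
  apply: continuous_sum => j _; apply: continuousM; first exact: coord_continuous.
  exact: cst_continuous.
have cA : compact (cball (0 : E) 1 `&` [set w | nsq w = 1]).
  apply: compact_closedI; first exact: cball_compact.
  have -> : [set w : E | nsq w = 1] = nsq @^-1` [set 1 : R] by [].
  apply: closed_comp; last exact: closed_eq.
  by move=> x _; exact: nsq_continuous.
have [c c0 H] : exists2 c : R, 0 < c & forall w, (cball (0 : E) 1 `&` [set w | nsq w = 1]) w -> c <= f w.
  have [[t0 At0]|nA] := pselect ((cball (0 : E) 1 `&` [set w | nsq w = 1]) !=set0); last first.
    by exists 1 => // t At; case: nA; exists t.
  have [m [mb mn] mM] := @compact_max _ _ (fun t => - f t) _ (ex_intro _ t0 At0) cA ltac:(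
    move=> w _; apply: continuousN; exact: fc).
  exists (f m); last by move=> t /mM; rewrite lerN2.
  rewrite -fE -{1}(trmxK m); apply: pA; rewrite trmx_eq0.
  by apply: contra_eq_neq mn => ->; rewrite nsq0 eq_sym oner_eq0.
exists c => // w; have [->|w0] := eqVneq w 0.
  by rewrite nsq0 mulr0 fE /f big1// => i _; rewrite mxE mul0r.
have e0 := en_gt0 w0.
set v := (en w)^-1 *: w.
have -> : w = en w *: v by rewrite /v scalerA divff ?gt_eqF// scale1r.
have n1 : nsq v = 1 by rewrite nsqZ -en_sq exprVn mulVf// gt_eqF// exprn_gt0.
rewrite nsqZ n1 mulr1 fE fZ mulrC ler_pM2l ?exprn_gt0//.
apply: H; split => //=; rewrite /cball/= subr0; apply: le_trans (norm_le_en _) _.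
by rewrite /en n1 sqrtr1.
Qed.

Lemma left_inverse_bound (J J' : 'M[R]_n) : J' *m J = 1%:M ->
  exists2 k' : R, 0 < k' & forall q : E, k' * nsq q <= nsq (J *m q^T)^T.
Proof.
move=> JK; have [|k' k'0 Hk'] := @posdef_bound (J^T *m J).
  move=> w w0; rewrite mulmxA -mulmxA -trmx_mul.
  have : 0 < nsq (J *m w)^T.
    rewrite -en_sq exprn_gt0// en_gt0// trmx_eq0.
    apply: contra w0 => /eqP Jw; have <- : J' *m (J *m w) = w by rewrite mulmxA JK mul1mx.
    by rewrite Jw mulmx0.
  rewrite /nsq /dot mxE => /lt_le_trans; apply; rewrite le_eqVlt; apply/orP; left; apply/eqP.
  by apply: eq_bigr => i _; rewrite !mxE.
exists k' => // q; apply: le_trans (Hk' q) _.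
rewrite mulmxA -mulmxA /nsq /dot mxE le_eqVlt; apply/orP; left; apply/eqP.
apply: eq_bigr => i _; rewrite [(J *m q^T)^T 0 i]mxE; congr (_ * _).
by rewrite -[q in q *m _]trmxK -trmx_mul mxE.
Qed.

(** The dual norm and the Euclidean norm of the chart are compared at a single point; uniformity in
    the point is the task of [superlin_unif]. *)
Lemma superlinear_chart (g : riemannian_metric M) (H : cotangent M * R -> R) c (y : E) (s A : R) :
  superlinear g H -> chart_range c y -> exists C : R, forall q, A * en q - C <= Hc H c (y, q, s).
Proof.
move=> Hs Dy; have xc := chart_inv_dom Dy; set x := chart_inv c y in xc.
have -> : y = chart_map c x by rewrite /x chart_invK.
pose J := change_jac (chart_at x) c x.
have [k k0 Hk] := posdef_bound (posdef_inv (riem_sym g x) (@riem_posdef _ _ _ g x)).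
have JK : change_jac c (chart_at x) x *m J = 1%:M by rewrite change_jacK//; exact: chart_at_dom.
have [k' k'0 Hk'] := left_inverse_bound JK.
pose kk := Num.sqrt (k * k').
have kk0 : 0 < kk by rewrite sqrtr_gt0 mulr_gt0.
have [C HC] := Hs x s (`|A| / kk).
exists C => q; rewrite /Hc /= bundle_inv_chart//.
apply: le_trans (HC _); rewrite lerD2r -/J.
have : kk * en q <= conorm g (Cotangent x (J *m q^T)).
  have kk2 : 0 <= k * k' by rewrite mulr_ge0// ltW.
  rewrite /conorm /= /kk /en -(sqrtrM _ kk2); apply: ler_wsqrtr.
  have := Hk (J *m q^T)^T; rewrite trmxK => /(le_trans _); apply.
  by rewrite -mulrA ler_pM2l.
move=> h; apply: (@le_trans _ _ (`|A| / kk * (kk * en q))).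
  by rewrite mulrA divfK ?gt_eqF// ler_wpM2r ?en_ge0// ler_norm.
by rewrite ler_wpM2l// divr_ge0// ltW.
Qed.

End Superlinear.

(** * Viscosity and proximal inequalities *)

Lemma near_lt (R : realType) (T : topologicalType) (f : T -> R) (x : T) (b : R) :
  {for x, continuous f} -> f x < b -> \forall z \near x, f z < b.
Proof. by move=> fc fb; exact: (cvgr_lt (f x) fc b fb). Qed.

Lemma near_gt (R : realType) (T : topologicalType) (f : T -> R) (x : T) (b : R) :
  {for x, continuous f} -> b < f x -> \forall z \near x, b < f z.
Proof. by move=> fc fb; exact: (cvgr_gt (f x) fc b fb). Qed.

Lemma near_eq_continuous (T U : topologicalType) (f g : T -> U) (y : T) :
  (\forall z \near y, f z = g z) -> {for y, continuous f} -> {for y, continuous g}.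
Proof.
move=> fg fc A; rewrite -(nbhs_singleton fg) => /fc fA.
by apply: filterS2 fg fA => z /= ->.
Qed.

Section PointwiseDiff.
Context {R : realType}.
Implicit Types (U V W : normedModType R).

(* Fixes the instance path through which ['d] is elaborated. *)
Definition dd V W (f : V -> W) (x v : V) : W := 'd f x v.

Lemma near_eq_dd V W (f g : V -> W) (x : V) : (\forall z \near x, f z = g z) ->
  differentiable f x -> differentiable g x /\ forall v, dd g x v = dd f x v.
Proof.
move=> fg df; have [h1 h2] := near_eq_differentiable fg df; split; first exact: h1.
move=> v.
exact: (congr1 (fun f : V -> W => f v) h2).
Qed.

Lemma dd_comp U V W (f : U -> V) (g : V -> W) (x : U) : differentiable f x ->
  differentiable g (f x) -> forall v, dd (g \o f) x v = dd g (f x) (dd f x v).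
Proof. by move=> df dg v; exact: (congr1 (fun f : U -> W => f v) (diff_comp df dg)). Qed.
End PointwiseDiff.

(** * Compactly supported test functions *)

Section Bump.
Context {R : realType} {n : nat}.
Notation E := 'rV[R]_n.
Implicit Types (x y z a q v : E).

(** A function of class C^1 that vanishes outside a ball, hence extends by zero from a chart to M.
    The square of the positive part is what makes it differentiable across the sphere. *)
Definition bump (K rho2 : R) a z : R := - (K * (Num.max 0 (rho2 - nsq (z - a))) ^+ 2).
Definition dbump (K rho2 : R) a z v : R := K * (4 * Num.max 0 (rho2 - nsq (z - a)) * dot (z - a) v).

Lemma dbump_linear K rho2 a z : linear (dbump K rho2 a z).
Proof. by move=> k u v; rewrite /dbump dotDr dotZr /GRing.scale/=; ring. Qed.
HB.instance Definition _ K rho2 a z := GRing.isLinear.Build R E R _ (dbump K rho2 a z) (@dbump_linear K rho2 a z).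

Lemma maxsq_approx (s t : R) :
  `|Num.max 0 t ^+ 2 - Num.max 0 s ^+ 2 - 2 * Num.max 0 s * (t - s)| <= (t - s) ^+ 2.
Proof.
have [t0|t0] := leP 0 t; have [s0|s0] := leP 0 s.
- rewrite (_ : _ - _ = (t - s) ^+ 2) ?ger0_norm ?sqr_ge0//; ring.
- rewrite mulr0 mul0r subr0 expr0n subr0 ger0_norm ?sqr_ge0//; nra.
- rewrite expr0n sub0r ler_norml; apply/andP; split; nra.
- by rewrite expr0n subrr mulr0 mul0r subr0 normr0 sqr_ge0.
Qed.

Lemma nsq_shift a x z : nsq (z - a) = nsq (x - a) + 2 * dot (x - a) (z - x) + nsq (z - x).
Proof. by rewrite -nsqD -sub_split. Qed.

Lemma bump_approx K rho2 a x : 0 <= K -> exists2 C : R, 0 < C & forall z, en (z - x) <= 1 ->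
  `|bump K rho2 a z - bump K rho2 a x - dbump K rho2 a x (z - x)| <= C * nsq (z - x).
Proof.
move=> K0; pose m := Num.max 0 (rho2 - nsq (x - a)).
have m0 : 0 <= m by rewrite le_max lexx.
exists (K * ((2 * en (x - a) + 1) ^+ 2 + 2 * m) + 1).
  by rewrite ltr_wpDl// mulr_ge0// addr_ge0 ?sqr_ge0// mulr_ge0.
move=> z z1; set d := en (z - x) in z1 *; have d0 : 0 <= d by exact: en_ge0.
have := maxsq_approx (rho2 - nsq (x - a)) (rho2 - nsq (z - a)); rewrite -/m.
set b := rho2 - nsq (z - a) - _ => h.
have bE : b = - (2 * dot (x - a) (z - x) + nsq (z - x)).
  by rewrite /b (nsq_shift a x z); ring.
have bb : `|b| <= (2 * en (x - a) + 1) * d.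
  rewrite bE normrN; apply: le_trans (ler_normD _ _) _.
  rewrite normrM (ger0_norm (nsq_ge0 _)) -en_sq -/d mulrDl mul1r normr_nat.
  apply: lerD; first by rewrite -mulrA ler_pM2l// abs_dot_le.
  by rewrite expr2 ler_piMl.
have b2 : b ^+ 2 <= (2 * en (x - a) + 1) ^+ 2 * nsq (z - x).
  rewrite -en_sq -/d -exprMn -(real_normK (num_real b)) lerXn2r ?nnegrE//.
  by rewrite mulr_ge0// addr_ge0// mulr_ge0// en_ge0.
have -> : bump K rho2 a z - bump K rho2 a x - dbump K rho2 a x (z - x) =
    - K * (Num.max 0 (rho2 - nsq (z - a)) ^+ 2 - m ^+ 2 - 2 * m * b) + K * (2 * m * nsq (z - x)).
  by rewrite /bump /dbump -/m bE; ring.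
apply: le_trans (ler_normD _ _) _; rewrite !normrM normrN (ger0_norm K0) (ger0_norm m0) (ger0_norm (nsq_ge0 _)) normr_nat.
have := ler_wpM2l K0 h; have := ler_wpM2l K0 b2; have := nsq_ge0 (z - x).
move: (nsq (z - x)) (en (x - a)) (`|_|) => N e T; lra.
Qed.

Lemma sqrt_lin_small (C e : R) : 0 < C -> 0 < e -> exists2 d : R, 0 < d & forall t : E,
  `|t| < d -> en t <= 1 /\ C * nsq t <= e * `|t|.
Proof.
move=> C0 e0; have S0 : 0 <= Num.sqrt n%:R :> R by exact: sqrtr_ge0.
have [d [d0 d1 dM]] := @pick_small R (Num.sqrt n%:R + C * n%:R) (Num.min 1 e)
   (addr_ge0 S0 (mulr_ge0 (ltW C0) (ler0n _ _))) ltac:(by rewrite lt_min ltr01).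
exists d => // t td.
have Cn : 0 <= C * n%:R by rewrite mulr_ge0// ltW.
have dm1 : d * (Num.sqrt n%:R + C * n%:R) <= 1 by min_ub dM.
have dme : d * (Num.sqrt n%:R + C * n%:R) <= e by min_ub dM.
split.
  apply: le_trans (en_le_norm _) _; apply: le_trans dm1; rewrite mulrC ler_pM//; first exact: ltW.
  by rewrite lerDl.
apply: (@le_trans _ _ (C * (n%:R * `|t| ^+ 2))); first by rewrite ler_wpM2l ?nsq_le_norm// ltW.
rewrite mulrA expr2 mulrA ler_wpM2r//; apply: le_trans dme.
by rewrite mulrC ler_pM//; [exact: ltW|rewrite lerDr].
Qed.

Lemma bump_diff K rho2 a x : 0 <= K -> differentiable (bump K rho2 a) x /\
  forall v, dd (bump K rho2 a) x v = dbump K rho2 a x v.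
Proof.
move=> K0; have [C C0 H] := bump_approx rho2 a x K0.
have lc : continuous (dbump K rho2 a x).
  move=> v; apply: (@continuousM _ _ (fun=> K) (fun v => 4 * Num.max 0 (rho2 - nsq (x - a)) * dot (x - a) v)).
    exact: cst_continuous.
  by apply: continuousM; [exact: cst_continuous|exact: dot_continuous].
have [|h1 h2] := @approx_differentiable R E R (bump K rho2 a) x (dbump K rho2 a x) lc.
  move=> e e0; have [d d0 Hd] := sqrt_lin_small C0 e0.
  apply/near_normP; exists d => // z /Hd[z1 z2].
  by apply: le_trans (H z z1) z2.
by split => // v; exact: (congr1 (fun f : E -> R => f v) h2).
Qed.

Lemma bump_out K rho2 a z : rho2 <= nsq (z - a) -> bump K rho2 a z = 0.
Proof. by move=> h; rewrite /bump max_l ?subr_le0// expr0n mulr0 oppr0. Qed.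

(* The bump centered at [y0 - s q] has gradient [q] at [y0] and large second
   derivatives there when [s] is small. *)
Lemma bump_touch (y0 q : E) (N r : R) : 0 < r -> exists K rho2 a,
  [/\ 0 <= K, (forall z, nsq (z - a) < rho2 -> `|z - y0| <= r),
      (forall z, `|z - a| ^+ 2 <= rho2 -> `|z - y0| <= r),
      (forall v, dbump K rho2 a y0 v = dot q v) &
      \forall z \near y0, dot q (z - y0) + N * nsq (z - y0) <= bump K rho2 a z - bump K rho2 a y0].
Proof.
move=> r0; pose Q := en q; have Q0 : 0 <= Q by exact: en_ge0.
pose rho := r / 2; have rho0 : 0 < rho by rewrite divr_gt0.
pose B := `|N| + 1.
have B0 : 0 < B by rewrite ltr_wpDl.
have c0 : 0 < Num.min (rho / 4) (1 / (4 * B)) by rewrite lt_min !divr_gt0// mulr_gt0.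
have [s [s0 s1 sM]] := @pick_small R Q _ Q0 c0.
have sQ : s * Q <= rho / 4 by min_ub sM.
have sB : s <= 1 / (4 * B) by min_ub s1.
have rho2 : 0 < rho ^+ 2 by rewrite exprn_gt0.
pose a := y0 - s *: q; pose m := rho ^+ 2 - s ^+ 2 * Q ^+ 2.
have ya : y0 - a = s *: q by rewrite /a opprB addrC subrK.
have nya : nsq (y0 - a) = s ^+ 2 * Q ^+ 2 by rewrite ya nsqZ -en_sq.
have mE : m = rho ^+ 2 - nsq (y0 - a) by rewrite nya.
have s2Q : s ^+ 2 * Q ^+ 2 <= rho ^+ 2 / 16.
  rewrite -exprMn; apply: (@le_trans _ _ ((rho / 4) ^+ 2)); last by rewrite expr_div_n; lra.
  have sQ0 : 0 <= s * Q by rewrite mulr_ge0// ltW.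
  by rewrite lerXn2r ?nnegrE// divr_ge0// ltW.
have m0 : rho ^+ 2 / 2 <= m by rewrite /m; lra.
have mp : 0 < m by apply: lt_le_trans m0; rewrite divr_gt0.
(* Forced by the gradient at y0, which equals 4 K m s q. *)
pose K := (4 * m * s)^-1.
have K0 : 0 < K by rewrite invr_gt0 !mulr_gt0.
have Kms : K * (4 * m * s) = 1 by rewrite mulVf// gt_eqF// !mulr_gt0.
exists K, (rho ^+ 2), a; split.
- exact: ltW.
- move=> z; rewrite -en_sq ltr_pXn2r ?nnegrE ?en_ge0 ?(ltW rho0)// => h.
  have := norm_le_en (z - a); have := norm_le_en (y0 - a); rewrite ya enZ gtr0_norm// -/Q.
  by have := ler_distD a z y0; rewrite (distrC a) ya /rho in h sQ *; lra.
- move=> z; rewrite ler_pXn2r ?nnegrE ?(ltW rho0)// => h.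
  have := norm_le_en (y0 - a); rewrite ya enZ gtr0_norm// -/Q.
  by have := ler_distD a z y0; rewrite (distrC a) ya /rho in h sQ *; lra.
- move=> v; rewrite /dbump -mE max_r ?(ltW mp)// ya dotZl.
  by apply: (@etrans _ _ (K * (4 * m * s) * dot q v)); [ring|rewrite Kms mul1r].
(* The favorable curvature 2 K m is 1 / (2 s), while the square of the linear term takes back at
   most 1 / (4 s); small s leaves more than N. *)
have gain : N + 1 <= 2 * K * m - 8 * K * s ^+ 2 * Q ^+ 2.
  have E1 : 2 * K * m = 1 / (2 * s) by rewrite /K; field; rewrite !gt_eqF.
  have E2 : 8 * K * s ^+ 2 * Q ^+ 2 = 2 * s * Q ^+ 2 / m by rewrite /K; field; rewrite !gt_eqF.
  have h1 : N + 1 <= B by rewrite lerD2r ler_norm.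
  have s40 : 0 < 4 * s by rewrite mulr_gt0.
  have h2 : 2 * s * Q ^+ 2 / m <= 1 / (4 * s).
    rewrite ler_pdivlMr// mulrAC ler_pdivrMr// mul1r; apply: le_trans m0; lra.
  have h4 : B <= 1 / (4 * s).
    by rewrite ler_pdivlMr//; move: sB; rewrite ler_pdivlMr ?mulr_gt0//; lra.
  rewrite E1 E2; have : 1 / (2 * s) = 1 / (4 * s) + 1 / (4 * s) by field; rewrite gt_eqF.
  lra.
have nc (b : E) : {for y0, continuous (fun z => nsq (z - b))}.
  by apply: (@continuous_comp _ _ _ (fun z => z - b) nsq); [exact: sub_continuous|exact: nsq_continuous].
have n1 : \forall z \near y0, nsq (z - a) < rho ^+ 2.
  by apply: near_lt; [exact: nc|rewrite nya; lra].
have n2 : \forall z \near y0, nsq (z - y0) < 1 / (2 * K).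
  by apply: near_lt; [exact: nc|rewrite subrr nsq0 divr_gt0// mulr_gt0].
apply: filterS2 n1 n2 => z; rewrite ltr_pdivlMr ?mulr_gt0// /bump => z1 z2.
rewrite -mE (max_r (ltW mp)) max_r; last by rewrite subr_ge0 ltW.
rewrite (nsq_shift a y0 z) nya ya dotZl.
set D := dot q (z - y0); set nn := nsq (z - y0) in z2 *.
have nn0 : 0 <= nn by exact: nsq_ge0.
have DQ : D ^+ 2 <= Q ^+ 2 * nn by rewrite en_sq; exact: dot_sq_le.
set T := 2 * (s * D) + nn.
have T2 : T ^+ 2 <= 8 * s ^+ 2 * (Q ^+ 2 * nn) + 2 * nn ^+ 2.
  have h1 : 8 * s ^+ 2 * D ^+ 2 <= 8 * s ^+ 2 * (Q ^+ 2 * nn) by rewrite ler_wpM2l// mulr_ge0// sqr_ge0.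
  have : 0 <= (2 * (s * D) - nn) ^+ 2 by rewrite sqr_ge0.
  rewrite /T sqrrB sqrrD; lra.
have KT := ler_wpM2l (ltW K0) T2.
have -> : - (K * (rho ^+ 2 - (s ^+ 2 * Q ^+ 2 + 2 * (s * D) + nn)) ^+ 2) - - (K * m ^+ 2) =
    K * (4 * m * s) * D + 2 * K * m * nn - K * T ^+ 2 by rewrite /T /m; ring.
rewrite Kms mul1r.
have := ler_wpM2r nn0 gain; have := ler_wpM2r nn0 (ltW z2); rewrite expr2 in KT.
move: KT; clear; lra.
Qed.

End Bump.

Section Bridge.
Context {R : realType} {n : nat} {M : manifold R n}.
Notation E := 'rV[R]_n.
Notation Z := (E * E * R)%type.
Implicit Types (x : M) (c d : chart M) (H : cotangent M * R -> R) (w f : M -> R).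

Definition bump_mfd c (K rho2 : R) (a : E) (x : M) : R :=
  if pselect (chart_dom c x) then bump K rho2 a (chart_map c x) else 0.

Lemma bump_mfdE c K rho2 a x : chart_dom c x -> bump_mfd c K rho2 a x = bump K rho2 a (chart_map c x).
Proof. by rewrite /bump_mfd; case: pselect. Qed.

Lemma near_eq_zero_diff (V W : normedModType R) (f : V -> W) (y : V) :
  (\forall z \near y, f z = 0) -> differentiable f y /\ forall v, dd f y v = 0.
Proof.
move=> f0; have f0' : \forall z \near y, cst 0 z = f z by apply: filterS f0 => z ->.
have [h1 h2] := near_eq_dd f0' (differentiable_cst 0 y).
by split => // v; rewrite h2 /dd diff_cst.
Qed.

Lemma chart_cball_closed c (y : E) (r : R) : cball y r `<=` chart_range c -> closed (chart_inv c @` cball y r).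
Proof.
move=> yr; apply: compact_closed; first exact: manifold_hausdorff.
apply: continuous_compact; last exact: cball_compact.
by apply: continuous_in_subspaceT => z; rewrite inE => /yr; exact: chart_inv_continuous.
Qed.

Lemma near_chart_ball c x (y : E) (r : R) : chart_dom c x -> `|chart_map c x - y| < r ->
  \forall x' \near x, chart_dom c x' /\ `|chart_map c x' - y| < r.
Proof.
move=> xc xr; have : \forall x' \near x, `|chart_map c x' - y| < r.
  apply: (@near_lt _ _ (fun x' => `|chart_map c x' - y|)) => //.
  apply: (@continuous_comp _ _ _ (fun x' => chart_map c x' - y) (fun z : E => `|z|)); last exact: norm_continuous.
  by apply: continuousB; [exact: chart_map_continuous|exact: cst_continuous].
by apply: filterS2 (near_dom xc) => x' h1 h2.
Qed.

(** In the domain of c the function is a bump composed with a change of charts. A point outside that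
    domain has a neighborhood missing the image of the ball, which is compact and therefore closed
    in the Hausdorff space M. *)
Lemma bump_mfd_class c K rho2 a r (y0 : E) : 0 <= K -> cball y0 r `<=` chart_range c ->
  (forall z, `|z - a| ^+ 2 <= rho2 -> `|z - y0| <= r) -> of_class 1 (bump_mfd c K rho2 a).
Proof.
move=> K0 yr ar d.
pose S := chart_inv c @` cball y0 r.
have cS : closed S by exact: chart_cball_closed.
have Sdom x : S x -> chart_dom c x by move=> [y /yr yc <-]; exact: chart_inv_dom.
have outS x : ~ S x -> bump_mfd c K rho2 a x = 0.
  move=> nS; rewrite /bump_mfd; case: pselect => // xc; apply: bump_out.
  rewrite leNgt; apply/negP => h; apply: nS; exists (chart_map c x); last by rewrite chart_mapK.
  by apply: ar; apply: le_trans (norm_sq_le _) (ltW h).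
set h := bump_mfd c K rho2 a \o chart_inv d.
have dom_diff y : chart_range d y -> chart_dom c (chart_inv d y) -> differentiable h y /\
    forall v, dd h y v = dbump K rho2 a (trans d c y) (dd (trans d c) y v).
  move=> yd xc; have xd := chart_inv_dom yd.
  have near_eq : \forall z \near y, (bump K rho2 a \o trans d c) z = h z.
    have := near_dom xc; rewrite (near_chart_inv _ yd); apply: filterS => z zc.
    by rewrite /h /= bump_mfdE.
  have dt : differentiable (trans d c) y by have := trans_differentiable xd xc; rewrite chart_invK.
  have [db dbE] := bump_diff rho2 a (trans d c y) K0.
  have [dh dhE] := near_eq_dd near_eq (differentiable_comp dt db).
  split => // v; apply: etrans (dhE v) _.
  by apply: etrans (dd_comp dt db v) _; exact: dbE.
have out_near y : chart_range d y -> ~ chart_dom c (chart_inv d y) -> \forall z \near y, h z = 0.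
  move=> yd nc; have : \forall z \near chart_inv d y, ~ S z.
    have oS : open (~` S) by exact: closed_openC.
    by apply: (open_nbhs_nbhs (conj oS _)) => /Sdom.
  by rewrite (near_chart_inv _ yd); apply: filterS => z /outS.
split.
  move=> y yd; have [xc|xc] := pselect (chart_dom c (chart_inv d y)).
    by have [] := dom_diff y yd xc.
  by have [] := near_eq_zero_diff (out_near y yd xc).
move=> v y yd; have [xc|xc] := pselect (chart_dom c (chart_inv d y)); last first.
  have n0 : \forall z \near y, dd h z v = 0.
    by have /near_join := out_near y yd xc; apply: filterS => z /near_eq_zero_diff[].
  apply: (@near_eq_continuous _ _ (fun=> 0)); last exact: cst_continuous.
  by apply: filterS n0 => z h0; exact: esym h0.
have xd := chart_inv_dom yd.
have nE : \forall z \near y, dbump K rho2 a (trans d c z) (dd (trans d c) z v) = dd h z v.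
  have := near_dom xc; rewrite (near_chart_inv _ yd); apply: filterS2 (near_chart_range yd) => z zd zc.
  by have [_ ->] := dom_diff z zd zc.
have [tD tC] := change_smooth d c 1.
have ydc : (chart_map d @` (chart_dom d `&` chart_dom c)) y by exists (chart_inv d y) => //; rewrite chart_invK.
have c1 : {for y, continuous (trans d c)} by apply: differentiable_continuous; exact: tD.
have c2 : {for y, continuous (fun z => dd (trans d c) z v)} by exact: tC.
have c3 : {for y, continuous (fun z => trans d c z - a)} by apply: continuousB => //; exact: cst_continuous.
apply: (near_eq_continuous nE).
rewrite /dbump; apply: (@continuousM _ _ (fun=> K) _ y); first exact: cst_continuous.
apply: (@continuousM _ _ (fun z => 4 * Num.max 0 (rho2 - nsq (trans d c z - a))) (fun z => dot (trans d c z - a) (dd (trans d c) z v))).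
  apply: continuousM; first exact: cst_continuous.
  apply: (@continuous_comp _ _ _ (fun z => rho2 - nsq (trans d c z - a)) (fun t : R => Num.max 0 t)).
    apply: continuousB; first exact: cst_continuous.
    by apply: (@continuous_comp _ _ _ (fun z => trans d c z - a) nsq) => //; exact: nsq_continuous.
  by apply: continuous_max => t; [exact: cst_continuous|exact: id].
rewrite /dot; apply: continuous_sum => i _; apply: continuousM.
  by apply: (@continuous_comp _ _ _ (fun z => trans d c z - a) (fun u : E => u 0 i)) => //; exact: coord_continuous.
by apply: (@continuous_comp _ _ _ (fun z => dd (trans d c) z v) (fun u : E => u 0 i)) => //; exact: coord_continuous.
Qed.

(** Viscosity tests use C^1 functions defined on all of M, so the paraboloid of the chart is
    replaced by a global bump with the same gradient that still touches w from above. *)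
Lemma viscosity_psup H w c (y q : E) : viscosity_subsolution H w -> chart_range c y ->
  psup (w \o chart_inv c) y q -> Hc H c (y, q, w (chart_inv c y)) <= 0.
Proof.
move=> Hw yc [N HN].
have [r r0 yr] : exists2 r : R, 0 < r & cball y r `<=` chart_range c.
  have /near_normP[d d0 Hd] := near_chart_range yc.
  exists (d / 2); first by rewrite divr_gt0.
  by move=> z /= zy; apply: Hd; apply: le_lt_trans zy _; rewrite ltr_pdivrMr// ltr_pMr// ltr1n.
have [K [rho2 [a [K0 _ ar dE tb]]]] := bump_touch y q N r0.
have fC := bump_mfd_class K0 yr ar.
set f := bump_mfd c K rho2 a in fC.
have xc := chart_inv_dom yc.
have fE z : chart_range c z -> (f \o chart_inv c) z = bump K rho2 a z.
  by move=> zc; rewrite /f /= bump_mfdE ?chart_invK//; exact: chart_inv_dom.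
have near_max : \forall z \near chart_inv c y, w z - f z <= w (chart_inv c y) - f (chart_inv c y).
  apply/(near_chart_inv _ yc); apply: filterS3 HN tb (near_chart_range yc) => z h1 h2 zc.
  have := fE z zc; have := fE y yc; move: h1 h2; rewrite /= => h1 h2 -> ->; lra.
have := Hw f _ fC near_max.
have near_eq : \forall z \near y, bump K rho2 a z = (f \o chart_inv c) z.
  by apply: filterS (near_chart_range yc) => z /fE.
have [db dbE] := bump_diff rho2 a y K0.
have [df dfE] := near_eq_dd near_eq db.
rewrite (@diff_at_chart _ _ _ f c _ xc) chart_invK//.
suff -> : gradE (f \o chart_inv c) y = q by [].
apply/rowP => i; rewrite mxE; apply: etrans (dfE _) _.
rewrite dbE dE /dot (bigD1 i)//= big1 ?addr0; last by move=> j ji; rewrite !mxE (negbTE ji) mulr0.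
by rewrite mxE !eqxx mulr1.
Qed.

Definition psup_sub_near H w c x := \forall y \near chart_map c x, forall q,
  psup (w \o chart_inv c) y q -> Hc H c (y, q, w (chart_inv c y)) <= 0.

(** The converse: a C^1 test function provides a supergradient of first order only, and
    [frechet_subsolution] reaches it from proximal supergradients at nearby points. *)
Lemma psup_viscosity H w c x f : chart_dom c x ->
  (forall y q s, chart_range c y -> {for (y, q, s), continuous (Hc H c)}) ->
  (\forall z \near x, {for z, continuous w}) ->
  psup_sub_near H w c x -> of_class 1 f ->
  (\forall y \near x, w y - f y <= w x - f x) -> H (diff_at f x, w x) <= 0.
Proof.
move=> xc HC wc ws fC fm.
have yc := chart_map_range xc; set y := chart_map c x in yc ws *.
have df : differentiable (f \o chart_inv c) y by have [h _] := fC c; apply: h.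
have wx : w x = (w \o chart_inv c) y by rewrite /= chart_mapK.
rewrite (diff_at_chart xc df); set p := gradE _ _.
have -> : H (bundle_inv c (chart_map c x, p^T), w x) = Hc H c (y, p, (w \o chart_inv c) y) by rewrite wx.
apply: (@frechet_subsolution _ _ (fun y q s => Hc H c (y, q, s)) (w \o chart_inv c) y p).
- move=> e e0; have hc := HC y p ((w \o chart_inv c) y) yc.
  have : \forall z \near (y, p, (w \o chart_inv c) y), Hc H c (y, p, (w \o chart_inv c) y) - e < Hc H c z.
    by apply: near_gt => //; rewrite gtrBl.
  move=> /nbhs_ballP[d /= d0 Hd]; exists d => // y' q' s' hy hq hs.
  suff : ball (y, p, (w \o chart_inv c) y) d (y', q', s') by move=> /Hd; lra.
  rewrite -ball_normE /= distrC prod_normE gt_max prod_normE gt_max /=.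
  by rewrite (le_lt_trans (norm_le_en _) hy) (le_lt_trans (norm_le_en _) hq).
- move: wc; rewrite (near_chart _ xc); apply: filterS2 (near_chart_range yc) => z zc wz.
  exact: continuous_chart.
- exact: ws.
- move=> sg sg0; move: fm; rewrite (near_chart _ xc); apply: filterS2 (differentiable_approx df sg0) => z h1 h2.
  rewrite -wx /p dot_gradE /=.
  have : f (chart_inv c z) - f x - 'd (f \o chart_inv c) y (z - y) <= sg * en (z - y).
    apply: le_trans (ler_norm _) _; move: h1; rewrite /= chart_mapK// => /le_trans; apply.
    by rewrite ler_wpM2l ?norm_le_en// ltW.
  move: h2; rewrite /=; lra.
Qed.

End Bridge.

Section Supersolution.
Context {R : realType} {n : nat} {M : manifold R n}.
Notation E := 'rV[R]_n.
Notation Z := (E * E * R)%type.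
Implicit Types (x : M) (c d : chart M) (H : cotangent M * R -> R) (w f : M -> R).

(* [w] is a supersolution of [H] iff [- w] is a subsolution of [negH H]. *)
Definition negH H (z : cotangent M * R) : R := - H (Cotangent (base z.1) (- covector z.1), - z.2).

Lemma Hc_negH H c (y q : E) (s : R) : Hc (negH H) c (y, q, s) = - Hc H c (y, - q, - s).
Proof.
rewrite /Hc /negH /bundle_inv /=; congr (- H (Cotangent _ _, _)).
by rewrite -mulmxN; congr (_ *m _); apply/matrixP => i j; rewrite !mxE.
Qed.

Lemma dd_opp (V W : normedModType R) (f : V -> W) (y v : V) : differentiable f y ->
  differentiable (fun z => - f z) y /\ dd (fun z => - f z) y v = - dd f y v.
Proof.
move=> df; have dN : differentiable (- f) y by exact: differentiableN.
split; first exact: dN.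
exact: (congr1 (fun h : V -> W => h v) (diffN df)).
Qed.

Lemma of_class1_opp f : of_class 1 f -> of_class 1 (fun x => - f x).
Proof.
move=> fC c; have [fd fdC] := fC c; split.
  by move=> y yc; have [] := dd_opp 0 (fd y yc).
move=> v y yc.
apply: (@near_eq_continuous _ _ (fun z => - dd (f \o chart_inv c) z v)).
  apply: filterS (near_chart_range yc) => z zc.
  by have [_ <-] := dd_opp v (fd z zc).
apply: continuousN; exact: fdC.
Qed.

Lemma diff_at_opp f x : of_class 1 f -> diff_at (fun z => - f z) x = Cotangent x (- covector (diff_at f x)).
Proof.
move=> fC; have [fd _] := fC (chart_at x).
have df := fd _ (chart_map_range (chart_at_dom x)).
rewrite /diff_at; congr Cotangent; apply/matrixP => i j; rewrite !mxE.
exact: (proj2 (dd_opp (delta_mx 0 i) df)).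
Qed.

Lemma negH_diff_at H f x (s : R) : of_class 1 f ->
  negH H (diff_at f x, s) = - H (diff_at (fun z => - f z) x, - s).
Proof. by move=> fC; rewrite (diff_at_opp x fC). Qed.

Lemma negH_diff_at_opp H f x (s : R) : of_class 1 f ->
  negH H (diff_at (fun z => - f z) x, s) = - H (diff_at f x, - s).
Proof.
move=> fC; have := negH_diff_at H x s (of_class1_opp fC).
by have -> : (fun z => - - f z) = f by apply/funext => z; rewrite opprK.
Qed.

Lemma supersolution_negH H w : viscosity_supersolution H w <-> viscosity_subsolution (negH H) (fun x => - w x).
Proof.
split=> Hw f x fC fm.
  rewrite negH_diff_at// opprK oppr_le0; apply: (Hw _ x (of_class1_opp fC)).
  by apply: filterS fm => y; lra.
have E := negH_diff_at_opp H x (- w x) fC; rewrite opprK in E.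
have := Hw (fun x => - f x) x (of_class1_opp fC); rewrite E oppr_le0; apply.
by apply: filterS fm => y; lra.
Qed.

Lemma viscosity_psub H w c (y q : E) : viscosity_supersolution H w -> chart_range c y ->
  psub (w \o chart_inv c) y q -> 0 <= Hc H c (y, q, w (chart_inv c y)).
Proof.
move=> /supersolution_negH Hw yc /psubN hq.
by have := viscosity_psup Hw yc hq; rewrite Hc_negH !opprK oppr_le0.
Qed.

Lemma neg_fiber_continuous (z0 : Z) : {for z0, continuous (fun z : Z => (z.1.1, - z.1.2, - z.2))}.
Proof.
have h2 := @snd1_continuous E E R z0; have h3 : {for z0, continuous (fun z : Z => z.2)} by exact: cvg_snd.
exact: for_pair (for_pair (@fst1_continuous E E R z0) (continuousN h2)) (continuousN h3).
Qed.

Definition psub_super_near H w c x := \forall y \near chart_map c x, forall q,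
  psub (w \o chart_inv c) y q -> 0 <= Hc H c (y, q, w (chart_inv c y)).

Lemma psub_viscosity H w c x f : chart_dom c x ->
  (forall y q s, chart_range c y -> {for (y, q, s), continuous (Hc H c)}) ->
  (\forall z \near x, {for z, continuous w}) ->
  psub_super_near H w c x -> of_class 1 f ->
  (\forall y \near x, w x - f x <= w y - f y) -> 0 <= H (diff_at f x, w x).
Proof.
move=> xc HC wc ws fC fm.
have := @psup_viscosity _ _ _ (negH H) (fun x => - w x) c x (fun x => - f x) xc _ _ _ (of_class1_opp fC) _.
have E := negH_diff_at_opp H x (- w x) fC; rewrite opprK in E.
rewrite E oppr_le0; apply.
- move=> y q s yc.
  have -> : Hc (negH H) c = fun z => - Hc H c (z.1.1, - z.1.2, - z.2).
    by apply/funext => -[[y' q'] s']; rewrite Hc_negH.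
  apply: continuousN.
  apply: (@continuous_comp _ _ _ (fun z : Z => (z.1.1, - z.1.2, - z.2)) (Hc H c)); last exact: HC.
  exact: (@neg_fiber_continuous (y, q, s)).
- by apply: filterS wc => z wz; exact: continuousN.
- apply: filterS ws => y ws q hq; rewrite Hc_negH !opprK oppr_le0; apply: ws.
  by have := psupN hq; congr psub; apply/funext => z /=; rewrite opprK.
- by apply: filterS fm => y; lra.
Qed.

End Supersolution.

(** * Local bounds for the perturbed equations *)

Section Regularity.
Context {R : realType} {n : nat} {M : manifold R n}.
Notation E := 'rV[R]_n.
Notation Z := (E * E * R)%type.
Implicit Types (x : M) (c d : chart M) (H P : cotangent M * R -> R) (w f : M -> R).

Definition family H P : Prop :=
  [/\ of_class_bundle 3 H, strictly_convex H, exists g : riemannian_metric M, superlinear g H,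
      of_class_bundle 3 P & forall z, `|P z| <= 1].

Definition Fc H P c (e : R) (y q : E) (s : R) : R := Hc (perturb H P e) c (y, q, s).

Lemma family_local H P c (y0 : E) (r B K : R) : family H P -> cball y0 r `<=` chart_range c ->
  exists C k e1 : R, [/\ 0 < C, 0 < k, 0 < e1 & forall e : R, 0 <= e <= e1 ->
   [/\ ham_lip (Fc H P c e) y0 r B K C, ham_cvx (Fc H P c e) y0 r B K C k &
       ham_sgr (Fc H P c e) y0 r B K C]].
Proof.
move=> [H3 Hx _ P3 P1] yr.
have H2 := class_CS (Hc_class c H3); have P2 := class_CS (Hc_class c P3).
have oD := @open_chart_range _ _ M c.
have pos (z : Z) (v : E) : tube (chart_range c) z -> v != 0 -> 0 < hessq (Hc H c) z v.
  by apply: hessq_pos => // d; exact: class_CS.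
have [C1 C10 L] := fam_lip B K (class_CS H2) (class_CS P2) yr.
have [C2 [k [e1 [C20 k0 e10 e11 CV]]]] := fam_cvx B K oD H2 P2 yr pos.
have P1' z : `|Hc P c z| <= 1 by exact: P1.
have [C3 [e2 [C30 e20 e21 SG]]] := fam_sgr B K oD H2 P2 yr pos P1'.
exists (C1 + C2 + C3), k, (Num.min e1 e2); split => //.
- by rewrite !addr_gt0.
- by rewrite lt_min e10.
move=> e /andP[e0]; rewrite le_min => /andP[ee1 ee2].
split.
- have e01 : 0 <= e <= 1 by rewrite e0 (le_trans ee1).
  move=> y y' q q' s s' h1 h2 h3 h4 h5 h6; apply: le_trans (L e e01 y y' q q' s s' h1 h2 h3 h4 h5 h6) _.
  by rewrite ler_wpM2r ?addr_ge0 ?en_ge0// -addrA lerDl addr_ge0// ltW.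
- have e01 : 0 <= e <= e1 by rewrite e0.
  move=> y p s h1 h2 h3; have [g gC Hg] := CV e e01 y p s h1 h2 h3; exists g => //.
  by apply: le_trans gC _; rewrite addrAC lerDr addr_ge0// ltW.
- have e01 : 0 <= e <= e2 by rewrite e0.
  move=> y p s h1 h2 h3; have [g gC Hg] := SG e e01 y p s h1 h2 h3; exists g => //.
  by apply: le_trans gC _; rewrite lerDr addr_ge0// ltW.
Qed.

Lemma perturb_lip H P c (y0 : E) (r B K e : R) : family H P -> cball y0 r `<=` chart_range c ->
  0 <= e <= 1 -> exists2 C : R, 0 < C & ham_lip (Fc H P c e) y0 r B K C.
Proof.
move=> [H3 _ _ P3 _] yr e01.
have [C C0 L] := fam_lip B K (class_CS (class_CS (Hc_class c H3))) (class_CS (class_CS (Hc_class c P3))) yr.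
by exists C => //; exact: L.
Qed.

Lemma family_superlin H P c (y0 : E) (r B A : R) : family H P -> cball y0 r `<=` chart_range c ->
  exists2 C : R, 0 < C & forall (e : R) (y q : E) (s : R), 0 <= e <= 1 -> `|y - y0| <= r -> `|s| <= B ->
    A * en q - C <= Fc H P c e y q s.
Proof.
move=> [H3 Hx [g Hg] P3 P1] yr.
have H2 := class_CS (Hc_class c H3).
have [|||||C C0 HC] := @superlin_unif _ _ (Hc H c) (chart_range c) y0 r B _ _ _ _ _ A => //.
- exact: open_chart_range.
- by move=> z w; apply: hessq_pos => // d; exact: class_CS.
- by move=> y s A' yc; exact: superlinear_chart Hg yc.
exists (C + 1); first by rewrite addr_gt0.
move=> e y q s /andP[e0 e1] hy hs; have := HC y q s hy hs.
have := P1 (bundle_inv c (y, q^T), s); rewrite ler_norml => /andP[h _].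
have : e * -1 <= e * P (bundle_inv c (y, q^T), s) by rewrite ler_wpM2l.
have -> : Fc H P c e y q s = Hc H c (y, q, s) + e * P (bundle_inv c (y, q^T), s) by [].
move: (Hc _ _ _) (P _) => a b; lra.
Qed.

Lemma Fc_continuous H P c (e : R) : family H P -> forall y q s, chart_range c y ->
  {for (y, q, s), continuous (Hc (perturb H P e) c)}.
Proof.
move=> [H3 _ _ P3 _] y q s yc.
have cH (G : cotangent M * R -> R) : of_class_bundle 3 G -> {for (y, q, s), continuous (Hc G c)}.
  by move=> /(Hc_class c) [Gd _]; apply: differentiable_continuous; apply: Gd.
apply: (@continuousD _ _ _ (Hc H c) (fun z => e * Hc P c z)); first exact: cH.
by apply: continuousM; [exact: cst_continuous|exact: cH].
Qed.

(** One Lipschitz constant for all subsolutions bounded by B and all parameters in [0, 1]; the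
    continuity of the supremum in Perron's method rests on it. *)
Lemma family_lipschitz H P c (y0 : E) (r B : R) : family H P -> 0 < r -> cball y0 r `<=` chart_range c ->
  exists2 K : R, 1 <= K & forall (e : R) w, 0 <= e <= 1 -> continuous w ->
   viscosity_subsolution (perturb H P e) w -> (forall x, `|w x| <= B) ->
   lip_on (w \o chart_inv c) y0 (r / 4) K.
Proof.
move=> fHP r0 yr; have [C C0 HC] := family_superlin B 1 fHP yr.
have B2 : 0 <= 4 * `|B| / r by rewrite divr_ge0 ?mulr_ge0// ltW.
(* Beyond the momentum C + 1 the Hamiltonian is positive by superlinearity with slope 1; the term in
   B makes the cone of slope K rise by more than 2 B over half the radius. *)
exists (C + 1 + 4 * `|B| / r + 1).
  by move: C0 B2; clear; lra.
move=> e w e01 wc ws wB.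
apply: (@subsolution_lip _ _ (Fc H P c e) _ _ _ B (C + 1)) => //.
- move=> y q s hy hs hq; have := HC e y q s e01 hy hs; lra.
- by move=> y /yr yc; apply: continuous_chart => //; exact: wc.
- by move=> y _; exact: wB.
- by move=> y q hy; apply: viscosity_psup => //; apply: yr; rewrite /cball/= ltW.
- by move: B2; clear; lra.
- by move: C0 B2; clear; lra.
- have : 2 * B <= 4 * `|B| / r * (r / 2).
    have -> : 4 * `|B| / r * (r / 2) = 2 * `|B| by field; rewrite gt_eqF.
    by rewrite ler_pM2l// ler_norm.
  have : 0 < (C + 1 + 1) * (r / 2) by rewrite mulr_gt0 ?divr_gt0// !addr_gt0.
  lra.
Qed.

End Regularity.

(** * Strictness near [Lambda] *)

Section DotLinear.
Context {R : realType} {n : nat}.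
Notation E := 'rV[R]_n.
Lemma dot_linear (q : E) : linear (dot q).
Proof. by move=> k u v; rewrite dotDr dotZr. Qed.
HB.instance Definition _ (q : E) := GRing.isLinear.Build R E R _ (dot q) (dot_linear q).

Lemma frechet_dd (f : E -> R) (y q : E) :
  (forall sg : R, 0 < sg -> \forall z \near y, `|f z - f y - dot q (z - y)| <= sg * en (z - y)) ->
  differentiable f y /\ forall v, dd f y v = dot q v.
Proof.
move=> H; have S0 : 0 < Num.sqrt n%:R + 1 :> R by rewrite ltr_wpDl// sqrtr_ge0.
have [|h1 h2] := @approx_differentiable R E R f y (dot q) (@dot_continuous R n q).
  move=> e e0; have := H _ (divr_gt0 e0 S0); apply: filterS => z /le_trans; apply.
  rewrite -mulrA ler_pM2l// mulrC ler_pdivrMr// mulrC.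
  by apply: le_trans (en_le_norm _) _; rewrite mulrDl mul1r lerDl.
by split => // v; exact: (congr1 (fun f : E -> R => f v) h2).
Qed.

Lemma gradE_dd (f : E -> R) (y q : E) : (forall v, dd f y v = dot q v) -> gradE f y = q.
Proof.
move=> H; apply/rowP => i; rewrite mxE; apply: etrans (H _) _.
rewrite /dot (bigD1 i)//= big1 ?addr0; last by move=> j ji; rewrite !mxE (negbTE ji) mulr0.
by rewrite mxE !eqxx mulr1.
Qed.
End DotLinear.

Lemma norm_between {R : realType} (s s1 s2 c d : R) : `|s1 - c| <= d -> `|s2 - c| <= d -> s1 <= s -> s <= s2 -> `|s - c| <= d.
Proof.
rewrite !ler_norml => /andP[? _] /andP[_ ?] ? ?; apply/andP; split; lra.
Qed.

Section SolLocal.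
Context {R : realType} {n : nat} {M : manifold R n}.
Notation E := 'rV[R]_n.
Notation Z := (E * E * R)%type.
Implicit Types (x : M) (c d : chart M) (H P : cotangent M * R -> R) (w f : M -> R).

Definition sol H P (e : R) w := viscosity_solution (perturb H P e) w.

Lemma chart_ball c (y : E) : chart_range c y -> exists2 r : R, 0 < r & cball y r `<=` chart_range c.
Proof.
move=> yc; have /near_normP[d d0 Hd] := near_chart_range yc.
exists (d / 2); first by rewrite divr_gt0.
by move=> z /= zy; apply: Hd; apply: le_lt_trans zy _; rewrite ltr_pdivrMr// ltr_pMr// ltr1n.
Qed.

(** The momentum bound 2 K + 2 covers the gradients 2 N (y - z) + 2 (y - y1) that doubling produces,
    and the bound K + 1 of the gradient estimates. The radius shrinks to r / 4 with the Lipschitz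
    estimate. *)
Lemma sol_local H P c (y0 : E) (r B : R) : family H P -> 0 < r -> cball y0 r `<=` chart_range c ->
  exists K C k e1 : R, [/\ 1 <= K, 0 < C, 0 < k, 0 < e1 <= 1 & forall e : R, 0 <= e <= e1 ->
   [/\ ham_lip (Fc H P c e) y0 (r / 4) (B + 1) (2 * K + 2) C,
       ham_cvx (Fc H P c e) y0 (r / 4) (B + 1) (2 * K + 2) C k,
       ham_sgr (Fc H P c e) y0 (r / 4) (B + 1) (2 * K + 2) C &
    forall w, sol H P e w -> (forall x, `|w x| <= B) ->
     [/\ lip_on (w \o chart_inv c) y0 (r / 4) K,
         sub_on (Fc H P c e) (w \o chart_inv c) y0 (r / 4) &
         sup_on (Fc H P c e) (w \o chart_inv c) y0 (r / 4)]]].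
Proof.
move=> fHP r0 yr; have [K K1 HK] := family_lipschitz B fHP r0 yr.
have r40 : 0 < r / 4 by rewrite divr_gt0.
have rr : r / 4 <= r by lra.
have yr4 : cball y0 (r / 4) `<=` chart_range c by move=> z /= h; apply: yr; apply: le_trans rr.
have [C [k [e1 [C0 k0 e10 Hf]]]] := family_local (B + 1) (2 * K + 2) fHP yr4.
exists K, C, k, (Num.min e1 1); split => //; first by rewrite lt_min e10 ltr01 ge_min lexx orbT.
move=> e /andP[e0]; rewrite le_min => /andP[ee1 e11].
have [|L V S] := Hf e; first by rewrite e0.
split => // w [wc ws wS] wB; split.
- by apply: (HK e) => //; rewrite e0.
- move=> y q yy; apply: viscosity_psup => //; apply: yr4; rewrite /cball/= ltW//.
- move=> y q yy; apply: viscosity_psub => //; apply: yr4; rewrite /cball/= ltW//.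
Qed.

(** By [psub_frechet] a proximal subgradient of u is its differential, so the corresponding point
    belongs to the set whose closure is [Lambda u]. *)
Lemma psub_graph H P (e : R) c u (y q : E) (B : R) : family H P -> chart_range c y ->
  sol H P 0 u -> (forall x, `|u x| <= B) -> psub (u \o chart_inv c) y q ->
  differentiable_at u (chart_inv c y) /\ diff_at u (chart_inv c y) = bundle_inv c (y, q^T).
Proof.
move=> fHP yc us uB ps; have [r r0 yr] := chart_ball yc.
have [K [C [k [e1 [K1 C0 k0 /andP[e10 _] Hl]]]]] := sol_local B fHP r0 yr.
have [|L V _ Hw] := Hl 0; first by rewrite lexx ltW.
have [lu su Su] := Hw u us uB.
have r40 : 0 < r / 4 by rewrite divr_gt0.
have KK : K + 1 <= 2 * K + 2 by lra.
have yy : `|y - y| <= r / 4 / 2 by rewrite subrr normr0 divr_ge0// ltW.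
have up := psub_frechet r40 K1 (ltW C0) k0 (ham_lip_le KK L) (ham_cvx_le KK V)
  (fun z _ => uB (chart_inv c z)) lu su Su yy ps.
have [N HN] := ps.
have [|du duE] := @frechet_dd _ _ (u \o chart_inv c) y q.
  move=> sg sg0; have [d [d0 _ dN]] := @pick_small R `|N| sg (normr_ge0 N) sg0.
  have nr : \forall z \near y, 1 * en (z - y) < d.
    by apply: near_lt; [exact: en_sub_continuous|rewrite subrr en0 mulr0].
  apply: filterS3 nr HN (up sg sg0) => z; rewrite mul1r => zd h1 h2.
  have : N * nsq (z - y) <= sg * en (z - y).
    rewrite -en_sq expr2 mulrA ler_wpM2r ?en_ge0//; apply: le_trans dN.
    apply: le_trans (_ : `|N| * en (z - y) <= _); first by rewrite ler_wpM2r ?en_ge0// ler_norm.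
    by rewrite mulrC ler_wpM2r// ltW.
  by move: h1 h2 => /=; rewrite ler_norml => h1 h2 h3; apply/andP; split; lra.
have xc := chart_inv_dom yc; have yE := chart_invK yc.
have du' : differentiable (u \o chart_inv c) (chart_map c (chart_inv c y)) by rewrite yE.
split; first by have [] := differentiable_chart xc (chart_at_dom _) du'.
by rewrite (diff_at_chart xc du') yE (gradE_dd duE).
Qed.

Lemma Hc_u_MVT (G : cotangent M * R -> R) c (y p : E) (s1 s2 : R) : of_class_bundle 1 G ->
  chart_range c y -> s1 <= s2 -> exists2 s : R, s1 <= s <= s2 &
  Hc G c (y, p, s2) - Hc G c (y, p, s1) = (s2 - s1) * dd (Hc G c) (y, p, s) (0, 0, 1).
Proof.
move=> GC yc s12; have [Gd _] := Hc_class c GC.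
have lE (t : R) : (y, p, s1) + t *: ((0, 0, s2 - s1) : Z) = (y, p, s1 + t * (s2 - s1)).
  by congr (_, _, _); rewrite /= ?scaler0 ?addr0.
have [|t /andP[t0 t1]] := @line_MVT _ _ (Hc G c) (y, p, s1) (0, 0, s2 - s1).
  by move=> t _; apply: Gd; rewrite lE.
have -> : (y, p, s1) + ((0, 0, s2 - s1) : Z) = (y, p, s2).
  by have := lE 1; rewrite scale1r mul1r => ->; congr (_, _, _); rewrite addrC subrK.
rewrite lE => h.
have s0 : 0 <= s2 - s1 by rewrite subr_ge0.
exists (s1 + t * (s2 - s1)).
  rewrite lerDl mulr_ge0//=; have := ler_wpM2r s0 t1; lra.
rewrite h; apply: etrans (_ : _ = 'd (Hc G c) (y, p, s1 + t * (s2 - s1)) ((s2 - s1) *: ((0, 0, 1) : Z))) _.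
  by congr ('d _ _ _); congr (_, _, _); rewrite /= ?scaler0// /GRing.scale/= mulr1.
by rewrite linearZ.
Qed.

Lemma partial_u_dd (G : cotangent M * R -> R) c (y p : E) (s : R) : of_class_bundle 1 G ->
  chart_range c y -> partial_u G (bundle_inv c (y, p^T), s) = dd (Hc G c) (y, p, s) (0, 0, 1).
Proof.
move=> GC yc; have [Gd _] := Hc_class c GC.
have dG : differentiable (Hc G c) (y, p, s) by apply: Gd.
rewrite /partial_u derive1E derive_line /=.
apply: etrans (_ : derive1 (fun t : R => Hc G c ((y, p, s) + t *: ((0, 0, 1) : Z))) 0 = _).
  apply: (congr1 (fun f : R -> R => derive1 f 0)); apply/funext => t.
  rewrite [t *: 1]mulr1 /Hc /=; congr (G (bundle_inv c (_, _), _)); rewrite ?scaler0 ?addr0//.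
  by rewrite [t *: 1]mulr1.
by apply: etrans (esym (derive_line _ _ _)) _; exact: deriveE.
Qed.

(** Continuity of the bundle chart, for the topology of [cotangent M] that is defined by its traces
    in bundle charts. *)
Lemma bundle_continuous c (y q : E) (s : R) (A : set (cotangent M * R)) : chart_range c y ->
  nbhs (bundle_inv c (y, q^T), s) A -> \forall z \near (y, q, s), A (bundle_inv c (z.1.1, z.1.2^T), z.2).
Proof.
move=> yc [[A1 A2] [/= nA1 nA2] AA].
move: nA1; rewrite nbhsE => -[V [openV Vz] VA].
have openV' : open ((chart_range c `*` [set: 'cV[R]_n]) `&` bundle_inv c @^-1` V) by exact: openV.
have n1 : \forall z \near ((y, q^T) : E * 'cV[R]_n), V (bundle_inv c z).
  have : nbhs ((y, q^T) : E * 'cV[R]_n) ((chart_range c `*` [set: 'cV[R]_n]) `&` bundle_inv c @^-1` V).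
    by apply: open_nbhs_nbhs; split => //; split.
  by apply: filterS => z [].
have n3 : \forall z \near ((y, q, s) : Z), V (bundle_inv c (z.1.1, z.1.2^T)).
  have h := @tr_fiber_continuous R n (y, q, s).
  apply: (h [set t : E * 'cV[R]_n * R | V (bundle_inv c t.1)]).
  exists ([set t | V (bundle_inv c t)], setT) => /=; first by split => //; exact: filterT.
  by move=> [t1 t2] [].
have n2 : \forall z \near ((y, q, s) : Z), A2 z.2.
  exists (setT, A2) => /=; first by split => //; exact: filterT.
  by move=> [t1 t2] [].
by apply: filterS2 n3 n2 => z h1 h2; apply: AA; split => //=; exact: VA.
Qed.

(** Compactness in the momentum: around a momentum in [Lambda] over y0 the derivative in the value
    stays positive, even after perturbation; around any other momentum u has no proximal subgradient
    at all near y0, because [Lambda] is closed, and the claim is void. *)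
Lemma u_pos_local H P c (y0 : E) (r B : R) u : family H P -> 0 < r -> cball y0 r `<=` chart_range c ->
  sol H P 0 u -> (forall x, `|u x| <= B) ->
  (forall z, Lambda u z -> 0 < partial_u H z) ->
  exists2 eta : R, 0 < eta & forall e : R, 0 <= e <= eta ->
    u_pos_on (Fc H P c e) (u \o chart_inv c) y0 eta eta.
Proof.
move=> fHP r0 yr us uB upos; have [H3 _ _ P3 _] := fHP.
have y00 : chart_range c y0 by apply: yr; rewrite /cball/= subrr normr0 ltW.
have H1 := class_CS (Hc_class c H3).
have HB1 : of_class_bundle 1 H by move=> d; do 2!apply: class_CS; exact: H3.
have PB1 : of_class_bundle 1 P by move=> d; do 2!apply: class_CS; exact: P3.
have ucont : {for y0, continuous (u \o chart_inv c)} by apply: continuous_chart => //; case: us => uc _ _; exact: uc.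
set u0 := (u \o chart_inv c) y0.
pose Pd (d : R) (q0 : E) := forall (e : R) y y' p q (s1 s2 : R), 0 <= e <= d ->
  `|y - y0| <= d -> `|y' - y0| <= d -> psub (u \o chart_inv c) y' q -> `|q - q0| <= d -> `|p - q0| <= d ->
  `|s1 - u0| <= d -> `|s2 - u0| <= d -> s1 <= s2 -> d * (s2 - s1) <= Fc H P c e y p s2 - Fc H P c e y p s1.
have [K [C [k [e1 [K1 C0 k0 /andP[e10 _] Hl]]]]] := sol_local B fHP r0 yr.
have [|_ _ _ Hw] := Hl 0; first by rewrite lexx ltW.
have [lu _ _] := Hw u us uB.
have [d d0 Hd] : exists2 d : R, 0 < d & forall q0, cball 0 K q0 -> Pd d q0.
  apply: compact_unif0; first exact: cball_compact.
    move=> d d' q0 d'0 dd HP e y y' p q s1 s2 /andP[e0 ed] h1 h2 h3 h4 h5 h6 h7 h8.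
    apply: le_trans (HP e y y' p q s1 s2 _ _ _ h3 _ _ _ _ h8); rewrite ?e0/=; try exact: le_trans dd.
    by rewrite ler_wpM2r// subr_ge0.
  move=> q0 _.
  suff [d d0 HP] : exists2 d : R, 0 < d & Pd d q0.
    exists (d / 2); first by rewrite divr_gt0.
    apply/near_normP; exists (d / 2); first by rewrite divr_gt0.
    move=> q1 q1q e y y' p q s1 s2 /andP[e0 ed] h1 h2 h3 h4 h5 h6 h7 h8.
    have dd : d / 2 <= d by rewrite ler_pdivrMr// ler_pMr// ler1n.
    apply: le_trans (HP e y y' p q s1 s2 _ _ _ h3 _ _ _ _ h8); rewrite ?e0/=; try exact: le_trans dd.
    - by rewrite ler_wpM2r// subr_ge0.
    - by have := ler_distD q1 q q0; lra.
    - by have := ler_distD q1 p q0; lra.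
  (* The alternative of the closed set [Lambda u] and its complement. *)
  have [inL|outL] := pselect (Lambda u (bundle_inv c (y0, q0^T), u0)); last first.
    have : nbhs (bundle_inv c (y0, q0^T), u0) (~` Lambda u).
      by apply: open_nbhs_nbhs; split => //; exact/closed_openC/closed_closure.
    move=> /(bundle_continuous y00)/nbhs_ballP[d /= d0 Hd].
    have [d1 d10 Hd1] := (contE _ _).1 ucont d d0.
    pose d2 := Num.min (d / 2) (Num.min (d1 / 2) (r / 2)).
    have d20 : 0 < d2 by rewrite !lt_min !divr_gt0.
    exists d2 => // e y y' p q s1 s2 _ _; rewrite !le_min => /and3P[h1 h2 h3] ps /andP[h4 _].
    have yc : chart_range c y' by apply: yr; rewrite /cball/=; lra.
    have [g1 g2] := psub_graph 0 fHP yc us uB ps.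
    exfalso; apply: (Hd (y', q, u (chart_inv c y'))).
      rewrite -ball_normE /= distrC prod_normE gt_max prod_normE gt_max /=.
      have l1 : `|y' - y0| < d by lra.
      have l2 : `|q - q0| < d by lra.
      have l3 : `|u (chart_inv c y') - u0| < d by apply: (Hd1 y'); lra.
      by rewrite l1 l2 l3.
    by rewrite /= -g2; apply: subset_closure; exists (chart_inv c y').
  have := upos _ inL; rewrite (partial_u_dd _ _ HB1 y00).
  have cD (G : cotangent M * R -> R) : of_class_bundle 3 G ->
      {for (y0, q0, u0), continuous (fun z => dd (Hc G c) z (0, 0, 1))}.
    move=> G3; have := class_CS (class_CS (Hc_class c G3)); case=> _ h; apply: (h (0, 0, 1)).
    by split.
  set a := dd _ _ _ => a0.
  have nH : \forall z \near (y0, q0, u0), a / 2 < dd (Hc H c) z (0, 0, 1).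
    by apply: near_gt; [exact: cD|rewrite -/a ltr_pdivrMr// ltr_pMr// ltr1n].
  set b := `|dd (Hc P c) (y0, q0, u0) (0, 0, 1)| + 1.
  have b0 : 0 < b by rewrite ltr_wpDl.
  have nP : \forall z \near (y0, q0, u0), - b < dd (Hc P c) z (0, 0, 1).
    apply: near_gt; first exact: cD.
    by rewrite /b; move: (dd _ _ _) => t; have := ler_norm (- t); rewrite normrN; lra.
  move: nH nP => /nbhs_ballP[da /= da0 Ha] /nbhs_ballP[db /= db0 Hb].
  pose d := Num.min da db.
  have d0 : 0 < d by rewrite lt_min da0.
  have dda : d <= da by rewrite ge_min lexx.
  have ddb : d <= db by rewrite ge_min lexx orbT.
  pose d2 := Num.min (d / 2) (Num.min (r / 2) (Num.min (a / 4) (a / (4 * b)))).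
  have d20 : 0 < d2 by rewrite !lt_min !divr_gt0// mulr_gt0.
  have d2d : d2 <= d / 2 by rewrite ge_min lexx.
  have d2r : d2 <= r / 2 by rewrite !ge_min lexx orbT.
  have d2a : d2 <= a / 4 by rewrite !ge_min lexx !orbT.
  have d2b : d2 * b <= a / 4.
    have : d2 <= a / (4 * b) by rewrite !ge_min lexx !orbT.
    rewrite ler_pdivlMr ?mulr_gt0// mulrCA => h; rewrite ler_pdivlMr// mulrC//.
  exists d2 => // e y y' p q s1 s2 /andP[e0 ed] h1 _ _ _ h2 h3 h4 s12.
  have yc : chart_range c y by apply: yr; apply: le_trans h1 _; apply: le_trans d2r _; rewrite ler_pdivrMr// ler_peMr ?ler1n// ltW.
  have inb s : s1 <= s <= s2 -> ball ((y0, q0, u0) : Z) d (y, p, s).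
    move=> /andP[sa sb]; rewrite -ball_normE /= distrC prod_normE gt_max prod_normE gt_max /=.
    have h5 := norm_between h3 h4 sa sb.
    have l z : z <= d2 -> z < d by move=> h; apply: le_lt_trans h (le_lt_trans d2d _); rewrite ltr_pdivrMr// ltr_pMr// ltr1n.
    by rewrite !l.
  have [sH sH12 EH] := Hc_u_MVT p HB1 yc s12.
  have [sP sP12 EP] := Hc_u_MVT p PB1 yc s12.
  have hH := Ha _ (le_ball dda (inb _ sH12)); have hP := Hb _ (le_ball ddb (inb _ sP12)).
  have s0 : 0 <= s2 - s1 by rewrite subr_ge0.
  have -> : Fc H P c e y p s2 - Fc H P c e y p s1 =
     (Hc H c (y, p, s2) - Hc H c (y, p, s1)) + e * (Hc P c (y, p, s2) - Hc P c (y, p, s1)).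
    by rewrite /Fc /perturb /Hc /=; ring.
  rewrite EH EP; move: (dd _ _ _) (dd _ _ _) hH hP => aP aH hH hP.
  rewrite mulrCA -mulrDr mulrC ler_wpM2l//.
  have : e * - b <= e * aP by rewrite ler_wpM2l// ltW.
  have : e * b <= d2 * b by rewrite ler_wpM2r// ltW.
  move: hH d2a d2b; clear; lra.
pose eta := Num.min d (r / 8).
have eta0 : 0 < eta by rewrite lt_min d0 divr_gt0.
have ed : eta <= d by rewrite ge_min lexx.
have er : eta <= r / 8 by rewrite ge_min lexx orbT.
exists eta => // e /andP[e0 ee] y y' p q s1 s2 h1 h2 ps qp h3 h4 s12.
have y'r : `|y' - y0| < r / 4 by lra.
have qK := psub_lip (le_trans ler01 K1) lu y'r ps.
have qin : cball 0 K q by rewrite /cball/= subr0; apply: le_trans (norm_le_en _) qK.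
have nq : `|p - q| <= d by rewrite distrC; apply: le_trans (norm_le_en _) _; apply: le_trans ed.
apply: le_trans (Hd q qin e y y' p q s1 s2 _ _ _ ps _ nq _ _ s12); rewrite ?e0/=; try exact: le_trans ed.
  by rewrite ler_wpM2r// subr_ge0.
by rewrite subrr normr0 ltW.
Qed.

End SolLocal.

Section Good.
Context {R : realType} {n : nat} {M : manifold R n}.
Notation E := 'rV[R]_n.
Implicit Types (x : M) (c d : chart M) (H P : cotangent M * R -> R) (w u : M -> R).

(** Strict supersolution property of w + tau and strict subsolution property of w - tau at (y, p),
    with rate e and for all shifts tau up to e. *)
Definition strict_at H P c (e e' : R) w (y p : E) := forall tau : R, 0 <= tau <= e ->
  (psub (w \o chart_inv c) y p -> e * tau <= Fc H P c e' y p (w (chart_inv c y) + tau)) /\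
  (psup (w \o chart_inv c) y p -> Fc H P c e' y p (w (chart_inv c y) - tau) <= - (e * tau)).

(* The local picture near [x], uniform in the solutions [w] of the perturbed
   equations with parameter in [[0, e]] which are [e]-close to [u]. *)
Definition good_at H P u (B e : R) x := exists c K, [/\ chart_dom c x, 1 <= K &
  forall e' : R, 0 <= e' <= e -> exists C r, [/\ 0 < C, 0 < r, cball (chart_map c x) r `<=` chart_range c,
    ham_lip (Fc H P c e') (chart_map c x) r B (2 * K + 2) C /\
    ham_sgr (Fc H P c e') (chart_map c x) r B (2 * K + 2) C &
    forall w, sol H P e' w -> (forall z, `|w z - u z| <= e) ->
      lip_on (w \o chart_inv c) (chart_map c x) r K /\
      forall y p, `|y - chart_map c x| <= r -> strict_at H P c e e' w y p]].

Lemma good_at_mono H P u (B e1 e2 : R) x : 0 < e2 -> e2 <= e1 -> good_at H P u B e1 x -> good_at H P u B e2 x.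
Proof.
move=> e20 e21 [c [K [xc K1 Hg]]]; exists c, K; split => // e' /andP[e'0 e'e].
have [|C [r [C0 r0 yr L Hw]]] := Hg e'; first by rewrite e'0 (le_trans e'e).
exists C, r; split => // w sw wu.
have [|lw Sw] := Hw w sw; first by move=> z; apply: le_trans (wu z) e21.
split => // y p yy tau /andP[t0 te].
have [|h1 h2] := Sw y p yy tau; first by rewrite t0 (le_trans te).
have h3 : e2 * tau <= e1 * tau by rewrite ler_wpM2r.
split=> hp; first exact: le_trans h3 (h1 hp).
by apply: le_trans (h2 hp) _; rewrite lerN2.
Qed.

Lemma good_local H P u (B : R) x0 : family H P -> sol H P 0 u -> (forall x, `|u x| <= B) ->
  (forall z, Lambda u z -> 0 < partial_u H z) ->
  exists2 d : R, 0 < d & \forall x \near x0, good_at H P u (B + 2) d x.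
Proof.
move=> fHP us uB upos; pose c := chart_at x0; have xc : chart_dom c x0 by exact: chart_at_dom.
have yc := chart_map_range xc; set y0 := chart_map c x0 in yc.
have [r r0 yr] := chart_ball yc.
(* B + 1 bounds every solution within distance 1 of u; the further unit in B + 2 is the room for the
   shifts by tau. *)
have [K [C [k [e1 [K1 C0 k0 /andP[e10 e11] Hl]]]]] := sol_local (B + 1) fHP r0 yr.
have uB1 x : `|u x| <= B + 1 by have := uB x; lra.
have [eta eta0 Hp] := u_pos_local fHP r0 yr us uB1 upos.
have r40 : 0 < r / 4 by rewrite divr_gt0.
have [|L0 V0 _ Hw0] := Hl 0; first by rewrite lexx ltW.
have [lu su Su] := Hw0 u us uB1.
have KK : K + 1 <= 2 * K + 2 by lra.
have [d0 d00 Hd] := @strict_psub_psup _ _ (Fc H P c 0) (u \o chart_inv c) y0 (r / 4) (B + 1) K C k eta eta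
  r40 K1 (ltW C0) k0 eta0 (ham_lip_le KK L0) (ham_cvx_le KK V0) (fun y _ => uB1 _) lu su Su.
pose d := Num.min (Num.min d0 e1) (Num.min eta (r / 4)).
have dp : 0 < d by rewrite !lt_min d00 e10 eta0.
have dd0 : d <= d0 by rewrite !ge_min lexx.
have de1 : d <= e1 by rewrite !ge_min lexx orbT.
have deta : d <= eta by rewrite !ge_min lexx !orbT.
have dr : d <= r / 4 by rewrite !ge_min lexx !orbT.
exists d => //; apply/(near_chart _ xc); rewrite -/y0.
have d2 : 0 < d / 2 by rewrite divr_gt0.
have nb : \forall y \near y0, `|y - y0| < d / 2 by apply/near_normP; exists (d / 2).
apply: filterS2 nb (near_chart_range yc) => y yd yrng.
exists c, K; split => //; first exact: chart_inv_dom.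
move=> e' /andP[e'0 e'd].
have [|L V S Hw] := Hl e'; first by rewrite e'0 (le_trans e'd).
have [_ _ _ _ P1] := fHP.
rewrite chart_invK//.
have inb z : `|z - y| <= d / 2 -> `|z - y0| <= d by move=> h; rewrite [leRHS]splitr; apply: le_trans (ler_distD y _ _) _; rewrite lerD// ltW.
have inr z : `|z - y| <= d / 2 -> `|z - y0| <= r / 4 by move=> /inb /le_trans; apply.
have BB : B + 2 = B + 1 + 1 by rewrite -addrA.
exists C, (d / 2); split => //.
- by move=> z h; apply: yr; apply: le_trans (inr z h) _; rewrite ler_pdivrMr// ler_peMr ?ler1n// ltW.
- split; rewrite BB.
    by move=> a b q q' s s' h1 h2; apply: L; exact: inr.
  by move=> a p s h1; apply: S; exact: inr.
move=> w sw wu; have wB x : `|w x| <= B + 1.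
  have := ler_distD (u x) (w x) 0; rewrite !subr0; have := uB x; have := wu x; lra.
have [lw sbw spw] := Hw w sw wB.
split; first by move=> a b h1 h2; apply: lw; exact: inr.
move=> a p h tau /andP[t0 td].
have dF (y' q : E) (s : R) : `|y' - y0| <= r / 4 -> `|Fc H P c e' y' q s - Fc H P c 0 y' q s| <= d.
  move=> _; have -> : Fc H P c e' y' q s - Fc H P c 0 y' q s = e' * P (bundle_inv c (y', q^T), s).
    by rewrite /Fc /Hc /perturb /= mul0r addr0 addrC addKr.
  rewrite normrM ger0_norm//; apply: le_trans e'd.
  by rewrite ler_piMr.
have ue : 0 <= e' <= eta by rewrite e'0 (le_trans e'd).
have [h1 h2] := Hd (Fc H P c e') (w \o chart_inv c) d (ltW dp) dd0 (ham_lip_le KK L) (ham_cvx_le KK V) dF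
  (Hp e' ue) (fun y _ => wB _) (fun y _ => wu _) lw sbw spw a p tau (le_trans (inb _ h) dd0) t0 (le_trans td dd0).
have h3 : d * tau <= eta * tau by rewrite ler_wpM2r.
split=> hp; first exact: le_trans h3 (h1 hp).
by apply: le_trans (h2 hp) _; rewrite lerN2.
Qed.

Lemma good_global H P u (B : R) : compact [set: M] -> family H P -> sol H P 0 u -> (forall x, `|u x| <= B) ->
  (forall z, Lambda u z -> 0 < partial_u H z) ->
  exists2 e : R, 0 < e <= 1 & forall x, good_at H P u (B + 2) e x.
Proof.
move=> cM fHP us uB upos.
have [|x _|e e0 He] := @compact_unif0 R M [set: M] (good_at H P u (B + 2)) cM.
- by move=> d d' x d'0 dd; exact: good_at_mono.
- exact: good_local.
have e10 : 0 < Num.min e 1 by rewrite lt_min e0 ltr01.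
exists (Num.min e 1); first by rewrite e10 ge_min lexx orbT.
by move=> x; apply: good_at_mono e10 _ (He x I); rewrite ge_min lexx.
Qed.

End Good.

(** * Doubling of the space variable *)

Section Doubling.
Context {R : realType} {n : nat}.
Notation E := 'rV[R]_n.

Lemma doubling_N (K sg : R) : 0 <= K -> 0 < sg -> exists N : R, [/\ 0 < N, K / N <= sg, K ^+ 2 / N <= sg & K ^+ 2 / N <= sg ^+ 2].
Proof.
move=> K0 s0; exists ((K + K ^+ 2 + 1) / sg + (K ^+ 2 + 1) / sg ^+ 2).
have K2 : 0 <= K ^+ 2 by rewrite sqr_ge0.
have s2 : 0 < sg ^+ 2 by rewrite exprn_gt0.
have A0 : 0 < (K + K ^+ 2 + 1) / sg by rewrite divr_gt0// ltr_wpDl// addr_ge0.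
have B0 : 0 < (K ^+ 2 + 1) / sg ^+ 2 by rewrite divr_gt0// ltr_wpDl.
have N0 := addr_gt0 A0 B0.
have sA : sg * ((K + K ^+ 2 + 1) / sg) = K + K ^+ 2 + 1 by field; rewrite gt_eqF.
have sB : sg ^+ 2 * ((K ^+ 2 + 1) / sg ^+ 2) = K ^+ 2 + 1 by field; rewrite gt_eqF.
have h1 := mulr_ge0 (ltW s0) (ltW B0); have h2 := mulr_ge0 (ltW s2) (ltW A0).
by split => //; rewrite ler_pdivrMr// mulrDr ?sA ?sB; lra.
Qed.

(** Only the space variable is doubled, since w does not depend on time. The Lipschitz bound on w
    keeps N |y - z| below K, and the terms (t - t1) ^ 2 and |y - y1| ^ 2 pull the maximum to the
    given one, so no limit is taken. Times run up to t1 only, as befits an evolution followed until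
    t1. *)
Lemma doubling (f : R -> E -> R) (w : E -> R) (b : R -> R) (t1 : R) (y1 : E) (r K sg : R) :
  0 < r -> 0 <= K -> lip_on w y1 r K ->
  (forall (t : R) y, t1 - r <= t <= t1 -> `|y - y1| <= r -> {for (t, y), continuous (fun z : R * E => f z.1 z.2)}) ->
  (forall t : R, t1 - r <= t <= t1 -> {for t, continuous b}) ->
  (forall (t : R) y, t1 - r <= t <= t1 -> `|y - y1| <= r -> f t y - w y - b t <= f t1 y1 - w y1 - b t1) ->
  0 < sg -> sg < r / 2 ->
  exists (th N : R) (yh zh : E), [/\ t1 - sg <= th <= t1, en (yh - y1) <= sg /\ en (yh - zh) <= sg,
    [/\ 0 <= N, N * en (yh - zh) <= K, `|zh - y1| < r & psub w zh ((2 * N) *: (yh - zh))],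
    f t1 y1 - w y1 - b t1 <= f th yh - w zh - b th <= f t1 y1 - w y1 - b t1 + sg &
    forall (t : R) y, t1 - r / 2 <= t <= t1 -> `|y - y1| <= r / 2 ->
      f t y <= f th yh + (b t - b th) + ((t - t1) ^+ 2 - (th - t1) ^+ 2) +
         dot ((2 * N) *: (yh - zh) + 2 *: (yh - y1)) (y - yh) + (N + 1) * nsq (y - yh)].
Proof.
move=> r0 K0 lw fc bc fmax s0 sr; set mu := f t1 y1 - w y1 - b t1.
have r20 : 0 < r / 2 by rewrite divr_gt0.
have rr : r / 2 < r by rewrite ltr_pdivrMr// ltr_pMr// ltr1n.
pose sg2 := sg / 2.
have s20 : 0 < sg2 by rewrite divr_gt0.
have ss : sg2 < sg by rewrite ltr_pdivrMr// ltr_pMr// ltr1n.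
have [N [N0 KN K2N K2N2]] := doubling_N K0 s20.
pose Phi (z : R * E * E) := f z.1.1 z.1.2 - w z.2 - b z.1.1 - (z.1.1 - t1) ^+ 2 - N * nsq (z.1.2 - z.2) - nsq (z.1.2 - y1).
pose X : set (R * E * E) := `[t1 - r / 2, t1]%classic `*` cball y1 (r / 2) `*` cball y1 (r / 2).
have tr t : t1 - r / 2 <= t <= t1 -> t1 - r <= t <= t1.
  by move=> /andP[h1 ->]; rewrite andbT; lra.
have yr y : `|y - y1| <= r / 2 -> `|y - y1| <= r by move=> /le_trans; apply; exact: ltW.
have yr' y : `|y - y1| <= r / 2 -> `|y - y1| < r by move=> /le_lt_trans; apply.
have X1 : X (t1, y1, y1).
  by split; first split; rewrite /cball/= ?subrr ?normr0 ?ltW// in_itv/= lexx andbT lerBlDr lerDl ltW.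
have [[[th yh] zh] [[/= thX yhX] zhX] Pmax] : exists2 z : R * E * E, X z & forall z', X z' -> Phi z' <= Phi z.
  apply: (compact_max (f := Phi)).
  - by exists (t1, y1, y1).
  - by do 2?apply: compact_setX; [exact: segment_compact|exact: cball_compact|exact: cball_compact].
  move=> [[t y] z] [[/= ht hy] hz]; rewrite in_itv/= in ht.
  have p11 := @fst1_continuous R E E (t, y, z).
  have p12 := @snd1_continuous R E E (t, y, z).
  have p2 : {for (t, y, z), continuous (fun z : R * E * E => z.2)} by exact: cvg_snd.
  have pc (V : topologicalType) (k : V) : {for (t, y, z), continuous (fun z : R * E * E => k)} by exact: cst_continuous.
  have pf : {for (t, y, z), continuous (fun z : R * E * E => f z.1.1 z.1.2)}.
    by apply: (@continuous_comp _ _ _ (fun z : R * E * E => z.1) (fun z : R * E => f z.1 z.2)); [exact: cvg_fst|exact: fc (tr _ ht) (yr _ hy)].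
  have pw : {for (t, y, z), continuous (fun z : R * E * E => w z.2)}.
    by apply: (@continuous_comp _ _ _ (fun z : R * E * E => z.2) w) => //; exact: lip_continuous K0 lw (yr' _ hz).
  have pb : {for (t, y, z), continuous (fun z : R * E * E => b z.1.1)}.
    by apply: (@continuous_comp _ _ _ (fun z : R * E * E => z.1.1) b) => //; exact: bc (tr _ ht).
  have pt : {for (t, y, z), continuous (fun z : R * E * E => (z.1.1 - t1) ^+ 2)}.
    apply: (@continuous_comp _ _ _ (fun z : R * E * E => z.1.1 - t1) (fun t : R => t ^+ 2)); last exact: exprn_continuous.
    exact: continuousB p11 (pc _ t1).
  have pn1 : {for (t, y, z), continuous (fun z : R * E * E => N * nsq (z.1.2 - z.2))}.
    apply: (continuousM (pc _ N)).
    by apply: (@continuous_comp _ _ _ (fun z : R * E * E => z.1.2 - z.2) nsq); [exact: continuousB p12 p2|exact: nsq_continuous].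
  have pn2 : {for (t, y, z), continuous (fun z : R * E * E => nsq (z.1.2 - y1))}.
    by apply: (@continuous_comp _ _ _ (fun z : R * E * E => z.1.2 - y1) nsq); [exact: continuousB p12 (pc _ y1)|exact: nsq_continuous].
  exact: continuousB (continuousB (continuousB (continuousB (continuousB pf pw) pb) pt) pn1) pn2.
rewrite in_itv/= in thX.
have max' t y z : t1 - r / 2 <= t <= t1 -> `|y - y1| <= r / 2 -> `|z - y1| <= r / 2 ->
    Phi (t, y, z) <= Phi (th, yh, zh).
  by move=> ht hy hz; apply: Pmax; split => //; split => //=; rewrite in_itv.
have d0 : 0 <= en (yh - zh) by exact: en_ge0.
have wK : w yh - w zh <= K * en (yh - zh).
  by have := lw yh zh (yr _ yhX) (yr _ zhX); rewrite ler_norml => /andP[].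
have NK : N * en (yh - zh) <= K.
  have := max' th yh yh thX yhX yhX; rewrite /Phi /= subrr nsq0 mulr0 => h.
  have h2 : N * en (yh - zh) * en (yh - zh) <= K * en (yh - zh) by rewrite -mulrA -expr2 en_sq; lra.
  have [d1|d1] := eqVneq (en (yh - zh)) 0; first by rewrite d1 mulr0.
  by rewrite -(ler_pM2r (_ : 0 < en (yh - zh))) // lt_neqAle eq_sym d1.
have eKN : en (yh - zh) <= K / N by rewrite ler_pdivlMr// mulrC.
have KeN : K * en (yh - zh) <= K ^+ 2 / N by rewrite expr2 -mulrA ler_wpM2l.
have NN0 : 0 <= N * nsq (yh - zh) by rewrite mulr_ge0 ?nsq_ge0// ltW.
have := max' t1 y1 y1; rewrite subrr normr0 lexx (ltW r20) andbT => /(_ _ isT isT).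
rewrite /Phi /= !subrr nsq0 mulr0 expr0n !subr0 -/mu => h1.
have {}h1 := h1 ltac:(by rewrite lerBlDr lerDl ltW).
have h2 := fmax th yh (tr _ thX) (yr _ yhX); rewrite -/mu in h2.
have t2 : 0 <= (th - t1) ^+ 2 by exact: sqr_ge0.
have y2 := nsq_ge0 (yh - y1).
(* The two localization terms are paid by the gain K ^ 2 / N of doubling, which N makes as small as
   wanted. *)
have sumle : (th - t1) ^+ 2 + nsq (yh - y1) <= sg2 ^+ 2.
  by move: NN0 wK KeN K2N2 h1 h2; clear; lra.
have yh1 : en (yh - y1) <= sg2.
  by rewrite -(@ler_pXn2r _ 2)// ?nnegrE ?en_ge0 ?(ltW s20)// en_sq; apply: le_trans _ sumle; rewrite lerDr.
have th1 : t1 - th <= sg2.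
  have [h|h] := leP (t1 - th) 0; first by rewrite (le_trans h)// ltW.
  rewrite -(@ler_pXn2r _ 2)// ?nnegrE ?(ltW h) ?(ltW s20)//.
  by rewrite -sqrrN opprB; apply: le_trans _ sumle; rewrite lerDl.
have thle : th <= t1 by case/andP: thX.
have yh2 : `|yh - y1| <= sg2 by apply: le_trans (norm_le_en _) yh1.
have yz : `|yh - zh| <= sg2 by apply: le_trans (norm_le_en _) (le_trans eKN KN).
have zh2 : `|zh - y1| <= sg 
  by rewrite [leRHS]splitr; apply: le_trans (ler_distD yh _ _) _; rewrite lerD// distrC.
have zhr : `|zh - y1| < r / 2 by apply: le_lt_trans sr.
exists th, N, yh, zh; split.
- by rewrite thle andbT lerBlDr -lerBlDl (le_trans th1)// ltW.
- by split; [exact: le_trans yh1 (ltW ss)|exact: le_trans (le_trans eKN KN) (ltW ss)].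
- split; [exact: ltW|exact: NK|exact: lt_trans rr|].
  exists N; apply: filterS (near_cball zhr) => z zz.
  have := max' th yh z thX yhX zz; rewrite /Phi /=.
  have -> : nsq (yh - z) = nsq (yh - zh) - 2 * dot (yh - zh) (z - zh) + nsq (z - zh).
    have -> : yh - z = (yh - zh) - (z - zh) by rewrite opprB addrA subrK.
    by rewrite nsqB.
  by rewrite dotZl; clear; lra.
- by move: NN0 wK KeN K2N h1 h2 t2 y2 ss; clear; move=> *; apply/andP; split; lra.
move=> t y ht hy; have := max' t y zh ht hy zhX; rewrite /Phi /=.
rewrite (nsq_shift zh yh y) (nsq_shift y1 yh y).
have -> : dot ((2 * N) *: (yh - zh) + 2 *: (yh - y1)) (y - yh) = 2 * N * dot (yh - zh) (y - yh) + 2 * dot (yh - y1) (y - yh).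
  by rewrite (dotDl ((2 * N) *: (yh - zh)) (2 *: (yh - y1))) (dotZl (2 * N)) (dotZl 2).
clear; lra.
Qed.

End Doubling.

(** * Comparison *)

Section Static.
Context {R : realType} {n : nat} {M : manifold R n}.
Notation E := 'rV[R]_n.
Implicit Types (x : M) (c d : chart M) (H P : cotangent M * R -> R) (w u : M -> R).

Lemma gap_le (a b c e : R) : `|a - c| <= e / 4 -> `|b - c| <= e / 4 -> a - b <= e / 2.
Proof. rewrite !ler_norml => /andP[? ?] /andP[? ?]; lra. Qed.

Lemma norm_near (a b B e : R) : `|a| <= B -> `|b - a| <= e / 4 -> e <= 1 -> `|b| <= B + 2.
Proof. by rewrite !ler_norml => /andP[? ?] /andP[? ?] ?; apply/andP; split; lra. Qed.

Lemma ball_range c (y1 : E) (r : R) y : cball y1 r `<=` chart_range c -> `|y - y1| <= r -> chart_range c y.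
Proof. by move=> yr h; apply: yr. Qed.

(** At a positive maximum mu of w1 - w2 doubling gives F <= 0 for w1 at its supergradient, while
    strictness of w2 + tau at its subgradient gives F >= e tau at the same value, with tau >= mu.
    The two gradients and points differ by O(sg). *)
Lemma comparison_le H P u (B e e' : R) w1 w2 : compact [set: M] -> (forall x, `|u x| <= B) ->
  0 < e <= 1 -> (forall x, good_at H P u (B + 2) e x) -> 0 <= e' <= e ->
  sol H P e' w1 -> sol H P e' w2 -> (forall x, `|w1 x - u x| <= e / 4) -> (forall x, `|w2 x - u x| <= e / 4) ->
  forall x, w1 x <= w2 x.
Proof.
move=> cM uB /andP[e0 e1] good e'e s1 s2 w1u w2u x0.
have w1c : continuous w1 by case: s1.
have w2c : continuous w2 by case: s2.
have [x1 _ xmax] := @compact_max R M (fun x => w1 x - w2 x) [set: M] (ex_intro _ x0 I) cM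
  (fun x _ => continuousB (w1c x) (w2c x)).
set mu := w1 x1 - w2 x1.
rewrite -subr_le0; apply: le_trans (xmax x0 I) _; rewrite -/mu leNgt; apply/negP => mu0.
have [c [K [xc K1 Hg]]] := good x1.
have [C [r [C0 r0 yr [L _] Hw]]] := Hg e' e'e.
have w2e x : `|w2 x - u x| <= e by have := w2u x; lra.
have [lw St] := Hw w2 s2 w2e.
set y1 := chart_map c x1 in yr L lw St.
have K0 : 0 <= K by exact: le_trans ler01 K1.
have wE w : (w \o chart_inv c) y1 = w x1 by rewrite /= chart_mapK.
(* The factor 3 counts the distance of the two points, at most sg, and of the two gradients, at most
   2 sg. *)
have [sg [sg0 sg1 sgC]] := @pick_small R (3 * C) (Num.min (Num.min (r / 4) 1) (Num.min (e / 4) (e * mu / 2)))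
   ltac:(by rewrite mulr_ge0// ltW) ltac:(by rewrite !lt_min ltr01 !divr_gt0// mulr_gt0).
have sgr : sg < r / 2 by apply: le_lt_trans sg1 _; rewrite !gt_min; apply/orP; left; apply/orP; left; lra.
have sg11 : sg <= 1 by min_ub sg1.
have sge : sg <= e / 4 by min_ub sg1.
have sgm : sg * (3 * C) <= e * mu / 2 by min_ub sgC.
(* Nothing depends on time: the time variable of [doubling] is a dummy and the barrier is zero. *)
have [th [N [yh [zh [thI [yh1 yz] [N0 NK zr ps] /andP[lo hi] touch]]]]] :=
  @doubling R n (fun _ y => (w1 \o chart_inv c) y) (w2 \o chart_inv c) (fun=> 0) 0 y1 r K sg r0 K0 lw
   ltac:(move=> t y _ hy; apply: (@continuous_comp _ _ _ (fun z : R * E => z.2) (w1 \o chart_inv c)); [exact: cvg_snd|apply: continuous_chart; [exact: ball_range yr hy|exact: w1c]])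
   ltac:(move=> t _; exact: cst_continuous)
   ltac:(move=> t y _ hy; rewrite !subr0 !wE; exact: xmax) sg0 sgr.
rewrite !wE !subr0 -/mu in lo hi.
set q2 := (2 * N) *: (yh - zh) in ps; set q1 := q2 + 2 *: (yh - y1).
have yhr : `|yh - y1| < r / 2 by apply: le_lt_trans (norm_le_en _) (le_lt_trans yh1 sgr).
have yhr1 : `|yh - y1| <= r by apply/ltW/(lt_trans yhr); rewrite ltr_pdivrMr// ltr_pMr// ltr1n.
have q2K : en q2 <= 2 * K by rewrite /q2 enZ ger0_norm ?mulr_ge0// -mulrA ler_pM2l.
have q1K : en q1 <= 2 * K + 2.
  apply: le_trans (enD _ _) _; rewrite enZ normr_nat; move: q2K yh1 sg11; clear; lra.
have pu : psup (w1 \o chart_inv c) yh q1.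
  exists (N + 1); have := near_cball yhr; apply: filterS => y hy.
  have h0 : - (r / 2) <= (0 : R) <= 0 by rewrite lexx andbT oppr_le0 divr_ge0// ltW.
  have := touch th y; rewrite !subrr !sub0r !addr0; apply => //.
  by move/andP: thI => [h1 ->]; rewrite andbT; move: sgr h1; clear; lra.
have yhc : chart_range c yh by exact: ball_range yr yhr1.
have F1 : Fc H P c e' yh q1 (w1 (chart_inv c yh)) <= 0 by case: s1 => _ h _; exact: viscosity_psup.
set tau := w1 (chart_inv c yh) - w2 (chart_inv c zh).
have tauE : w2 (chart_inv c zh) + tau = w1 (chart_inv c yh) by rewrite /tau addrC subrK.
have mue : mu <= e / 2.
  exact: gap_le (w1u x1) (w2u x1).
have tI : 0 <= tau <= e.
  by move: lo hi mu0 mue sge; rewrite /tau /=; clear; move=> *; apply/andP; split; lra.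
have [F2 _] := St zh q2 (ltW zr) tau tI.
have {}F2 := F2 ps; rewrite tauE in F2.
have wB : `|w1 (chart_inv c yh)| <= B + 2.
  exact: norm_near (uB _) (w1u _) e1.
have LF := L zh yh q2 q1 _ _ (ltW zr) yhr1 ltac:(by apply: le_trans q2K _; rewrite lerDl) q1K wB wB.
rewrite subrr normr0 addr0 in LF.
have qq : en (q2 - q1) <= 2 * sg.
  by rewrite /q1 opprD addrA subrr sub0r enN enZ normr_nat ler_pM2l.
have : C * (en (zh - yh) + en (q2 - q1)) <= C * (3 * sg).
  by rewrite ler_pM2l// enC; move: yz qq; clear; lra.
have : e * mu <= e * tau by rewrite ler_pM2l.
have := mulr_gt0 e0 mu0.
move: F1 F2 LF sgm; clear; lra.
Qed.

Lemma comparison H P u (B e e' : R) w1 w2 : compact [set: M] -> (forall x, `|u x| <= B) ->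
  0 < e <= 1 -> (forall x, good_at H P u (B + 2) e x) -> 0 <= e' <= e ->
  sol H P e' w1 -> sol H P e' w2 -> (forall x, `|w1 x - u x| <= e / 4) -> (forall x, `|w2 x - u x| <= e / 4) ->
  w1 = w2.
Proof.
move=> cM uB e0 good e'e s1 s2 h1 h2; apply/funext => x; apply/eqP; rewrite eq_le.
by rewrite (comparison_le cM uB e0 good e'e s1 s2 h1 h2) (comparison_le cM uB e0 good e'e s2 s1 h2 h1).
Qed.

End Static.

(** * Perron's method *)

Section Perron.
Context {R : realType} {n : nat} {M : manifold R n}.
Notation E := 'rV[R]_n.
Notation Z := (E * E * R)%type.
Implicit Types (x : M) (c d : chart M) (H P : cotangent M * R -> R) (w u v : M -> R).

Lemma chart_continuous c x (f : M -> R) : chart_dom c x ->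
  {for chart_map c x, continuous (f \o chart_inv c)} -> {for x, continuous f}.
Proof.
move=> xc fc; apply: (@near_eq_continuous _ _ ((f \o chart_inv c) \o chart_map c)).
  by apply: filterS (near_dom xc) => z zc /=; rewrite chart_mapK.
by apply: continuous_comp => //; exact: chart_map_continuous.
Qed.

Lemma Fc_near H P c (e : R) (y q : E) (s a : R) : family H P -> chart_range c y ->
  exists2 d : R, 0 < d & forall z p t, `|z - y| < d -> en (p - q) < d -> `|t - s| < d ->
    (Fc H P c e y q s < a -> Fc H P c e z p t < a) /\ (a < Fc H P c e y q s -> a < Fc H P c e z p t).
Proof.
move=> fHP yc; have cF := @Fc_continuous _ _ _ H P c e fHP y q s yc.
have [lt|lt|lt] := ltgtP (Fc H P c e y q s) a.
- have /nbhs_ballP[d /= d0 Hd] : \forall z \near ((y, q, s) : Z), Hc (perturb H P e) c z < a by exact: near_lt.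
  exists d => // z p t h1 h2 h3; split => // _; apply: (Hd (z, p, t)).
  rewrite -ball_normE /= distrC prod_normE gt_max prod_normE gt_max /=.
  by rewrite h1 h3 (le_lt_trans (norm_le_en _) h2).
- have /nbhs_ballP[d /= d0 Hd] : \forall z \near ((y, q, s) : Z), a < Hc (perturb H P e) c z by exact: near_gt.
  exists d => // z p t h1 h2 h3; split => // _; apply: (Hd (z, p, t)).
  rewrite -ball_normE /= distrC prod_normE gt_max prod_normE gt_max /=.
  by rewrite h1 h3 (le_lt_trans (norm_le_en _) h2).
- by exists 1 => // *; split.
Qed.

Lemma psup_nonneg (f : E -> R) (y q : E) : psup f y q ->
  exists2 N : R, 0 <= N & \forall z \near y, f z <= f y + dot q (z - y) + N * nsq (z - y).
Proof.
move=> [N HN]; exists `|N| => //; apply: filterS HN => z /le_trans; apply.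
by rewrite lerD2l ler_wpM2r ?nsq_ge0// ler_norm.
Qed.

(** If a paraboloid with slope d lies below f, and f lies below its tangent with slope p up to first
    order, then the slopes coincide: test in the direction d - p. *)
Lemma touch_gradient (f : E -> R) (y p d : E) (N : R) :
  (forall sg : R, 0 < sg -> \forall z \near y, f z <= f y + dot p (z - y) + sg * en (z - y)) ->
  (\forall z \near y, f y + dot d (z - y) - N * nsq (z - y) <= f z) -> d = p.
Proof.
move=> up lo; apply/eqP; rewrite -subr_eq0; apply/eqP/en_eq0/eqP.
rewrite eq_le en_ge0 andbT; apply/ler_addgt0Pr => sg sg0; rewrite add0r.
have [->|dp0] := eqVneq (d - p) 0; first by rewrite en0 ltW.
have e0 := en_gt0 dp0.
have [t0 t00 Ht] := near_line (d - p) (filterI (up sg sg0) lo).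
have t02 : 0 < t0 / 2 by rewrite divr_gt0.
rewrite -subr_le0 -(pmulr_rle0 _ e0).
apply: (@lin_ub_le0 _ _ (N * nsq (d - p)) _ t02) => t tp tt.
have [||h1 h2] := Ht t; [exact: ltW|lra|].
rewrite !addrKx in h1 h2; rewrite nsqZ !dotZr in h2; rewrite dotZr enZ gtr0_norm// in h1.
have h3 : dot d (d - p) - dot p (d - p) = en (d - p) * en (d - p).
  by rewrite -dotBl -expr2 en_sq.
rewrite -(ler_pM2l tp); move: h1 h2; rewrite mulrBr -h3; clear; lra.
Qed.


Definition perron H P u (e' dl : R) : set (M -> R) := [set w | [/\ continuous w, viscosity_subsolution (perturb H P e') w &
  forall x, u x - dl <= w x <= u x + dl]].

Definition perron_sup H P u (e' dl : R) x : R := sup [set w x | w in perron H P u e' dl].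

(** The condition e' <= e * dl balances the two errors: u - dl and u + dl are strict by e * dl for
    the unperturbed equation, and the perturbation costs at most e'. *)
Definition perron_setup H P u (B e e' dl : R) := [/\ family H P, sol H P 0 u, (forall x, `|u x| <= B),
  0 < e <= 1 /\ (forall x, good_at H P u (B + 2) e x) & [/\ 0 < dl, dl <= e, 0 <= e' & e' <= e * dl]].

Lemma u_strict H P u (B e e' dl : R) x : perron_setup H P u B e e' dl -> exists c r, [/\ chart_dom c x, 0 < r, cball (chart_map c x) r `<=` chart_range c &
  forall y p, `|y - chart_map c x| <= r ->
   (psub (u \o chart_inv c) y p -> 0 <= Fc H P c e' y p (u (chart_inv c y) + dl)) /\
   (psup (u \o chart_inv c) y p -> Fc H P c e' y p (u (chart_inv c y) - dl) <= 0)].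
Proof.
move=> S; have [fHP us uB [e01 good] [dl0 dle e'0 e'd]] := S.
have [c [K [xc _ Hg]]] := good x; case/andP: (e01) => e0 _.
have [|C [r [_ r0 yr _ Hw]]] := Hg 0; first by rewrite lexx ltW.
have [|_ St] := Hw u us; first by move=> z; rewrite subrr normr0 ltW.
exists c, r; split => // y p yy.
have [|h1 h2] := St y p yy dl; first by rewrite (ltW dl0) dle.
have FE s : Fc H P c e' y p s = Fc H P c 0 y p s + e' * P (bundle_inv c (y, p^T), s).
  by rewrite /Fc /Hc /perturb /= mul0r addr0.
have [_ _ _ _ P1] := fHP.
have Pb s : - e' <= e' * P (bundle_inv c (y, p^T), s) <= e'.
  rewrite -ler_norml normrM ger0_norm// ler_piMr//.
split=> hp; rewrite FE.
  have := h1 hp; have /andP[h3 _] := Pb (u (chart_inv c y) + dl); move: e'd h3; clear; lra.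
have := h2 hp; have /andP[_ h3] := Pb (u (chart_inv c y) - dl); move: e'd h3; clear; lra.
Qed.

Lemma perron_lower H P u (B e e' dl : R) : perron_setup H P u B e e' dl -> perron H P u e' dl (fun x => u x - dl).
Proof.
move=> S; have [fHP us uB [e01 good] [dl0 dle e'0 e'd]] := S.
have uc : continuous u by case: us.
split.
- by move=> x; apply: continuousB; [exact: uc|exact: cst_continuous].
- move=> f x fC fm; have [c [r [xc r0 yr Hs]]] := u_strict x S.
  apply: (@psup_viscosity _ _ _ (perturb H P e') (fun x => u x - dl) c x f xc _ _ _ fC fm).
  + by move=> y q s; exact: Fc_continuous.
  + by apply: nearW => z; apply: continuousB; [exact: uc|exact: cst_continuous].
  have nb : \forall y \near chart_map c x, `|y - chart_map c x| <= r.
    by apply: near_cball; rewrite subrr normr0.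
  apply: filterS nb => y yy q [N HN]; apply: (proj2 (Hs y q yy)).
  by exists N; apply: filterS HN => z /=; lra.
by move=> x; rewrite lexx/=; lra.
Qed.

Lemma perron_ub H P u (e' dl : R) w x : perron H P u e' dl w -> w x <= perron_sup H P u e' dl x.
Proof.
move=> Sw; apply: sup_upper_bound; last by exists w.
split; first by exists (w x); exists w.
by exists (u x + dl) => _ [w' [_ _ Hw'] <-]; case/andP: (Hw' x).
Qed.

Lemma perron_sup_le H P u (B e e' dl : R) x (a : R) : perron_setup H P u B e e' dl ->
  (forall w, perron H P u e' dl w -> w x <= a) -> perron_sup H P u e' dl x <= a.
Proof.
move=> S Ha; apply: sup_le_ub; first by exists (u x - dl); exists (fun x => u x - dl) => //; exact: perron_lower S.
by move=> _ [w Sw <-]; exact: Ha.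
Qed.

Lemma perron_between H P u (B e e' dl : R) x : perron_setup H P u B e e' dl ->
  u x - dl <= perron_sup H P u e' dl x <= u x + dl.
Proof.
move=> S; apply/andP; split; first by have := perron_ub x (perron_lower S).
by apply: (perron_sup_le S) => w [_ _ Hw]; case/andP: (Hw x).
Qed.

Lemma perron_adherent H P u (B e e' dl : R) x (eta : R) : perron_setup H P u B e e' dl -> 0 < eta ->
  exists2 w, perron H P u e' dl w & perron_sup H P u e' dl x - eta < w x.
Proof.
move=> S eta0; apply: contrapT => nex.
have : perron_sup H P u e' dl x <= perron_sup H P u e' dl x - eta.
  apply: (perron_sup_le S) => w Sw; rewrite leNgt; apply/negP => h; apply: nex; exists w => //.
by move: eta0; clear; lra.
Qed.

Lemma perron_e' H P u (B e e' dl : R) : perron_setup H P u B e e' dl -> 0 <= e' <= 1.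
Proof.
move=> [_ _ _ [/andP[h0 h1] _] [dl0 dle e'0 e'd]]; rewrite e'0 (le_trans e'd)//.
have := ler_wpM2l (ltW h0) dle; have := ler_wpM2l (ltW h0) h1; lra.
Qed.

Lemma perron_bound H P u (B e e' dl : R) w x : perron_setup H P u B e e' dl -> perron H P u e' dl w -> `|w x| <= B + 1.
Proof.
move=> [_ _ uB [/andP[_ h1] _] [dl0 dle _ _]] [_ _ Hw]; have := uB x; have := Hw x.
by rewrite !ler_norml => /andP[h2 h3] /andP[h4 h5]; apply/andP; split; lra.
Qed.

(** A supremum of functions with a common Lipschitz constant in each chart; no semicontinuous
    envelopes occur. *)
Lemma perron_sup_continuous H P u (B e e' dl : R) : perron_setup H P u B e e' dl -> continuous (perron_sup H P u e' dl).
Proof.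
move=> S; have [fHP us uB [e01 good] [dl0 dle e'0 e'd]] := S.
move=> x; have xc := chart_at_dom x; set c := chart_at x in xc.
have [r r0 yr] := chart_ball (chart_map_range xc).
have [K K1 HK] := family_lipschitz (B + 1) fHP r0 yr.
apply: (chart_continuous xc).
have lv : lip_on (perron_sup H P u e' dl \o chart_inv c) (chart_map c x) (r / 4) K.
  suff one (y z : E) : `|y - chart_map c x| <= r / 4 -> `|z - chart_map c x| <= r / 4 ->
      perron_sup H P u e' dl (chart_inv c y) <= perron_sup H P u e' dl (chart_inv c z) + K * en (y - z).
    move=> y z hy hz; have := one y z hy hz; have := one z y hz hy.
    by rewrite /= ler_norml (enC z y) => h1 h2; apply/andP; split; move: h1 h2; clear; lra.
  move=> hy hz; apply: (perron_sup_le S) => w Sw; have [wc ws _] := Sw.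
  have := HK e' w (perron_e' S) wc ws (fun x => perron_bound x S Sw) y z hy hz.
  by rewrite /= ler_norml => /andP[_]; have := perron_ub (chart_inv c z) Sw; clear; lra.
by apply: lip_continuous (le_trans ler01 K1) lv _; rewrite subrr normr0 divr_gt0.
Qed.

(** A member of the family within k ^ 2 of the supremum at y, minus a slightly more curved
    paraboloid, has a maximum within k of y; its supergradient there is close to q, where F would be
    positive. *)
Lemma perron_sup_psup H P u (B e e' dl : R) c (y q : E) : perron_setup H P u B e e' dl ->
  chart_range c y -> psup (perron_sup H P u e' dl \o chart_inv c) y q ->
  Fc H P c e' y q (perron_sup H P u e' dl (chart_inv c y)) <= 0.
Proof.
move=> S; have [fHP us uB [e01 good] [dl0 dle e'0 e'd]] := S.
set V := perron_sup H P u e' dl.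
move=> yc /psup_nonneg[N N0 HN]; rewrite leNgt; apply/negP => F0.
have [d d0 Hd] := Fc_near e' q (V (chart_inv c y)) 0 fHP yc.
have : \forall z \near y, V (chart_inv c z) <= V (chart_inv c y) + dot q (z - y) + N * nsq (z - y) /\ chart_range c z.
  by apply: filterS2 HN (near_chart_range yc).
move=> /near_normP[rho rho0 Hrho].
have rho2 : 0 < rho / 2 by rewrite divr_gt0.
have [k [k0 kb kM]] := @pick_small R (en q + 2 * (N + 1) + 1) (Num.min (rho / 4) (Num.min (d / 2) 1))
  ltac:(by rewrite !addr_ge0 ?en_ge0// mulr_ge0// addr_ge0) ltac:(by rewrite !lt_min ltr01 !divr_gt0).
have kr : k <= rho / 4 by min_ub kb.
have kd : k <= d / 2 by min_ub kb.
have k1 : k <= 1 by min_ub kb.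
have kMd : k * (en q + 2 * (N + 1) + 1) <= d / 2 by min_ub kM.
have [w Sw wy] := perron_adherent (chart_inv c y) S (exprn_gt0 2 k0).
have [wc ws _] := Sw.
pose g (z : E) := (w \o chart_inv c) z - dot q (z - y) - (N + 1) * nsq (z - y).
have inr (z : E) : `|z - y| <= rho / 2 -> `|z - y| < rho by move=> h; apply: le_lt_trans h _; lra.
have [||m mI mM] := @cball_max _ _ g y (rho / 2); first exact: ltW.
  move=> z /inr/Hrho[_ zc]; apply: continuousB; last exact: nsq_sub_continuous.
  by apply: continuousB; [apply: continuous_chart => //; exact: wc|exact: dot_sub_continuous].
have [vm mc] := Hrho m (inr _ mI).
have := mM y; rewrite /cball/= subrr normr0 => /(_ (ltW rho2)); rewrite /g /= subrr dot0r nsq0 mulr0 !subr0 => gm.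
have wm := perron_ub (chart_inv c m) Sw; rewrite -/V in wm wy.
have nm : nsq (m - y) <= k ^+ 2 by move: wy gm wm vm; clear; lra.
have em : en (m - y) <= k by rewrite -(@ler_pXn2r _ 2)// ?nnegrE ?en_ge0 ?(ltW k0)// en_sq.
have mr : `|m - y| < rho / 2 by apply: le_lt_trans (norm_le_en _) _; apply: le_lt_trans em _; move: kr rho0; clear; lra.
have ps : psup (w \o chart_inv c) m (q + (2 * (N + 1)) *: (m - y)).
  exists (N + 1); apply: filterS (near_cball mr) => z zz.
  have := mM z zz; rewrite /g (nsq_shift y m z) /=.
  have -> : dot q (z - y) = dot q (m - y) + dot q (z - m) by rewrite -dotDr -sub_split.
  rewrite (dotDl q) (dotZl (2 * (N + 1))); clear; lra.
have F1 : Fc H P c e' m (q + (2 * (N + 1)) *: (m - y)) (w (chart_inv c m)) <= 0 by exact: viscosity_psup.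
have dq : `|dot q (m - y)| <= k * en q.
  by apply: le_trans (abs_dot_le _ _) _; rewrite mulrC ler_wpM2r ?en_ge0.
have k2 : k ^+ 2 <= k by rewrite expr2 ler_piMl// ltW.
have Nn0 := mulr_ge0 N0 (nsq_ge0 (m - y)).
have Nk : N * nsq (m - y) <= N * k by rewrite ler_wpM2l// (le_trans nm).
have nn0 := nsq_ge0 (m - y).
have q0 := mulr_ge0 (ltW k0) (en_ge0 q).
have kN := mulr_ge0 (ltW k0) N0.
have a1 : `|m - y| < d by apply: le_lt_trans (norm_le_en _) _; apply: le_lt_trans em _; move: kd d0; clear; lra.
have a2 : en (q + (2 * (N + 1)) *: (m - y) - q) < d.
  rewrite addrKx enZ ger0_norm ?mulr_ge0 ?addr_ge0//.
  have h1 : 2 * (N + 1) * en (m - y) <= 2 * (N + 1) * k by rewrite ler_wpM2l// mulr_ge0// addr_ge0.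
  by apply: le_lt_trans h1 _; move: kMd q0 d0 k0; clear; lra.
have a3 : `|w (chart_inv c m) - V (chart_inv c y)| < d.
  move: dq; rewrite ler_norml ltr_norml => /andP[dq1 dq2].
  by move: vm wm gm wy k0 kMd d0 k2 Nn0 Nk nn0 dq1 dq2 q0 kN; clear; move=> *; apply/andP; split; lra.
have [_ Fpos] := Hd m _ _ a1 a2 a3.
by have := Fpos F0; rewrite ltNge F1.
Qed.

Lemma perron_sup_sub H P u (B e e' dl : R) : perron_setup H P u B e e' dl ->
  viscosity_subsolution (perturb H P e') (perron_sup H P u e' dl).
Proof.
move=> S; have [fHP us uB [e01 good] [dl0 dle e'0 e'd]] := S.
move=> f x fC fm; have xc := chart_at_dom x.
apply: (@psup_viscosity _ _ _ (perturb H P e') (perron_sup H P u e' dl) _ x f xc _ _ _ fC fm).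
- by move=> y q s; exact: Fc_continuous.
- by apply: nearW; exact: perron_sup_continuous S.
apply: filterS (near_chart_range (chart_map_range xc)) => y yc q.
exact: perron_sup_psup S yc.
Qed.

(* Replacing [v] by the maximum of [v] and [zeta] on the set where the chart [c] takes its
   values in the ball of radius [2 * k] yields again a subsolution. *)
Lemma bump_up H P c (e' k r : R) (y : E) v (zeta : E -> R) (D : E -> E) (N : R) : family H P ->
  continuous v -> viscosity_subsolution (perturb H P e') v -> 0 < k -> k < r -> cball y r `<=` chart_range c ->
  (forall z : E, {for z, continuous zeta}) ->
  (forall z : E, k < en (z - y) -> `|z - y| <= r -> zeta z < v (chart_inv c z)) ->
  (forall z : E, en (z - y) <= k -> Fc H P c e' z (D z) (zeta z) < 0) ->
  (forall z z' : E, zeta z + dot (D z) (z' - z) - N * nsq (z' - z) <= zeta z') ->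
  exists w : M -> R, [/\ continuous w, viscosity_subsolution (perturb H P e') w,
    forall x, v x <= w x, zeta y <= w (chart_inv c y) &
    forall x, w x = v x \/ exists2 z : E, en (z - y) <= k & x = chart_inv c z /\ w x = zeta z].
Proof.
move=> fHP vc vs k0 kr yr zc zv Fneg zlo.
pose A : set M := [set x | chart_dom c x /\ `|chart_map c x - y| < r].
pose K : set M := chart_inv c @` cball y k.
pose w x := if `[< A x >] then Num.max (v x) (zeta (chart_map c x)) else v x.
have r0 : 0 < r by exact: lt_trans k0 kr.
have KA x : K x -> A x.
  move=> [z zk <-]; have zr : `|z - y| < r by apply: le_lt_trans kr.
  have zcr : chart_range c z by apply: yr; exact: ltW.
  by split; [exact: chart_inv_dom|rewrite chart_invK].
have AK x : A x -> ~ K x -> zeta (chart_map c x) < v x.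
  move=> [xc xr] nK; have <- : chart_inv c (chart_map c x) = x by rewrite chart_mapK.
  rewrite chart_mapK//; have -> : v x = v (chart_inv c (chart_map c x)) by rewrite chart_mapK.
  apply: zv; last exact: ltW.
  rewrite ltNge; apply/negP => h; apply: nK; exists (chart_map c x); last by rewrite chart_mapK.
  by apply: le_trans (norm_le_en _) h.
have Aopen x : A x -> \forall x' \near x, A x'.
  by move=> [xc xr]; exact: near_chart_ball.
have Kc : closed K by apply: chart_cball_closed => z zk; apply: yr; apply: le_trans zk (ltW kr).
have wA x : A x -> w x = Num.max (v x) (zeta (chart_map c x)) by move=> Ax; rewrite /w; case: asboolP.
have wK x : ~ K x -> w x = v x.
  move=> nK; rewrite /w; case: asboolP => // Ax; apply/max_idPl/ltW; exact: AK.
have vw x : v x <= w x by rewrite /w; case: asboolP => // _; rewrite le_max lexx.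
exists w; split => //.
- move=> x; have [Ax|nAx] := pselect (A x).
    apply: (@near_eq_continuous _ _ (fun x' => Num.max (v x') (zeta (chart_map c x')))).
      by apply: filterS (Aopen x Ax) => x' Ax'; rewrite wA.
    apply: (@continuous_max _ _ v (zeta \o chart_map c)); first exact: vc.
    by apply: continuous_comp; [apply: chart_map_continuous; case: Ax|exact: zc].
  have nK : (~` K) x by move=> /KA.
  apply: (@near_eq_continuous _ _ v); last exact: vc.
  have : \forall x' \near x, (~` K) x' by apply: open_nbhs_nbhs; split => //; exact: closed_openC.
  by apply: filterS => x' h; rewrite wK.
- move=> f x fC fm.
  have vcase : w x = v x -> perturb H P e' (diff_at f x, w x) <= 0.
    move=> wx; rewrite wx; apply: (vs f x fC); apply: filterS fm => x'; rewrite wx.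
    by apply: le_trans; rewrite lerD2r.
  have [Kx|/wK wx] := pselect (K x); last exact: vcase.
  have Ax := KA x Kx; have [xc xr] := Ax; set z := chart_map c x in xr.
  have [h|h] := leP (zeta z) (v x).
    by apply: vcase; rewrite wA//; apply/max_idPl.
  have wx : w x = zeta z by rewrite wA//; apply/max_idPr/ltW.
  have zk : en (z - y) <= k.
    rewrite leNgt; apply/negP => zk; have := zv z zk (ltW xr).
    by rewrite /z chart_mapK// -/z ltNge (ltW h).
  have zc' := chart_map_range xc; rewrite -/z in zc'.
  have df : differentiable (f \o chart_inv c) z by have [h1 _] := fC c; apply: h1.
  (* Where w equals [zeta], the test function touches [zeta] from above, so its gradient is the
     slope of the paraboloid. *)
  have gE : D z = gradE (f \o chart_inv c) z.
    apply: (touch_gradient (N := N) (y := z) (f := f \o chart_inv c)).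
      move=> sg sg0; apply: filterS (differentiable_approx df sg0) => z' h1.
      rewrite dot_gradE /=.
      have : f (chart_inv c z') - f (chart_inv c z) - 'd (f \o chart_inv c) z (z' - z) <= sg * en (z' - z).
        by apply: le_trans (ler_norm _) _; apply: le_trans h1 _; rewrite ler_wpM2l ?norm_le_en// ltW.
      move: ('d _ _ _) => a; clear; lra.
    have fm2 : \forall z' \near z, w (chart_inv c z') - f (chart_inv c z') <= w x - f x.
      by move: fm; rewrite (near_chart _ xc).
    have A2 : \forall z' \near z, A (chart_inv c z') by move: (Aopen x Ax); rewrite (near_chart _ xc).
    apply: filterS3 fm2 A2 (near_chart_range zc') => z' h1 h2 h3.
    have : zeta z' <= w (chart_inv c z') by rewrite wA// chart_invK// le_max lexx orbT.
    have := zlo z z'; move: h1; rewrite wx /= /z chart_mapK// -/z; clear; lra.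
  rewrite (diff_at_chart xc df) -/z -gE wx.
  exact: ltW (Fneg z zk).
- have Ky : K (chart_inv c y) by exists y => //; rewrite /cball/= subrr normr0 ltW.
  have yc : chart_range c y by apply: yr; rewrite /cball/= subrr normr0 ltW.
  by rewrite (wA _ (KA _ Ky)) chart_invK// le_max lexx orbT.
- move=> x; have [Kx|/wK] := pselect (K x); last by left.
  have Ax := KA x Kx; have [xc xr] := Ax; set z := chart_map c x in xr.
  have [h|h] := leP (zeta z) (v x).
    by left; rewrite wA//; apply/max_idPl.
  have wx : w x = zeta z by rewrite wA//; apply/max_idPr/ltW.
  right; exists z; last by rewrite /z chart_mapK.
  rewrite leNgt; apply/negP => zk; have := zv z zk (ltW xr).
  by rewrite /z chart_mapK// -/z ltNge (ltW h).
Qed.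

Lemma psub_nonneg (f : E -> R) (y q : E) : psub f y q ->
  exists2 N : R, 0 <= N & \forall z \near y, f y + dot q (z - y) - N * nsq (z - y) <= f z.
Proof.
move=> [N HN]; exists `|N| => //; apply: filterS HN => z; apply: le_trans.
by rewrite lerD2l lerN2 ler_wpM2r ?nsq_ge0// ler_norm.
Qed.

(** Where the supremum meets u + dl, its subgradient is one of u and strictness of u + dl applies.
    Elsewhere a failing inequality allows the supremum to be raised by a small paraboloid within the
    family, against its maximality. *)
Lemma perron_sup_psub H P u (B e e' dl : R) x0 : perron_setup H P u B e e' dl ->
  exists2 c, chart_dom c x0 & psub_super_near (perturb H P e') (perron_sup H P u e' dl) c x0.
Proof.
move=> S; have [fHP us uB [e01 good] [dl0 dle e'0 e'd]] := S.
have uc : continuous u by case: us.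
set V := perron_sup H P u e' dl.
have [c [r [xc r0 yr Hs]]] := u_strict x0 S; exists c => //.
have nb : \forall y \near chart_map c x0, `|y - chart_map c x0| <= r by apply: near_cball; rewrite subrr normr0.
apply: filterS nb => y yr0 q ps; rewrite leNgt; apply/negP => F0.
have yc : chart_range c y by exact: yr.
have /andP[_ Vu] := perron_between (chart_inv c y) S; rewrite -/V in Vu.
move: Vu; rewrite le_eqVlt => /orP[/eqP Vu|Vu].
  have [h _] := Hs y q yr0.
  have : psub (u \o chart_inv c) y q.
    case: ps => N HN; exists N; apply: filterS HN => z /=; rewrite Vu.
    have /andP[_] := perron_between (chart_inv c z) S; rewrite -/V; clear; lra.
  by move=> /h; rewrite -Vu leNgt F0.
have {ps}[N N0 HN] := psub_nonneg ps.
have [d d0 Hd] := Fc_near e' q (V (chart_inv c y)) 0 fHP yc.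
(* Half the distance to the upper obstacle u + dl, so that the raised function stays below it. *)
set g0 := (u (chart_inv c y) + dl - V (chart_inv c y)) / 2.
have g00 : 0 < g0 by rewrite divr_gt0// subr_gt0.
have nu : \forall z \near y, V (chart_inv c y) + g0 - dl < u (chart_inv c z).
  apply: (@near_gt _ _ (u \o chart_inv c)); first by apply: continuous_chart => //; exact: uc.
  by rewrite /g0 /=; move: Vu; clear; lra.
clearbody g0.
have : \forall z \near y, [/\ V (chart_inv c y) + dot q (z - y) - N * nsq (z - y) <= V (chart_inv c z), chart_range c z &
    V (chart_inv c y) + g0 - dl < u (chart_inv c z)].
  by apply: filterS3 HN (near_chart_range yc) nu.
move=> /near_normP[rho rho0 Hrho].
have [k [k0 kb kM]] := @pick_small R (en q + 2 * (N + 1) + 1) (Num.min (Num.min (rho / 4) 1) (Num.min (d / 2) (g0 / 2)))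
  ltac:(by rewrite !addr_ge0 ?en_ge0// mulr_ge0// addr_ge0) ltac:(by rewrite !lt_min ltr01 !divr_gt0).
have kr : k <= rho / 4 by min_ub kb.
have k1 : k <= 1 by min_ub kb.
have kd : k <= d / 2 by min_ub kb.
have kMd : k * (en q + 2 * (N + 1) + 1) <= d / 2 by min_ub kM.
have kMg : k * (en q + 2 * (N + 1) + 1) <= g0 / 2 by min_ub kM.
(* It exceeds the supremum by k ^ 2 at y, and its curvature N + 1 instead of N brings it below the
   supremum beyond the radius k. *)
pose zeta (z : E) := V (chart_inv c y) + k ^+ 2 + dot q (z - y) - (N + 1) * nsq (z - y).
pose D (z : E) : E := q - (2 * (N + 1)) *: (z - y).
have k2 : k ^+ 2 <= k by rewrite expr2 ler_piMl// ltW.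
have kk0 : 0 < k ^+ 2 by rewrite exprn_gt0.
have q0 := mulr_ge0 (ltW k0) (en_ge0 q).
have kN := mulr_ge0 (ltW k0) N0.
have dq (z : E) : en (z - y) <= k -> `|dot q (z - y)| <= k * en q.
  by move=> zk; apply: le_trans (abs_dot_le _ _) _; rewrite mulrC ler_wpM2r ?en_ge0.
have nz (z : E) : en (z - y) <= k -> nsq (z - y) <= k ^+ 2.
  by move=> zk; rewrite -en_sq ler_pXn2r// nnegrE ?en_ge0// ltW.
have kk1 : (N + 1) * k ^+ 2 <= (N + 1) * k by rewrite ler_wpM2l// addr_ge0.
have zb (z : E) : en (z - y) <= k -> `|zeta z - V (chart_inv c y)| <= k * (en q + 2 * (N + 1)) .
  move=> zk; have := dq z zk; have := nsq_ge0 (z - y).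
  have : (N + 1) * nsq (z - y) <= (N + 1) * k ^+ 2 by rewrite ler_wpM2l ?nz// addr_ge0.
  have : 0 <= (N + 1) * nsq (z - y) by rewrite mulr_ge0 ?nsq_ge0// addr_ge0.
  rewrite !ler_norml /zeta => h0 h1 h2 /andP[h3 h4]; move: h0 h1 h2 h3 h4 kk1 k2 kk0 kN q0 k0; clear.
  by move=> *; apply/andP; split; lra.
have zr (z : E) : `|z - y| <= rho / 2 -> `|z - y| < rho by move=> h; apply: le_lt_trans h _; move: rho0; clear; lra.
have zrk (z : E) : en (z - y) <= k -> `|z - y| < rho.
  by move=> h; apply: zr; apply: le_trans (norm_le_en _) _; apply: le_trans h _; move: rho0 kr; clear; lra.
have kr2 : k < rho / 2 by move: rho0 kr; clear; lra.
have [|||||w [wc ws vw zw wcase]] := @bump_up H P c e' k (rho / 2) y V zeta D (N + 1) fHP (perron_sup_continuous S) (perron_sup_sub S) k0 kr2.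
- by move=> z /zr/Hrho[].
- move=> z; apply: continuousB; last exact: nsq_sub_continuous.
  by apply: continuousD; [exact: cst_continuous|exact: dot_sub_continuous].
- move=> z kz /zr/Hrho[h _ _]; apply: lt_le_trans h.
  have : k ^+ 2 < nsq (z - y) by rewrite -en_sq ltr_pXn2r// nnegrE ?en_ge0// ltW.
  by rewrite /zeta; clear; lra.
- move=> z zk; have [|||h _] := Hd z (D z) (zeta z); last exact: h.
  + by apply: le_lt_trans (norm_le_en _) _; apply: le_lt_trans zk _; move: kd d0; clear; lra.
  + rewrite /D addrC addKr enN enZ ger0_norm ?mulr_ge0 ?addr_ge0//.
    have h1 : 2 * (N + 1) * en (z - y) <= 2 * (N + 1) * k by rewrite ler_wpM2l// mulr_ge0// addr_ge0.
    by apply: le_lt_trans h1 _; move: kMd q0 d0 k0; clear; lra.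
  + by apply: le_lt_trans (zb z zk) _; move: kMd d0 k0; clear; lra.
- move=> z z'; rewrite /zeta /D (nsq_shift y z z').
  have -> : dot q (z' - y) = dot q (z - y) + dot q (z' - z) by rewrite -dotDr -sub_split.
  rewrite (dotBl q) (dotZl (2 * (N + 1))); clear; lra.
have Sw : perron H P u e' dl w.
  split => // x; have /andP[h1 h2] := perron_between x S; rewrite -/V in h1 h2.
  rewrite (le_trans h1 (vw x))/=; case: (wcase x) => [->//|[z zk [-> ->]]].
  have [_ _ h] := Hrho z (zrk z zk).
  have := zb z zk; rewrite ler_norml => /andP[_]; move: h kMg g00 k0; clear; lra.
have := perron_ub (chart_inv c y) Sw; rewrite -/V.
move: zw; rewrite /zeta subrr dot0r nsq0 mulr0 subr0 addr0; move: kk0; clear; lra.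
Qed.

Lemma existence H P u (B e e' dl : R) : perron_setup H P u B e e' dl ->
  exists2 v, sol H P e' v & forall x, `|v x - u x| <= dl.
Proof.
move=> S; have [fHP us uB [e01 good] [dl0 dle e'0 e'd]] := S.
exists (perron_sup H P u e' dl); last first.
  move=> x; have /andP[h1 h2] := perron_between x S; rewrite ler_norml.
  by move: h1 h2; clear; move=> *; apply/andP; split; lra.
split; [exact: perron_sup_continuous S|exact: perron_sup_sub S|].
move=> f x fC fm; have [c xc sp] := perron_sup_psub x S.
apply: (@psub_viscosity _ _ _ (perturb H P e') (perron_sup H P u e' dl) c x f xc _ _ sp fC fm).
- by move=> y q s; exact: Fc_continuous.
- by apply: nearW; exact: perron_sup_continuous S.
Qed.

End Perron.

(** * The Lagrangian *)

Section UniformLipschitz.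
Context {R : realType} {n : nat} {M : manifold R n}.
Notation E := 'rV[R]_n.
Notation Z := (E * E * R)%type.
Implicit Types (x : M) (c d : chart M) (G H P : cotangent M * R -> R).

Lemma cotangent_chart c x (p : 'cV[R]_n) : chart_dom c x ->
  exists q : E, Cotangent x p = bundle_inv c (chart_map c x, q^T).
Proof.
move=> xc; exists (change_jac c (chart_at x) x *m p)^T.
rewrite bundle_inv_chart// trmxK mulmxA change_jacK ?mul1mx//; exact: chart_at_dom.
Qed.

Definition ulip G (lam : R) := forall z (s s' : R), `|G (z, s) - G (z, s')| <= lam * `|s - s'|.

Lemma partial_u_ulip G (lam : R) : of_class_bundle 1 G -> (forall z, `|partial_u G z| <= lam) -> ulip G lam.
Proof.
move=> GC Hl [x p] s s'.
have [q qE] := cotangent_chart p (chart_at_dom x); rewrite qE.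
have yc := chart_map_range (chart_at_dom x); move: (chart_map _ _) yc => y yc.
wlog ss : s s' / s' <= s.
  by move=> W; have [/W//|/ltW/W] := leP s' s; rewrite distrC (distrC s').
have [t _] := Hc_u_MVT q GC yc ss; rewrite /Hc /= => ->.
rewrite -(partial_u_dd _ _ GC yc) normrM mulrC ler_wpM2r//.
Qed.

Lemma partial_u_near0 G (z : cotangent M * R) : (\forall z' \near z, G z' = 0) -> partial_u G z = 0.
Proof.
case: z => z s [[A1 A2] [/= n1 n2] AA]; rewrite /partial_u /=.
have ns : \forall t \near s, (fun=> 0 : R) t = G (z, t).
  by apply: filterS n2 => t At; rewrite AA//; split => //=; exact: nbhs_singleton.
have dc : differentiable (cst 0 : R -> R) s by exact: differentiable_cst.
have [h1 h2] := near_eq_dd ns dc.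
rewrite derive1E; apply: etrans (deriveE _ h1) _; apply: etrans (h2 1) _.
by rewrite /dd diff_cst.
Qed.

(** A neighborhood in [cotangent M] must be open in every bundle chart at once. The set of covectors
    at which the strict bound holds for all s in a compact interval is such a set. *)
Lemma partial_u_near_bounded G (z : cotangent M * R) : of_class_bundle 1 G -> exists C : R, \forall z' \near z, `|partial_u G z'| <= C.
Proof.
move=> GC; case: z => [[x p] s0].
have cont d (y : E) (q : 'cV[R]_n) (s : R) : chart_range d y ->
    {for (y, q, s), continuous (fun z : E * 'cV[R]_n * R => dd (Hc G d) (z.1.1, z.1.2^T, z.2) (0, 0, 1))}.
  move=> yd; have [_ h] := Hc_class d GC.
  apply: (@continuous_comp _ _ _ (fun z : E * 'cV[R]_n * R => (z.1.1, z.1.2^T, z.2)) (fun z : Z => dd (Hc G d) z (0, 0, 1))).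
    exact: trmx_fiber_continuous.
  by apply: h.
pose I : set R := `[s0 - 1, s0 + 1]%classic.
have cI : compact I by exact: segment_compact.
have pE d (y : E) (q : 'cV[R]_n) (s : R) : chart_range d y ->
    partial_u G (bundle_inv d (y, q), s) = dd (Hc G d) (y, q^T, s) (0, 0, 1).
  by move=> yd; rewrite -(partial_u_dd _ _ GC yd) trmxK.
have [q qE] := cotangent_chart p (chart_at_dom x); rewrite qE.
have yc := chart_map_range (chart_at_dom x); move: (chart_at x) (chart_map _ _) yc => c y yc.
have [C C0 HC] : exists2 C : R, 0 < C & forall s, I s -> `|partial_u G (bundle_inv c (y, q^T), s)| < C.
  apply: compact_unif => //; first by move=> C C' s CC /lt_le_trans; apply.
  move=> s _; have /cvgr_norm_lt : {for s, continuous (fun s => dd (Hc G c) (y, q^T^T, s) (0, 0, 1))}.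
    apply: (@continuous_comp _ _ _ (fun s : R => (y, q^T, s)) (fun z : E * 'cV[R]_n * R => dd (Hc G c) (z.1.1, z.1.2^T, z.2) (0, 0, 1))); last exact: cont.
    move=> B [[N1 N2] [/= n1 n2] NN]; apply: filterS n2 => t Nt.
    by apply: (NN (_, t)); split => //=; exact: nbhs_singleton.
  move=> h; exists (`|dd (Hc G c) (y, q^T^T, s) (0, 0, 1)| + 1).
  have {}h := h (`|dd (Hc G c) (y, q^T^T, s) (0, 0, 1)| + 1) ltac:(by rewrite ltrDl ltr01).
  by apply: filterS h => s' /=; rewrite pE.
exists C; pose A : set (cotangent M) := [set z | forall s, I s -> `|partial_u G (z, s)| < C].
have Ao : open A.
  move=> d; rewrite openE => -[y' q'] [[yd _] Az].
  have : \forall z \near (y', q'), I `<=` [set s | `|dd (Hc G d) (z.1, z.2^T, s) (0, 0, 1)| < C].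
    move/compact_near_coveringP : cI => /(_ _ (nbhs (y', q')) (fun z s => `|dd (Hc G d) (z.1, z.2^T, s) (0, 0, 1)| < C)).
    apply => s Is.
    have : \forall z \near (y', q', s), `|dd (Hc G d) (z.1.1, z.1.2^T, z.2) (0, 0, 1)| < C.
      have Azs : `|dd (Hc G d) (y', q'^T, s) (0, 0, 1)| < C by rewrite -pE//; exact: Az.
      by have /cvgr_norm_lt h := cont d y' q' s yd; exact: (h C Azs).
    move=> [[N1 N2] [/= n1 n2] NN]; exists (N2, N1) => // -[a b] [/= h1 h2].
    exact: (NN (b, a)).
  have nr : \forall z \near (y', q'), chart_range d z.1.
    exists (chart_range d, setT) => /=; first by split; [exact: near_chart_range|exact: filterT].
    by move=> [a b] [].
  apply: filterS2 nr => -[a b] /= ad h; split => // s Is.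
  by have := h s Is; rewrite /= -pE.
exists (A, I) => /=.
  split; first by apply: open_nbhs_nbhs; split => // s Is; exact: HC.
  apply/nbhs_ballP; exists 1; first exact: ltr01.
  by move=> t; rewrite -ball_normE /I /= in_itv/= ltr_norml => /andP[h1 h2]; apply/andP; split; lra.
by move=> [z s] [/= Az Is]; rewrite ltW// Az.
Qed.

(** On the compact support local bounds become uniform; off the support the derivative vanishes. *)
Lemma partial_u_bounded P : of_class_bundle 1 P -> compact (supp P) ->
  exists2 lam : R, 0 < lam & forall z, `|partial_u P z| <= lam.
Proof.
move=> PC cP.
have [|z _|lam l0 Hl] := @compact_unif R _ (supp P) (fun C z => `|partial_u P z| <= C) cP.
- by move=> C C' z CC /le_trans; apply.
- exact: partial_u_near_bounded.
exists lam => // z; have [/Hl//|nz] := pselect (supp P z).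
rewrite partial_u_near0 ?normr0 ?ltW//.
have : \forall z' \near z, (~` supp P) z'.
  by apply: open_nbhs_nbhs; split => //; apply: closed_openC; exact: closed_closure.
apply: filterS => z' nz'; apply/eqP; apply: contrapT => /negP h; apply: nz'.
exact: subset_closure.
Qed.

End UniformLipschitz.

Section LagrangianChart.
Context {R : realType} {n : nat} {M : manifold R n}.
Notation E := 'rV[R]_n.
Implicit Types (x : M) (c d : chart M) (G : cotangent M * R -> R) (gam : R -> M).

(** The Legendre transform of G in the chart c. *)
Definition Lc G c (y v : E) (s : R) : \bar R :=
  ereal_sup [set (dot v q - Hc G c (y, q, s))%:E | q in [set: E]].

Lemma derive1_dd (f : R -> E) (t : R) : derivable f t 1 -> differentiable f t /\ derive1 f t = dd f t 1.
Proof.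
move=> h; have df : differentiable f t by exact/derivable1_diffP.
by split => //; rewrite derive1E; exact: deriveE.
Qed.

Lemma velocity_chart c gam (t : R) : (\forall t' \near t, chart_dom c (gam t')) ->
  derivable (chart_map c \o gam) t 1 ->
  velocity gam t = derive1 (chart_map c \o gam) t *m change_jac c (chart_at (gam t)) (gam t).
Proof.
move=> nt dg; have [df fE] := derive1_dd dg.
have xc := nbhs_singleton nt; have xa := chart_at_dom (gam t).
rewrite /velocity; set a := chart_at (gam t) in xa *.
have ne : \forall t' \near t, (trans c a \o (chart_map c \o gam)) t' = (chart_map a \o gam) t'.
  by apply: filterS nt => t' tc; rewrite /= transE.
have dt := trans_differentiable xc xa.
have [d1 d1E] := near_eq_dd ne (differentiable_comp df dt).
have [_ ->] := derive1_dd (proj2 (derivable1_diffP _ _) d1).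
rewrite d1E; apply: etrans (dd_comp df dt _) _; rewrite fE.
exact: diff_trans.
Qed.

Lemma pairing_chart c x (v q : E) : chart_dom c x ->
  pairing x (v *m change_jac c (chart_at x) x) (change_jac (chart_at x) c x *m q^T) = dot v q.
Proof.
move=> xc; rewrite /pairing mulmxA -(mulmxA v) change_jacK//; last exact: chart_at_dom.
by rewrite mulmx1 /dot mxE; apply: eq_bigr => i _; rewrite !mxE.
Qed.

(** [velocity] is computed in the chart of the current point, which jumps along the curve. Where the
    curve is differentiable, the pairing of a velocity and a covector does not depend on the
    chart. *)
Lemma lagrangian_chart G c gam (t s : R) : (\forall t' \near t, chart_dom c (gam t')) ->
  derivable (chart_map c \o gam) t 1 ->
  lagrangian G (gam t) (velocity gam t) s = Lc G c (chart_map c (gam t)) (derive1 (chart_map c \o gam) t) s.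
Proof.
move=> nt dg; rewrite (velocity_chart nt dg); move: (derive1 _ _) => v.
have xc := nbhs_singleton nt; move: (gam t) xc => x xc.
have term (q : E) : pairing x (v *m change_jac c (chart_at x) x) (change_jac (chart_at x) c x *m q^T) -
    G (Cotangent x (change_jac (chart_at x) c x *m q^T), s) = dot v q - Hc G c (chart_map c x, q, s).
  have hH : Hc G c (chart_map c x, q, s) = G (Cotangent x (change_jac (chart_at x) c x *m q^T), s) :=
    congr1 (fun z => G (z, s)) (bundle_inv_chart q^T xc).
  by rewrite hH pairing_chart.
rewrite /lagrangian /Lc; congr ereal_sup; apply/seteqP; split => _ [p _ <-].
  have [q qE] := cotangent_chart p xc.
  exists q => //; rewrite -term.
  have -> : p = change_jac (chart_at x) c x *m q^T by move: qE; rewrite bundle_inv_chart// => -[].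
  by [].
exact: (ex_intro2 _ _ (change_jac (chart_at x) c x *m p^T) I (congr1 (fun r : R => r%:E) (term p))).
Qed.

Lemma lagrangian_ge G x v (s : R) : ((- G (Cotangent x 0, s))%:E <= lagrangian G x v s)%E.
Proof.
apply: ereal_sup_ubound; exists 0 => //.
by rewrite /pairing mulmx0 mxE sub0r.
Qed.

Lemma lagrangian_ulip G (lam : R) x v (s s' : R) : ulip G lam ->
  (lagrangian G x v s <= lagrangian G x v s' + (lam * `|s - s'|)%:E)%E.
Proof.
move=> Hl; apply: ge_ereal_sup => _ [p _ <-].
apply: (@le_trans _ _ ((pairing x v p - G (Cotangent x p, s'))%:E + (lam * `|s - s'|)%:E)%E).
  rewrite lee_fin; have := Hl (Cotangent x p) s s'; rewrite ler_norml => /andP[]; lra.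
by rewrite leeD2r//; apply: ereal_sup_ubound; exists p.
Qed.

Lemma Lc_le G c (y v : E) (s k : R) : (forall q, dot v q - Hc G c (y, q, s) <= k) -> (Lc G c y v s <= k%:E)%E.
Proof. by move=> h; apply: ge_ereal_sup => _ [q _ <-]; rewrite lee_fin. Qed.

Lemma Lc_ge G c (y v q : E) (s : R) : ((dot v q - Hc G c (y, q, s))%:E <= Lc G c y v s)%E.
Proof. by apply: ereal_sup_ubound; exists q. Qed.

(** The part of the data on which the construction of the evolution rests, with constants local in
    charts. Convexity enters the evolution later, as the supporting slope g of [evolution_psup]. *)
Definition evo_ham G (lam : R) := [/\ 0 < lam, ulip G lam,
  forall c (y0 : E) (r B A : R), cball y0 r `<=` chart_range c -> exists2 C : R, 0 < C &
    forall (y q : E) (s : R), `|y - y0| <= r -> `|s| <= B -> A * en q - C <= Hc G c (y, q, s),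
  forall c (y0 : E) (r B K : R), cball y0 r `<=` chart_range c -> exists2 C : R, 0 < C &
    ham_lip (fun y q s => Hc G c (y, q, s)) y0 r B K C &
  forall c (y q : E) (s : R), chart_range c y -> {for (y, q, s), continuous (Hc G c)}].

Lemma perturb_evo H P (lamH lamP e : R) : family H P -> 0 <= e <= 1 -> 0 < lamH -> ulip H lamH -> 0 < lamP -> ulip P lamP ->
  evo_ham (perturb H P e) (lamH + lamP).
Proof.
move=> fHP e01 h0 hl p0 pl; split; first exact: addr_gt0.
- move=> z s s'; rewrite /perturb opprD addrACA -mulrBr; apply: le_trans (ler_normD _ _) _.
  rewrite mulrDl lerD// normrM; case/andP: e01 => e0 e1; rewrite ger0_norm//.
  by apply: le_trans (ler_piMl (normr_ge0 _) e1) (pl _ _ _).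
- move=> c y0 r B A yr; have [C C0 HC] := @family_superlin _ _ _ H P c y0 r B A fHP yr.
  by exists C => // y q s; exact: HC.
- by move=> c y0 r B K yr; exact: perturb_lip.
- by move=> c y q s; exact: Fc_continuous.
Qed.

(** The momentum p = 0 bounds the Lagrangian from below by -G(x, 0, s), so all costs are bounded
    below and their integrals can be split and compared. *)
Lemma zero_section_bound G (lam B : R) : compact [set: M] -> evo_ham G lam ->
  exists2 C : R, 0 < C & forall x (s : R), `|s| <= B -> `|G (Cotangent x 0, s)| <= C.
Proof.
move=> cM [_ _ _ lG cG].
have [|x _|C C0 HC] := @compact_unif R M [set: M] (fun C x => forall s, `|s| <= B -> `|G (Cotangent x 0, s)| <= C) cM.
- by move=> C C' x CC h s sB; apply: le_trans (h s sB) CC.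
- have xc := chart_at_dom x; move: (chart_at x) xc => c xc.
  have [r r0 yr] := chart_ball (chart_map_range xc).
  have [C C0 L] := lG c _ r B 0 yr.
  exists (`|Hc G c (chart_map c x, 0, 0)| + C * (1 + `|B|)).
  have n1 : \forall y \near chart_map c x, 1 * en (y - chart_map c x) < 1.
    by apply: near_lt; [exact: en_sub_continuous|rewrite subrr en0 mulr0].
  have n2 : \forall y \near chart_map c x, `|y - chart_map c x| <= r by apply: near_cball; rewrite subrr normr0.
  apply/(near_chart _ xc); apply: filterS3 n1 n2 (near_chart_range (chart_map_range xc)) => y y1 yy yc s sB.
  rewrite mul1r in y1.
  have -> : G (Cotangent (chart_inv c y) 0, s) = Hc G c (y, 0, s).
    by rewrite /Hc /bundle_inv /= trmx0 mulmx0.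
  have B0 : 0 <= B by exact: le_trans (normr_ge0 _) sB.
  have z0 : en (0 : E) <= 0 by rewrite en0.
  have y0 : `|chart_map c x - chart_map c x| <= r by rewrite subrr normr0 ltW.
  have b0 : `|0 : R| <= B by rewrite normr0.
  have h1 := L _ _ _ _ _ _ yy y0 z0 z0 sB b0; have h2 := L _ _ _ _ _ _ y0 yy z0 z0 b0 sB.
  have h3 : C * (en (y - chart_map c x) + en (0 - 0 : E) + `|s - 0|) <= C * (1 + `|B|).
    by rewrite ler_pM2l// subrr en0 addr0 subr0 (ger0_norm B0) lerD// ltW.
  have h4 : C * (en (chart_map c x - y) + en (0 - 0 : E) + `|0 - s|) <= C * (1 + `|B|).
    by rewrite enC distrC.
  have := ler_norm (Hc G c (chart_map c x, 0, 0)); have := ler_norm (- Hc G c (chart_map c x, 0, 0)); rewrite normrN.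
  rewrite ler_norml; move: h1 h2 h3 h4; clear; move=> *; apply/andP; split; lra.
by exists C => // x s sB; exact: HC.
Qed.

End LagrangianChart.

(** * Curves and their action *)

Section ScalarAC.
Context {R : realType}.
Notation mu := (@lebesgue_measure R).

Definition sac (a b : R) (g : R -> R) := forall e : R, 0 < e -> exists2 d : R, 0 < d &
  forall (m : nat) (l r : 'I_m -> R), (forall k, [/\ a <= l k, l k <= r k & r k <= b]) ->
    trivIset [set: 'I_m] (fun k => `]l k, r k[%classic) ->
    \sum_(k < m) (r k - l k) < d -> \sum_(k < m) `|g (r k) - g (l k)| < e.

Lemma clamp_continuous (a b : R) : a <= b -> continuous (clamp a b).
Proof.
by move=> ab x; apply: continuous_max; [exact: cst_continuous|apply: continuous_min; [exact: cst_continuous|exact: cvg_id]].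
Qed.

Lemma within_clamp (T : topologicalType) (a b : R) (f : R -> T) : a <= b ->
  {within `[a, b], continuous f} -> continuous (f \o clamp a b).
Proof.
move=> ab /subspace_continuousP cf x A nA.
have xab : `[a, b]%classic (clamp a b x) by rewrite /= in_itv/=; exact: clamp_itv.
have h : \forall y \near x, `[a, b]%classic (clamp a b y) -> A (f (clamp a b y)) := clamp_continuous ab (cf _ xab A nA).
suff : \forall y \near x, A (f (clamp a b y)) by [].
apply: filterS h => y; apply.
by rewrite /= in_itv/=; exact: clamp_itv.
Qed.

Lemma near_clamp (a b t : R) : a < t < b -> \forall s \near t, clamp a b s = s.
Proof.
move=> tab; have := near_in_itvoo (_ : t \in `]a, b[); rewrite in_itv/= => /(_ tab).
by apply: filterS => s; rewrite in_itv/= => /andP[h1 h2]; rewrite clamp_id// !ltW.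
Qed.

Lemma ends_null (a b : R) (N : set R) : measurable N -> mu N = 0%E ->
  measurable (N `|` [set a; b]) /\ mu (N `|` [set a; b]) = 0%E.
Proof.
move=> mN N0; have m2 : measurable ([set a; b] : set R) by exact: measurableU.
have h1 : mu [set a] = 0%E := lebesgue_measure_set1 a.
have h2 : mu [set b] = 0%E := lebesgue_measure_set1 b.
have h3 : mu [set a; b] = 0%E by apply/eqP; rewrite measureU0//; exact/eqP.
by split; [exact: measurableU|apply/eqP; rewrite measureU0//; exact/eqP].
Qed.

(** The density of the clamped function. Clamping spoils the derivative at the two ends, which
    therefore join the null set. *)
Lemma sac_density (a b : R) (g : R -> R) : a <= b -> sac a b g ->
  exists (h : R -> R) (N : set R), [/\ mu.-integrable [set: R] (EFin \o h), measurable N, mu N = 0%E,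
    (\int[mu]_(t in `[a, b]) (h t)%:E = (g b - g a)%:E)%E &
    forall t, a <= t <= b -> ~ N t -> a < t < b /\ derivable g t 1 /\ derive1 g t = h t].
Proof.
move=> ab sg; have ac := acR_clamp ab sg.
have [|h [hi hI [N [mN N0 HN]]]] := acR_density ab ac.
  by move=> x; rewrite /= (clamp_id (clamp_itv ab x)).
have [mN' N'0] := ends_null a b mN N0.
exists h, (N `|` [set a; b]); split => //.
  have := hI a b ab; rewrite /= !clamp_id ?lexx ?ab// => <-.
  rewrite integral_itv_obnd_cbnd//; apply: measurable_funTS.
  exact: measurable_int hi.
move=> t /andP[ta tb] /not_orP[nN /not_orP[/= na nb]].
have tab : a < t < b by rewrite !lt_neqAle ta tb !andbT eq_sym; apply/andP; split; apply/eqP.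
have [dt dE] : derivable (g \o clamp a b) t 1 /\ derive1 (g \o clamp a b) t = h t.
  by apply: contrapT => h1; apply: nN; apply: HN.
have ne : \forall s \near t, (g \o clamp a b) s = g s.
  by apply: filterS (near_clamp tab) => s /= ->.
have [h1 h2] := near_eq_dd ne (proj1 (derivable1_diffP _ _) dt).
split => //; split; first exact/derivable1_diffP.
rewrite -dE !derive1E; apply: etrans (deriveE _ h1) _; apply: etrans (h2 1) _.
by apply/esym; exact: (deriveE _ (proj1 (derivable1_diffP _ _) dt)).
Qed.

(** A property of segments that is local and survives concatenation holds on [a, b]: a Lebesgue
    number d allows progress by steps of length d. It reduces statements on curves to one chart. *)
Lemma interval_ind (P : R -> R -> Prop) (a b : R) : a <= b ->
  (forall x y z : R, a <= x -> x <= y -> y <= z -> z <= b -> P x y -> P y z -> P x z) ->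
  (forall s : R, a <= s <= b -> exists2 d : R, 0 < d & forall x y : R, a <= x -> x <= y -> y <= b ->
    s - d <= x -> y <= s + d -> P x y) -> P a b.
Proof.
move=> ab glue loc.
have [|||d d0 Hd] := @compact_unif0 R R `[a, b]%classic (fun d s => forall x y : R, a <= x -> x <= y -> y <= b ->
    s - d <= x -> y <= s + d -> P x y).
- exact: segment_compact.
- by move=> d d' s d'0 dd H x y h1 h2 h3 h4 h5; apply: H => //; lra.
- move=> s; rewrite /= in_itv/= => /loc[d d0 Hd]; exists (d / 2); first by rewrite divr_gt0.
  apply/nbhs_ballP; exists (d / 2); first by rewrite /= divr_gt0.
  move=> s'; rewrite -ball_normE /= ltr_norml => /andP[h1 h2] x y h3 h4 h5 h6 h7.
  by apply: Hd => //; lra.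
have step (k : nat) : P a (Num.min b (a + k%:R * d)).
  elim: k => [|k IH].
    by rewrite mul0r addr0 (min_idPr ab); apply: (Hd a) => //; rewrite /= ?in_itv/= ?lexx ?ab//; lra.
  have h0 : a <= a + k%:R * d by rewrite lerDl mulr_ge0// ltW.
  have h1 : a + k%:R * d <= a + k.+1%:R * d by rewrite lerD2l ler_pM2r// ler_nat.
  apply: glue IH _ => //; rewrite ?le_min ?ge_min ?lexx ?h0 ?h1 ?ab ?orbT//.
  have hd : a + k.+1%:R * d = a + k%:R * d + d by rewrite -natr1 mulrDl mul1r addrA.
  apply: (Hd (Num.min b (a + k%:R * d))); rewrite /= ?in_itv/= ?le_min ?ge_min ?lexx ?h0 ?h1 ?ab ?orbT//.
  - by apply/andP; split; [rewrite lerBlDr ge_min lerDl ltW|rewrite lerBlDr ge_min lerDl (ltW d0) orbT].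
  - rewrite {2}/Num.min; case: ltP => h2; first by apply/orP; left; lra.
    by apply/orP; right; lra.
have [k kE] : exists k : nat, b - a <= k%:R * d.
  exists (Num.truncn ((b - a) / d)).+1; rewrite -ler_pdivrMr//; apply/ltW/truncnS_gt.
by have := step k; rewrite (min_idPl _)//; lra.
Qed.

End ScalarAC.

Section CurveChart.
Context {R : realType} {n : nat} {M : manifold R n}.
Notation E := 'rV[R]_n.
Notation mu := (@lebesgue_measure R).
Implicit Types (x : M) (c d : chart M) (G : cotangent M * R -> R) (gam : R -> M).

Lemma abs_cont_sac (a b K : R) (f : R -> E) (Q : E -> R) : abs_cont a b f -> 0 <= K ->
  (forall s t : R, a <= s <= b -> a <= t <= b -> `|Q (f s) - Q (f t)| <= K * `|f s - f t|) -> sac a b (Q \o f).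
Proof.
move=> ac K0 L e e0; have [d d0 Hd] := ac (e / (K + 1)) (divr_gt0 e0 (ltr_wpDl K0 ltr01)).
exists d => // m l r lr tr sd; have := Hd m l r lr tr sd; rewrite ltr_pdivlMr ?ltr_wpDl//.
apply: le_lt_trans; rewrite mulr_suml; apply: ler_sum => k _.
have [h1 h2 h3] := lr k; apply: le_trans (L _ _ _ _) _.
- by rewrite h3 andbT (le_trans h1).
- by rewrite h1 (le_trans h2).
by rewrite mulrC ler_wpM2l// lerDl.
Qed.

Lemma abs_cont_density (a b : R) (f : R -> E) : a <= b -> abs_cont a b f ->
  exists (v : R -> E) (N : set R), [/\ forall i, measurable_fun [set: R] (fun t => v t 0 i), measurable N, mu N = 0%E &
    forall t, a <= t <= b -> ~ N t -> a < t < b /\ derivable f t 1 /\ derive1 f t = v t].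
Proof.
move=> ab ac.
have comp (i : 'I_n) : exists hN : (R -> R) * set R, [/\ measurable_fun [set: R] hN.1, measurable hN.2, mu hN.2 = 0%E &
    forall t, a <= t <= b -> ~ hN.2 t -> a < t < b /\ derivable (fun t => f t 0 i) t 1 /\ derive1 (fun t => f t 0 i) t = hN.1 t].
  have [|h [N [hi mN N0 _ H]]] := @sac_density R a b (fun t => f t 0 i) ab.
    apply: (@abs_cont_sac a b 1 f (fun y => y 0 i)) => // s t _ _; rewrite mul1r.
    by have := @coord_le_norm R n (f s - f t) i; rewrite !mxE.
  by exists (h, N); split => //=; apply/measurable_EFinP; exact: measurable_int hi.
have [hN HhN] := choice comp.
have bigN : measurable (\big[setU/set0]_(i < n) (hN i).2) /\ mu (\big[setU/set0]_(i < n) (hN i).2) = 0%E.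
  apply: (big_ind (fun A : set R => measurable A /\ mu A = 0%E)) => [|A A' [mA A0] [mA' A'0]|i _].
  - by split => //; exact: measure0.
  - by split; [exact: measurableU|apply/eqP; rewrite measureU0//; exact/eqP].
  - by case: (HhN i).
have [mN' N'0] := @ends_null R a b (\big[setU/set0]_(i < n) (hN i).2)
  ltac:(by case: bigN) ltac:(by case: bigN).
exists (fun t => \row_i (hN i).1 t), (\big[setU/set0]_(i < n) (hN i).2 `|` [set a; b]); split => //.
  by move=> i; under eq_fun do rewrite mxE; case: (HhN i).
move=> t /andP[ta tb] /not_orP[nN /not_orP[/= na nb]].
have tab : a < t < b by rewrite !lt_neqAle ta tb !andbT eq_sym; apply/andP; split; apply/eqP.
have Hi (i : 'I_n) : derivable (fun t => f t 0 i) t 1 /\ derive1 (fun t => f t 0 i) t = (hN i).1 t.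
  case: (HhN i) => _ _ _ /(_ t); rewrite ta tb => /(_ isT)[|_ []]//.
  by move=> h; apply: nN; rewrite (bigD1 i)//=; left.
have df : derivable f t 1 by apply/derivable_mxP => i j; rewrite (ord1 i); case: (Hi j).
split => //; split => //; rewrite derive1E derive_mx//; apply/rowP => i; rewrite !mxE.
by case: (Hi i) => _; rewrite derive1E.
Qed.

End CurveChart.

(** * The Lagrangian along a curve *)

Section CurveLagrangian.
Context {R : realType} {n : nat} {M : manifold R n}.
Notation E := 'rV[R]_n.
Notation mu := (@lebesgue_measure R).
Implicit Types (x : M) (c d : chart M) (G : cotangent M * R -> R) (gam : R -> M).

Definition curve (a b : R) gam := {within `[a, b], continuous gam} /\
  forall c (a' b' : R), a <= a' -> a' <= b' -> b' <= b ->
    gam @` `[a', b'] `<=` chart_dom c -> abs_cont a' b' (chart_map c \o gam).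

Definition ell G gam (s : R -> R) (t : R) : \bar R := lagrangian G (gam t) (velocity gam t) (s t).

Lemma within_sub (T : topologicalType) (a b a' b' : R) (f : R -> T) : a <= a' -> b' <= b ->
  {within `[a, b], continuous f} -> {within `[a', b'], continuous f}.
Proof.
by move=> aa bb; apply: continuous_subspaceW; apply: subset_itv; rewrite bnd_simp.
Qed.

Lemma curve_sub (a b a' b' : R) gam : a <= a' -> b' <= b -> curve a b gam -> curve a' b' gam.
Proof.
move=> aa bb [cg ag]; split; first exact: within_sub cg.
by move=> c l r h1 h2 h3; apply: ag; rewrite ?(le_trans aa)// (le_trans h3).
Qed.

Lemma lee_shift (I : \bar R) (x : R) : (0 <= I + (- x)%:E)%E -> (x%:E <= I)%E.
Proof.
case: I => [r| |]//=; last by move=> _; rewrite leey.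
by rewrite !lee_fin; lra.
Qed.

(** An enumeration of the rational momenta. By continuity of the Hamiltonian the supremum in the
    Lagrangian may be restricted to them, and a countable supremum is measurable. *)
Definition ratvec (k : nat) : E := map_mx ratr (odflt (0 : 'rV[rat]_n) (unpickle k)).

Lemma ratvec_dense (q : E) (e : R) : 0 < e -> exists k, `|ratvec k - q| <= e.
Proof.
move=> e0; have H (i : 'I_n) : exists r : rat, q 0 i - e < ratr r < q 0 i + e.
  have [|r] := @rat_in_itvoo R (q 0 i - e) (q 0 i + e); first lra.
  by rewrite in_itv/= => h; exists r.
have [r Hr] := choice H.
exists (pickle (\row_i r i)); rewrite /ratvec pickleK /=.
rewrite /Num.Def.normr/= mx_normrE (bigmax_le _ (ltW e0))//= => -[i j] _.
by rewrite !mxE; have /andP[h1 h2] := Hr j; rewrite (ord1 i) ler_norml; apply/andP; split; lra.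
Qed.

Lemma pair_mid_continuous (y : E) (s : R) : continuous (fun q : E => (y, q, s)).
Proof.
move=> q A [[A1 A2] [/= [[B1 B2] [/= nB1 nB2] BB] n2] AA]; apply: filterS nB2 => q' h.
by apply: AA; split => /=; [apply: BB; split => //=; exact: nbhs_singleton|exact: nbhs_singleton].
Qed.

Lemma Lc_ratvec G c (y v : E) (s : R) : (forall q, {for q, continuous (fun q => Hc G c (y, q, s))}) ->
  Lc G c y v s = esups (fun k => (dot v (ratvec k) - Hc G c (y, ratvec k, s))%:E) 0.
Proof.
move=> cH; apply/eqP; rewrite eq_le; apply/andP; split; last first.
  by apply: ge_ereal_sup => _ [k _ <-]; exact: Lc_ge.
apply: ge_ereal_sup => _ [q _ <-]; apply/lee_addgt0Pr => e e0.
have cq : {for q, continuous (fun q => dot v q - Hc G c (y, q, s))}.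
  by apply: continuousB; [exact: dot_continuous|exact: cH].
have : \forall q' \near q, dot v q - Hc G c (y, q, s) - e < dot v q' - Hc G c (y, q', s).
  by apply: near_gt => //; lra.
move=> /near_normP[d d0 Hd].
have [k hk] := ratvec_dense q (divr_gt0 d0 (ltr0Sn R 1)).
have {}hk : `|ratvec k - q| < d by apply: le_lt_trans hk _; lra.
apply: (@le_trans _ _ ((dot v (ratvec k) - Hc G c (y, ratvec k, s))%:E + e%:E)%E).
  by rewrite lee_fin; have := Hd _ hk; lra.
by rewrite leeD2r//; apply: ereal_sup_ubound; exists k.
Qed.

Section Chart.
Variables (G : cotangent M * R -> R) (lam : R) (c : chart M) (a b : R) (gam : R -> M) (s : R -> R).
Hypotheses (hG : evo_ham G lam) (ab : a <= b) (cg : curve a b gam)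
  (gc : gam @` `[a, b] `<=` chart_dom c) (sc : {within `[a, b], continuous s}).

Let f := chart_map c \o gam.

Lemma in_chart t : a <= t <= b -> chart_dom c (gam t).
Proof. by move=> tab; apply: gc; exists t => //=; rewrite in_itv. Qed.

Lemma near_in_chart t : a < t < b -> \forall t' \near t, chart_dom c (gam t').
Proof.
move=> tab; have := near_in_itvoo (_ : t \in `]a, b[); rewrite in_itv/= => /(_ tab).
by apply: filterS => t'; rewrite in_itv/= => /andP[h1 h2]; apply: in_chart; rewrite !ltW.
Qed.

Lemma chart_curve_ac : abs_cont a b f.
Proof. by case: cg => _; apply. Qed.

Lemma aem_chart : aem a b (ell G gam s).
Proof.
have [_ _ _ _ HC] := hG.
have [v [N [mv mN N0 Hv]]] := abs_cont_density ab chart_curve_ac.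
have gk : continuous (gam \o clamp a b) by apply: within_clamp => //; case: cg.
have sk : continuous (s \o clamp a b) by exact: within_clamp.
have fk : continuous (f \o clamp a b).
  move=> t; apply: (@continuous_comp _ _ _ (gam \o clamp a b) (chart_map c)); first exact: gk.
  by apply: chart_map_continuous; apply: in_chart; exact: clamp_itv.
exists (fun t => esups (fun k => (dot (v t) (ratvec k) - Hc G c (f (clamp a b t), ratvec k, s (clamp a b t)))%:E) 0), N.
split => //.
- apply: measurable_fun_esups => k; apply/measurable_EFinP; apply: measurable_funTS.
  apply: measurable_funB.
    apply: measurable_sum => i; apply: measurable_funM; [exact: mv|exact: measurable_cst].
  apply: continuous_measurable_fun => t.
  apply: (@continuous_comp _ _ _ (fun t => (f (clamp a b t), ratvec k, s (clamp a b t))) (Hc G c)).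
    by apply: for_pair (for_pair (fk t) _) (sk t); exact: cst_continuous.
  by apply: HC; apply: chart_map_range; apply: in_chart; exact: clamp_itv.
- move=> t tab nN; have [tab' [dt dE]] := Hv t tab nN.
  rewrite /ell (lagrangian_chart G (s t) (near_in_chart tab') dt) clamp_id//.
  rewrite (_ : derive1 _ t = v t)//; apply: Lc_ratvec => q.
  have yc := chart_map_range (in_chart tab).
  apply: (@continuous_comp _ _ _ (fun q : E => (chart_map c (gam t), q, s t)) (Hc G c)); last exact: HC.
  exact: pair_mid_continuous.
Qed.

(* Fenchel's inequality [(Q \o f)' <= ell + Hc (f, DQ f, s)], integrated. *)
Lemma fenchel (Q : E -> R) (DQ : E -> E) (K K0 C : R) : 0 <= K0 -> 0 <= C ->
  (forall t, a <= t <= b -> differentiable Q (f t) /\ forall w, dd Q (f t) w = dot (DQ (f t)) w) ->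
  (forall t t', a <= t <= b -> a <= t' <= b -> `|Q (f t) - Q (f t')| <= K0 * `|f t - f t'|) ->
  (forall t, a <= t <= b -> Hc G c (f t, DQ (f t), s t) <= K) ->
  (forall t, a <= t <= b -> ((- C)%:E <= ell G gam s t)%E) ->
  ((Q (f b) - Q (f a) - K * (b - a))%:E <= \int[mu]_(t in `[a, b]) ell G gam s t)%E.
Proof.
move=> K00 C0 Qd Ql HK Hge.
have [h [N [hi mN N0 hI Hh]]] := sac_density ab (abs_cont_sac chart_curve_ac K00 Ql).
have [v [N' [_ mN' N'0 Hv]]] := abs_cont_density ab chart_curve_ac.
have hab : mu.-integrable `[a, b] (EFin \o h) by apply: integrableS hi.
have kab := const_integrable a b K.
have ki : mu.-integrable `[a, b] (EFin \o (fun t => K - h t)).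
  rewrite (_ : _ \o _ = (EFin \o cst K) \- (EFin \o h))%E//; exact: integrableB.
(* Fenchel's inequality in the form 0 <= ell + (K - h), with h the density of Q along the curve. *)
have := @int_le R a b C (cst 0%E) (ell G gam s) (N `|` N') (fun t => K - h t) ab C0 _ _ _ aem_chart ki _ Hge _.
rewrite integral0 => H.
have {}H := H ltac:(exact: measurableU) ltac:(by apply/eqP; rewrite measureU0//; exact/eqP).
have {}H := H ltac:(by exists (cst 0%E), set0; split => //; exact: measure0) ltac:(by move=> t _; rewrite lee_fin oppr_le0).
have kI : (\int[mu]_(t in `[a, b]) (K - h t)%:E = (K * (b - a) - (Q (f b) - Q (f a)))%:E)%E.
  rewrite (_ : (fun t => _) = (fun t => (cst K t)%:E - (h t)%:E)%E)//.
  by rewrite integralB_EFin// hI const_integral.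
rewrite kI in H.
have {}H : (0%E <= \int[mu]_(t in `[a, b]) ell G gam s t + (K * (b - a) - (Q (f b) - Q (f a)))%:E)%E.
  apply: H => t tab /not_orP[nN nN'].
  have [tab' [_ hE]] := Hh t tab nN; have [_ [dt vE]] := Hv t tab nN'.
  rewrite /ell (lagrangian_chart G (s t) (near_in_chart tab') dt).
  apply: (@le_trans _ _ ((dot (derive1 f t) (DQ (f t)) - Hc G c (f t, DQ (f t), s t))%:E + (K - h t)%:E)%E); last first.
    by rewrite leeD2r//; exact: Lc_ge.
  have [df fE] := derive1_dd dt; have [dQ QE] := Qd t tab.
  have -> : h t = dot (derive1 f t) (DQ (f t)).
    rewrite -hE derive1E; apply: etrans (deriveE _ (differentiable_comp df dQ)) _.
    by apply: etrans (dd_comp df dQ 1) _; rewrite QE -fE dotC.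
  by rewrite lee_fin; have := HK t tab; lra.
by apply: lee_shift; rewrite opprB.
Qed.
End Chart.

(** The measurability in one chart, [aem_chart], spread over the curve by [interval_ind]. *)
Lemma aem_ell G (lam a b : R) gam (s : R -> R) : evo_ham G lam -> a <= b -> curve a b gam ->
  {within `[a, b], continuous s} -> aem a b (ell G gam s).
Proof.
move=> hG ab cg sc; apply: (@interval_ind R (fun x y : R => aem x y (ell G gam s)) a b ab).
  by move=> x y z _ xy yz _; exact: aem_glue.
move=> t tab; have xc := chart_at_dom (gam t); set c := chart_at _ in xc.
have gk : continuous (gam \o clamp a b) by apply: within_clamp => //; case: cg.
have gt : (gam \o clamp a b) t = gam t by rewrite /= clamp_id.
have nd : \forall t' \near t, chart_dom c ((gam \o clamp a b) t').
  by apply: (gk t (chart_dom c)); rewrite gt; exact: near_dom.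
have /nbhs_ballP[d /= d0 Hd] := nd.
exists (d / 2); first by rewrite divr_gt0.
move=> x y ax xy yb xt yt; apply: (@aem_chart G lam c) => //.
- exact: curve_sub cg.
- move=> _ [t' /= + <-]; rewrite in_itv/= => /andP[h1 h2].
  have := Hd t'; rewrite /= clamp_id; last by rewrite (le_trans ax)//= (le_trans h2).
  by apply; rewrite -ball_normE /= ltr_norml; apply/andP; split; lra.
- exact: within_sub sc.
Qed.

End CurveLagrangian.

(** * Costs: splitting, comparison, shift in time *)

Section Cost.
Context {R : realType} {n : nat} {M : manifold R n}.
Notation E := 'rV[R]_n.
Notation mu := (@lebesgue_measure R).
Implicit Types (x : M) (c d : chart M) (G : cotangent M * R -> R) (gam : R -> M) (U : R -> M -> R).

(** Joint continuity for nonnegative times; freezing negative times at 0 makes it plain continuity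
    on a full product. *)
Definition jcont U := continuous (fun z : R * M => U (Num.max 0 z.1) z.2).

Definition cost G U gam (a b : R) : \bar R := (\int[mu]_(t in `[a, b]) ell G gam (fun t => U t (gam t)) t)%E.

Lemma jcont_along U gam (a b h : R) : jcont U -> a <= b -> 0 <= a + h -> {within `[a, b], continuous gam} ->
  {within `[a, b], continuous (fun t => U (t + h) (gam t))}.
Proof.
move=> cU ab ah cg; have gk := within_clamp ab cg.
have ck : continuous (fun t : R => U (Num.max 0 (clamp a b t + h)) (gam (clamp a b t))).
  move=> t; apply: (@continuous_comp _ _ _ (fun t : R => (clamp a b t + h, gam (clamp a b t))) (fun z : R * M => U (Num.max 0 z.1) z.2)); last exact: cU.
  apply: for_pair; last exact: gk.
  by apply: continuousD; [exact: clamp_continuous|exact: cst_continuous].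
apply: subspace_eq_continuous (continuous_subspaceT ck) => t; rewrite inE/= in_itv/= => tab.
by rewrite /from_subspace clamp_id//; rewrite (max_idPr _)//; case/andP: tab => h1 _; apply: le_trans ah _; rewrite lerD2r.
Qed.

Lemma jcont_along0 U gam (a b : R) : jcont U -> a <= b -> 0 <= a -> {within `[a, b], continuous gam} ->
  {within `[a, b], continuous (fun t => U t (gam t))}.
Proof.
move=> cU ab a0 cg; have := @jcont_along U gam a b 0 cU ab; rewrite addr0 => /(_ a0 cg).
by apply: subspace_eq_continuous => t _; rewrite /from_subspace addr0.
Qed.

Lemma int_le_const (a b k C : R) (f : R -> \bar R) (N : set R) : a <= b -> 0 <= C -> measurable N -> mu N = 0%E ->
  aem a b f -> (forall t, a <= t <= b -> ((- C)%:E <= f t)%E) ->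
  (forall t, a <= t <= b -> ~ N t -> (f t <= k%:E)%E) -> (\int[mu]_(t in `[a, b]) f t <= (k * (b - a))%:E)%E.
Proof.
move=> ab C0 mN N0 mf fC fk.
have := @int_le R a b C f (cst 0%E) N (cst k) ab C0 mN N0 mf (aem_const a b 0) (const_integrable a b k) fC.
rewrite integral0 add0e const_integral//; apply.
- by move=> t _; rewrite lee_fin oppr_le0.
- by move=> t tab nN; rewrite add0e; exact: fk.
Qed.

Lemma int_ge_const (a b C : R) (f : R -> \bar R) : a <= b -> 0 <= C ->
  aem a b f -> (forall t, a <= t <= b -> ((- C)%:E <= f t)%E) ->
  ((- (C * (b - a)))%:E <= \int[mu]_(t in `[a, b]) f t)%E.
Proof.
move=> ab C0 mf fC; apply: lee_shift; rewrite opprK.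
have := @int_le R a b C (cst 0%E) f set0 (cst C) ab C0 measurable0 (measure0 _) (aem_const a b 0) mf (const_integrable a b C).
rewrite integral0 const_integral//; apply => //.
- by move=> t _; rewrite lee_fin oppr_le0.
- by move=> t tab _; rewrite -(leeBlDr)// sub0e -EFinN; exact: fC.
Qed.

Section Along.
Variables (G : cotangent M * R -> R) (lam C0 B T : R).
Hypotheses (hG : evo_ham G lam) (C00 : 0 <= C0) (HC0 : forall x (s : R), `|s| <= B -> `|G (Cotangent x 0, s)| <= C0).

Lemma ell_ge gam (s : R -> R) (t : R) : `|s t| <= B -> ((- C0)%:E <= ell G gam s t)%E.
Proof.
move=> sB; apply: le_trans (lagrangian_ge _ _ _ _); rewrite lee_fin lerN2.
by apply: le_trans (ler_norm _) _; exact: HC0.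
Qed.

Variable U : R -> M -> R.
Hypotheses (cU : jcont U) (UB : forall t x, 0 <= t <= T -> `|U t x| <= B).

Lemma cost_aem gam (a b : R) : 0 <= a -> a <= b -> curve a b gam -> aem a b (ell G gam (fun t => U t (gam t))).
Proof.
move=> a0 ab cg; apply: (aem_ell hG ab cg).
by apply: jcont_along0 => //; case: cg.
Qed.

Lemma cost_ell_ge gam (a b : R) : 0 <= a -> b <= T -> forall t, a <= t <= b -> ((- C0)%:E <= ell G gam (fun t => U t (gam t)) t)%E.
Proof. by move=> a0 bT t /andP[h1 h2]; apply: ell_ge; apply: UB; rewrite (le_trans a0)// (le_trans h2). Qed.

Lemma cost_ge gam (a b : R) : 0 <= a -> a <= b -> b <= T -> curve a b gam -> ((- (C0 * (b - a)))%:E <= cost G U gam a b)%E.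
Proof. by move=> a0 ab bT cg; apply: int_ge_const => //; [exact: cost_aem|exact: cost_ell_ge]. Qed.

Lemma cost_split gam (a m b : R) : 0 <= a -> a <= m -> m <= b -> b <= T -> curve a b gam ->
  cost G U gam a b = (cost G U gam a m + cost G U gam m b)%E.
Proof.
move=> a0 am mb bT cg; apply: (int_split am mb C00) => //; first exact: cost_aem (le_trans am mb) cg.
exact: cost_ell_ge.
Qed.

Lemma cost_cmp U' gam (a b : R) (k : R -> R) : jcont U' -> (forall t x, 0 <= t <= T -> `|U' t x| <= B) ->
  0 <= a -> a <= b -> b <= T -> curve a b gam -> mu.-integrable `[a, b] (EFin \o k) ->
  (forall t, a <= t <= b -> lam * `|U t (gam t) - U' t (gam t)| <= k t) ->
  (cost G U gam a b <= cost G U' gam a b + \int[mu]_(t in `[a, b]) (k t)%:E)%E.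
Proof.
move=> cU' UB' a0 ab bT cg ik hk; have [_ ul _ _ _] := hG.
apply: (@int_le R a b C0 _ _ set0 k ab C00 measurable0 (measure0 _)) => //.
- exact: cost_aem.
- by apply: (aem_ell hG ab cg); apply: jcont_along0 => //; case: cg.
- exact: cost_ell_ge.
- by move=> t /andP[h1 h2]; apply: ell_ge; apply: UB'; rewrite (le_trans a0)// (le_trans h2).
- move=> t tab _; apply: le_trans (@lagrangian_ulip _ _ _ G lam (gam t) (velocity gam t) (U t (gam t)) (U' t (gam t)) ul) _.
  by apply: leeD2l; rewrite lee_fin; exact: hk.
Qed.

End Along.

Lemma derive1_shift (f : R -> E) (h t : R) : derive1 (fun t => f (t + h)) t = derive1 f (t + h).
Proof.
rewrite /derive1 (_ : (fun k => k^-1 *: (f (k + t + h) - f (t + h))) = (fun k => k^-1 *: (f (k + (t + h)) - f (t + h))))//.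
by apply/funext => k; rewrite addrA.
Qed.

Lemma velocity_shift gam (h t : R) : velocity (fun t => gam (t + h)) t = velocity gam (t + h).
Proof. exact: (derive1_shift (chart_map (chart_at (gam (t + h))) \o gam)). Qed.

Lemma curve_shift gam (a b h : R) : a <= b -> curve (a + h) (b + h) gam -> curve a b (fun t => gam (t + h)).
Proof.
move=> ab [cg ag]; split.
  have abh : a + h <= b + h by rewrite lerD2r.
  have gk := within_clamp abh cg.
  have ck : continuous (fun t : R => gam (clamp (a + h) (b + h) (t + h))).
    move=> t; apply: (@continuous_comp _ _ _ (fun t : R => t + h) (gam \o clamp (a + h) (b + h))); last exact: gk.
    by apply: cvgD; [exact: cvg_id|exact: cvg_cst].
  apply: subspace_eq_continuous (continuous_subspaceT ck) => t; rewrite inE/= in_itv/= => tab.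
  by rewrite /from_subspace clamp_id// !lerD2r.
move=> c l r h1 h2 h3 hc e e0.
have [|||| d d0 Hd] := ag c (l + h) (r + h) _ _ _ _ e e0; rewrite ?lerD2r//.
  move=> _ [t + <-]; rewrite /= in_itv/= => /andP[t1 t2]; apply: hc; exists (t - h); rewrite /= ?subrK// in_itv/=.
  by rewrite lerBrDr t1 lerBlDr.
exists d => // m l' r' lr tr sd.
apply: (Hd m (fun k => l' k + h) (fun k => r' k + h)).
- by move=> k; rewrite !lerD2r.
- apply/trivIsetP => i j _ _ ij; have /trivIsetP/(_ i j I I ij) := tr.
  move=> /seteqP[H _]; apply/seteqP; split => // t [/=]; rewrite !in_itv/= => /andP[p1 p2] /andP[p3 p4].
  by apply: (H (t - h)); split; rewrite /= in_itv/= ltrBrDr ltrBlDr; apply/andP.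
- by under eq_bigr do rewrite opprD addrACA subrr addr0.
Qed.

Lemma cost_shift G (lam C0 B h : R) U U' gam (a b : R) : evo_ham G lam -> 0 <= C0 ->
  (forall x (s : R), `|s| <= B -> `|G (Cotangent x 0, s)| <= C0) -> jcont U ->
  (forall t x, a + h <= t <= b + h -> `|U t x| <= B) -> (forall t x, a <= t <= b -> U' t x = U (t + h) x) ->
  a <= b -> 0 <= a + h -> curve (a + h) (b + h) gam ->
  cost G U' (fun t => gam (t + h)) a b = cost G U gam (a + h) (b + h).
Proof.
move=> hG C00 HC0 cU UB UU ab ah cg.
have abh : a + h <= b + h by rewrite lerD2r.
rewrite /cost -(@int_shift R (a + h) (b + h) (- h) C0) ?addrK//; last 2 first.
- exact: (cost_aem hG cU ah abh cg).
- by move=> t tab; apply: (ell_ge HC0); exact: UB.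
apply: eq_integral => t; rewrite inE/= in_itv/= => tab.
by rewrite /ell opprK velocity_shift UU.
Qed.

End Cost.

Section AbsCont.
Context {R : realType} {n : nat}.
Notation E := 'rV[R]_n.

Lemma abs_cont_eq (a b : R) (f g : R -> E) : (forall t, a <= t <= b -> f t = g t) -> abs_cont a b f -> abs_cont a b g.
Proof.
move=> fg af e e0; have [d d0 Hd] := af e e0; exists d => // m l r lr tr sd.
apply: le_lt_trans (Hd m l r lr tr sd); apply: ler_sum => k _.
by have [h1 h2 h3] := lr k; rewrite !fg ?h1 ?h3 ?andbT// ?(le_trans h1)// (le_trans h2).
Qed.

Lemma abs_cont_glue (a m b : R) (f : R -> E) : a <= m -> m <= b -> abs_cont a m f -> abs_cont m b f -> abs_cont a b f.
Proof.
move=> am mb f1 f2 e e0; have e2 : 0 < e / 2 by rewrite divr_gt0.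
have [d1 d10 H1] := f1 _ e2; have [d2 d20 H2] := f2 _ e2.
exists (Num.min d1 d2); first by rewrite lt_min d10.
move=> k l r lr tr; rewrite lt_min => /andP[s1 s2].
have part (x y d : R) (xy : x <= y) : \sum_(i < k) (r i - l i) < d -> \sum_(i < k) (clamp x y (r i) - clamp x y (l i)) < d.
  by apply: le_lt_trans; apply: ler_sum => i _; apply: clamp_lip; case: (lr i).
have cl (x y : R) (xy : x <= y) (i : 'I_k) : [/\ x <= clamp x y (l i), clamp x y (l i) <= clamp x y (r i) & clamp x y (r i) <= y].
  have /andP[h1 _] := clamp_itv xy (l i); have /andP[_ h2] := clamp_itv xy (r i).
  by split => //; apply: clamp_nd; case: (lr i).
have h1 := H1 k _ _ (cl a m am) (clamp_disj am tr) (part _ _ _ am s1).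
have h2 := H2 k _ _ (cl m b mb) (clamp_disj mb tr) (part _ _ _ mb s2).
rewrite (splitr e); apply: le_lt_trans (ltrD h1 h2); rewrite -big_split /=; apply: ler_sum => i _.
(* This identity lets one interval straddle m: its increment is the sum of those over the two
   clamped parts. *)
have fE (x : R) : a <= x <= b -> f x = f (clamp a m x) + f (clamp m b x) - f m.
  move=> /andP[ax xb]; have [xm|/ltW xm] := leP x m.
    have -> : clamp m b x = m by rewrite /clamp (min_idPr xb) (max_idPl xm).
    by rewrite clamp_id ?ax// addrK.
  have -> : clamp a m x = m by rewrite /clamp (min_idPl xm) (max_idPr am).
  by rewrite (clamp_id (x := x)) ?xm// addrC addKr.
have [p1 p2 p3] := lr i.
rewrite (fE (r i)) ?p3 ?andbT ?(le_trans p1)// (fE (l i)) ?p1 ?(le_trans p2)//.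
move: (f (clamp a m (r i))) (f (clamp m b (r i))) (f (clamp a m (l i))) (f (clamp m b (l i))) (f m) => A B A' B' C.
have -> : A + B - C - (A' + B' - C) = (A - A') + (B - B') by apply/rowP => j; rewrite !mxE; ring.
exact: ler_normD.
Qed.

Lemma abs_cont_lip (a b K : R) (f : R -> E) : 0 <= K ->
  (forall s t, a <= s <= b -> a <= t <= b -> `|f s - f t| <= K * `|s - t|) -> abs_cont a b f.
Proof.
move=> K0 L e e0; exists (e / (K + 1)); first by rewrite divr_gt0// ltr_wpDl.
move=> m l r lr _; rewrite ltr_pdivlMr ?ltr_wpDl//; apply: le_lt_trans; rewrite mulr_suml; apply: ler_sum => k _.
have [h1 h2 h3] := lr k; apply: le_trans (L _ _ _ _) _.
- by rewrite h3 andbT (le_trans h1).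
- by rewrite h1 (le_trans h2).
by rewrite mulrC ger0_norm ?subr_ge0// ler_wpM2l ?subr_ge0// lerDl.
Qed.

Lemma derivable_lip (a b K : R) (f : R -> E) : 0 <= K ->
  (forall t, a <= t <= b -> derivable f t 1 /\ `|derive1 f t| <= K) ->
  forall s t, a <= s <= b -> a <= t <= b -> `|f s - f t| <= K * `|s - t|.
Proof.
move=> K0 H s t; wlog st : s t / t <= s.
  by move=> W hs ht; have [h|/ltW h] := leP t s; [exact: W|rewrite distrC (distrC s); exact: W].
move=> /andP[as_ sb] /andP[at_ tb].
rewrite [leLHS]/Num.Def.normr/= mx_normrE (bigmax_le _ _)//= ?mulr_ge0// => -[i0 i] _.
rewrite (ord1 i0) !mxE {i0}.
have Hi u : t <= u <= s -> is_derive u 1 (fun u => f u 0 i) (derive1 f u 0 i).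
  move=> /andP[h1 h2]; have [|df _] := H u; first by rewrite (le_trans at_)//= (le_trans h2).
  have di : derivable (fun u => f u 0 i) u 1 by exact: (proj1 (derivable_mxP _ _ _) df 0 i).
  by apply: DeriveDef => //; rewrite derive1E derive_mx// mxE.
have [||u] := @MVT_segment R (fun u => f u 0 i) (fun u => derive1 f u 0 i) t s st.
- by move=> u; rewrite in_itv/= => /andP[h1 h2]; apply: Hi; rewrite !ltW.
- apply: derivable_within_continuous => u; rewrite in_itv/= => h.
  by have [] := Hi u h.
rewrite in_itv/= => /andP[h1 h2] ->; rewrite normrM ler_wpM2r//.
have [|_ h] := H u; first by rewrite (le_trans at_)//= (le_trans h2).
exact: le_trans (coord_le_norm _ _) h.
Qed.

End AbsCont.

(** * Extension of curves by segments in a chart *)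

Section Extend.
Context {R : realType} {n : nat} {M : manifold R n}.
Notation E := 'rV[R]_n.
Notation mu := (@lebesgue_measure R).
Implicit Types (x : M) (c d : chart M) (G : cotangent M * R -> R) (gam : R -> M) (U : R -> M -> R).

(** The curve that leaves y at time t with constant velocity w in the chart c. *)
Definition seg c (y w : E) (t : R) : R -> M := fun s => chart_inv c (y + (s - t) *: w).

Lemma line_diff (y w : E) (t s : R) : differentiable (fun s : R => y + (s - t) *: w) s /\ dd (fun s : R => y + (s - t) *: w) s 1 = w.
Proof.
have Hi (i : 'I_n) : is_derive s (1 : R) (fun s : R => (y + (s - t) *: w) 0 i) (w 0 i).
  rewrite (_ : (fun s : R => _) = (fun s : R => y 0 i + (s - t) * w 0 i)); last by apply/funext => r; rewrite !mxE.
  by apply: is_derive_eq; rewrite /GRing.scale/=; ring.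
have dl : derivable (fun s : R => y + (s - t) *: w) s 1.
  by apply/derivable_mxP => i j; rewrite (ord1 i); case: (Hi j).
have df : differentiable (fun s : R => y + (s - t) *: w) s by exact/derivable1_diffP.
split => //; apply: etrans (esym (deriveE _ df)) _; rewrite derive_mx//; apply/rowP => j; rewrite mxE.
by case: (Hi j).
Qed.

Lemma seg_continuous c (y w : E) (t s : R) : chart_range c (y + (s - t) *: w) -> {for s, continuous (seg c y w t)}.
Proof.
move=> yc; apply: (@continuous_comp _ _ _ (fun s : R => y + (s - t) *: w) (chart_inv c)); last exact: chart_inv_continuous.
by apply: differentiable_continuous; case: (line_diff y w t s).
Qed.

Lemma seg_abs_cont c d (y w : E) (t a b : R) : a <= b ->
  (forall s, a <= s <= b -> chart_range c (y + (s - t) *: w)) ->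
  (forall s, a <= s <= b -> chart_dom d (seg c y w t s)) -> abs_cont a b (chart_map d \o seg c y w t).
Proof.
move=> ab yc yd; have [Td TC] := change_smooth c d 1.
have inU (s : R) : a <= s <= b -> (chart_map c @` (chart_dom c `&` chart_dom d)) (y + (s - t) *: w).
  move=> h; exists (seg c y w t s); last by rewrite /seg chart_invK//; exact: yc.
  by split; [apply: chart_inv_dom; exact: yc|exact: yd].
have dE (s : R) : a <= s <= b -> derivable (chart_map d \o seg c y w t) s 1 /\
    derive1 (chart_map d \o seg c y w t) s = dd (trans c d) (y + (s - t) *: w) w.
  move=> h; have [l1 l2] := line_diff y w t s; have tr := Td _ (inU s h).
  have df := differentiable_comp l1 tr.
  split; first exact/derivable1_diffP.
  rewrite derive1E; apply: etrans (deriveE _ df) _.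
  by apply: etrans (dd_comp l1 tr 1) _; rewrite l2.
have [|s|K K0 HK] := @compact_unif R R `[a, b]%classic (fun C s => `|dd (trans c d) (y + (s - t) *: w) w| <= C) (@segment_compact _ _ _).
- by move=> C C' s CC h; exact: le_trans h CC.
- rewrite /= in_itv/= => h; exists (`|dd (trans c d) (y + (s - t) *: w) w| + 1).
  have cs : {for s, continuous (fun s : R => `|dd (trans c d) (y + (s - t) *: w) w|)}.
    apply: (@continuous_comp _ _ _ (fun s : R => dd (trans c d) (y + (s - t) *: w) w) (fun z : E => `|z|)); last exact: norm_continuous.
    apply: (@continuous_comp _ _ _ (fun s : R => y + (s - t) *: w) (fun z : E => dd (trans c d) z w)); last exact: TC (inU s h).
    by apply: differentiable_continuous; case: (line_diff y w t s).
  have : \forall s' \near s, `|dd (trans c d) (y + (s' - t) *: w) w| < `|dd (trans c d) (y + (s - t) *: w) w| + 1.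
    by apply: near_lt => //; rewrite ltrDl.
  by apply: filterS => s' /ltW.
apply: (@abs_cont_lip _ _ a b K) (ltW K0) _; apply: derivable_lip (ltW K0) _ => s h.
by have [h1 ->] := dE s h; split => //; apply: HK; rewrite /= in_itv.
Qed.

Definition extend gam c (y w : E) (t : R) : R -> M := fun s => if s <= t then gam s else seg c y w t s.

Lemma extend_l gam c (y w : E) (t s : R) : s <= t -> extend gam c y w t s = gam s.
Proof. by rewrite /extend => ->. Qed.

Lemma extend_r gam c (y w : E) (t s : R) : gam t = chart_inv c y -> t <= s -> extend gam c y w t s = seg c y w t s.
Proof.
move=> gt ts; rewrite /extend; case: leP => // st; have -> : s = t by apply/eqP; rewrite eq_le st.
by rewrite /seg subrr scale0r addr0.
Qed.

Lemma curve_extend gam c (y w : E) (t s : R) : 0 <= t -> 0 <= s -> curve 0 t gam -> gam t = chart_inv c y ->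
  (forall r, t <= r <= t + s -> chart_range c (y + (r - t) *: w)) -> curve 0 (t + s) (extend gam c y w t).
Proof.
move=> t0 s0 [cg ag] gt yc; split.
  have -> : `[0, t + s]%classic = `[0, t]%classic `|` `[t, t + s]%classic.
    apply/seteqP; split => r /=; rewrite !in_itv/=.
      by move=> /andP[h1 h2]; case: (leP r t) => h; [left; rewrite h1|right; rewrite ltW].
    by move=> [/andP[h1 h2]|/andP[h1 h2]]; apply/andP; split; lra.
  apply: withinU_continuous; try exact: interval_closed.
    by apply: subspace_eq_continuous cg => r; rewrite inE/= in_itv/= => /andP[_ h]; rewrite /from_subspace extend_l.
  have : {within `[t, t + s], continuous (seg c y w t)}.
    by apply: continuous_in_subspaceT => r; rewrite inE/= in_itv/= => h; apply: seg_continuous; exact: yc.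
  by apply: subspace_eq_continuous => r; rewrite inE/= in_itv/= => /andP[h _]; rewrite /from_subspace (extend_r _ gt).
move=> d a b a0 ab bts im.
have imd (r : R) : a <= r <= b -> chart_dom d (extend gam c y w t r).
  by move=> h; apply: im; exists r => //=; rewrite in_itv.
have left (a' b' : R) : 0 <= a' -> a <= a' -> a' <= b' -> b' <= b -> b' <= t -> abs_cont a' b' (chart_map d \o extend gam c y w t).
  move=> h1 h2 h3 h4 h5; apply: (@abs_cont_eq _ _ _ _ (chart_map d \o gam)).
    by move=> r /andP[_ h]; rewrite /= extend_l// (le_trans h).
  apply: ag => // _ [r + <-]; rewrite /= in_itv/= => /andP[r1 r2].
  by rewrite -(extend_l gam c y w (le_trans r2 h5)); apply: imd; rewrite (le_trans h2)//= (le_trans r2).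
have right (a' b' : R) : t <= a' -> a <= a' -> a' <= b' -> b' <= b -> abs_cont a' b' (chart_map d \o extend gam c y w t).
  move=> h1 h2 h3 h4; apply: (@abs_cont_eq _ _ _ _ (chart_map d \o seg c y w t)).
    by move=> r /andP[h _]; rewrite /= (extend_r _ gt)// (le_trans h1).
  apply: seg_abs_cont => // r /andP[r1 r2].
    by apply: yc; rewrite (le_trans h1)//= (le_trans r2)// (le_trans h4).
  by rewrite -(extend_r _ gt (le_trans h1 r1)); apply: imd; rewrite (le_trans h2)//= (le_trans r2).
have [bt|/ltW tb] := leP b t; first exact: left.
have [ta|/ltW at_] := leP t a; first exact: right.
by apply: (abs_cont_glue at_ tb); [apply: left|apply: right].
Qed.

Lemma velocity_near (g1 g2 : R -> M) (t : R) : (\forall s \near t, g1 s = g2 s) -> velocity g1 t = velocity g2 t.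
Proof.
move=> h; rewrite /velocity (nbhs_singleton h) !derive1E; apply: near_eq_derive.
by apply: filterS h => s /= ->.
Qed.

(** The value of the control problem in which the unknown inside the Lagrangian is frozen at U. An
    evolution is a fixed point of U |-> val U. *)
Definition val G (phi : M -> R) U (t : R) x : \bar R :=
  ereal_inf [set action G phi U t gam | gam in [set gam | abs_cont_curve t gam /\ gam t = x]].

Section Value.
Variables (G : cotangent M * R -> R) (lam C0 B T : R) (phi : M -> R) (U : R -> M -> R).
Hypotheses (hG : evo_ham G lam) (C00 : 0 <= C0) (HC0 : forall x (s : R), `|s| <= B -> `|G (Cotangent x 0, s)| <= C0).
Hypotheses (cU : jcont U) (UB : forall t x, 0 <= t <= T -> `|U t x| <= B).

(** Half of dynamic programming: a curve ending at y is prolonged by a segment whose running cost is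
    at most k. Upper bounds on values are obtained this way. *)
Lemma val_extend c (y w : E) (t s k : R) : 0 <= t -> 0 <= s -> t + s <= T ->
  (forall r, t <= r <= t + s -> chart_range c (y + (r - t) *: w)) ->
  (forall r q, t <= r <= t + s -> dot w q - Hc G c (y + (r - t) *: w, q, U r (seg c y w t r)) <= k) ->
  (val G phi U (t + s) (seg c y w t (t + s)) <= val G phi U t (chart_inv c y) + (k * s)%:E)%E.
Proof.
move=> t0 s0 tT yc hk; rewrite -leeBlDr//; apply: le_ereal_inf_tmp => _ [gam [cg gt] <-]; rewrite leeBlDr//.
have cv : curve 0 t gam := cg.
have ce := curve_extend t0 s0 cv gt yc.
have ts : t <= t + s by rewrite lerDl.
have t1 : t <= T by exact: le_trans tT.
set g' := extend gam c y w t in ce.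
apply: (@le_trans _ _ (action G phi U (t + s) g')).
  apply: ereal_inf_lbound; exists g' => //; split => //; exact: extend_r.
have cS := cost_split hG C00 HC0 cU UB (lexx 0) t0 ts tT ce.
have -> : action G phi U (t + s) g' = ((phi (g' 0))%:E + (cost G U g' 0 t + cost G U g' t (t + s)))%E by rewrite -cS.
have -> : cost G U g' 0 t = cost G U gam 0 t.
  apply: (@integral_eq_off_null R _ [set t]) => [||r /=]; [exact: measurable_set1|exact: lebesgue_measure_set1|].
  rewrite in_itv/= => /andP[r0 rt] /eqP nr; rewrite /ell.
  have rt' : r < t by rewrite lt_neqAle nr rt.
  have ne : \forall r' \near r, g' r' = gam r'.
    by apply: filterS (near_lt (f := id) (@cvg_id _ _) rt') => r' /ltW; exact: extend_l.
  by rewrite (velocity_near ne) (nbhs_singleton ne).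
have c2 : (cost G U g' t (t + s) <= (k * (t + s - t))%:E)%E.
  have cts : curve t (t + s) g' by apply: curve_sub ce.
  have [m2 z2] := @ends_null R t (t + s) set0 measurable0 (measure0 _).
  apply: (int_le_const ts C00 m2 z2) => //.
  - exact: (cost_aem hG cU t0 ts cts).
  - exact: (cost_ell_ge HC0 UB g' t0 tT).
  move=> r /andP[tr rs] /not_orP[_ /not_orP[/= n1 n2]].
  have trs : t < r < t + s by rewrite !lt_neqAle tr rs !andbT eq_sym; apply/andP; split; apply/eqP.
  have rr : t <= r <= t + s by rewrite tr.
  have ne : \forall r' \near r, g' r' = seg c y w t r'.
    have tr' : t < r by case/andP: trs.
    by apply: filterS (near_gt (f := id) (@cvg_id _ _) tr') => r' /ltW; exact: extend_r.
  have yr := yc r rr; have nr : \forall r' \near r, chart_range c (y + (r' - t) *: w).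
    have lc : {for r, continuous (fun r : R => y + (r - t) *: w)} by apply: differentiable_continuous; case: (line_diff y w t r).
    by apply: lc; exact: near_chart_range.
  have nd : \forall r' \near r, chart_dom c (g' r').
    by apply: filterS2 ne nr => r' -> h; exact: chart_inv_dom.
  have nl : \forall r' \near r, y + (r' - t) *: w = (chart_map c \o g') r'.
    by apply: filterS2 ne nr => r' h h'; rewrite /= h /seg chart_invK.
  have [l1 l2] := line_diff y w t r.
  have [d1 d1E] := near_eq_dd nl l1.
  have dg : derivable (chart_map c \o g') r 1 by exact/derivable1_diffP.
  rewrite /ell (lagrangian_chart G _ nd dg) derive1E.
  have -> : 'D_1 (chart_map c \o g') r = w by apply: etrans (deriveE _ d1) _; apply: etrans (d1E 1) _; exact: l2.
  have -> : chart_map c (g' r) = y + (r - t) *: w by rewrite (nbhs_singleton ne) /seg chart_invK.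
  rewrite (nbhs_singleton ne); apply: Lc_le => q; exact: hk.
rewrite addrAC subrr add0r in c2.
have -> : g' 0 = gam 0 by exact: extend_l.
by rewrite addeA; apply: leeD2l.
Qed.

End Value.
End Extend.

(** * Curves of bounded cost move slowly *)

Section Displacement.
Context {R : realType} {n : nat} {M : manifold R n}.
Notation E := 'rV[R]_n.
Notation mu := (@lebesgue_measure R).
Implicit Types (x : M) (c d : chart M) (G : cotangent M * R -> R) (gam : R -> M) (U : R -> M -> R).

Lemma Hc_bound G (lam : R) c (y0 : E) (r B A : R) : evo_ham G lam -> 0 <= r -> 0 <= A -> cball y0 r `<=` chart_range c ->
  exists2 K : R, 0 < K & forall (y p : E) (s : R), `|y - y0| <= r -> en p <= A -> `|s| <= B -> Hc G c (y, p, s) <= K.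
Proof.
move=> [_ _ _ lG _] r0 A0 yr; have [C C0 L] := lG c y0 r B A yr.
exists (`|Hc G c (y0, 0, 0)| + C * (Num.sqrt n%:R * r + A + `|B|) + 1).
  by rewrite ltr_wpDl// addr_ge0// mulr_ge0 ?(ltW C0)// !addr_ge0// mulr_ge0 ?sqrtr_ge0.
move=> y p s yy pA sB; have B0 : 0 <= B by exact: le_trans (normr_ge0 _) sB.
have := L y y0 p 0 s 0 yy; rewrite subrr !normr0 en0 => /(_ r0 pA A0 sB B0); rewrite !subr0 => h.
have h2 : C * (en (y - y0) + en p + `|s|) <= C * (Num.sqrt n%:R * r + A + `|B|).
  rewrite ler_pM2l// (ger0_norm B0); apply: lerD => //; apply: lerD => //.
  by apply: le_trans (en_le_norm _) _; rewrite ler_wpM2l ?sqrtr_ge0.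
have := ler_norm (Hc G c (y0, 0, 0)); lra.
Qed.

(** It bounds the cost of standing still from above. *)
Lemma G_lower G (lam B : R) : compact [set: M] -> evo_ham G lam ->
  exists2 C : R, 0 < C & forall x p (s : R), `|s| <= B -> - C <= G (Cotangent x p, s).
Proof.
move=> cM [_ _ sG _ _].
have [|x _|C C0 HC] := @compact_unif R M [set: M] (fun C x => forall p (s : R), `|s| <= B -> - C <= G (Cotangent x p, s)) cM.
- by move=> C C' x CC h p s sB; apply: le_trans (h p s sB); rewrite lerN2.
- have xc := chart_at_dom x; move: (chart_at x) xc => c xc.
  have [r r0 yr] := chart_ball (chart_map_range xc).
  have [C C0 L] := sG c _ r B 0 yr; exists C.
  have n2 : \forall y \near chart_map c x, `|y - chart_map c x| <= r by apply: near_cball; rewrite subrr normr0.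
  apply/(near_chart _ xc); apply: filterS2 n2 (near_chart_range (chart_map_range xc)) => y yy yc p s sB.
  have [q ->] := cotangent_chart p (chart_inv_dom yc).
  by have := L y q s yy sB; rewrite mul0r sub0r chart_invK.
by exists C => // x p s sB; exact: HC.
Qed.

Section Along.
Variables (G : cotangent M * R -> R) (lam C0 B T : R) (U : R -> M -> R).
Hypotheses (hG : evo_ham G lam) (C00 : 0 <= C0) (HC0 : forall x (s : R), `|s| <= B -> `|G (Cotangent x 0, s)| <= C0).
Hypotheses (cU : jcont U) (UB : forall t x, 0 <= t <= T -> `|U t x| <= B).

(** After its last time on the sphere of radius r the curve stays in the ball and travels at least r
    / 2. Fenchel's inequality with a linear function of slope A in that direction then costs at
    least Bc + 2 minus a multiple of the time, more than the budget if the time is short. *)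
Lemma displacement c (y0 : E) (r Bc : R) : 0 < r -> 0 <= Bc -> cball y0 r `<=` chart_range c ->
  exists2 d : R, 0 < d & forall gam (a b : R), 0 <= a -> a <= b -> b <= T -> b - a <= d -> curve a b gam ->
   (cost G U gam a b <= Bc%:E)%E -> chart_dom c (gam b) -> `|chart_map c (gam b) - y0| <= r / 2 ->
   forall t, a <= t <= b -> chart_dom c (gam t) /\ `|chart_map c (gam t) - y0| <= r.
Proof.
move=> r0 Bc0 yr; pose A := (Bc + 2) * (2 / r).
have A0 : 0 <= A by rewrite mulr_ge0// ?divr_ge0// ?addr_ge0// ltW.
have [K K0 HK] := Hc_bound B hG (ltW r0) A0 yr.
have [d [d0 _ dM]] := @pick_small R (K + C0) (1 / 2) ltac:(by rewrite addr_ge0// ltW) ltac:(by rewrite divr_gt0).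
exists d => // gam a b a0 ab bT bad cg cB bc br t tab; apply: contrapT => nt.
pose D : set M := [set x | chart_dom c x /\ `|chart_map c x - y0| < r].
have gk : continuous (gam \o clamp a b) by apply: within_clamp => //; case: cg.
have oD x : D x -> \forall x' \near x, D x'.
  by move=> [xc xr]; exact: near_chart_ball.
pose S : set R := `[a, b]%classic `&` [set s | ~ D (gam (clamp a b s))].
have cS : compact S.
  apply: compact_closedI; first exact: segment_compact.
  rewrite (_ : [set s | _] = ~` [set s | D (gam (clamp a b s))])//; apply: open_closedC; rewrite openE => s Ds.
  exact: (gk s D (oD _ Ds)).
have tS : S t.
  split; first by rewrite /= in_itv.
  by rewrite /= clamp_id// => -[h1 /ltW h2]; apply: nt.
(* The last time outside the open ball; from then on the curve stays in one chart. *)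
have [m [mI mD] mmax] := @compact_max R R (fun s : R => s) S (ex_intro _ t tS) cS (fun s _ => @cvg_id _ _).
have mab : a <= m <= b by move: mI; rewrite /= in_itv.
have /andP[am mb] := mab.
rewrite /= clamp_id// in mD.
have Db s : m < s -> s <= b -> D (gam s).
  move=> ms sb; apply: contrapT => nD; have := mmax s; rewrite leNgt ms => /(_ _) h.
  suff : false by []. apply: h; split; first by rewrite /= in_itv/= sb (le_trans am)// ltW.
  by rewrite /= clamp_id// sb (le_trans am)// ltW.
have mltb : m < b.
  rewrite lt_neqAle mb andbT; apply/eqP => mE; apply: mD; rewrite mE; split => //.
  by apply: le_lt_trans br _; rewrite ltr_pdivrMr// ltr_pMr// ltr1n.
have Kc := chart_cball_closed yr.
(* A limit of points of the ball lies in its closed image, hence still in the domain of the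
   chart. *)
have inK : (chart_inv c @` cball y0 r) (gam m).
  apply: contrapT => nK.
  have nb : \forall s \near m, ~ (chart_inv c @` cball y0 r) (gam (clamp a b s)).
    have := gk m (~` (chart_inv c @` cball y0 r)); rewrite /= clamp_id//; apply.
    by apply: open_nbhs_nbhs; split => //; exact: closed_openC.
  have /nbhs_ballP[e /= e0 He] := nb.
  pose s := Num.min b (m + e / 2).
  have ms : m < s by rewrite lt_min mltb ltrDl divr_gt0.
  have sb : s <= b by rewrite ge_min lexx.
  have se : s <= m + e / 2 by rewrite ge_min lexx orbT.
  have [sc sr] := Db s ms sb.
  apply: (He s); first by rewrite -ball_normE /= distrC gtr0_norm ?subr_gt0// ltrBlDl (le_lt_trans se)// ltrD2l ltr_pdivrMr// ltr_pMr// ltr1n.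
  rewrite clamp_id; last by rewrite sb (le_trans am)// ltW.
  by exists (chart_map c (gam s)); [exact: ltW|exact: chart_mapK].
have [z zr zE] := inK.
have mc : chart_dom c (gam m) by rewrite -zE; apply: chart_inv_dom; exact: yr.
have mz : chart_map c (gam m) = z by rewrite -zE chart_invK//; exact: yr.
have mr : `|chart_map c (gam m) - y0| = r.
  apply/eqP; rewrite eq_le {1}mz zr /= leNgt; apply/negP => h; exact: mD.
have cmb : curve m b gam by exact: curve_sub cg.
have im (s : R) : m <= s <= b -> chart_dom c (gam s) /\ `|chart_map c (gam s) - y0| <= r.
  move=> /andP[ms sb]; move: ms; rewrite le_eqVlt => /orP[/eqP <-|ms]; first by rewrite mr.
  by have [h1 /ltW h2] := Db s ms sb.
have gim : gam @` `[m, b] `<=` chart_dom c.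
  by move=> _ [s + <-]; rewrite /= in_itv/= => /im[].
set v := chart_map c (gam b) - chart_map c (gam m).
have vr : r / 2 <= en v.
  apply: le_trans (norm_le_en _); rewrite /v.
  have := ler_distD (chart_map c (gam b)) (chart_map c (gam m)) y0; rewrite mr (distrC (chart_map c (gam m))).
  by move: br; lra.
have v0 : 0 < en v by apply: lt_le_trans vr; rewrite divr_gt0.
pose p : E := (A / en v) *: v.
have pA : en p <= A by rewrite /p enZ ger0_norm ?divr_ge0 ?(ltW v0)// divfK// gt_eqF.
have m0 : 0 <= m by exact: le_trans am.
have sc : {within `[m, b], continuous (fun t => U t (gam t))} by apply: jcont_along0 => //; case: cmb.
have fen := @fenchel R n M G lam c m b gam (fun t => U t (gam t)) hG mb cmb gim sc (dot p) (fun=> p) K (A * Num.sqrt n%:R) C0.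
have {}fen : ((dot p (chart_map c (gam b)) - dot p (chart_map c (gam m)) - K * (b - m))%:E <= cost G U gam m b)%E.
  apply: fen => //.
  - by rewrite mulr_ge0// sqrtr_ge0.
  - move=> s _; apply: frechet_dd => sg sg0; move: (_ s) => z1.
    have n1 : \forall z' \near z1, `|z' - z1| <= 1 by apply: near_cball; rewrite subrr normr0.
    apply: filterS n1 => z' _; by rewrite -dotBr subrr normr0 mulr_ge0 ?en_ge0// ltW.
  - move=> s s' _ _; rewrite -dotBr; apply: le_trans (abs_dot_le _ _) _; rewrite -mulrA.
    by apply: ler_pM => //; [exact: en_ge0|exact: en_ge0|exact: en_le_norm].
  - move=> s h; have [_ h2] := im s h; apply: HK => //; apply: UB.
    by case/andP: h => h3 h4; rewrite (le_trans m0)// (le_trans h4).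
  - exact: (cost_ell_ge HC0 UB gam m0 bT).
have pv : dot p (chart_map c (gam b)) - dot p (chart_map c (gam m)) = A * en v.
  by rewrite -dotBr -/v /p dotZl -[dot v v]/(nsq v) -en_sq expr2 mulrA divfK// gt_eqF.
have cS' := cost_split hG C00 HC0 cU UB a0 am mb bT cg.
have c1 := cost_ge hG C00 HC0 cU UB a0 am (le_trans mb bT) (curve_sub (lexx a) mb cg).
have Ar : Bc + 2 <= A * en v.
  have -> : Bc + 2 = A * (r / 2) by rewrite /A; field; rewrite gt_eqF.
  by rewrite ler_wpM2l.
have h1 : K * (b - m) <= K * d by rewrite ler_pM2l//; move: bad am; lra.
have h2 : C0 * (m - a) <= C0 * d by rewrite ler_wpM2l//; move: bad mb; lra.
rewrite cS' in cB; rewrite pv in fen.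
have : ((- (C0 * (m - a)) + (A * en v - K * (b - m)))%:E <= Bc%:E)%E.
  by apply: le_trans cB; rewrite EFinD; exact: leeD.
by rewrite lee_fin; move: h1 h2 Ar dM; rewrite mulrC; lra.
Qed.

End Along.
End Displacement.

(** * The value function *)

Section ValueFunction.
Context {R : realType} {n : nat} {M : manifold R n}.
Notation E := 'rV[R]_n.
Notation mu := (@lebesgue_measure R).
Implicit Types (x : M) (c d : chart M) (G : cotangent M * R -> R) (gam : R -> M) (U : R -> M -> R).

Lemma jcont_bounded U (T : R) : compact [set: M] -> jcont U ->
  exists2 B : R, 0 < B & forall t x, 0 <= t <= T -> `|U t x| <= B.
Proof.
move=> cM cU; pose A : set (R * M) := `[0, T]%classic `*` [set: M].
have [|z _|B B0 HB] := @compact_bounded_fun R _ A (fun z : R * M => U (Num.max 0 z.1) z.2).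
- by apply: compact_setX => //; exact: segment_compact.
- exact: cU.
exists B => // t x /andP[t0 tT]; have := HB (t, x); rewrite /= (max_idPr t0); apply.
by split => //=; rewrite in_itv/= t0.
Qed.

Lemma jcont_time U (T eta : R) : compact [set: M] -> jcont U -> 0 < eta ->
  exists2 d : R, 0 < d & forall t t' x, 0 <= t <= T -> 0 <= t' -> `|t - t'| <= d -> `|U t x - U t' x| <= eta.
Proof.
move=> cM cU e0; pose A : set (R * M) := `[0, T]%classic `*` [set: M].
pose V (z : R * M) := U (Num.max 0 z.1) z.2.
have e2 : 0 < eta / 2 by rewrite divr_gt0.
have [|||d d0 Hd] := @compact_unif0 R _ A (fun (d : R) z => forall t', `|z.1 - t'| <= d -> `|V z - V (t', z.2)| <= eta).
- by apply: compact_setX => //; exact: segment_compact.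
- by move=> d d' z d'0 dd H t' h; apply: H; exact: le_trans dd.
- move=> [t x] _; have /cvgr_dist_lt/(_ _ e2) := cU (t, x).
  move=> [[A1 A2] [/= n1 n2] AA]; have /nbhs_ballP[d /= d0 Hd] := n1.
  exists (d / 2); first by rewrite divr_gt0.
  have b2 : nbhs t (ball t (d / 2)) by apply/nbhs_ballP; exists (d / 2); rewrite //= divr_gt0.
  exists (ball t (d / 2), A2) => //= -[s y] [/= hs hy] t' ht.
  have s1 : A1 s by apply: Hd; apply: le_ball hs; lra.
  have t1 : A1 t'.
    by apply: Hd; move: hs ht; rewrite -!ball_normE /= => hs ht; have := ler_distD s t t'; lra.
  have p1 := AA (s, y) (conj s1 hy); have p2 := AA (t', y) (conj t1 hy).
  have := ler_distD (V (t, x)) (V (s, y)) (V (t', y)); rewrite (distrC (V (s, y)) (V (t, x))).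
  by move: p1 p2; rewrite /= /V /=; lra.
exists d => // t t' x /andP[t0 tT] t'0 tt; have := Hd (t, x) _ t'; rewrite /V /= (max_idPr t0) (max_idPr t'0).
by apply => //; split => //=; rewrite in_itv/= t0.
Qed.

Lemma drop_arith (A V ps p0 r1 r2 k eta c c' : R) : A <= ps + (r2 + k) -> k <= eta / 4 -> - (eta / 4) <= p0 - ps ->
  p0 + r1 + r2 <= V + eta / 4 -> - c <= r1 -> c <= c' -> c' <= eta / 4 -> A <= V + eta.
Proof. lra. Qed.

Lemma ext_arith1 (m t e d : R) : t <= m -> 0 <= e -> 0 < d -> 0 <= m + (e + d) - t.
Proof. lra. Qed.

Lemma ext_arith2 (m t e d X S k b b' : R) : m <= t + d -> e <= X -> S = X + 2 * d -> S + k <= b -> 0 <= k -> b <= b' ->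
  m + (e + d) - t <= b'.
Proof. lra. Qed.

Lemma ext_arith3 (A A' V ks k S b eta : R) : A' <= V + ks -> A <= A' + eta / 2 -> ks <= k -> S + k <= b -> 0 <= S ->
  b <= eta / 2 -> A <= V + eta.
Proof. lra. Qed.

Lemma ext_arith4 (a b c h k : R) : b <= 1 * c -> a <= b -> 1 * c - k <= h -> a - h <= k.
Proof. lra. Qed.

Lemma max_close (t1 t2 d : R) : `|t1 - t2| <= d -> Num.max t1 t2 <= t1 + d /\ Num.max t1 t2 <= t2 + d.
Proof.
move=> h; have d0 := le_trans (normr_ge0 _) h; move: h; rewrite ler_norml => /andP[h1 h2].
by rewrite !ge_max; split; apply/andP; split; lra.
Qed.

Lemma max0_close (a b m : R) : `|a - b| <= m -> `|Num.max 0 a - Num.max 0 b| <= m.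
Proof.
by rewrite /Num.max !ler_norml => /andP[h1 h2]; do 2!case: ltP => ?; apply/andP; split; lra.
Qed.

Lemma ext_arith5 (a b d m r : R) : a <= d -> b <= 1 * (2 * d) -> d <= m -> m <= r / 3 -> a + b <= r.
Proof. lra. Qed.

Lemma ext_arith6 (m t e d : R) : t <= m -> 0 <= e -> 0 < d -> 0 < m + (e + d) - t /\ e <= m + (e + d) - t.
Proof. by move=> h1 h2 h3; split; lra. Qed.

Lemma ext_arith7 (m t e d S X : R) : m <= t + d -> e <= X -> S = X + 2 * d -> m + (e + d) - t <= S.
Proof. lra. Qed.

Lemma dist_le2 (a b e : R) : a <= b + e -> b <= a + e -> `|a - b| <= e.
Proof. by move=> h1 h2; rewrite ler_norml; apply/andP; split; lra. Qed.

Lemma fin_split (a1 a2 : \bar R) (p c1 c2 w : R) : ((- c1)%:E <= a1)%E -> ((- c2)%:E <= a2)%E ->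
  (p%:E + (a1 + a2) <= w%:E)%E -> exists r1 r2 : R, [/\ a1 = r1%:E, a2 = r2%:E, - c1 <= r1, - c2 <= r2 & p + r1 + r2 <= w].
Proof.
case: a1 => [r1| |]//; case: a2 => [r2| |]//; rewrite -?EFinD !lee_fin ?addrA => h1 h2 h3.
by exists r1, r2.
Qed.

Lemma jcont_shift U (s : R) : 0 <= s -> jcont U -> jcont (fun t => U (t + s)).
Proof.
move=> s0 cU z; apply: (@near_eq_continuous _ _ (fun z : R * M => U (Num.max 0 (Num.max 0 z.1 + s)) z.2)).
  near=> z'; rewrite (max_idPr (_ : 0 <= Num.max 0 z'.1 + s))//.
  by rewrite addr_ge0// le_max lexx.
apply: (@continuous_comp _ _ _ (fun z : R * M => (Num.max 0 z.1 + s, z.2)) (fun z : R * M => U (Num.max 0 z.1) z.2)); last exact: cU.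
apply: for_pair; last exact: cvg_snd.
apply: continuousD; last exact: cst_continuous.
by apply: continuous_max; [exact: cst_continuous|exact: cvg_fst].
Unshelve. all: by end_near. Qed.

Section Bounds.
Variables (G : cotangent M * R -> R) (lam C0 B T : R) (phi : M -> R) (U : R -> M -> R) (Bp : R).
Hypotheses (cM : compact [set: M]) (hG : evo_ham G lam) (C00 : 0 <= C0) (HC0 : forall x (s : R), `|s| <= B -> `|G (Cotangent x 0, s)| <= C0)
  (HC1 : forall x p (s : R), `|s| <= B -> - C0 <= G (Cotangent x p, s)).
Hypotheses (cU : jcont U) (UB : forall t x, 0 <= t <= T -> `|U t x| <= B).
Hypotheses (pc : continuous phi) (pB : forall x, `|phi x| <= Bp) (Bp0 : 0 <= Bp).

Lemma actionE (t : R) gam : action G phi U t gam = ((phi (gam 0%R))%:E + cost G U gam 0 t)%E.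
Proof. by []. Qed.

Lemma val_restrict (m t : R) gam : 0 <= m -> m <= t -> t <= T -> curve 0 t gam ->
  (val G phi U m (gam m) + cost G U gam m t <= action G phi U t gam)%E.
Proof.
move=> m0 mt tT cg; rewrite actionE (cost_split hG C00 HC0 cU UB (lexx 0) m0 mt tT cg) [leRHS]addeA.
rewrite leeD2r//; apply: ereal_inf_lbound; exists gam => //; split => //.
exact: curve_sub (lexx 0) mt cg.
Qed.

Lemma val_ge (t : R) x : 0 <= t <= T -> ((- (Bp + C0 * t))%:E <= val G phi U t x)%E.
Proof.
move=> /andP[t0 tT]; apply: le_ereal_inf_tmp => _ [gam [cg _] <-].
have := cost_ge hG C00 HC0 cU UB (lexx 0) t0 tT cg; rewrite subr0 => h.
rewrite actionE opprD EFinD; apply: leeD => //; rewrite lee_fin.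
by have := pB (gam 0); rewrite ler_norml => /andP[].
Qed.

Lemma curve_point x : curve 0 0 (fun=> x).
Proof.
split; first by apply: continuous_subspaceT; exact: cst_continuous.
move=> c a b _ _ _ _ e e0; exists 1 => // m l r _ _ _.
by rewrite big1// => k _; rewrite /= subrr normr0.
Qed.

Lemma val0 x : 0 <= T -> val G phi U 0 x = (phi x)%:E.
Proof.
move=> T0; have i0 (f : R -> \bar R) : (\int[mu]_(t in `[0%R, 0%R]) f t = 0)%E.
  by apply: (integral_Sset1 0) => t /=; rewrite in_itv/= => h; apply/eqP; rewrite eq_le andbC.
apply/eqP; rewrite eq_le; apply/andP; split.
  apply: ereal_inf_lbound; exists (fun=> x); first by split => //; exact: curve_point.
  by rewrite actionE /cost i0 adde0.
by apply: le_ereal_inf_tmp => _ [gam [_ <-] <-]; rewrite actionE /cost i0 adde0.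
Qed.

(** By standing still at x, that is, by extending the trivial curve with velocity 0. *)
Lemma val_le (t : R) x : 0 <= t <= T -> (val G phi U t x <= (phi x + C0 * t)%:E)%E.
Proof.
move=> /andP[t0 tT]; have T0 := le_trans t0 tT.
have xc := chart_at_dom x; set c := chart_at x in xc; have yc := chart_map_range xc.
have sE (r : R) : chart_map c x + (r - 0) *: (0 : E) = chart_map c x by rewrite scaler0 addr0.
have := @val_extend R n M G lam C0 B T phi U hG C00 HC0 cU UB c (chart_map c x) 0 0 t C0 (lexx 0) t0.
rewrite !add0r /seg sE chart_mapK// val0// EFinD; apply => //.
- by move=> r _; rewrite sE.
- move=> r q /andP[r0 rt]; rewrite dot0l sub0r sE chart_mapK// lerNl.
  rewrite /Hc /bundle_inv /=; apply: HC1; apply: UB; rewrite r0 (le_trans rt)//.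
Qed.

Lemma val_fin (t : R) x : 0 <= t <= T -> val G phi U t x = (fine (val G phi U t x))%:E.
Proof.
move=> h; have := val_ge x h; have := val_le x h.
by case: (val _ _ _ _ _).
Qed.

Lemma val_bound (t : R) x : 0 <= t <= T -> `|fine (val G phi U t x)| <= Bp + C0 * t.
Proof.
move=> h; have := val_ge x h; have := val_le x h; rewrite (val_fin x h) !lee_fin /= => h1 h2.
by rewrite ler_norml h2 (le_trans h1)// lerD2r; have := pB x; rewrite ler_norml => /andP[].
Qed.

Lemma near_optimal (t eta : R) x : 0 <= t <= T -> 0 < eta -> exists gam, [/\ curve 0 t gam, gam t = x &
  (action G phi U t gam <= (fine (val G phi U t x) + eta)%:E)%E].
Proof.
move=> h e0; have [|a [gam [cg gt] <-] ha] := @lb_ereal_inf_adherent R [set action G phi U t gam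
      | gam in [set gam | abs_cont_curve t gam /\ gam t = x]] eta e0.
  by rewrite -/(val G phi U t x) (val_fin x h).
exists gam; split => //; move: ha; rewrite -/(val G phi U t x) (val_fin x h) -EFinD.
exact: ltW.
Qed.

(** [displacement] without charts: along curves of bounded cost and short duration a continuous
    function varies little. *)
Lemma cost_modulus (f : M -> R) (eta Bc : R) : continuous f -> 0 < eta -> 0 <= Bc ->
  exists2 d : R, 0 < d & forall gam (a b : R), 0 <= a -> a <= b -> b <= T -> b - a <= d -> curve a b gam ->
   (cost G U gam a b <= Bc%:E)%E -> `|f (gam a) - f (gam b)| <= eta.
Proof.
move=> fc e0 Bc0; have e2 : 0 < eta / 2 by rewrite divr_gt0.
have [||d d0 Hd] := @compact_unif0 R M [set: M] (fun (d : R) x => forall gam (a b : R), 0 <= a -> a <= b -> b <= T -> b - a <= d -> curve a b gam ->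
   (cost G U gam a b <= Bc%:E)%E -> gam b = x -> `|f (gam a) - f (gam b)| <= eta) cM.
- by move=> d d' x d'0 dd H gam a b h1 h2 h3 h4; apply: H => //; exact: le_trans dd.
- move=> x _; have xc := chart_at_dom x; set c := chart_at x in xc; have yc := chart_map_range xc; set y := chart_map c x in yc *.
  have fcy : {for y, continuous (f \o chart_inv c)} by apply: continuous_chart => //; exact: fc.
  have /cvgr_dist_lt/(_ _ e2) n1 := fcy.
  have : \forall z \near y, chart_range c z /\ `|(f \o chart_inv c) y - (f \o chart_inv c) z| < eta / 2.
    by apply: filterS2 n1 (near_chart_range yc) => z h1 h2.
  move=> /near_normP[r r0 Hr].
  have r2 : 0 < r / 2 by rewrite divr_gt0.
  have r4 : 0 < r / 2 / 2 by rewrite divr_gt0.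
  have inr (z : E) : `|z - y| <= r / 2 -> `|z - y| < r by move=> h; apply: le_lt_trans h _; lra.
  have yr : cball y (r / 2) `<=` chart_range c by move=> z /inr/Hr[].
  have [d d0 Hd] := displacement hG C00 HC0 cU UB r2 Bc0 yr.
  exists d => //.
  have nb : \forall z \near y, `|z - y| <= r / 2 / 2 by apply: near_cball; rewrite subrr normr0.
  apply/(near_chart _ xc); apply: filterS2 nb (near_chart_range yc) => z zz zc gam a b h1 h2 h3 h4 h5 h6 gb.
  have bc : chart_dom c (gam b) by rewrite gb; exact: chart_inv_dom.
  have br : `|chart_map c (gam b) - y| <= r / 2 / 2 by rewrite gb chart_invK.
  have H := Hd gam a b h1 h2 h3 h4 h5 h6 bc br.
  have one (t : R) : a <= t <= b -> `|f (gam t) - (f \o chart_inv c) y| < eta / 2.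
    by move=> /H[p1 /inr/Hr[_]]; rewrite /= chart_mapK// distrC.
  have := one a; have := one b; rewrite !lexx h2 => /(_ isT) q1 /(_ isT) q2.
  by have := ler_distD ((f \o chart_inv c) y) (f (gam a)) (f (gam b)); rewrite (distrC ((f \o chart_inv c) y) (f (gam b))); lra.
exists d => // gam a b h1 h2 h3 h4 h5 h6; exact: (Hd (gam b) I).
Qed.

(* An almost optimal curve loses little when its initial piece is dropped and
   the rest is shifted in time. *)
Lemma val_drop (eta : R) : 0 < eta -> exists2 d : R, 0 < d & forall (t s : R) x, 0 <= s <= d -> s <= t -> t <= T ->
  fine (val G phi U (t - s) x) <= fine (val G phi U t x) + eta.
Proof.
move=> e0; have [T0|T0] := leP 0 T; last first.
  by exists 1 => // t s x /andP[s0 _] st tT; move: (le_lt_trans (le_trans s0 st) (le_lt_trans tT T0)); rewrite ltxx.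
have [lam0 _ _ _ _] := hG.
have e4 : 0 < eta / 4 by rewrite divr_gt0.
have CT : 0 <= C0 * T by exact: mulr_ge0.
have Bc0 : 0 <= 2 * Bp + 2 * (C0 * T) + eta by rewrite !addr_ge0 ?mulr_ge0// ltW.
have [d1 d10 H1] := cost_modulus pc e4 Bc0.
have lT : 0 < 4 * (lam * T + 1) by rewrite mulr_gt0// ltr_wpDl// mulr_ge0// ltW.
have [d2 d20 H2] := jcont_time T cM cU (divr_gt0 e0 lT).
have [d3 [d30 _ d3C]] := pick_small C00 e4.
exists (Num.min d1 (Num.min d2 d3)); first by rewrite !lt_min d10 d20.
move=> t s x /andP[s0]; rewrite !le_min => /and3P[sd1 sd2 sd3] st tT.
have t0 : 0 <= t by exact: le_trans st.
have t0T : 0 <= t <= T by rewrite t0.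
have ts0 : 0 <= t - s by rewrite subr_ge0.
have tsT : 0 <= t - s <= T by rewrite ts0 (le_trans _ tT)// gerBl.
have [gam [cg gt ha]] := near_optimal x t0T e4.
have cg1 : curve 0 s gam by exact: curve_sub (lexx 0) st cg.
have cg2 : curve s t gam by exact: curve_sub s0 (lexx t) cg.
move: ha; rewrite actionE (cost_split hG C00 HC0 cU UB (lexx 0) s0 st tT cg) => ha.
have [r1 [r2 [E1 E2 l1 l2 hr]]] := fin_split (cost_ge hG C00 HC0 cU UB (lexx 0) s0 (le_trans st tT) cg1)
  (cost_ge hG C00 HC0 cU UB s0 st tT cg2) ha.
have vb := val_bound x t0T.
have C0t : C0 * t <= C0 * T by rewrite ler_wpM2l.
have C0ts : C0 * (t - s) <= C0 * T by rewrite ler_wpM2l//; case/andP: tsT.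
have C0s : C0 * (s - 0) <= C0 * d3 by rewrite subr0 ler_wpM2l.
have p0 := pB (gam 0); rewrite ler_norml in p0; case/andP: p0 => p01 p02.
have r1B : (cost G U gam 0 s <= (2 * Bp + 2 * (C0 * T) + eta)%:E)%E.
  by rewrite E1 lee_fin; move: vb; rewrite ler_norml => /andP[_ vb]; lra.
have pg := H1 gam 0 s (lexx 0) s0 (le_trans st tT) ltac:(by rewrite subr0) cg1 r1B.
have cg' : curve 0 (t - s) (fun r => gam (r + s)) by apply: curve_shift => //; rewrite add0r subrK.
have Us : jcont (fun r => U (r + s)) by exact: jcont_shift.
have UsB r y : 0 <= r <= t - s -> `|U (r + s) y| <= B.
  by move=> /andP[h1 h2]; apply: UB; rewrite addr_ge0//= (le_trans _ tT)// -lerBrDr.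
have UB' r y : 0 <= r <= t - s -> `|U r y| <= B.
  by move=> /andP[h1 h2]; apply: UB; rewrite h1 (le_trans h2)//; case/andP: tsT.
(* The Lipschitz constant in the value times the change of U under the shift in time; its integral
   over at most T is below eta / 4. *)
pose k := lam * (eta / (4 * (lam * T + 1))).
have cc := @cost_cmp R n M G lam C0 B (t - s) hG C00 HC0 U cU UB' (fun r => U (r + s)) (fun r => gam (r + s)) 0 (t - s) (cst k) Us UsB
  (lexx 0) ts0 (lexx _) cg' (const_integrable 0 (t - s) k).
have {}cc := cc ltac:(move=> r /andP[r0 rs]; rewrite ler_pM2l//; apply: H2; rewrite ?r0 ?addr_ge0//;
   [by rewrite (le_trans rs)//; case/andP: tsT|by rewrite opprD addrA subrr sub0r normrN ger0_norm]).
rewrite const_integral// subr0 in cc.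
have cs := @cost_shift R n M G lam C0 B s U (fun r => U (r + s)) gam 0 (t - s) hG C00 HC0 cU.
rewrite add0r subrK in cs.
rewrite cs// ?E2 in cc; last by move=> r y /andP[h1 h2]; apply: UB; rewrite (le_trans s0)// (le_trans h2).
pose g' (r : R) := gam (r + s).
have : (val G phi U (t - s) x <= action G phi U (t - s) g')%E.
  by apply: ereal_inf_lbound; exists g' => //; split => //; rewrite /g' subrK.
rewrite (val_fin x tsT) actionE {1}/g' add0r => hv.
have : ((fine (val G phi U (t - s) x))%:E <= (phi (gam s))%:E + (r2%:E + (k * (t - s))%:E))%E.
  by apply: le_trans hv _; rewrite leeD2l.
rewrite -!EFinD lee_fin => h.
have kT : k * (t - s) <= eta / 4.
  have kk : 0 <= k by rewrite /k mulr_ge0 ?divr_ge0// ltW.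
  have : k * (t - s) <= k * T by rewrite ler_wpM2l//; case/andP: tsT.
  move=> /le_trans; apply; rewrite /k mulrAC mulrA ler_pdivrMr//.
  have h4 : eta / 4 * (4 * (lam * T + 1)) = eta * (lam * T + 1) by field.
  by rewrite h4 mulrC ler_pM2l// lerDl.
move: pg; rewrite ler_norml => /andP[pg1 pg2].
have d3C' : C0 * d3 <= eta / 4 by rewrite mulrC.
exact: drop_arith h kT pg1 hr l1 C0s d3C'.
Qed.

(** From (t1, y1) a segment of speed at most 1 leads to y2 at a time t' a little later than both t1
    and t2; [val_drop] then goes back from t' to t2. *)
Lemma val_near x0 (eta : R) : 0 < eta -> exists2 d : R, 0 < d & forall (t1 t2 : R) (y1 y2 : E),
  0 <= t1 -> 0 <= t2 -> t1 + 1 <= T -> t2 + 1 <= T -> `|t1 - t2| <= d ->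
  `|y1 - chart_map (chart_at x0) x0| <= d -> `|y2 - chart_map (chart_at x0) x0| <= d ->
  fine (val G phi U t2 (chart_inv (chart_at x0) y2)) <= fine (val G phi U t1 (chart_inv (chart_at x0) y1)) + eta.
Proof.
move=> e0; have xc := chart_at_dom x0; set c := chart_at x0 in xc *; have yc := chart_map_range xc; set y0 := chart_map c x0 in yc *.
have [r r0 yr] := chart_ball yc.
have [_ _ sG _ _] := hG; have [k k0 Hk] := sG c y0 r B 1 yr.
have e2 : 0 < eta / 2 by rewrite divr_gt0.
have [d1 d10 H1] := val_drop e2.
set S := 2 * (Num.sqrt n%:R + 1) : R.
have S0 : 0 < S by rewrite mulr_gt0// ltr_wpDl// sqrtr_ge0.
have S2 : 2 <= S by rewrite /S ler_peMr// lerDr sqrtr_ge0.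
pose m := Num.min (Num.min (r / 3) 1) (Num.min d1 (eta / 2)).
have m0 : 0 < m by rewrite !lt_min ltr01 d10 e2 divr_gt0.
have [d [d0 dm dM]] := @pick_small R (S * (k + 1)) m ltac:(by rewrite mulr_ge0 ?addr_ge0// ltW) m0.
have mr : m <= r / 3 by rewrite !ge_min lexx.
have m1 : m <= 1 by rewrite !ge_min lexx orbT.
have md : m <= d1 by rewrite !ge_min lexx !orbT.
have me : m <= eta / 2 by rewrite !ge_min lexx !orbT.
have dS : 0 <= d * S by rewrite mulr_ge0// ltW.
have dSk : 0 <= d * S * k by rewrite mulr_ge0// ltW.
have dSm : d * S + d * S * k <= m by move: dM; rewrite mulrA mulrDr mulr1 addrC.
exists d => // t1 t2 y1 y2 t10 t20 t1T t2T tt yd1 yd2.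
have nyy : `|y2 - y1| <= 2 * d.
  by apply: le_trans (ler_distD y0 _ _) _; rewrite mulr_natl mulr2n lerD// distrC.
have eyy : en (y2 - y1) <= Num.sqrt n%:R * (2 * d).
  by apply: le_trans (en_le_norm _) _; rewrite ler_wpM2l ?sqrtr_ge0.
have ht1 : t1 <= Num.max t1 t2 by rewrite le_max lexx.
have ht2 : t2 <= Num.max t1 t2 by rewrite le_max lexx orbT.
have [mx1 mx2] := max_close tt.
move: (Num.max t1 t2) ht1 ht2 mx1 mx2 => mx ht1 ht2 mx1 mx2.
(* Late enough for the speed to be at most 1; the extra d keeps the duration positive when y1 =
   y2. *)
set t' := mx + (en (y2 - y1) + d).
have en0' := en_ge0 (y2 - y1).
have SE : d * S = Num.sqrt n%:R * (2 * d) + 2 * d by rewrite /S; ring.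
set s := t' - t1; have [s0 es] : 0 < s /\ en (y2 - y1) <= s by exact: ext_arith6.
have sS : s <= d * S by exact: ext_arith7 mx1 eyy SE.
have t'E : t1 + s = t' by rewrite /s addrC subrK.
have t'T : t1 + s <= T.
  apply: le_trans t1T; rewrite lerD2l (le_trans sS)// (le_trans _ m1)// (le_trans _ dSm)//.
  by rewrite lerDl.
set w : E := s^-1 *: (y2 - y1).
have wE : y1 + (t1 + s - t1) *: w = y2.
  by rewrite addrAC subrr add0r /w scalerA divff ?gt_eqF// scale1r addrC subrK.
have w1 : en w <= 1 by rewrite /w enZ gtr0_norm ?invr_gt0// mulrC ler_pdivrMr// mul1r.
have inb (q : R) : t1 <= q <= t1 + s -> `|y1 + (q - t1) *: w - y0| <= r.
  move=> /andP[q1 q2]; have -> : y1 + (q - t1) *: w - y0 = (y1 - y0) + ((q - t1) / s) *: (y2 - y1).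
    by rewrite /w scalerA addrAC.
  apply: le_trans (ler_normD _ _) _; rewrite normrZ ger0_norm ?divr_ge0 ?(ltW s0) ?subr_ge0//.
  have hs : (q - t1) / s * `|y2 - y1| <= 1 * (2 * d).
    by apply: ler_pM => //; rewrite ?divr_ge0 ?(ltW s0) ?subr_ge0// ler_pdivrMr// mul1r lerBlDl.
  exact: ext_arith5 yd1 hs dm mr.
have := @val_extend R n M G lam C0 B T phi U hG C00 HC0 cU UB c y1 w t1 s k t10 (ltW s0) t'T.
have t1I : 0 <= t1 <= T by rewrite t10 (le_trans _ t1T)// lerDl.
have tsI : 0 <= t1 + s <= T by rewrite t'T andbT addr_ge0// ltW.
rewrite /seg wE (val_fin _ t1I) (val_fin _ tsI) -EFinD lee_fin => hv.
have {}hv := hv ltac:(by move=> q h; apply: yr; exact: inb) ltac:(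
  move=> q p h; have hB := UB (chart_inv c (y1 + (q - t1) *: w)) (_ : 0 <= q <= T);
  have {}hB := hB ltac:(case/andP: h => h1 h2; rewrite (le_trans t10 h1)/=; exact: le_trans h2 t'T);
  have := Hk _ p _ (inb q h) hB; have := dot_le w p; have := ler_wpM2r (en_ge0 p) w1; exact: ext_arith4).
have dr : t1 + s - (t1 + s - t2) = t2 by ring.
have q1 : 0 <= t1 + s - t2 by rewrite t'E /t'; exact: ext_arith1.
have q2 : t1 + s - t2 <= d1 by rewrite t'E /t'; exact: ext_arith2 mx2 eyy SE dSm dSk md.
have q3 : t1 + s - t2 <= t1 + s by rewrite gerBl.
have := H1 (t1 + s) (t1 + s - t2) (chart_inv c y2); rewrite dr t'T q1 q2 => /(_ isT q3 isT) hd.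
have ks : k * s <= d * S * k by rewrite mulrC ler_pM2r.
exact: ext_arith3 hv hd ks dSm dS me.
Qed.

End Bounds.

Lemma action_data G (lam T : R) (phi : M -> R) U : compact [set: M] -> evo_ham G lam -> continuous phi -> jcont U ->
  exists C0 B Bp : R, [/\ 0 <= C0, (forall x (s : R), `|s| <= B -> `|G (Cotangent x 0, s)| <= C0),
   (forall x p (s : R), `|s| <= B -> - C0 <= G (Cotangent x p, s)),
   (forall t x, 0 <= t <= T -> `|U t x| <= B) & (forall x, `|phi x| <= Bp) /\ 0 <= Bp].
Proof.
move=> cM hG pc cU; have [B B0 UB] := jcont_bounded T cM cU.
have [C C_0 HC] := zero_section_bound B cM hG; have [C' C'0 HC'] := G_lower B cM hG.
have [Bp Bp0 pB] := compact_bounded_fun cM (fun x _ => pc x).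
exists (C + C'), B, Bp; split => //.
- by rewrite addr_ge0// ltW.
- by move=> x s sB; apply: le_trans (HC x s sB) _; rewrite lerDl ltW.
- by move=> x p s sB; apply: le_trans (HC' x p s sB); rewrite lerN2 lerDr ltW.
- by split; [move=> x; exact: pB|exact: ltW].
Qed.

Lemma val_jcont G (lam : R) (phi : M -> R) U : compact [set: M] -> evo_ham G lam -> continuous phi -> jcont U ->
  jcont (fun t x => fine (val G phi U t x)).
Proof.
move=> cM hG pc cU [t0 x0]; pose T : R := Num.max 0 t0 + 2.
have [C0 [B [Bp [C00 HC0 HC1 UB [pB Bp0]]]]] := action_data T cM hG pc cU.
apply/cvgrPdist_le => eta e0.
have [d d0 Hd] := val_near cM hG C00 HC0 HC1 cU UB pc pB Bp0 x0 e0.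
have xc := chart_at_dom x0; set c := chart_at x0 in xc Hd; have yc := chart_map_range xc; set y0 := chart_map c x0 in yc Hd.
pose m := Num.min d 1; have m0 : 0 < m by rewrite lt_min d0 ltr01.
have md : m <= d by rewrite ge_min lexx.
have m1 : m <= 1 by rewrite ge_min lexx orbT.
have n1 : nbhs t0 (ball t0 m) by apply/nbhs_ballP; exists m.
have n2 : \forall x \near x0, chart_dom c x /\ `|chart_map c x - y0| <= d.
  apply/(near_chart _ xc).
  have nb : \forall z \near y0, `|z - y0| <= d by apply: near_cball; rewrite subrr normr0.
  by apply: filterS2 nb (near_chart_range yc) => z h1 h2; rewrite chart_invK//; split => //; exact: chart_inv_dom.
exists (ball t0 m, [set x | chart_dom c x /\ `|chart_map c x - y0| <= d]) => // -[t x] [/= ht [hx1 hx2]].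
have tt : `|Num.max 0 t0 - Num.max 0 t| <= m.
  by move: ht; rewrite -ball_normE /= => /ltW; exact: max0_close.
have p0 : 0 <= Num.max 0 t0 by rewrite le_max lexx.
have p1 : 0 <= Num.max 0 t by rewrite le_max lexx.
have T1 : Num.max 0 t0 + 1 <= T by rewrite /T; lra.
have T2 : Num.max 0 t + 1 <= T by move: tt; rewrite ler_norml /T => /andP[h1 h2]; lra.
have y00 : `|y0 - y0| <= d by rewrite subrr normr0 ltW.
have tt' : `|Num.max 0 t - Num.max 0 t0| <= d by rewrite distrC (le_trans tt).
have a1 := Hd _ _ _ _ p0 p1 T1 T2 (le_trans tt md) y00 hx2.
have a2 := Hd _ _ _ _ p1 p0 T2 T1 tt' hx2 y00.
move: a1 a2; rewrite !chart_mapK// => a1 a2.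
exact: (@dist_le2 _ _ _ a2 a1).
Qed.
End ValueFunction.

(** * The evolution *)

Section Picard.
Context {R : realType} {n : nat} {M : manifold R n}.
Notation mu := (@lebesgue_measure R).
Implicit Types (x : M) (G : cotangent M * R -> R) (gam : R -> M) (U : R -> M -> R) (phi : M -> R).

(** The bounds u k - 2 a / 2 ^ k increase and u k + 2 a / 2 ^ k decrease, so the supremum of the
    lower ones is the limit, with its rate. *)
Lemma geometric_limit (u : nat -> R) (a : R) : (forall k, `|u k.+1 - u k| <= a / 2 ^+ k) ->
  exists l : R, forall k, `|l - u k| <= 2 * a / 2 ^+ k.
Proof.
move=> H; pose b k := 2 * a / 2 ^+ k.
have bS k : b k = a / 2 ^+ k + b k.+1.
  by rewrite /b exprS; field; rewrite expf_neq0.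
have lo k : u k - b k <= u k.+1 - b k.+1.
  by have := H k; rewrite ler_norml (bS k) => /andP[h1 h2]; lra.
have hi k : u k.+1 + b k.+1 <= u k + b k.
  by have := H k; rewrite ler_norml (bS k) => /andP[h1 h2]; lra.
have b0 k : 0 <= b k by rewrite /b divr_ge0 ?exprn_ge0// mulr_ge0//; have := le_trans (normr_ge0 _) (H 0); rewrite expr0 divr1.
have loh j k : (j <= k)%N -> u j - b j <= u k - b k.
  by elim: k => [|k IH]; [rewrite leqn0 => /eqP ->|rewrite leq_eqVlt => /orP[/eqP ->//|/IH/le_trans]; apply].
have hih j k : (j <= k)%N -> u k + b k <= u j + b j.
  by elim: k => [|k IH]; [rewrite leqn0 => /eqP ->|rewrite leq_eqVlt => /orP[/eqP ->//|/IH h]; exact: le_trans (hi k) h].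
have jk j k : u j - b j <= u k + b k.
  apply: le_trans (loh _ _ (leq_maxl j k)) _; apply: le_trans _ (hih _ _ (leq_maxr j k)).
  by rewrite lerD2l ge0_cp.
exists (sup (range (fun k => u k - b k))) => k.
have h1 : u k - b k <= sup (range (fun k => u k - b k)).
  apply: sup_upper_bound; last by exists k.
  by split; [exists (u 0 - b 0), 0|exists (u 0 + b 0) => _ [j _ <-]; exact: jk].
have h2 : sup (range (fun k => u k - b k)) <= u k + b k.
  by apply: sup_le_ub; [exists (u 0 - b 0), 0|move=> _ [j _ <-]; exact: jk].
by rewrite -/(b k) ler_norml; apply/andP; split; lra.
Qed.

Lemma halving (a X p e : R) : 0 <= a -> 0 <= X -> 0 <= p -> a * X * p <= e -> a * p / 2 * X <= e.
Proof.
move=> a0 X0 p0 h; have h0 : 0 <= a * X * p by rewrite !mulr_ge0.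
have -> : a * p / 2 * X = a * X * p / 2 by field.
lra.
Qed.

Lemma half_pow_small (c e : R) : 0 <= c -> 0 < e -> exists k : nat, c / 2 ^+ k <= e.
Proof.
move=> c0 e0; exists (Num.truncn (c / e)).+1; rewrite ler_pdivrMr ?exprn_gt0// mulrC -ler_pdivrMr//.
apply: le_trans (ltW (truncnS_gt _)) _; rewrite -natrX ler_nat; apply: ltnW; exact: ltn_expl.
Qed.

(** The weight exp (2 lam t) turns the factor lam of the Lipschitz bound into 1 / 2: this is the
    contraction constant. *)
Lemma integral_exp (lam c t : R) : 0 < lam -> 0 <= t ->
  mu.-integrable `[0, t] (EFin \o (fun r => lam * (c * expR (2 * lam * r)))) /\
  (\int[mu]_(r in `[0%R, t]) (lam * (c * expR (2 * lam * r)))%:E = (c / 2 * (expR (2 * lam * t) - 1))%:E)%E.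
Proof.
move=> l0 t0; pose f (r : R) := lam * (c * expR (2 * lam * r)); pose F (r : R) := c / 2 * expR (2 * lam * r).
have dF (r : R) : is_derive r 1 F (f r).
  by rewrite /F; apply: is_derive_eq; rewrite /f /GRing.scale/=; field.
have cF : continuous F.
  by move=> r; apply: differentiable_continuous; apply/derivable1_diffP; case: (dF r).
have cf : continuous f.
  have -> : f = fun r => 2 * lam * F r by apply/funext => r; rewrite /f /F; field.
  by move=> r; apply: (@continuousM _ _ (fun=> 2 * lam) F r); [exact: cst_continuous|exact: cF].
split.
  by apply: continuous_compact_integrable; [exact: segment_compact|exact: continuous_subspaceT].
move: t0; rewrite le_eqVlt => /orP[/eqP <-|t0].
  rewrite mulr0 expR0 subrr mulr0; apply: (integral_Sset1 0) => r /=; rewrite in_itv/= => h.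
  by apply/eqP; rewrite eq_le andbC.
have := @continuous_FTC2 R f F 0 t t0 (continuous_subspaceT cf).
rewrite /F mulr0 expR0 => ->.
- by rewrite -EFinB; congr (_%:E); ring.
- split.
  + by move=> r _; case: (dF r).
  + by apply: cvg_at_right_filter; exact: cF.
  + by apply: cvg_at_left_filter; exact: cF.
- by move=> r _; rewrite derive1E; case: (dF r).
Qed.

Lemma evo_ham_le G (lam lam' : R) : lam <= lam' -> evo_ham G lam -> evo_ham G lam'.
Proof.
move=> ll [l0 ul sG lG cG]; split => //; first exact: lt_le_trans ll.
by move=> z s s'; apply: le_trans (ul z s s') _; rewrite ler_wpM2r.
Qed.

Lemma dist3_lt (a b p q e : R) : `|a - p| <= e / 3 -> `|p - q| < e / 3 -> `|b - q| <= e / 3 -> `|a - b| < e.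
Proof.
move=> h1 h2; rewrite distrC => h3; have := ler_distD p a b; have := ler_distD q p b.
move: h1 h2 h3; move: `|a - p| `|p - q| `|q - b| `|a - b| `|p - b| => ? ? ? ? ?; clear; lra.
Qed.

Section Contraction.
Variables (G : cotangent M * R -> R) (lam : R) (phi : M -> R).
Hypotheses (cM : compact [set: M]) (hG : evo_ham G lam) (l1 : 1 <= lam) (pc : continuous phi).

Definition step U : R -> M -> R := fun t x => fine (val G phi U t x).

Lemma step_jcont U : jcont U -> jcont (step U).
Proof. by move=> cU; exact: val_jcont cM hG pc cU. Qed.

Lemma val_step U (t : R) x : jcont U -> 0 <= t -> val G phi U t x = (step U t x)%:E.
Proof.
move=> cU t0; have [C0 [B [Bp [C00 HC0 HC1 UB [pB _]]]]] := action_data t cM hG pc cU.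
by apply: (val_fin hG C00 HC0 HC1 cU UB pB); rewrite t0 lexx.
Qed.

Lemma step_le U U' (c : R) : jcont U -> jcont U' -> (forall t x, 0 <= t -> `|U t x - U' t x| <= c * expR (2 * lam * t)) ->
  forall t x, 0 <= t -> step U t x <= step U' t x + c / 2 * expR (2 * lam * t).
Proof.
move=> cU cU' H t x t0.
have l0 : 0 < lam by exact: lt_le_trans ltr01 l1.
have [B1 B10 UB1] := jcont_bounded t cM cU; have [B2 B20 UB2] := jcont_bounded t cM cU'.
have [C C_0 HC] := zero_section_bound (B1 + B2) cM hG.
have UB s y : 0 <= s <= t -> `|U s y| <= B1 + B2 by move=> h; apply: le_trans (UB1 s y h) _; rewrite lerDl ltW.
have UB' s y : 0 <= s <= t -> `|U' s y| <= B1 + B2 by move=> h; apply: le_trans (UB2 s y h) _; rewrite lerDr ltW.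
have [ik kI] := integral_exp c l0 t0.
have c0 : 0 <= c.
  by have := le_trans (normr_ge0 _) (H t x t0); rewrite pmulr_lge0// expR_gt0.
have : (val G phi U t x <= val G phi U' t x + (c / 2 * (expR (2 * lam * t) - 1))%:E)%E.
  rewrite -leeBlDr//; apply: le_ereal_inf_tmp => _ [gam [cg gt] <-]; rewrite leeBlDr//.
  apply: (@le_trans _ _ (action G phi U t gam)); first by apply: ereal_inf_lbound; exists gam.
  rewrite !actionE -addeA; apply: leeD => //; rewrite -kI.
  apply: (cost_cmp hG (ltW C_0) HC cU UB cU' UB' (lexx 0) t0 (lexx t) cg ik) => s /andP[s0 _].
  by rewrite ler_pM2l//; exact: H.
rewrite !val_step// -EFinD lee_fin mulrBr mulr1; have k0 : 0 <= c / 2 by exact: divr_ge0.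
by move/le_trans; apply; rewrite lerD2l gerBl.
Qed.

Lemma step_contraction U U' (c : R) : jcont U -> jcont U' -> (forall t x, 0 <= t -> `|U t x - U' t x| <= c * expR (2 * lam * t)) ->
  forall t x, 0 <= t -> `|step U t x - step U' t x| <= c / 2 * expR (2 * lam * t).
Proof.
move=> cU cU' H t x t0; apply: dist_le2; first exact: step_le.
by apply: step_le => // s y s0; rewrite distrC; exact: H.
Qed.

Definition picard k : R -> M -> R := iter k step (fun=> phi).

Lemma picard_jcont k : jcont (picard k).
Proof.
elim: k => [|k IH]; last exact: step_jcont.
by move=> z; apply: (@continuous_comp _ _ _ (fun z : R * M => z.2) phi); [exact: cvg_snd|exact: pc].
Qed.

(** The weight dominates 1 and t because lam >= 1, so the linear growth of the first iterate fits
    under it. *)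
Lemma expR_ge (t : R) : 0 <= t -> t <= expR (2 * lam * t) /\ 1 <= expR (2 * lam * t).
Proof.
move=> t0; have l2 : 1 <= 2 * lam by move: l1 => h; lra.
have h : t <= 2 * lam * t by rewrite -[leLHS]mul1r ler_wpM2r.
by have h1 := expR_ge1Dx (2 * lam * t); split; lra.
Qed.

Lemma picard_first : exists2 D : R, 0 <= D & forall t x, 0 <= t -> `|picard 1 t x - picard 0 t x| <= D * expR (2 * lam * t).
Proof.
have [Bp Bp0 pB] := compact_bounded_fun cM (fun x _ => @pc x).
have {}pB x : `|phi x| <= Bp by exact: pB.
have [C C_0 HC] := zero_section_bound Bp cM hG; have [C' C'0 HC'] := G_lower Bp cM hG.
have CC0 : 0 <= C + C' by rewrite addr_ge0// ltW.
have HC1 x (s : R) : `|s| <= Bp -> `|G (Cotangent x 0, s)| <= C + C'.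
  by move=> h; apply: le_trans (HC x s h) _; rewrite lerDl ltW.
have HC2 x p (s : R) : `|s| <= Bp -> - (C + C') <= G (Cotangent x p, s).
  by move=> h; apply: le_trans (HC' x p s h); rewrite lerN2 lerDr ltW.
exists (2 * Bp + (C + C')); first by rewrite addr_ge0// mulr_ge0// ltW.
move=> t x t0; have [h1 h2] := expR_ge t0.
have tt : 0 <= t <= t by rewrite t0 lexx.
have UB (s : R) y : 0 <= s <= t -> `|picard 0 s y| <= Bp by move=> _; exact: pB.
have := val_le phi hG CC0 HC1 HC2 (@picard_jcont 0) UB x tt.
have := val_ge hG CC0 HC1 (@picard_jcont 0) UB pB x tt.
rewrite (val_step x (@picard_jcont 0) t0) !lee_fin -/(picard 1) => v1 v2.
have := pB x; rewrite !ler_norml => /andP[p1 p2].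
have a1 : (C + C') * t <= (C + C') * expR (2 * lam * t) by rewrite ler_wpM2l.
have a2 : 2 * Bp * 1 <= 2 * Bp * expR (2 * lam * t) by rewrite ler_wpM2l// mulr_ge0// ltW.
have a3 : (C + C') * t >= 0 by exact: mulr_ge0.
by move: v1 v2; rewrite /picard /= => v1 v2; apply/andP; split; lra.
Qed.

(** The iterates converge geometrically in the weighted norm, uniformly on bounded times, so the
    limit is jointly continuous and fixed by [step]. *)
Lemma evolution_exists : exists2 U, jcont U & is_evolution G phi U.
Proof.
have [D D0 HD] := picard_first.
have pk k t x : 0 <= t -> `|picard k.+1 t x - picard k t x| <= D / 2 ^+ k * expR (2 * lam * t).
  elim: k t x => [|k IH] t x t0; first by rewrite expr0 divr1; exact: HD.
  have := step_contraction (@picard_jcont k.+1) (@picard_jcont k) IH x t0.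
  by rewrite exprSr invfM mulrA.
(* The limit is chosen pointwise, with an arbitrary value at negative times. *)
have lim (z : R * M) : exists l : R, 0 <= z.1 -> forall k, `|l - picard k z.1 z.2| <= 2 * D * expR (2 * lam * z.1) / 2 ^+ k.
  have [z0|z0] := leP 0 z.1; last by exists 0.
  have [|l Hl] := @geometric_limit (fun k => picard k z.1 z.2) (D * expR (2 * lam * z.1)).
    by move=> k; apply: le_trans (pk k _ _ z0) _; rewrite mulrAC.
  by exists l => _ k; rewrite -(mulrA 2 D).
have [L HL] := choice lim; pose U (t : R) x := L (t, x).
have HU k t x : 0 <= t -> `|U t x - picard k t x| <= 2 * D / 2 ^+ k * expR (2 * lam * t).
  by move=> t0; have := HL (t, x) t0 k; rewrite mulrAC.
have E0 (t : R) : 0 <= 2 * D * expR (2 * lam * t) by rewrite mulr_ge0 ?expR_ge0// mulr_ge0.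
have cU : jcont U.
  move=> [t0 x0]; apply/cvgrPdist_le => eta e0.
  have e3 : 0 < eta / 3 by rewrite divr_gt0.
  pose T := Num.max 0 t0 + 1.
  have [k Hk] := half_pow_small (E0 T) e3.
  have c1 : \forall z \near ((t0, x0) : R * M), Num.max 0 z.1 < T.
    apply: (@near_lt _ _ (fun z : R * M => Num.max 0 z.1)); last by rewrite ltrDl.
    by apply: continuous_max; [exact: cst_continuous|exact: cvg_fst].
  have /cvgrPdist_lt/(_ _ e3) c2 := @picard_jcont k (t0, x0).
  apply: filterS2 c1 c2 => -[t x] /= h1 h2.
  have p0 : 0 <= Num.max 0 t0 by rewrite le_max lexx.
  have p1 : 0 <= Num.max 0 t by rewrite le_max lexx.
  have bd (s : R) y : 0 <= s -> s <= T -> `|U s y - picard k s y| <= eta / 3.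
    move=> s0 sT; apply: le_trans (HU k s y s0) _; apply: le_trans _ Hk.
    rewrite mulrAC; apply: ler_wpM2r; first by rewrite invr_ge0 exprn_ge0.
    apply: ler_wpM2l; first exact: mulr_ge0.
    by rewrite ler_expR ler_pM2l// mulr_gt0//; exact: lt_le_trans ltr01 l1.
  have b1 := bd (Num.max 0 t0) x0 p0 ltac:(by rewrite /T lerDl).
  have b2 := bd (Num.max 0 t) x p1 (ltW h1).
  exact: ltW (dist3_lt b1 h2 b2).
have fix_ t x : 0 <= t -> step U t x = U t x.
  move=> t0; apply/eqP; rewrite -subr_eq0 -normr_le0; apply/ler_addgt0Pr => e e0; rewrite add0r.
  have e2 : 0 < e / 2 by rewrite divr_gt0.
  have [k Hk] := half_pow_small (E0 t) e2.
  have s1 := step_contraction cU (@picard_jcont k) (HU k) x t0.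
  have s2 := HU k.+1 t x t0.
  have hh : 2 * D / 2 ^+ k / 2 * expR (2 * lam * t) <= e / 2.
    by apply: halving Hk; rewrite ?mulr_ge0 ?expR_ge0// invr_ge0 exprn_ge0.
  have hh2 : 2 * D / 2 ^+ k.+1 * expR (2 * lam * t) <= e / 2 by rewrite exprSr invfM mulrA.
  apply: le_trans (ler_distD (picard k.+1 t x) _ _) _; rewrite [leRHS]splitr.
  by apply: lerD; [exact: le_trans s1 hh|rewrite distrC; exact: le_trans s2 hh2].
exists U => //; split.
  apply: subspace_eq_continuous (continuous_subspaceT cU) => z; rewrite inE/= => z0.
  by rewrite /from_subspace (max_idPr z0).
by move=> t x t0; rewrite -/(val G phi U t x) val_step// fix_.
Qed.

End Contraction.

Lemma evolution_jcont G phi U : is_evolution G phi U -> jcont U.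
Proof.
move=> [/subspace_continuousP cU _] z A nA.
have z0 : [set z : R * M | 0 <= z.1] (Num.max 0 z.1, z.2) by rewrite /= le_max lexx.
have pc : {for z, continuous (fun z : R * M => (Num.max 0 z.1, z.2))}.
  apply: for_pair; last exact: cvg_snd.
  by apply: continuous_max; [exact: cst_continuous|exact: cvg_fst].
have h : \forall y \near z, [set z : R * M | 0 <= z.1] (Num.max 0 y.1, y.2) -> A (U (Num.max 0 y.1) y.2) := pc _ (cU _ z0 A nA).
suff : \forall y \near z, A (U (Num.max 0 y.1) y.2) by [].
by apply: filterS h => y; apply; rewrite /= le_max lexx.
Qed.

End Picard.

(** * Viscosity inequalities for the evolution *)

Section EvolutionViscosity.
Context {R : realType} {n : nat} {M : manifold R n}.
Notation E := 'rV[R]_n.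
Notation Z := (E * E * R)%type.
Notation mu := (@lebesgue_measure R).
Implicit Types (x : M) (c : chart M) (G : cotangent M * R -> R) (gam : R -> M) (U : R -> M -> R) (phi : M -> R).

Lemma Hc_near_lt G (lam : R) c (y q : E) (s a : R) : evo_ham G lam -> chart_range c y -> Hc G c (y, q, s) < a ->
  exists2 d : R, 0 < d & forall (z p : E) (t : R), `|z - y| < d -> en (p - q) < d -> `|t - s| < d -> Hc G c (z, p, t) < a.
Proof.
move=> [_ _ _ _ cG] yc lt.
have /nbhs_ballP[d /= d0 Hd] : \forall z \near ((y, q, s) : Z), Hc G c z < a by apply: near_lt => //; exact: cG.
exists d => // z p t h1 h2 h3; apply: (Hd (z, p, t)).
rewrite -ball_normE /= distrC prod_normE gt_max prod_normE gt_max /=.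
by rewrite h1 h3 (le_lt_trans (norm_le_en _) h2).
Qed.

(** At (y0, s0) the supporting slope g is a velocity whose Legendre supremum is attained at q;
    nearby, the supremum for the same velocity exceeds this value by at most eta. *)
Lemma Lc_near G (lam : R) c (y0 q g : E) (s0 eta : R) : evo_ham G lam -> chart_range c y0 -> 0 < eta ->
  (forall p, Hc G c (y0, q, s0) + dot g (p - q) <= Hc G c (y0, p, s0)) ->
  exists2 d : R, 0 < d & forall (y p : E) (s : R), `|y - y0| <= d -> `|s - s0| <= d ->
    chart_range c y /\ dot g p - Hc G c (y, p, s) <= dot g q - Hc G c (y0, q, s0) + eta.
Proof.
move=> hG yc e0 Hg; have [_ _ sG lG _] := hG.
have [r r0 yr] := chart_ball yc.
set k := dot g q - Hc G c (y0, q, s0).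
have [C C0 HC] := sG c y0 r (`|s0| + 1) (en g + 1) yr.
have K0 : 0 <= `|C - k| by exact: normr_ge0.
have [L L0 HL] := lG c y0 r (`|s0| + 1) `|C - k| yr.
have S0 : 0 <= Num.sqrt n%:R + 1 :> R by rewrite addr_ge0 ?sqrtr_ge0.
have m0 : 0 < Num.min (Num.min r 1) eta by rewrite !lt_min r0 ltr01.
have [d [d0 dm dM]] := @pick_small R (L * (Num.sqrt n%:R + 1)) _ ltac:(by rewrite mulr_ge0// ltW) m0.
have dr : d <= r by min_ub dm.
have d1 : d <= 1 by min_ub dm.
have de : d * (L * (Num.sqrt n%:R + 1)) <= eta by min_ub dM.
exists d => // y p s yd sd.
have yr' : `|y - y0| <= r by exact: le_trans dr.
split; first exact: yr.
have sB : `|s| <= `|s0| + 1 by have := ler_distD s0 s 0; rewrite !subr0; lra.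
have s0B : `|s0| <= `|s0| + 1 by rewrite lerDl.
have [pK|pK] := leP (en p) `|C - k|; last first.
  have h1 := HC y p s yr' sB; have h2 := dot_le g p; have h3 := ler_norm (C - k).
  by move: h1 h2 h3 pK e0; rewrite mulrDl mul1r; clear; lra.
have y00 : `|y0 - y0| <= r by rewrite subrr normr0 ltW.
have h := HL y0 y p p s0 s y00 yr' pK pK s0B sB.
have hg := Hg p; rewrite dotBr in hg.
have : L * (en (y0 - y) + en (p - p) + `|s0 - s|) <= eta.
  apply: le_trans _ de; rewrite mulrCA ler_pM2l// subrr en0 addr0 mulrDr mulr1 distrC.
  apply: lerD => //; rewrite enC; apply: le_trans (en_le_norm _) _; rewrite mulrC.
  by rewrite ler_wpM2r ?sqrtr_ge0.
by move: h hg; rewrite /k; clear; lra.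
Qed.

Lemma jcont_chart U c (t : R) (y : E) : jcont U -> chart_range c y ->
  {for (t, y), continuous (fun z : R * E => U (Num.max 0 z.1) (chart_inv c z.2))}.
Proof.
move=> cU yc; apply: (@continuous_comp _ _ _ (fun z : R * E => (z.1, chart_inv c z.2)) (fun z : R * M => U (Num.max 0 z.1) z.2)); last exact: cU.
apply: for_pair; first exact: cvg_fst.
by apply: (@continuous_comp _ _ _ (fun z : R * E => z.2) (chart_inv c)); [exact: cvg_snd|exact: chart_inv_continuous].
Qed.

Lemma jcont_chart_near U c (th d : R) (yh : E) : jcont U -> 0 <= th -> chart_range c yh -> 0 < d ->
  exists2 d1 : R, 0 < d1 & forall z : R * E, ball ((th, yh) : R * E) d1 z ->
    `|U (Num.max 0 z.1) (chart_inv c z.2) - U th (chart_inv c yh)| < d.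
Proof.
move=> cU th0 yc d0; apply/nbhs_ballP.
have /cvgr_dist_lt/(_ _ d0) := jcont_chart (t := th) cU yc; rewrite /= (max_idPr th0).
by apply: filterS => z; rewrite distrC.
Qed.

Lemma fin_add (a : \bar R) (p w m : R) : (p%:E + a <= w%:E)%E -> w - p <= m -> (a <= m%:E)%E.
Proof.
case: a => [k| |] //; last by move=> _ _; rewrite leNye.
by rewrite -EFinD !lee_fin; lra.
Qed.

Lemma fin_mid (a : \bar R) (p w q : R) : (p%:E + a <= w%:E)%E -> (q%:E <= a)%E -> p + q <= w.
Proof.
case: a => [k| |] //.
by rewrite -EFinD !lee_fin; lra.
Qed.

Lemma sub_arith (U U' al qg w2 k h N eta : R) : 0 < h -> U <= U' + k * h ->
  U' <= U - al * h - qg * h + N * (h ^+ 2 + w2 * h ^+ 2) -> N * (h + w2 * h) <= eta -> al + qg <= k + eta.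
Proof.
move=> h0 h1 h2 h3; rewrite -(ler_pM2r h0).
have h4 : N * (h + w2 * h) * h <= eta * h by rewrite ler_pM2r.
by move: h1 h2 h4; rewrite !expr2; lra.
Qed.

(** The point (th, yh) is reached from time th - h with constant velocity g, the velocity dual to q,
    at the cost estimated in [Lc_near]; the upper test at the starting point, divided by h, gives
    the inequality. *)
Lemma evolution_psup G (lam : R) phi U c (th al N r : R) (yh q g : E) : compact [set: M] -> evo_ham G lam ->
  continuous phi -> jcont U -> (forall t x, 0 <= t -> val G phi U t x = (U t x)%:E) ->
  0 < th -> 0 < r -> 0 <= N -> chart_range c yh ->
  (forall p, Hc G c (yh, q, U th (chart_inv c yh)) + dot g (p - q) <= Hc G c (yh, p, U th (chart_inv c yh))) ->
  (forall (t : R) (y : E), th - r <= t <= th -> `|y - yh| <= r ->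
    U t (chart_inv c y) <= U th (chart_inv c yh) + al * (t - th) + dot q (y - yh) + N * ((t - th) ^+ 2 + nsq (y - yh))) ->
  al + Hc G c (yh, q, U th (chart_inv c yh)) <= 0.
Proof.
move=> cM hG pc cU HU th0 r0 N0 yc Hg Ht.
have [C0 [B [Bp [C00 HC0 HC1 UB [pB _]]]]] := action_data th cM hG pc cU.
set Uh := U th (chart_inv c yh) in Hg Ht *.
apply/ler_addgt0Pr => eta e0; rewrite add0r.
have e2 : 0 < eta / 2 by rewrite divr_gt0.
have [d d0 Hd] := Lc_near hG yc e2 Hg.
have [d1 d10 Hd1] := jcont_chart_near cU (ltW th0) yc d0.
have g0 := en_ge0 g; have n0 := nsq_ge0 g.
have m0 : 0 < Num.min (Num.min (Num.min th (r / 2)) (d1 / 2)) (Num.min d (eta / 2)).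
  by rewrite !lt_min th0 d0 !divr_gt0.
have [h [h0 hm hM]] := @pick_small R (en g + N * (1 + nsq g)) _ ltac:(by rewrite addr_ge0// mulr_ge0// addr_ge0) m0.
have hth : h <= th by min_ub hm.
have hr : h <= r / 2 by min_ub hm.
have hd1 : h <= d1 / 2 by min_ub hm.
have hge : h * en g <= h * (en g + N * (1 + nsq g)) by rewrite ler_pM2l// lerDl mulr_ge0// addr_ge0.
have hNe : h * (N * (1 + nsq g)) <= h * (en g + N * (1 + nsq g)) by rewrite ler_pM2l// lerDr.
have gr : h * en g <= r / 2 by min_ub (le_trans hge hM).
have gd1 : h * en g <= d1 / 2 by min_ub (le_trans hge hM).
have gd : h * en g <= d by min_ub (le_trans hge hM).
have Ne : h * (N * (1 + nsq g)) <= eta / 2 by min_ub (le_trans hNe hM).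
(* The starting point is displaced against g, so that the segment arrives at yh at time th. *)
pose y1 : E := yh - h *: g.
have yE (t : R) : y1 + (t - (th - h)) *: g = yh + (t - th) *: g.
  by rewrite /y1; apply/rowP => i; rewrite !mxE; ring.
have yn (t : R) : th - h <= t <= th -> en (yh + (t - th) *: g - yh) <= h * en g.
  move=> /andP[h1 h2]; rewrite addrAC subrr add0r enZ ler_wpM2r// ler_norml.
  by apply/andP; split; move: h1 h2 h0; clear; lra.
have seg_th : seg c y1 g (th - h) (th - h + h) = chart_inv c yh.
  by rewrite /seg yE (_ : th - h + h - th = 0) ?scale0r ?addr0//; ring.
have near_ok (t : R) p : th - h <= t <= th -> chart_range c (yh + (t - th) *: g) /\
    dot g p - Hc G c (yh + (t - th) *: g, p, U t (chart_inv c (yh + (t - th) *: g))) <= dot g q - Hc G c (yh, q, Uh) + eta / 2.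
  move=> ht; have yd := yn t ht; case/andP: (ht) => h1 h2.
  have t0 : 0 <= t by move: h1 hth; clear; lra.
  apply: Hd; first exact: le_trans (norm_le_en _) (le_trans yd gd).
  apply: ltW; have := Hd1 (t, yh + (t - th) *: g); rewrite /= (max_idPr t0); apply.
  split; rewrite -ball_normE /=.
    by rewrite ger0_norm ?subr_ge0//; move: h1 hd1 d10; clear; lra.
  rewrite distrC; apply: le_lt_trans (le_trans (norm_le_en _) (le_trans yd gd1)) _.
  by rewrite ltr_pdivrMr// ltr_pMr// ltr1n.
have th_h : 0 <= th - h by rewrite subr_ge0.
have thE : th - h + h = th by rewrite subrK.
have := @val_extend R n M G lam C0 B th phi U hG C00 HC0 cU UB c y1 g (th - h) h (dot g q - Hc G c (yh, q, Uh) + eta / 2) th_h (ltW h0).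
rewrite seg_th thE lexx => /(_ isT) hv.
have {}hv := hv ltac:(by move=> t ht; rewrite yE; case: (near_ok t 0 ht)) ltac:(by move=> t p ht; rewrite /seg yE; case: (near_ok t p ht)).
rewrite !HU// ?(ltW th0)// -EFinD lee_fin -/Uh in hv.
have := Ht (th - h) y1.
have -> : th - h - th = - h by ring.
have -> : y1 - yh = - (h *: g) by rewrite /y1 addrAC subrr add0r.
rewrite normrN dotNr nsqN dotZr nsqZ => ht.
have {}ht := ht ltac:(by apply/andP; split; move: hr r0 h0; clear; lra) ltac:(by apply: le_trans (norm_le_en _) _; rewrite enZ gtr0_norm//; move: gr r0; clear; lra).
have Nh : N * (h + nsq g * h) <= eta / 2 by apply: le_trans _ Ne; rewrite le_eqVlt; apply/orP; left; apply/eqP; ring.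
have := @sub_arith Uh (U (th - h) (chart_inv c y1)) al (dot q g) (nsq g) _ h N (eta / 2) h0 hv _ Nh.
rewrite (dotC q g) => ha; have {}ha := ha ltac:(by move: ht; rewrite dotC sqrrN mulrN (mulrC (nsq g)) (mulrC h); clear; lra).
by move: ha; clear; lra.
Qed.

Lemma super_arith (U U' al Q c h N eta : R) : 0 < h -> U' + c <= U + h ^+ 2 -> U - al * h + Q - N * h ^+ 2 <= U' ->
  - Q + (al + 2 * eta) * h <= c -> h * (1 + N) <= eta -> 0 < eta -> False.
Proof.
move=> h0 h1 h2 h3 h4 e0; have h5 : h * (1 + N) * h <= eta * h by rewrite ler_pM2r.
have h6 : 0 < eta * h by exact: mulr_gt0.
by move: h1 h2 h3 h5 h6; rewrite !expr2; lra.
Qed.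

(** An almost optimal curve ending at yh stays near yh during the last h by [displacement]. Were the
    inequality false, Fenchel's inequality for the test paraboloid would make this last piece too
    expensive. *)
Lemma evolution_psub G (lam : R) phi U c (th al N r : R) (yh q : E) : compact [set: M] -> evo_ham G lam ->
  continuous phi -> jcont U -> (forall t x, 0 <= t -> val G phi U t x = (U t x)%:E) ->
  0 < th -> 0 < r -> 0 <= N -> chart_range c yh ->
  (forall (t : R) (y : E), th - r <= t <= th -> `|y - yh| <= r ->
    U th (chart_inv c yh) + al * (t - th) + dot q (y - yh) - N * ((t - th) ^+ 2 + nsq (y - yh)) <= U t (chart_inv c y)) ->
  0 <= al + Hc G c (yh, q, U th (chart_inv c yh)).
Proof.
move=> cM hG pc cU HU th0 r0 N0 yc Ht; rewrite leNgt; apply/negP => F0.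
have [C0 [B [Bp [C00 HC0 HC1 UB [pB _]]]]] := action_data th cM hG pc cU.
set Uh := U th (chart_inv c yh) in F0 Ht.
have [eta e0 etaE] : exists2 eta : R, 0 < eta & al + Hc G c (yh, q, Uh) = - (3 * eta).
  by exists (- (al + Hc G c (yh, q, Uh)) / 3); [rewrite divr_gt0// oppr_gt0|field].
have [d d0 Hd] := @Hc_near_lt G lam c yh q Uh (- al - 2 * eta) hG yc ltac:(by move: etaE e0; clear; lra).
have [r1 r10 yr] := chart_ball yc.
have [d1 d10 Hd1] := jcont_chart_near cU (ltW th0) yc d0.
have m0 : 0 < Num.min (Num.min r r1) (Num.min (d / 2) (d1 / 2)) by rewrite !lt_min r0 r10 !divr_gt0.
have S0 : 0 <= 2 * N * (Num.sqrt n%:R) by rewrite !mulr_ge0 ?sqrtr_ge0.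
have [ro [ro0 rom roM]] := @pick_small R (2 * N * Num.sqrt n%:R) _ S0 m0.
have ror : ro <= r by min_ub rom.
have ror1 : ro <= r1 by min_ub rom.
have rod : ro <= d / 2 by min_ub rom.
have rod1 : ro <= d1 / 2 by min_ub rom.
have roN : ro * (2 * N * Num.sqrt n%:R) <= d / 2 by min_ub roM.
have yro : cball yh ro `<=` chart_range c by move=> z zz; apply: yr; exact: le_trans ror1.
have B0 : 0 <= B by apply: le_trans (UB th (chart_inv c yh) _); rewrite ?normr_ge0// (ltW th0) lexx.
have Bc0 : 0 <= 2 * B + 1 by rewrite addr_ge0// mulr_ge0.
have [d2 d20 Hd2] := displacement hG C00 HC0 cU UB ro0 Bc0 yro.
have m1 : 0 < Num.min (Num.min (Num.min th r) (d1 / 2)) (Num.min (Num.min d2 1) eta) by rewrite !lt_min th0 r0 d20 ltr01 e0 divr_gt0.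
have [h [h0 hm hM]] := @pick_small R (1 + N) _ ltac:(by rewrite addr_ge0) m1.
have hth : h <= th by min_ub hm.
have hr : h <= r by min_ub hm.
have hd1 : h <= d1 / 2 by min_ub hm.
have hd2 : h <= d2 by min_ub hm.
have h1 : h <= 1 by min_ub hm.
have hN : h * (1 + N) <= eta by min_ub hM.
have th_h : 0 <= th - h by rewrite subr_ge0.
have thh : th - h <= th by rewrite gerBl ltW.
have thI : 0 <= th <= th by rewrite lexx ltW.
have h2 : 0 < h ^+ 2 by exact: exprn_gt0.
(* The defect h ^ 2 disappears after division by h. *)
have [gam [cg gt ha]] := near_optimal hG C00 HC0 HC1 cU UB pB (chart_inv c yh) thI h2.
rewrite (HU th _ (ltW th0)) /= -/Uh in ha.
have vr := val_restrict phi hG C00 HC0 cU UB th_h thh (lexx th) cg.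
rewrite HU// in vr; have {}vr := le_trans vr ha.
have cgh : curve (th - h) th gam by exact: curve_sub th_h (lexx th) cg.
have h21 : h ^+ 2 <= 1 by rewrite expr2; exact: le_trans (ler_piMl (ltW h0) h1) h1.
have costB : (cost G U gam (th - h) th <= (2 * B + 1)%:E)%E.
  have := UB th (chart_inv c yh) thI; have := UB (th - h) (gam (th - h)) ltac:(by rewrite th_h).
  rewrite ler_norml -/Uh ler_norml => /andP[v2 v3] /andP[v4 v5].
  by apply: fin_add vr _; move: v2 v5 h21; clear; lra.
have gc : chart_dom c (gam th) by rewrite gt; exact: chart_inv_dom.
have gr : `|chart_map c (gam th) - yh| <= ro / 2 by rewrite gt chart_invK// subrr normr0 divr_ge0// ltW.
have hh : th - (th - h) <= d2 by rewrite opprB addrC subrK.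
have Hin := Hd2 gam (th - h) th th_h thh (lexx th) hh cgh costB gc gr.
pose f := chart_map c \o gam.
(* The space part of the test function; its gradient [DQ] stays close to q in the small ball, where
   the Hamiltonian is below -al - 2 eta. *)
pose Q (y : E) := dot q (y - yh) - N * nsq (y - yh).
pose DQ (y : E) : E := q - (2 * N) *: (y - yh).
have im : gam @` `[th - h, th] `<=` chart_dom c by move=> _ [t + <-]; rewrite /= in_itv/= => /Hin[].
have sc : {within `[th - h, th], continuous (fun t => U t (gam t))} by apply: jcont_along0 => //; case: cgh.
have eno (y : E) : `|y - yh| <= ro -> en (y - yh) <= Num.sqrt n%:R * ro.
  by move=> yy; apply: le_trans (en_le_norm _) _; rewrite ler_wpM2l ?sqrtr_ge0.
have QE (z y : E) : Q z - Q y = dot (DQ y) (z - y) - N * nsq (z - y).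
  rewrite /Q /DQ (nsq_shift yh y z) (dotBl q) (dotZl (2 * N)).
  have -> : dot q (z - yh) = dot q (y - yh) + dot q (z - y) by rewrite -dotDr -sub_split.
  by clear; ring.
have K00 : 0 <= (en q + N * (4 * (Num.sqrt n%:R * ro))) * Num.sqrt n%:R.
  by rewrite mulr_ge0 ?sqrtr_ge0// addr_ge0 ?en_ge0// !mulr_ge0 ?sqrtr_ge0// ltW.
have fen := @fenchel R n M G lam c (th - h) th gam (fun t => U t (gam t)) hG thh cgh im sc Q DQ (- al - 2 * eta) _ C0 K00 C00.
have {}fen : ((Q (f th) - Q (f (th - h)) - (- al - 2 * eta) * (th - (th - h)))%:E <= cost G U gam (th - h) th)%E.
  apply: fen.
  - move=> t _; move: (_ t) => y; apply: frechet_dd => sg sg0.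
    have [e [ee0 _ eN]] := @pick_small R N sg N0 sg0.
    have nr : \forall z \near y, 1 * en (z - y) < e.
      by apply: near_lt; [exact: en_sub_continuous|rewrite subrr en0 mulr0].
    apply: filterS nr => z; rewrite mul1r => ze; rewrite QE addrAC subrr add0r normrN ger0_norm ?mulr_ge0 ?nsq_ge0//.
    rewrite -en_sq expr2 mulrA ler_wpM2r ?en_ge0//; apply: le_trans eN.
    by rewrite mulrC ler_wpM2r// ltW.
  - move=> t t' /Hin[_ i1] /Hin[_ i2]; rewrite -/f -/(f t) -/(f t') in i1 i2 *.
    rewrite -mulrA; apply: le_trans (_ : (en q + N * (4 * (Num.sqrt n%:R * ro))) * en (f t - f t') <= _); last first.
      by rewrite ler_wpM2l ?en_le_norm// addr_ge0 ?en_ge0// !mulr_ge0 ?sqrtr_ge0// ltW.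
    have -> : Q (f t) - Q (f t') = dot (q - N *: ((f t - yh) + (f t' - yh))) (f t - f t').
      have -> : f t - f t' = (f t - yh) - (f t' - yh) by rewrite opprB addrA subrK.
      rewrite /Q; move: (f t - yh) (f t' - yh) => a b.
      by rewrite (dotBl q) (dotZl N) !dotBr !dotDl /nsq (dotC b a); clear; ring.
    apply: le_trans (abs_dot_le _ _) _; rewrite ler_wpM2r ?en_ge0//.
    apply: le_trans (enD _ _) _; rewrite enN enZ ger0_norm// lerD2l ler_wpM2l//.
    apply: le_trans (enD _ _) _; have := eno _ i1; have := eno _ i2.
    have : 0 <= Num.sqrt n%:R * ro by rewrite mulr_ge0 ?sqrtr_ge0// ltW.
    by clear; lra.
  - move=> t ht; have [i0 i1] := Hin t ht; case/andP: (ht) => t1 t2.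
    have t0 : 0 <= t by exact: le_trans th_h t1.
    apply: ltW; apply: Hd.
    + by apply: le_lt_trans i1 _; move: rod d0; clear; lra.
    + rewrite /DQ addrAC subrr add0r enN enZ ger0_norm ?mulr_ge0//.
      have := ler_wpM2l (_ : 0 <= 2 * N) (eno _ i1); rewrite mulr_ge0// => /(_ isT) hx.
      by apply: le_lt_trans hx _; move: roN d0; clear; lra.
    + have := Hd1 (t, f t); rewrite /= (max_idPr t0) /f /= chart_mapK//; apply.
      split; rewrite -ball_normE /=.
        by rewrite ger0_norm ?subr_ge0//; move: t1 hd1 d10; clear; lra.
      by rewrite distrC; apply: le_lt_trans i1 _; move: rod1 d10; clear; lra.
  - exact: (cost_ell_ge HC0 UB gam th_h (lexx th)).
have [i0 i1] := Hin (th - h) ltac:(by rewrite lexx).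
have := Ht (th - h) (f (th - h)) ltac:(by rewrite thh andbT; move: hr; clear; lra) (le_trans i1 ror).
rewrite /f /= chart_mapK// -/(f (th - h)).
have -> : th - h - th = - h by ring.
rewrite sqrrN => hl.
have Qth : Q (f th) = 0 by rewrite /Q /f /= gt chart_invK// subrr dot0r nsq0 mulr0 subr0.
rewrite Qth in fen.
have v1 := fin_mid vr fen.
apply: (@super_arith Uh (U (th - h) (gam (th - h))) al (Q (f (th - h))) _ h N eta h0 v1 _ _ hN e0).
  by move: hl; rewrite /Q; clear; lra.
by clear; lra.
Qed.

End EvolutionViscosity.

(** * Asymptotic stability *)

Section Barrier.
Context {R : realType} {n : nat}.
Notation E := 'rV[R]_n.

Definition barrier (rho k t : R) : R := rho / (1 + k * t).

Lemma barrier_den (k t : R) : 0 <= k -> 0 <= t -> 1 <= 1 + k * t.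
Proof. by move=> k0 t0; rewrite lerDl mulr_ge0. Qed.

Lemma barrier_bound (rho k t : R) : 0 <= rho -> 0 <= k -> 0 <= t -> 0 <= barrier rho k t <= rho.
Proof.
move=> r0 k0 t0; have d1 := barrier_den k0 t0; have d0 : 0 < 1 + k * t by exact: lt_le_trans ltr01 d1.
by rewrite /barrier divr_ge0 ?(ltW d0)//= ler_pdivrMr// ler_peMr.
Qed.

Lemma barrier_continuous (rho k t : R) : 0 <= k -> 0 <= t -> {for t, continuous (barrier rho k)}.
Proof.
move=> k0 t0; apply: continuousM; first exact: cst_continuous.
apply: continuousV; first by rewrite gt_eqF// (lt_le_trans ltr01)// barrier_den.
apply: continuousD; first exact: cst_continuous.
by apply: continuousM; [exact: cst_continuous|exact: cvg_id].
Qed.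

(** The barrier lies below its tangent plus a quadratic term with uniform constant; the tangent
    slope becomes part of the time slope in the viscosity test. *)
Lemma barrier_expand (rho k t s : R) : 0 <= rho -> 0 <= k -> 0 <= t -> 0 <= s ->
  barrier rho k t - barrier rho k s <= - (k * rho / (1 + k * s) ^+ 2) * (t - s) + rho * k ^+ 2 * (t - s) ^+ 2.
Proof.
move=> r0 k0 t0 s0; have dt := barrier_den k0 t0; have ds := barrier_den k0 s0.
have t1 : 0 < 1 + k * t by exact: lt_le_trans ltr01 dt.
have s1 : 0 < 1 + k * s by exact: lt_le_trans ltr01 ds.
have -> : barrier rho k t - barrier rho k s = - (k * rho / (1 + k * s) ^+ 2) * (t - s) +
    rho * k ^+ 2 * (t - s) ^+ 2 * ((1 + k * t) * (1 + k * s) ^+ 2)^-1.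
  by rewrite /barrier; field; rewrite !gt_eqF.
have q0 : 0 <= rho * k ^+ 2 * (t - s) ^+ 2 by exact: mulr_ge0 (mulr_ge0 r0 (sqr_ge0 _)) (sqr_ge0 _).
rewrite lerD2l ler_piMr//.
rewrite invf_le1; first by rewrite mulr_ege1// expr_ge1// ltW.
by rewrite mulr_gt0 ?exprn_gt0.
Qed.

(** The speed of decay is at most k times the barrier. With k = e this is what the strictness e tau,
    tau >= barrier, can absorb. *)
Lemma barrier_slope (rho k t : R) : 0 <= rho -> 0 <= k -> 0 <= t -> k * rho / (1 + k * t) ^+ 2 <= k * barrier rho k t.
Proof.
move=> r0 k0 t0; have dt := barrier_den k0 t0; have t1 : 0 < 1 + k * t by exact: lt_le_trans ltr01 dt.
rewrite /barrier mulrA expr2 invfM mulrA ler_piMr ?divr_ge0 ?mulr_ge0 ?(ltW t1)//.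
by rewrite invf_le1.
Qed.

(* What the doubling of variables yields at an interior maximum of
   [f t y - w y - barrier t], in the form required by the sub/supersolution
   tests for the evolution. *)
Lemma barrier_touch (f : R -> E -> R) (w : E -> R) (rho k t1 mu0 : R) (y1 : E) (r K sg : R) :
  0 <= rho -> 0 <= k -> 0 < r -> r < t1 -> 0 <= K -> lip_on w y1 r K ->
  (forall (t : R) y, t1 - r <= t <= t1 -> `|y - y1| <= r -> {for (t, y), continuous (fun z : R * E => f z.1 z.2)}) ->
  (forall (t : R) y, t1 - r <= t <= t1 -> `|y - y1| <= r -> f t y - w y - barrier rho k t <= mu0) ->
  f t1 y1 - w y1 - barrier rho k t1 = mu0 -> 0 < sg -> sg < r / 2 -> sg <= 1 ->
  exists (th al N r' : R) (yh zh : E) (q : E * E), [/\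
    0 < th /\ 0 < r' /\ 0 <= N /\ - (k * barrier rho k th) - 2 * sg <= al,
    `|yh - y1| <= r /\ `|zh - y1| < r /\ en (yh - zh) <= sg,
    en q.1 <= 2 * K + 2 /\ en q.2 <= 2 * K /\ en (q.2 - q.1) <= 2 * sg,
    psub w zh q.2 /\ barrier rho k th + mu0 <= f th yh - w zh <= barrier rho k th + mu0 + sg &
    0 <= th - r' /\ forall (t : R) y, th - r' <= t <= th -> `|y - yh| <= r' ->
      f t y <= f th yh + al * (t - th) + dot q.1 (y - yh) + N * ((t - th) ^+ 2 + nsq (y - yh))].
Proof.
move=> rho0 k0 r0 rt K0 lw fc fm fe s0 sr s1.
have bc (t : R) : t1 - r <= t <= t1 -> {for t, continuous (barrier rho k)}.
  by move=> /andP[h1 _]; apply: barrier_continuous => //; move: h1 rt; clear; lra.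
have fm' (t : R) y : t1 - r <= t <= t1 -> `|y - y1| <= r -> f t y - w y - barrier rho k t <= f t1 y1 - w y1 - barrier rho k t1.
  by rewrite fe; exact: fm.
have [th [N [yh [zh [/andP[thl thr] [yh1 yz] [N0 NK zr ps] /andP[lo hi] touch]]]]] := doubling r0 K0 lw fc bc fm' s0 sr.
rewrite fe in lo hi.
have th0 : 0 < th by move: thl sr rt r0; clear; lra.
have b0 := barrier_bound rho0 k0 (ltW th0).
exists th, (- (k * rho / (1 + k * th) ^+ 2) + 2 * (th - t1)), (N + 2 + rho * k ^+ 2), (r / 2 - sg), yh, zh,
  ((2 * N) *: (yh - zh) + 2 *: (yh - y1), (2 * N) *: (yh - zh)) => /=.
have rk : 0 <= rho * k ^+ 2 by rewrite mulr_ge0// sqr_ge0.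
have q2K : en ((2 * N) *: (yh - zh)) <= 2 * K by rewrite enZ ger0_norm ?mulr_ge0// -mulrA ler_pM2l.
split.
- split => //; split; first by rewrite subr_gt0.
  split; first by rewrite !addr_ge0.
  by have := barrier_slope rho0 k0 (ltW th0); move: thl; clear; lra.
- split; last by split.
  by apply: le_trans (norm_le_en _) (le_trans yh1 _); move: sr r0; clear; lra.
- split; last split => //.
    apply: le_trans (enD _ _) _; rewrite (enZ 2) normr_nat; move: q2K yh1 s1; clear; lra.
  by rewrite opprD addrA subrr sub0r enN enZ normr_nat ler_pM2l.
- by split => //; move: lo hi; clear; move=> *; apply/andP; split; lra.
split; first by move: thl rt r0 s0; clear; lra.
move=> t y /andP[tl tr] yy.
have t0 : 0 <= t by move: tl thl rt r0 s0; clear; lra.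
have ty : `|y - y1| <= r / 2.
  by have := ler_distD yh y y1; have := le_trans (norm_le_en _) yh1; move: yy; clear; lra.
have := touch t y ltac:(by apply/andP; split; move: tl tr thl thr; clear; lra) ty.
have := barrier_expand rho0 k0 t0 (ltW th0).
have h1 := sqr_ge0 (t - th); have h2 := nsq_ge0 (y - yh).
have h3 : 0 <= N * (t - th) ^+ 2 by exact: mulr_ge0.
have h4 : 0 <= rho * k ^+ 2 * nsq (y - yh) by exact: mulr_ge0.
have -> : (t - t1) ^+ 2 - (th - t1) ^+ 2 = (t - th) ^+ 2 + 2 * (th - t1) * (t - th) by ring.
move: h1 h2 h3 h4; rewrite !mulrDl !mulrDr; clear; lra.
Qed.

End Barrier.

Section Stability.
Context {R : realType} {n : nat} {M : manifold R n}.
Notation E := 'rV[R]_n.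
Implicit Types (x : M) (c : chart M) (H P G : cotangent M * R -> R) (u v : M -> R) (U W : R -> M -> R) (phi : M -> R).

(** A level mu0, at most e, that the excess over the barrier attains at some positive time, and the
    first time t1 at which it is attained. The cap e keeps the shifts tau within reach of
    strictness. *)
Lemma first_time W (rho k e T : R) x : compact [set: M] -> jcont W -> 0 <= rho -> 0 <= k -> 0 < e -> 0 <= T ->
  (forall x, W 0 x <= rho) -> barrier rho k T < W T x ->
  exists (mu0 t1 : R) x1, [/\ 0 < mu0, mu0 <= e, 0 < t1, W t1 x1 - barrier rho k t1 = mu0 &
    forall t x, 0 <= t <= t1 -> W t x - barrier rho k t <= mu0].
Proof.
move=> cM cW rho0 k0 e0 T0 W0 WT; set mu0 := Num.min e (W T x - barrier rho k T).
have m0 : 0 < mu0 by rewrite lt_min e0 subr_gt0.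
have me : mu0 <= e by rewrite ge_min lexx.
have mW : mu0 <= W T x - barrier rho k T by rewrite ge_min lexx orbT.
pose Wt (z : R * M) := W (Num.max 0 z.1) z.2 - barrier rho k (Num.max 0 z.1).
have mx (t : R) : 0 <= Num.max 0 t by rewrite le_max lexx.
have cWt : continuous Wt.
  move=> z; apply: (@continuousB _ _ _ (fun z : R * M => W (Num.max 0 z.1) z.2) (fun z : R * M => barrier rho k (Num.max 0 z.1))); first exact: cW.
  apply: (@continuous_comp _ _ _ (fun z : R * M => Num.max 0 z.1) (barrier rho k)); last exact: barrier_continuous.
  by apply: continuous_max; [exact: cst_continuous|exact: cvg_fst].
pose X : set (R * M) := (`[0, T]%classic `*` [set: M]) `&` [set z | mu0 <= Wt z].
have cX : compact X.
  apply: compact_closedI; first by apply: compact_setX => //; exact: segment_compact.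
  rewrite (_ : [set z | _] = ~` [set z | Wt z < mu0]).
    by apply: open_closedC; rewrite openE => z zl; exact: (near_lt (cWt z) zl).
  by apply/seteqP; split => z /=; [move=> h; apply/negP; rewrite -leNgt|move/negP; rewrite -leNgt].
have XT : X (T, x).
  split; first by split => //=; rewrite in_itv/= T0 lexx.
  by rewrite /= /Wt /= (max_idPr T0).
have [[t1 x1] [[/= tI _] /= Xm] Xmin] := @compact_max R _ (fun z : R * M => - z.1) X (ex_intro _ _ XT) cX
  (fun z _ => continuousN (@cvg_fst _ _ _ _ _)).
move: tI; rewrite in_itv/= => /andP[t10 t1T]; rewrite /Wt /= (max_idPr t10) in Xm.
have t1p : 0 < t1.
  rewrite lt_neqAle t10 andbT; apply/eqP => tE.
  have := W0 x1; move: Xm; rewrite -tE /barrier mulr0 addr0 divr1 leNgt => /negP h h2; apply: h.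
  by rewrite (le_lt_trans _ m0)// subr_le0.
have before (t : R) x' : 0 <= t -> t < t1 -> W t x' - barrier rho k t <= mu0.
  move=> t0 tt; apply: contrapT => /negP; rewrite -ltNge => h.
  have := Xmin (t, x'); rewrite /= lerN2 leNgt tt => h2; suff : false by [].
  apply: h2; split; first by split => //=; rewrite in_itv/= t0 (le_trans (ltW tt)).
  by rewrite /= /Wt /= (max_idPr t0) ltW.
(* At t1 itself a larger excess would, by continuity, be present slightly earlier. *)
have upto (t : R) x' : 0 <= t <= t1 -> W t x' - barrier rho k t <= mu0.
  move=> /andP[t0]; rewrite le_eqVlt => /orP[/eqP ->|]; last exact: before.
  apply: contrapT => /negP; rewrite -ltNge => h.
  have h' : mu0 < Wt (t1, x') by rewrite /Wt /= (max_idPr t10).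
  have [[A1 A2] [/= n1 n2] AA] := near_gt (cWt (t1, x')) h'.
  have /nbhs_ballP[d /= d0 Hd] := n1.
  pose s := Num.max 0 (t1 - d / 2).
  have s0 : 0 <= s by exact: mx.
  have st : s < t1 by rewrite gt_max t1p ltrBlDr ltrDl divr_gt0.
  have sd : t1 - d / 2 <= s by rewrite le_max lexx orbT.
  have : mu0 < Wt (s, x').
    apply: (AA (s, x')); split => /=; last exact: nbhs_singleton n2.
    apply: Hd; rewrite -ball_normE /= gtr0_norm ?subr_gt0//; lra.
  by rewrite /Wt /= (max_idPr s0) ltNge before.
exists mu0, t1, x1; split => //.
by apply/eqP; rewrite eq_le Xm upto// t10 lexx.
Qed.

Lemma lip_on_sub (w : E -> R) (y : E) (r r' K : R) : r' <= r -> lip_on w y r K -> lip_on w y r' K.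
Proof. by move=> rr L a b h1 h2; apply: L; exact: le_trans rr. Qed.

Lemma lip_onN (w : E -> R) (y : E) (r K : R) : lip_on w y r K -> lip_on (fun y => - w y) y r K.
Proof. by move=> L a b h1 h2; rewrite opprK addrC distrC enC; have := L b a h2 h1; rewrite distrC. Qed.

Lemma psubN_psup (w : E -> R) (y q : E) : psub (fun y => - w y) y q -> psup w y (- q).
Proof.
move=> [N HN]; exists N; apply: filterS HN => z; rewrite dotNl; lra.
Qed.

Lemma stab_arith (e b m F1 F2 al C sg t : R) : e * t <= F2 -> b + m <= t -> 0 < e -> al + F1 <= 0 -> - (e * b) - 2 * sg <= al ->
  F2 - F1 <= C * (3 * sg) -> sg * (3 * C + 2) <= e * m / 2 -> 0 < m -> False.
Proof.
move=> h1 h2 e0 h3 h4 h5 h6 m0; have : e * (b + m) <= e * t by rewrite ler_pM2l.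
have : 0 < e * m by exact: mulr_gt0.
lra.
Qed.

Lemma bound_shiftD (a b tau B e : R) : `|a| <= B -> `|b - a| <= e / 4 -> 0 <= tau <= e -> e <= 1 -> `|b + tau| <= B + 2.
Proof.
rewrite !ler_norml => /andP[? ?] /andP[? ?] /andP[? ?] ?.
by apply/andP; split; lra.
Qed.

Lemma bound_shiftB (a b tau B e : R) : `|a| <= B -> `|b - a| <= e / 4 -> 0 <= tau <= e -> e <= 1 -> `|b - tau| <= B + 2.
Proof.
rewrite !ler_norml => /andP[? ?] /andP[? ?] /andP[? ?] ?.
by apply/andP; split; lra.
Qed.

Lemma tau_arith (bb rho m sg e : R) : 0 <= e -> bb <= rho -> rho <= e / 4 -> m <= e / 4 -> sg <= e / 4 -> bb + m + sg <= e.
Proof. lra. Qed.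

Lemma touchN_arith (a b al x y z : R) : - a <= - b + al * x + y + z -> b + - al * x + - y - z <= a.
Proof. lra. Qed.

Section Setup.
Variables (H P : cotangent M * R -> R) (u v : M -> R) (B e e' lam : R) (phi : M -> R) (U : R -> M -> R) (rho : R).
Let G := perturb H P e'.
Hypotheses (cM : compact [set: M]) (uB : forall x, `|u x| <= B) (e01 : 0 < e <= 1)
  (good : forall x, good_at H P u (B + 2) e x) (e'e : 0 <= e' <= e) (vs : sol H P e' v) (vu : forall x, `|v x - u x| <= e / 4)
  (hG : evo_ham G lam) (pc : continuous phi) (cU : jcont U) (HU : forall t x, 0 <= t -> val G phi U t x = (U t x)%:E)
  (rho0 : 0 <= rho) (rhoe : rho <= e / 4) (pv : forall x, `|phi x - v x| <= rho).

Lemma evolution_init x : U 0 x = phi x.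
Proof.
have [C0 [B' [Bp [C00 HC0 HC1 UB [pB _]]]]] := action_data 0 cM hG pc cU.
have h := val0 G phi U x (lexx 0).
by have := HU x (lexx 0); rewrite h => -[].
Qed.

Lemma v_along : continuous (fun z : R * M => v z.2).
Proof.
have vc : continuous v by case: vs.
by move=> z; apply: (@continuous_comp _ _ _ (fun z : R * M => z.2) v); [exact: cvg_snd|exact: vc].
Qed.

(** At the first excess m over the barrier b, the evolution satisfies al + F <= 0 with al >= -e b up
    to 2 sg, while strictness of v + tau, with tau >= b + m, gives F >= e (b + m) at almost the same
    point. What remains is e m <= O(sg). *)
Lemma stable_upper (t : R) x : 0 <= t -> U t x - v x <= barrier rho e t.
Proof.
move=> t0; case/andP: (e01) => e0 e1; rewrite leNgt; apply/negP => viol.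
have cW : jcont (fun t x => U t x - v x) by move=> z; apply: continuousB; [exact: cU|exact: v_along].
have e40 : 0 < e / 4 by rewrite divr_gt0.
have W0 x' : U 0 x' - v x' <= rho.
  by rewrite evolution_init; apply: le_trans (ler_norm _) (pv x').
have [m [t1 [x1 [m0 me t10 eq1 upto]]]] := first_time cM cW rho0 (ltW e0) e40 t0 W0 viol.
have [c [K [xc K1 Hg]]] := good x1.
have [C [r [C0 r0 yr [L S] Hw]]] := Hg e' e'e.
have ve x' : `|v x' - u x'| <= e by apply: le_trans (vu x') _; rewrite ler_pdivrMr// ler_peMr ?(ltW e0)// ler1n.
have [lv St] := Hw v vs ve.
set y1 := chart_map c x1 in yr L S lv St.
have K0 : 0 <= K by exact: le_trans ler01 K1.
(* Below t1, so that the window of times before t1 consists of positive times. *)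
pose r2 := Num.min r (t1 / 2).
have r20 : 0 < r2 by rewrite lt_min r0 divr_gt0.
have r2r : r2 <= r by rewrite ge_min lexx.
have r2t : r2 < t1 by rewrite gt_min ltr_pdivrMr// ltr_pMr// ltr1n orbT.
have b0 : 0 < Num.min (Num.min (r2 / 4) (e / 4)) (e * m / 2) by rewrite !lt_min !divr_gt0// mulr_gt0.
(* 3 C bounds the change of the Hamiltonian between the doubled points, 2 the error in the time
   slope. *)
have [sg [sg0 sgb sgM]] := @pick_small R (3 * C + 2) _ ltac:(by rewrite addr_ge0// mulr_ge0// ltW) b0.
have sgr : sg <= r2 / 4 by min_ub sgb.
have sge : sg <= e / 4 by min_ub sgb.
have sgm : sg * (3 * C + 2) <= e * m / 2 by min_ub sgM.
have rng (y : E) : `|y - y1| <= r2 -> chart_range c y by move=> h; apply: yr; exact: le_trans r2r.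
have [|||||th [al [N [r' [yh [zh [[q1 q2] [/= [th0 [r'0 [N0 hal]]] [yh1 [zh1 yz]] [q1K [q2K q12]] [ps /andP[lo hi]] [thr' touch]]]]]]]]] :=
  @barrier_touch R n (fun t y => U (Num.max 0 t) (chart_inv c y)) (v \o chart_inv c) rho e t1 m y1 r2 K sg rho0 (ltW e0) r20 r2t K0
   (lip_on_sub r2r lv) (fun t y _ hy => jcont_chart (t := t) cU (rng y hy)).
- move=> t' y /andP[h1 h2] hy; have t'0 : 0 <= t' by apply: le_trans h1; rewrite subr_ge0 ltW.
  by rewrite (max_idPr t'0); apply: upto; rewrite t'0.
- by rewrite (max_idPr (ltW t10)) /= chart_mapK.
- exact: sg0.
- by apply: le_lt_trans sgr _; rewrite ltr_pM2l// ltf_pV2 ?posrE// ltr_nat.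
- by apply: le_trans sge _; apply: le_trans _ e1; rewrite ler_pdivrMr// ler_peMr ?(ltW e0)// ler1n.
rewrite (max_idPr (ltW th0)) in lo hi touch.
have /andP[bb0 bbr] := barrier_bound rho0 (ltW e0) (ltW th0).
set tau := U th (chart_inv c yh) - (v \o chart_inv c) zh in lo hi.
have tauI : 0 <= tau <= e.
  by apply/andP; split; [apply: le_trans lo; rewrite addr_ge0// ltW|exact: le_trans hi (tau_arith (ltW e0) bbr rhoe me sge)].
have tE : v (chart_inv c zh) + tau = U th (chart_inv c yh) by rewrite /tau addrC subrK.
have UB : `|U th (chart_inv c yh)| <= B + 2.
  rewrite -tE; exact: (bound_shiftD (uB _) (vu _) tauI e1).
have yh1r := le_trans yh1 r2r; have zh1r : `|zh - y1| <= r by apply: le_trans (ltW zh1) r2r.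
have [g _ Hgg] := S yh q1 _ yh1r q1K UB.
have F1 : al + Fc H P c e' yh q1 (U th (chart_inv c yh)) <= 0.
  apply: (@evolution_psup R n M G lam phi U c th al N r' yh q1 g cM hG pc cU HU th0 r'0 N0 (rng yh yh1) Hgg).
  move=> t' y ht hy; have := touch t' y ht hy.
  by rewrite (max_idPr (le_trans thr' _))//; case/andP: ht.
have [F2 _] := St zh q2 zh1r tau tauI; have {}F2 := F2 ps; rewrite tE in F2.
have q2K2 : en q2 <= 2 * K + 2 by apply: le_trans q2K _; rewrite lerDl.
have LF := L zh yh q2 q1 _ _ zh1r yh1r q2K2 q1K UB UB.
rewrite subrr normr0 addr0 in LF.
have LF' : C * (en (zh - yh) + en (q2 - q1)) <= C * (3 * sg).
  by rewrite ler_pM2l// (_ : 3 * sg = sg + 2 * sg); [rewrite enC; exact: lerD|ring].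
exact: stab_arith F2 lo e0 F1 hal (le_trans LF LF') sgm m0.
Qed.

(** The same argument for -U and -v: a subgradient of -v is a supergradient of v, so strictness of v
    - tau enters, together with the supersolution inequality of the evolution. *)
Lemma stable_lower (t : R) x : 0 <= t -> v x - U t x <= barrier rho e t.
Proof.
move=> t0; case/andP: (e01) => e0 e1; rewrite leNgt; apply/negP => viol.
have cW : jcont (fun t x => v x - U t x) by move=> z; apply: continuousB; [exact: v_along|exact: cU].
have e40 : 0 < e / 4 by rewrite divr_gt0.
have W0 x' : v x' - U 0 x' <= rho.
  by rewrite evolution_init; apply: le_trans (ler_norm _) _; rewrite distrC; exact: pv.
have [m [t1 [x1 [m0 me t10 eq1 upto]]]] := first_time cM cW rho0 (ltW e0) e40 t0 W0 viol.
have [c [K [xc K1 Hg]]] := good x1.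
have [C [r [C0 r0 yr [L S] Hw]]] := Hg e' e'e.
have ve x' : `|v x' - u x'| <= e by apply: le_trans (vu x') _; rewrite ler_pdivrMr// ler_peMr ?(ltW e0)// ler1n.
have [lv St] := Hw v vs ve.
set y1 := chart_map c x1 in yr L S lv St.
have K0 : 0 <= K by exact: le_trans ler01 K1.
pose r2 := Num.min r (t1 / 2).
have r20 : 0 < r2 by rewrite lt_min r0 divr_gt0.
have r2r : r2 <= r by rewrite ge_min lexx.
have r2t : r2 < t1 by rewrite gt_min ltr_pdivrMr// ltr_pMr// ltr1n orbT.
have b0 : 0 < Num.min (Num.min (r2 / 4) (e / 4)) (e * m / 2) by rewrite !lt_min !divr_gt0// mulr_gt0.
have [sg [sg0 sgb sgM]] := @pick_small R (3 * C + 2) _ ltac:(by rewrite addr_ge0// mulr_ge0// ltW) b0.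
have sgr : sg <= r2 / 4 by min_ub sgb.
have sge : sg <= e / 4 by min_ub sgb.
have sgm : sg * (3 * C + 2) <= e * m / 2 by min_ub sgM.
have rng (y : E) : `|y - y1| <= r2 -> chart_range c y by move=> h; apply: yr; exact: le_trans r2r.
have [|||||th [al [N [r' [yh [zh [[q1 q2] [/= [th0 [r'0 [N0 hal]]] [yh1 [zh1 yz]] [q1K [q2K q12]] [ps /andP[lo hi]] [thr' touch]]]]]]]]] :=
  @barrier_touch R n (fun t y => - U (Num.max 0 t) (chart_inv c y)) (fun y => - (v \o chart_inv c) y) rho e t1 m y1 r2 K sg rho0 (ltW e0) r20 r2t K0
   (lip_onN (lip_on_sub r2r lv)) (fun t y _ hy => continuousN (jcont_chart (t := t) cU (rng y hy))).
- move=> t' y /andP[h1 h2] hy; have t'0 : 0 <= t' by apply: le_trans h1; rewrite subr_ge0 ltW.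
  by rewrite (max_idPr t'0) opprK (addrC (- _)); apply: upto; rewrite t'0.
- by rewrite (max_idPr (ltW t10)) opprK (addrC (- _)) /= chart_mapK.
- exact: sg0.
- by apply: le_lt_trans sgr _; rewrite ltr_pM2l// ltf_pV2 ?posrE// ltr_nat.
- by apply: le_trans sge _; apply: le_trans _ e1; rewrite ler_pdivrMr// ler_peMr ?(ltW e0)// ler1n.
rewrite (max_idPr (ltW th0)) opprK (addrC (- _)) in lo hi; rewrite (max_idPr (ltW th0)) in touch.
have /andP[bb0 bbr] := barrier_bound rho0 (ltW e0) (ltW th0).
set tau := (v \o chart_inv c) zh - U th (chart_inv c yh) in lo hi.
have tauI : 0 <= tau <= e.
  by apply/andP; split; [apply: le_trans lo; rewrite addr_ge0// ltW|exact: le_trans hi (tau_arith (ltW e0) bbr rhoe me sge)].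
have tE : v (chart_inv c zh) - tau = U th (chart_inv c yh) by rewrite /tau /= opprB addrC subrK.
have UB : `|U th (chart_inv c yh)| <= B + 2.
  rewrite -tE; exact: (bound_shiftB (uB _) (vu _) tauI e1).
have yh1r := le_trans yh1 r2r; have zh1r : `|zh - y1| <= r by apply: le_trans (ltW zh1) r2r.
have F1 : 0 <= - al + Fc H P c e' yh (- q1) (U th (chart_inv c yh)).
  apply: (@evolution_psub R n M G lam phi U c th (- al) N r' yh (- q1) cM hG pc cU HU th0 r'0 N0 (rng yh yh1)).
  move=> t' y ht hy; have := touch t' y ht hy.
  rewrite (max_idPr (le_trans thr' _)); last by case/andP: ht.
  rewrite dotNl; exact: touchN_arith.
have [_ F2] := St zh (- q2) zh1r tau tauI; have {}F2 := F2 (psubN_psup ps); rewrite tE in F2.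
have q2K2 : en (- q2) <= 2 * K + 2 by rewrite enN; apply: le_trans q2K _; rewrite lerDl.
have q1K2 : en (- q1) <= 2 * K + 2 by rewrite enN.
have LF := L yh zh (- q1) (- q2) _ _ yh1r zh1r q1K2 q2K2 UB UB.
rewrite subrr normr0 addr0 opprK (addrC (- q1)) in LF.
have LF' : C * (en (yh - zh) + en (q2 - q1)) <= C * (3 * sg).
  by rewrite ler_pM2l// (_ : 3 * sg = sg + 2 * sg); [exact: lerD|ring].
apply: (@stab_arith e (barrier rho e th) m (- Fc H P c e' yh (- q1) (U th (chart_inv c yh)))
  (- Fc H P c e' zh (- q2) (U th (chart_inv c yh))) al C sg tau _ lo e0 _ hal _ sgm m0).
- by rewrite lerNr.
- by move: F1; rewrite addrC subr_ge0 subr_le0.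
- by rewrite opprK addrC; exact: le_trans LF LF'.
Qed.

Lemma stable (t : R) x : 0 <= t -> `|U t x - v x| <= barrier rho e t.
Proof.
move=> t0; have h1 := stable_upper x t0; have h2 := stable_lower x t0.
by rewrite ler_norml h1 andbT lerNl opprB.
Qed.

End Setup.
End Stability.

(** * The sup norm and the conclusion *)

Section SupNorm.
Context {R : realType} {n : nat} {M : manifold R n}.
Implicit Types (x : M) (f : M -> R).

Lemma supnorm_le f (a : R) : 0 <= a -> (forall x, `|f x| <= a) -> supnorm f <= a.
Proof.
move=> a0 fa; have [[x]|/forallNP nM] := pselect (exists x : M, True).
  by move=> _; apply: sup_le_ub; [exists `|f x|, x|move=> _ [y _ <-]; exact: fa].
(* On an empty manifold the supremum is taken over the empty set and has the default value 0. *)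
suff -> : supnorm f = 0 by [].
by rewrite /supnorm (_ : [set _ | _ in _] = set0) ?sup0// -subset0 => y [x _ _]; exact: (nM x).
Qed.

(** When no supremum exists, [sup] returns 0, so no assumption on f appears. *)
Lemma supnorm_ge0 f : 0 <= supnorm f.
Proof.
have [hs|nhs] := pselect (has_sup [set `|f x| | x in [set: M]]); last by rewrite /supnorm sup_out.
have [[_ [x _ _]] _] := hs.
by apply: le_trans (normr_ge0 (f x)) _; apply: sup_upper_bound => //; exists x.
Qed.

Lemma le_supnorm f x : compact [set: M] -> continuous f -> `|f x| <= supnorm f.
Proof.
move=> cM fc; have [C _ HC] := compact_bounded_fun cM (fun y _ => fc y).
apply: sup_upper_bound; last by exists x.
by split; [exists `|f x|, x|exists C => _ [y _ <-]; exact: HC].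
Qed.

Lemma barrier_cvg (rho k e : R) : 0 <= rho -> 0 < k -> 0 < e -> \forall t \near +oo, barrier rho k t <= e.
Proof.
move=> r0 k0 e0; near=> t.
have t0 : 0 <= t by near: t; apply: nbhs_pinfty_ge; rewrite num_real.
have tr : rho / (k * e) <= t by near: t; apply: nbhs_pinfty_ge; rewrite num_real.
have d0 : 0 < 1 + k * t by apply: lt_le_trans (barrier_den (ltW k0) t0).
rewrite /barrier ler_pdivrMr//; move: tr; rewrite ler_pdivrMr ?mulr_gt0//.
by rewrite mulrDr mulr1 => h; apply: le_trans h _; rewrite mulrA [_ * k]mulrC [e * _]mulrC; lra.
Unshelve. all: by end_near. Qed.

End SupNorm.

Lemma perturb0 (R : realType) (n : nat) (M : manifold R n) (H P : cotangent M * R -> R) : perturb H P 0 = H.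
Proof. by apply/funext => z; rewrite /perturb mul0r addr0. Qed.

Theorem theorem1p2 (R : realType) (n : nat) (M : manifold R n)
    (g : riemannian_metric M)
    (M_compact : compact [set: M]) (M_connected : connected [set: M])
    (H : cotangent M * R -> R)
    (H_C3 : of_class_bundle 3 H)
    (H_convex : strictly_convex H)
    (H_superlinear : superlinear g H)
    (H_lipschitz : lipschitz_u H)
    (P : cotangent M * R -> R)
    (P_C3 : of_class_bundle 3 P)
    (P_compact : compact (supp P))
    (P_bound : forall z, `|P z| <= 1)
    (u : M -> R)
    (u_sol : viscosity_solution H u)
    (u_pos : forall z, Lambda u z -> 0 < partial_u H z) :
  exists2 delta0 : R, 0 < delta0 &
    forall delta : R, 0 < delta <= delta0 ->
    exists2 eps_delta : R, 0 < eps_delta &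
      forall eps : R, 0 <= eps <= eps_delta ->
      exists v : M -> R,
        unique (fun w : M -> R => viscosity_solution (perturb H P eps) w /\
                                  supnorm (w \- u) <= delta) v /\
        locally_asymptotically_stable (perturb H P eps) v.
Proof.
have fHP : family H P by split => //; exists g.
have us : sol H P 0 u by rewrite /sol perturb0.
have uc : continuous u by case: u_sol.
have [B B0 uB] := compact_bounded_fun M_compact (fun x _ => uc x).
have {}uB x : `|u x| <= B by exact: uB.
have [e e01 good] := good_global M_compact fHP us uB u_pos.
have [lamH lH0 lH] := H_lipschitz.
have [lamP lP0 lP] := partial_u_bounded (fun c => class_CS (class_CS (P_C3 c))) P_compact.
have ulH := partial_u_ulip (fun c => class_CS (class_CS (H_C3 c))) lH.
have ulP := partial_u_ulip (fun c => class_CS (class_CS (P_C3 c))) lP.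
have /andP[e0 e1] := e01.
(* [comparison] and [stable] ask that the solutions stay within e / 4 of u. *)
exists (e / 4); first by rewrite divr_gt0.
move=> dl /andP[dl0 dl4]; have dle : dl <= e by lra.
(* The size of perturbation that the strictness of u - dl and u + dl absorbs. *)
exists (e * dl); first exact: mulr_gt0.
move=> e' /andP[e'0 e'd].
have e'e : 0 <= e' <= e by rewrite e'0 (le_trans e'd)// ler_piMr ?(ltW e0)// (le_trans dle).
have S : perron_setup H P u B e e' dl by split.
have [v vs vu] := existence S.
have vc : continuous v by case: vs.
have vu4 x : `|v x - u x| <= e / 4 by exact: le_trans (vu x) dl4.
exists v; split.
  split; first by split => //; apply: supnorm_le => //; exact: ltW.
  move=> w [ws wu]; apply: (comparison M_compact uB e01 good e'e vs ws vu4) => x.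
  apply: le_trans dl4; apply: le_trans wu; apply: (@le_supnorm _ _ _ (w \- u)) => // y.
  by apply: continuousB; [case: ws => wc _ _; exact: wc|exact: uc].
(* The Lipschitz constant in the value is raised by 1 to meet the lower bound 1 <= lam required by
   the weight. *)
have hG : evo_ham (perturb H P e') (lamH + lamP + 1).
  apply: evo_ham_le (perturb_evo fHP _ lH0 ulH lP0 ulP); first by rewrite lerDl.
  by rewrite e'0 (le_trans _ e1)//; case/andP: e'e.
have l1 : 1 <= lamH + lamP + 1 by rewrite lerDr addr_ge0// ltW.
have main phi rho : continuous phi -> 0 <= rho -> rho <= e / 4 -> supnorm (phi \- v) <= rho ->
    forall t, 0 <= t -> supnorm (semigroup (perturb H P e') t phi \- v) <= barrier rho e t.
  move=> pc r0 r4 pv t t0.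
  have [U0 _ ev0] := evolution_exists M_compact hG l1 pc.
  (* [stable] holds for every evolution; existence ensures that the one picked by [xget] is an
     evolution. *)
  have : [set U | is_evolution (perturb H P e') phi U] (xget (fun _ _ => 0) [set U | is_evolution (perturb H P e') phi U]).
    by apply: xgetPex; exists U0.
  rewrite /semigroup; move: (xget _ _) => U ev.
  apply: supnorm_le; first by case/andP: (barrier_bound r0 (ltW e0) t0).
  move=> x; apply: (stable M_compact uB e01 good e'e vs vu4 hG pc (evolution_jcont ev) _ r0 r4) => //.
    by move=> s y s0; case: ev => _ h; exact/esym/h.
  move=> y; apply: le_trans pv; apply: (@le_supnorm _ _ _ (phi \- v)) => // z.
  by apply: continuousB; [exact: pc|exact: vc].
have e40 : 0 < e / 4 by rewrite divr_gt0.
split.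
  (* The barrier is at most its initial value; eta / 2 makes the final inequality strict. *)
  move=> eta eta0; exists (Num.min (eta / 2) (e / 4)); first by rewrite lt_min e40 divr_gt0.
  move=> phi pc /ltW pv t /ltW t0.
  have m0 : 0 <= Num.min (eta / 2) (e / 4) by rewrite le_min !divr_ge0// ltW.
  have := main phi _ pc m0 _ pv t t0; rewrite ge_min lexx orbT => /(_ isT) /le_lt_trans; apply.
  have /andP[_ /le_lt_trans] := barrier_bound m0 (ltW e0) t0; apply.
  by rewrite gt_min ltr_pdivrMr// ltr_pMr// ltr1n.
exists (e / 4) => // phi pc /ltW pv; apply/cvgrPdist_le => eta eta0.
near=> t.
have t0 : 0 <= t by near: t; apply: nbhs_pinfty_ge; rewrite num_real.
rewrite sub0r normrN ger0_norm ?supnorm_ge0//; apply: le_trans (main phi _ pc (ltW e40) (lexx _) pv t t0) _.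
by near: t; exact: barrier_cvg (ltW e40) e0 eta0.
Unshelve. all: by end_near. Qed.
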